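(* The category $\mathring{\mathcal{H}}_{0,n}$ (the Hassett category) can be isomorphically modeled by the topological category $(\mathcal{Y}_n,\hat G_n)$.
   Context: A category $\mathcal{C}_1$ can be modeled by a category $\mathcal{C}_2$ if there exist birational morphisms from the objects of $\mathcal{C}_1$ to the objects of $\mathcal{C}_2$ such that these birational morphisms cover all objects of $\mathcal{C}_2$ and commute with the morphisms of the two categories; it is isomorphically modeled if these birational morphisms are isomorphisms. Hassett spaces: weight data (genus $0$) is $\mathcal{A}=(a_1,\ldots,a_n)\in\mathbb{Q}^n$ with $0<a_i\le 1$ and $\sum a_i>2$; $\overline{\mathcal{M}}_{0,\mathcal{A}}$ is the moduli space of connected nodal genus $0$ curves $C$ with marked points $s_1,\ldots,s_n$ in the smooth locus such that $K_C+\sum a_is_i$ is ample and $\sum_{i\in I}a_i\le 1$ whenever the $s_i$, $i\in I$, coincide. $\mathcal{D}_{0,n}=\{a\in\mathbb{R}^n : 0<a_i\le1,\ \sum a_i>2\}$, with chambers defined by the hyperplanes $\sum_{j\in S}a_j=1$, $2\le|S|\le n-2$, and $\partial\mathcal{D}_{0,n}=\{t : \sum t_i=2,\ 0<t_i<1\}$. The objects of $\mathring{\mathcal{H}}_{0,n}$ are $\overline{\mathcal{M}}_{0,\mathcal{A}_0}$, $\mathcal{A}_0=(1,\ldots,1)$, and those $\overline{\mathcal{M}}_{0,\mathcal{A}}$ for which $\mathcal{A}$ belongs to a chamber $w_c\subset\mathcal{D}_{0,n}$ whose closure meets $\partial\mathcal{D}_{0,n}$ in a chamber of maximal dimension $n-1$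 (i.e. its closure contains a chamber $C_\omega\subset\mathring{\Delta}_{n,2}$ with $\dim C_\omega=n-1$). The morphisms are the reduction morphisms $\rho_{\mathcal{A}_0,\mathcal{A}}:\overline{\mathcal{M}}_{0,\mathcal{A}_0}\to\overline{\mathcal{M}}_{0,\mathcal{A}}$, which successively collapse components along which $K_C+\sum a_is_i$ fails to be ample. Grassmannian side: $G_{n,2}$ is the Grassmannian of $2$-dimensional subspaces of $\mathbb{C}^n$ with Plücker coordinates $P^I$, $|I|=2$, and the canonical actions of $(\mathbb{C}^* )^n$ and $T^n$. The moment map is $\mu(L)=\frac{1}{\sum_I|P^I(L)|^2}\sum_I|P^I(L)|^2\Lambda_I$, $\Lambda_I$ the indicator vector of $I$; its image is $\Delta_{n,2}=\{x\in[0,1]^n : \sum x_i=2\}$, with relative interior $\mathring{\Delta}_{n,2}$, and it induces $\hat\mu:G_{n,2}/T^n\to\Delta_{n,2}$. Strata: $W_\sigma=\{L : P^I(L)\ne 0\iff I\in\sigma\}\neq\emptyset$; admissible polytopes $P_\sigma=\mathrm{conv}(\Lambda_I, I\in\sigma)$, $\mu(W_\sigma)=\mathring{P}_\sigma$; $F_\sigma=W_\sigma/(\mathbb{C}^* )^n$. Chambers: $C_\omega=\bigcap_{\sigma\in\omega}\mathring{P}_\sigma\ne\emptyset$ with $C_\omega\cap\mathring{P}_\sigma=\emptyset$ for $\sigma\notin\omega$. Spaces of parameters: $F_\omega=\bigcup_{\sigma\in\omega}F_\sigma$, as a variety the categorical quotient of $\bigcup_{\sigma\in\omega}W_\sigma$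 by $(\mathbb{C}^* )^n$, identified with the GIT quotient of $(\mathbb{C}P^1)^n$ by the diagonal $PGL_2(\mathbb{C})$ with fractional linearisation in $C_\omega$; there is a canonical homeomorphism $h_\omega:\hat\mu^{-1}(C_\omega)\to C_\omega\times F_\omega$. The main stratum $W_n$ (all $P^I\ne0$) has $F_n=W_n/(\mathbb{C}^* )^n\cong\mathcal{M}_{0,n}$, dense in every $F_\omega$ with $C_\omega\subset\mathring{\Delta}_{n,2}$. The universal space of parameters $\mathcal{F}_n$ is a smooth compact compactification of $F_n$, identified with $\overline{\mathcal{M}}_{0,n}$, and $p_\omega:\mathcal{F}_n\to F_\omega$ is the continuous projection which is the identity on $F_n$. $G_n:\Delta_{n,2}\times\mathcal{F}_n\to G_{n,2}/T^n$ is $G_n(x,y)=h_\omega^{-1}(x,p_\omega(y))$ for $x\in C_\omega$. Let $Y_n=\bigcup_{\dim C_\omega=n-1}C_\omega$, $\mathcal{Y}_n=Y_n\times\mathcal{F}_n$ and $\hat G_n=G_n|_{\mathcal{Y}_n}$. The category $(\mathcal{Y}_n,\hat G_n)$ has as objects $\mathcal{F}_n$ and the spaces $F_\omega$ with $\dim C_\omega=n-1$, and as morphisms the projections $p_\omega:\mathcal{F}_n\to F_\omega$. *)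

(* Defs.v *)
From HB Require Import structures.
From mathcomp Require Import all_boot all_order all_algebra.
From mathcomp Require Import complex.
From mathcomp Require Import all_classical all_reals all_analysis.

Set Implicit Arguments.
Unset Strict Implicit.
Unset Printing Implicit Defensive.

Import Order.TTheory GRing.Theory Num.Theory.
Import numFieldNormedType.Exports.
Local Open Scope classical_set_scope.
Local Open Scope complex_scope.
Local Open Scope ring_scope.

(** The ground field is [R[i]], the complex numbers over [R : realType].
    Complex varieties are the classical ones (reduced, separated, of finite
    type), presented as spaces with functions. *)

(** [zopen] gives the Zariski open sets; [reg x f] says that [f] is regular in
    a neighbourhood of [x].  Functions are total, and the values of [f] away
    from [x] are irrelevant, so the [f] with [reg x f], up to equality near
    [x], form the local ring at [x].  The sheaf of regular functions is
    recovered as [{f | forall x, U x -> reg x f}] on an open [U]. *)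
Record space (R : realType) := Space {
  pt :> Type;
  zopen : set (set pt);
  reg : pt -> (pt -> R[i]) -> Prop }.

Arguments reg {R s}.
Arguments zopen {R s}.

Section Spaces.
Context {R : realType}.
Local Notation C := R[i].
Implicit Types B M X Y Z : space R.

Definition zclosed X (S : set X) := zopen (~` S).

Definition near_pt X (x : X) (P : set X) :=
  exists U : set X, [/\ zopen U, U x & U `<=` P].

Definition is_morph X Y (f : X -> Y) :=
  (forall U : set Y, zopen U -> zopen (f @^-1` U)) /\
  (forall x h, reg (f x) h -> reg x (h \o f)).

Definition is_iso X Y (f : X -> Y) :=
  is_morph f /\
  exists g : Y -> X, [/\ is_morph g, cancel f g & cancel g f].

Definition isomorphic X Y := exists f : X -> Y, is_iso f.

(** An isomorphism onto a subset of [Y] with its induced structure. *)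
Definition is_immersion X Y (e : X -> Y) :=
  [/\ injective e,
      forall U : set X, zopen U <-> exists2 V : set Y, zopen V & U = e @^-1` V
    & forall x f, reg x f <->
        exists2 g, reg (e x) g &
          exists V : set Y, [/\ zopen V, V (e x) &
            forall y, V (e y) -> f y = g (e y)]].

Definition is_closed_immersion X Y (e : X -> Y) :=
  is_immersion e /\ zclosed (range e).

Definition is_open_immersion X Y (e : X -> Y) :=
  is_immersion e /\ zopen (range e).

Definition sub_space X (S : set X) : space R :=
  @Space R {x : X | S x}
    [set U | exists2 V : set X, zopen V & U = [set x | V (sval x)]]
    (fun x f => exists2 g, reg (sval x) g &
       near_pt (sval x) [set y | forall h : S y, f (exist _ y h) = g y]).

(** The quotient by an equivalence relation: points are the equivalence
    classes, and open sets and regular functions are those whose pullback is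
    open, resp. regular (for a group action: the invariant functions).  This is
    the categorical quotient among spaces with functions. *)
Definition class_of X (E : X -> set X) (x : X) : {c : set X | exists y, c = E y} :=
  exist _ (E x) (ex_intro _ x erefl).

Definition quot_space X (E : X -> set X) : space R :=
  @Space R {c : set X | exists y, c = E y}
    [set U | zopen [set x | U (class_of E x)]]
    (fun c f => exists U : set {c : set X | exists y, c = E y},
       [/\ zopen [set x | U (class_of E x)], U c &
           forall x, U (class_of E x) -> reg x (f \o class_of E)]).

(** The product: basic open sets are the non-vanishing loci of the functions
    [sum_i f_i(x) g_i(y)], and regular functions are locally quotients of such
    functions. *)
Definition tensor X Y k (f : 'I_k -> X -> C) (g : 'I_k -> Y -> C) (p : X * Y) : C :=
  \sum_i f i p.1 * g i p.2.

Definition prod_zopen X Y : set (set (X * Y)) :=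
  [set W | forall p, W p ->
     exists (U : set X) (V : set Y) k (f : 'I_k -> X -> C) (g : 'I_k -> Y -> C),
       [/\ zopen U /\ zopen V,
           (forall i x, U x -> reg x (f i)) /\ (forall i y, V y -> reg y (g i)),
           U p.1 /\ V p.2,
           tensor f g p != 0
         & forall q, U q.1 -> V q.2 -> tensor f g q != 0 -> W q]].

Definition prod_space X Y : space R :=
  @Space R (X * Y)%type (@prod_zopen X Y)
    (fun p h => exists k (f f' : 'I_k -> X -> C) (g g' : 'I_k -> Y -> C),
       [/\ forall i, reg p.1 (f i) /\ reg p.1 (f' i),
           forall i, reg p.2 (g i) /\ reg p.2 (g' i)
         & exists W, [/\ prod_zopen W, W p &
             forall q, W q ->
               tensor f' g' q != 0 /\ h q = tensor f g q / tensor f' g' q]]).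

Inductive polyfun (T I : Type) (c : I -> T -> C) : (T -> C) -> Prop :=
| polyfun_cst a : polyfun c (fun=> a)
| polyfun_coord i : polyfun c (c i)
| polyfun_add p q : polyfun c p -> polyfun c q -> polyfun c (fun t => p t + q t)
| polyfun_mul p q : polyfun c p -> polyfun c q -> polyfun c (fun t => p t * q t).

Definition entry m n (i : 'I_m * 'I_n) (M : 'M[C]_(m, n)) : C := M i.1 i.2.

Definition aff_space m n : space R :=
  @Space R 'M[C]_(m, n)
    [set U | forall x, U x -> exists p, [/\ polyfun (@entry m n) p, p x != 0 &
                                          forall y, p y != 0 -> U y]]
    (fun x f => exists p q, [/\ polyfun (@entry m n) p, polyfun (@entry m n) q,
        q x != 0 & forall y, q y != 0 -> f y = p y / q y]).

Definition nonzero_rows N : space R :=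
  sub_space [set v : aff_space 1 N.+1 | v != 0 :> 'rV_N.+1].

(** Projective [N]-space; its points are the lines minus the origin. *)
Definition proj_space N : space R :=
  quot_space (fun v w : nonzero_rows N =>
          exists2 a : C, a != 0 & (sval w : 'rV_N.+1) = a *: (sval v : 'rV_N.+1)).

(** [v] is a vector of homogeneous coordinates of [x]. *)
Definition homog N (x : proj_space N) (v : 'rV[C]_N.+1) :=
  exists2 w : nonzero_rows N, sval x w & sval w = v.

Definition is_affine X :=
  exists m (S : set (aff_space 1 m)), zclosed S /\ isomorphic X (sub_space S).

Definition is_separated X :=
  forall m (S : set (aff_space 1 m)) (f g : sub_space S -> X),
    zclosed S -> is_morph f -> is_morph g -> zopen [set z | f z <> g z].

Definition is_variety X :=
  [/\ zopen [set: X],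
      (forall U V : set X, zopen U -> zopen V -> zopen (U `&` V)) /\
      (forall F : set (set X), F `<=` zopen -> zopen (\bigcup_(U in F) U)),
      (forall (x : X) f g, near_pt x [set y | f y = g y] -> reg x f -> reg x g),
      (exists k (U : 'I_k -> set X),
        [/\ forall i, zopen (U i), forall x, exists i, U i x
          & forall i, is_affine (sub_space (U i))])
    & is_separated X].

(** [u_1, ..., u_d] generate the maximal ideal of the local ring at [x]. *)
Definition max_ideal_gen X (x : X) d (u : 'I_d -> X -> C) :=
  (forall i, reg x (u i) /\ u i x = 0) /\
  forall f, reg x f -> f x = 0 ->
    exists2 g : 'I_d -> X -> C, (forall i, reg x (g i)) &
      near_pt x [set y | f y = \sum_i g i y * u i y].

(** For [X] of pure dimension [d] this is smoothness, i.e. regularity of all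
    local rings. *)
Definition is_smooth X d := forall x : X, exists u : 'I_d -> X -> C, max_ideal_gen x u.

(** The classical topology is generated, Zariski-locally, by the absolute
    values of regular functions; [e] is automatically real. *)
Definition euclid_open X (U : set X) :=
  forall x, U x ->
    exists k (f : 'I_k -> X -> C) (e : C),
      [/\ forall i, reg x (f i), 0 < e &
          near_pt x [set y | (forall i, `|f i y - f i x| < e) -> U y]].

Definition euclid_continuous X Y (f : X -> Y) :=
  forall V : set Y, euclid_open V -> euclid_open (f @^-1` V).

Definition euclid_dense X (S : set X) :=
  forall U : set X, euclid_open U -> U !=set0 -> (U `&` S) !=set0.

Definition euclid_compact X :=
  forall (I : Type) (U : I -> set X),
    (forall i, euclid_open (U i)) -> (forall x, exists i, U i x) ->
    exists k (i : 'I_k -> I), forall x, exists j, U (i j) x.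

Definition zdense X (U : set X) :=
  forall V : set X, zopen V -> V !=set0 -> (V `&` U) !=set0.

Definition is_birational X Y (f : X -> Y) :=
  is_morph f /\
  exists (U : set X) (V : set Y),
    [/\ zopen U /\ zdense U, zopen V /\ zdense V
      & exists2 g : sub_space U -> sub_space V, is_iso g &
          forall x, sval (g x) = f (sval x)].

(** [Y = B x_M X], the square being formed by [q : Y -> B], [psi : Y -> X],
    [phi : B -> M] and [pi : X -> M]. *)
Definition is_cartesian Y B X M
    (q : Y -> B) (psi : Y -> X) (phi : B -> M) (pi : X -> M) :=
  [/\ is_morph psi, forall y, pi (psi y) = phi (q y)
    & forall Z (f : Z -> B) (g : Z -> X), is_variety Z -> is_morph f -> is_morph g ->
        (forall z, pi (g z) = phi (f z)) ->
        exists! h : Z -> Y, [/\ is_morph h, forall z, q (h z) = f z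
                              & forall z, psi (h z) = g z]].

Definition adj X k (K : 'I_k -> set X) : rel 'I_k :=
  fun v w => (v != w) && `[< (K v `&` K w) !=set0 >].

(** An ordinary double point, with local equation [u_0 u_1 = 0]. *)
Definition is_node X (x : X) :=
  exists2 u : 'I_2 -> X -> C, max_ideal_gen x u & near_pt x [set y | u 0 y * u 1 y = 0].

(** A connected nodal curve of genus 0, i.e. a tree of projective lines, with
    irreducible components [K 0, ..., K (k - 1)].  The cardinal counts the
    edges of the dual graph twice. *)
Definition is_tree_curve X k (K : 'I_k -> set X) :=
  [/\ forall v, zclosed (K v) /\ isomorphic (sub_space (K v)) (proj_space 1),
      forall x, exists v, K v x,
      (forall v w x y, v != w -> K v x -> K w x -> K v y -> K w y -> x = y) /\
      (forall u v w x, K u x -> K v x -> K w x -> [|| u == v, v == w | u == w]),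
      forall v w x, v != w -> K v x -> K w x -> is_node x
    & [/\ (0 < k)%N, forall v w, connect (adj K) v w
        & #|[pred e : ('I_k * 'I_k)%type | adj K e.1 e.2]| = (k.-1).*2]].

(** The degree of [K_X + sum_i a_i s_i] on the component [K v] of a tree of
    projective lines: the dualizing sheaf restricts to [O(-2 + m)], where [m] is
    the number of nodes on [K v]. *)
Definition log_degree n (a : 'I_n -> rat) X (s : 'I_n -> X) k (K : 'I_k -> set X) v : rat :=
  - 2 + #|[pred w | adj K v w]|%:R + \sum_(i | `[< K v (s i) >]) a i.

(** Ampleness of [K_X + sum_i a_i s_i] is positivity of its degree on every
    irreducible component. *)
Definition is_weighted_stable n (a : 'I_n -> rat) X (s : 'I_n -> X) :=
  exists k (K : 'I_k -> set X),
    [/\ is_tree_curve K,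
        forall i v w, K v (s i) -> K w (s i) -> v = w,
        forall v, 0 < log_degree a s K v
      & forall I : {set 'I_n}, (forall i j, i \in I -> j \in I -> s i = s j) ->
          \sum_(i in I) a i <= 1].

(** Flatness of the local ring of [X] at [x] over that of [B] at [pi x], by the
    equational criterion: every linear relation is a consequence of relations
    with coefficients in the base. *)
Definition is_flat_at X B (pi : X -> B) (x : X) :=
  forall k (f : 'I_k -> B -> C) (g : 'I_k -> X -> C),
    (forall i, reg (pi x) (f i)) -> (forall i, reg x (g i)) ->
    near_pt x [set y | \sum_i f i (pi y) * g i y = 0] ->
    exists m (c : 'I_k -> 'I_m -> B -> C) (h : 'I_m -> X -> C),
      [/\ forall i j, reg (pi x) (c i j), forall j, reg x (h j),
          forall i, near_pt x [set y | g i y = \sum_j c i j (pi y) * h j y]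
        & forall j, near_pt (pi x) [set b | \sum_i f i b * c i j b = 0]].

(** The scheme-theoretic fibre through [x] is reduced at [x]: germs vanishing on
    the fibre lie in the ideal generated by the maximal ideal at [pi x]. *)
Definition has_reduced_fibre_at X B (pi : X -> B) (x : X) :=
  forall f, reg x f -> near_pt x [set y | pi y = pi x -> f y = 0] ->
    exists k (h : 'I_k -> B -> C) (g : 'I_k -> X -> C),
      [/\ forall i, reg (pi x) (h i) /\ h i (pi x) = 0, forall i, reg x (g i)
        & near_pt x [set y | f y = \sum_i h i (pi y) * g i y]].

Definition is_locally_projective X B (pi : X -> B) :=
  forall b : B, exists U : set B, [/\ zopen U, U b &
    exists N (e : sub_space (pi @^-1` U) -> prod_space (sub_space U) (proj_space N)),
      is_closed_immersion e /\ forall x, sval (e x).1 = pi (sval x)].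

Definition fibre X B (pi : X -> B) (b : B) : space R := sub_space [set x | pi x = b].

(** A family of weighted stable curves of genus 0: a flat proper morphism with
    sections, whose scheme-theoretic fibres are weighted stable.  As
    [K + sum_i a_i s_i] is relatively ample, such a proper morphism is projective
    locally on the base, which is the form of properness used here. *)
Definition is_family n (a : 'I_n -> rat) X B (pi : X -> B) (s : 'I_n -> B -> X) :=
  [/\ is_variety X, is_morph pi,
      forall i, is_morph (s i) /\ forall b, pi (s i b) = b,
      is_locally_projective pi /\
      (forall x, is_flat_at pi x /\ has_reduced_fibre_at pi x)
    & forall b, exists2 t : 'I_n -> fibre pi b, (forall i, sval (t i) = s i b) &
        is_weighted_stable a t].

(** [M], with universal curve [pi : X -> M] and sections [s], represents the
    functor of families of weighted stable curves over varieties. *)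
Definition is_fine_moduli n (a : 'I_n -> rat) M X (pi : X -> M) (s : 'I_n -> M -> X) :=
  [/\ is_variety M, is_family a pi s
    & forall B Y (q : Y -> B) (t : 'I_n -> B -> Y), is_variety B -> is_family a q t ->
        exists! phi : B -> M, is_morph phi /\
          exists2 psi : Y -> X, is_cartesian q psi phi pi &
            forall i b, psi (t i b) = s i (phi b)].

(** [collapses a s s'] : the pointed curve [s'] is obtained from [s] by
    successively collapsing to points components along which
    [K + sum_i a_i s_i] fails to be ample. *)
Inductive collapses n (a : 'I_n -> rat) :
    forall X (s : 'I_n -> X) X' (s' : 'I_n -> X'), Prop :=
| collapses_iso X (s : 'I_n -> X) X' (s' : 'I_n -> X') (f : X -> X') :
    is_iso f -> (forall i, f (s i) = s' i) -> collapses a s s'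
| collapses_step X (s : 'I_n -> X) X1 (s1 : 'I_n -> X1) X' (s' : 'I_n -> X')
    k (K : 'I_k -> set X) v k1 (K1 : 'I_k1 -> set X1) (c : X -> X1) (p : X1) :
    is_tree_curve K -> is_tree_curve K1 ->
    log_degree a s K v <= 0 ->
    is_morph c -> c @^-1` [set p] = K v -> (forall y, exists x, c x = y) ->
    is_immersion (fun x : sub_space (~` K v) => c (sval x)) ->
    (forall i, c (s i) = s1 i) ->
    collapses a s1 s' -> collapses a s s'.

End Spaces.

Record weights (n : nat) := Weights {
  wt :> 'I_n -> rat;
  wt_bounds : forall i, 0 < wt i <= 1;
  wt_sum : 2 < \sum_i wt i }.

Record hassett_space (R : realType) n (a : 'I_n -> rat) := HassettSpace {
  hs_sp :> space R;
  hs_curve : space R;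
  hs_proj : hs_curve -> hs_sp;
  hs_sec : 'I_n -> hs_sp -> hs_curve;
  hs_fine : is_fine_moduli a hs_proj hs_sec }.

Definition is_reduction (R : realType) n (a0 a : 'I_n -> rat)
    (M0 : hassett_space R a0) (M : hassett_space R a) (rho : M0 -> M) :=
  is_morph rho /\
  forall m, exists (t : 'I_n -> fibre (@hs_proj _ _ _ M0) m)
                   (t' : 'I_n -> fibre (@hs_proj _ _ _ M) (rho m)),
    [/\ forall i, sval (t i) = hs_sec i m, forall i, sval (t' i) = hs_sec i (rho m)
      & collapses a t t'].

Section Chambers.
Context {R : realType} {n : nat}.

(** Sets of Pluecker indices; the indices are two-element subsets. *)
Definition pluecker_set := {set {set 'I_n}}.

Definition pluecker (L : 'M[R[i]]_(2, n)) (i j : 'I_n) : R[i] :=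
  L 0 i * L 1 j - L 0 j * L 1 i.

Definition pl_support (L : 'M[R[i]]_(2, n)) : pluecker_set :=
  [set I : {set 'I_n} | [exists i, exists j, (I == [set i; j]) && (pluecker L i j != 0)]]%SET.

Definition full_rank : space R :=
  sub_space [set L : @aff_space R 2 n | mxrank (L : 'M[R[i]]_(2, n)) = 2%N].

(** The Grassmannian of planes in [C^n], a plane being given by the 2 by [n]
    matrices of which it is the row space. *)
Definition Gr : space R :=
  quot_space (fun L L' : full_rank => exists2 g : 'M[R[i]]_2, g \in unitmx &
          (sval L' : 'M[R[i]]_(2, n)) = g *m (sval L : 'M[R[i]]_(2, n))).

(** [L] is a matrix whose row space is the plane [c]. *)
Definition spans (c : Gr) (L : 'M[R[i]]_(2, n)) :=
  exists2 l : full_rank, sval c l & sval l = L.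

Definition stratum (sigma : pluecker_set) : set Gr :=
  [set c | exists2 L, spans c L & pl_support L = sigma].

Definition is_admissible (sigma : pluecker_set) := stratum sigma !=set0.

Definition Lambda (I : {set 'I_n}) : 'rV[R]_n := \row_i (i \in I)%:R.

Definition affine_hull (sigma : pluecker_set) : set 'rV[R]_n :=
  [set x | exists c : {set 'I_n} -> R,
     \sum_(I in sigma) c I = 1 /\ x = \sum_(I in sigma) c I *: Lambda I].

Definition polytope (sigma : pluecker_set) : set 'rV[R]_n :=
  [set x | exists c : {set 'I_n} -> R, [/\ forall I, 0 <= c I,
     \sum_(I in sigma) c I = 1 & x = \sum_(I in sigma) c I *: Lambda I]].

Definition polytope_int (sigma : pluecker_set) : set 'rV[R]_n :=
  [set x | polytope sigma x /\
     exists2 e : R, 0 < e &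
       forall y, affine_hull sigma y -> `|y - x| < e -> polytope sigma y].

Definition chamber (omega : {set pluecker_set}) : set 'rV[R]_n :=
  [set x | forall sigma, sigma \in omega -> polytope_int sigma x].

Definition is_chamber (omega : {set pluecker_set}) :=
  [/\ forall sigma, sigma \in omega -> is_admissible sigma,
      chamber omega !=set0
    & forall sigma, is_admissible sigma -> sigma \notin omega ->
        chamber omega `&` polytope_int sigma = set0].

Definition has_affine_frame (S : set 'rV[R]_n) d :=
  exists x (M : 'M[R]_(d, n)), [/\ S x, forall i, S (x + row i M) & row_free M].

Definition has_dim (S : set 'rV[R]_n) d :=
  has_affine_frame S d /\ ~ has_affine_frame S d.+1.

Definition is_max_chamber (omega : {set pluecker_set}) :=
  is_chamber omega /\ has_dim (chamber omega) n.-1.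

Definition hypersimplex_int : set 'rV[R]_n :=
  [set t | \sum_i t 0 i = 2 /\ forall i, 0 < t 0 i < 1].

Definition weight_domain : set 'rV[R]_n :=
  [set a | (forall i, 0 < a 0 i <= 1) /\ 2 < \sum_i a 0 i].

Definition is_wall (S : {set 'I_n}) := (2 <= #|S| <= n - 2)%N.

Definition wall_sign (a : 'rV[R]_n) (S : {set 'I_n}) : R :=
  Num.sg (\sum_(j in S) a 0 j - 1).

(** The chamber of the weight domain containing [a], for [a] on no wall. *)
Definition weight_chamber (a : 'rV[R]_n) : set 'rV[R]_n :=
  [set b | weight_domain b /\ forall S, is_wall S -> wall_sign b S = wall_sign a S].

Definition wt_row (A : weights n) : 'rV[R]_n := \row_i ratr (A i).

Definition near_boundary (A : weights n) :=
  (forall S, is_wall S -> wall_sign (wt_row A) S != 0) /\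
  exists omega, [/\ is_max_chamber omega, chamber omega `<=` hypersimplex_int
                  & chamber omega `<=` closure (weight_chamber (wt_row A))].

(** The union of the strata [W_sigma], [sigma \in omega]. *)
Definition strata (omega : {set pluecker_set}) : space R :=
  sub_space [set c : Gr | exists2 sigma, sigma \in omega & stratum sigma c].

(** The space [F_omega], the quotient by the torus acting by scaling the
    columns. *)
Definition param_space (omega : {set pluecker_set}) : space R :=
  quot_space (fun c c' : strata omega =>
    exists L L' (t : 'rV[R[i]]_n), [/\ spans (sval c) L, spans (sval c') L',
      forall i, t 0 i != 0 & L' = L *m diag_mx t]).

(** The point [y] of [F_omega] is the orbit of the row space of [L]. *)
Definition represents omega (y : param_space omega) (L : 'M[R[i]]_(2, n)) :=
  exists2 c : strata omega, sval y c & spans (sval c) L.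

Definition main_param_space : space R :=
  param_space [set [set I : {set 'I_n} | #|I| == 2%N]]%SET.

End Chambers.

Arguments Gr : clear implicits.
Arguments pluecker_set : clear implicits.
Arguments main_param_space : clear implicits.
Arguments param_space : clear implicits.
Arguments near_boundary R {n} A.
Arguments is_max_chamber R {n} omega.

(** The universal space of parameters: a smooth compactification of [F_n],
    identified with the moduli space of stable [n]-pointed curves of genus 0 so
    that the orbit of a plane in [F_n] corresponds to the projective line marked
    by the columns of a matrix spanning the plane. *)
Record universal_space (R : realType) (n : nat) := UniversalSpace {
  us_moduli :> hassett_space R (fun _ : 'I_n => 1);
  us_incl : main_param_space R n -> us_moduli;
  us_open : is_open_immersion us_incl;
  us_dense : euclid_dense (range us_incl);
  us_compact : euclid_compact us_moduli;
  us_smooth : is_smooth us_moduli (n - 3);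
  us_columns : forall y L, represents y L ->
    exists2 f : proj_space 1 -> fibre (@hs_proj _ _ _ us_moduli) (us_incl y), is_iso f &
      forall i x, homog x (col i L)^T -> sval (f x) = hs_sec i (us_incl y) }.

(** A continuous map to [F_omega] which is the identity on [F_n]. *)
Definition is_projection (R : realType) n (F : universal_space R n) omega
    (p : F -> param_space R n omega) :=
  euclid_continuous p /\
  forall y L, represents y L -> represents (p (us_incl F y)) L.

(** A class of spaces with designated morphisms: [sc_hom f] says that the map [f]
    is one of the morphisms, identities included. *)
Record space_cat (R : realType) := SpaceCat {
  sc_ob : Type;
  sc_sp :> sc_ob -> space R;
  sc_hom : forall a b, (sc_sp a -> sc_sp b) -> Prop }.

Section Modeling.
Context {R : realType}.
Implicit Types D E : space_cat R.

(** Each morphism of [D] has a counterpart in [E], and all squares formed by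
    a morphism of [D], a morphism of [E] and the maps [h] commute. *)
Definition is_model D E (Phi : sc_ob D -> sc_ob E) (h : forall a, D a -> E (Phi a)) :=
  [/\ forall a, is_birational (h a),
      forall b, exists a, Phi a = b
    & forall a a' (f : D a -> D a'), sc_hom f ->
        (exists g : E (Phi a) -> E (Phi a'), sc_hom g) /\
        (forall g : E (Phi a) -> E (Phi a'), sc_hom g ->
           forall x, g (h a x) = h a' (f x))].

Definition modeled D E :=
  exists (Phi : sc_ob D -> sc_ob E) (h : forall a, D a -> E (Phi a)), is_model h.

Definition isomorphically_modeled D E :=
  exists (Phi : sc_ob D -> sc_ob E) (h : forall a, D a -> E (Phi a)),
    is_model h /\ forall a, is_iso (h a).

End Modeling.

Section Categories.
Context {R : realType} {n : nat}.

Definition all_ones (A : weights n) := forall i, A i = 1.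

Definition hassett_ob := {A : weights n | all_ones A \/ near_boundary R A}.

Section Hassett.
Variables (H : forall A : weights n, hassett_space R A)
          (rho : forall A0 A : weights n, H A0 -> H A).

Inductive hassett_hom :
    forall A B : hassett_ob, (H (sval A) -> H (sval B)) -> Prop :=
| hassett_id (A : hassett_ob) : @hassett_hom A A id
| hassett_red (A0 A : hassett_ob) : all_ones (sval A0) ->
    @hassett_hom A0 A (@rho (sval A0) (sval A)).

Definition hassett_cat : space_cat R :=
  @SpaceCat R hassett_ob (fun A => H (sval A)) hassett_hom.

End Hassett.

Definition max_chambers := {omega : {set pluecker_set n} | is_max_chamber R omega}.

(** [None] stands for the universal space of parameters. *)
Definition param_ob (F : universal_space R n) (o : option max_chambers) : space R :=
  if o is Some omega then param_space R n (sval omega) else F.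

Section ParamCat.
Variables (F : universal_space R n)
          (p : forall omega : max_chambers, F -> param_space R n (sval omega)).

Inductive param_hom :
    forall a b : option max_chambers, (param_ob F a -> param_ob F b) -> Prop :=
| param_id a : @param_hom a a id
| param_proj (omega : max_chambers) :
    @param_hom None (Some omega) (@p omega).

Definition param_cat : space_cat R :=
  @SpaceCat R (option max_chambers) (param_ob F) param_hom.

End ParamCat.
End Categories.

Arguments max_chambers : clear implicits.

(* Main.v *)
(** For weights [A] near the boundary every stable curve is a projective line:
    two leaves of a tree would carry disjoint sets of marked points of weight
    above [1], but at the points of the chamber the total weight is [2].  A stable
    marked line is a [2] by [n] matrix with nonzero columns in which the total
    weight of a set of proportional columns is at most [1]; comparing walls, and
    writing a point of the hypersimplex whose sums over proportional columns are
    at most [1] as a convex combination of vertices, these are the matrices whose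
    planes lie in the strata of the chamber.  Thus the points of the Hassett space
    and of the space of parameters are both the classes of such matrices under
    change of basis and rescaling of the columns.

    The map from the space of parameters to the Hassett space is the classifying
    map of the tautological family of lines.  Its inverse is a morphism because a
    family of marked lines is, locally on the base, given by a matrix of regular
    functions: embed the family in projective space by a map of degree [d] on the
    fibres, put the first section at infinity and let [u] generate its ideal.
    For some [k], forms of degree [k] restrict onto the polynomials of degree
    at most [kd], so there are forms with zeros of order [kd] and [kd - 1] along
    the section; their quotient is a coordinate on each fibre, as the degree of
    the fibres is locally constant.

    The squares commute on the orbits of generic planes, where both composites
    are determined by the matrix, hence everywhere, because these orbits are dense
    and varieties are Hausdorff in the classical topology. *)

From mathcomp Require Import all_boot all_order all_algebra.
From mathcomp Require Import complex.
From mathcomp Require Import all_classical all_reals all_analysis.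
From mathcomp Require Import ring lra zify.
Require Import Defs.

Set Implicit Arguments.
Unset Strict Implicit.
Unset Printing Implicit Defensive.

Import Order.TTheory GRing.Theory Num.Theory.
Import numFieldNormedType.Exports.
Local Open Scope classical_set_scope.
Local Open Scope complex_scope.
Local Open Scope ring_scope.

#[local] Arguments reg {R s} _ _ : simpl never.
#[local] Arguments zopen {R s} _ : simpl never.

(** * Spaces with functions *)

Section Good.
Context {R : realType}.
Local Notation C := R[i].
Implicit Types X Y Z : space R.

(** The obstacle is the inverse map. It needs matrices depending regularly on a point of the Hassett
    space, which is known only as a representing object, while the isomorphisms of its fibres with
    the line are chosen point by point, without any regularity. Regularity is recovered from forms
    whose coefficients are built from jets along the section. They give a coordinate on the fibres
    only where the degree is constant. Their existence yields [k * d m0 <= k * d m] for [m] near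
    [m0]; the opposite inequality comes from completeness of the line, used on the tautological
    families over matrices, which are products. Irreducibility of the space of matrices then makes
    the degree the same over the whole open set on which the universal curve is embedded.

    The two sides are compared through the relation [config m L]. It determines [m] from [L], by
    uniqueness of the classifying map over a one-point base, and [L] from [m] up to change of basis
    and rescaling of columns, because every automorphism of the line is linear. *)

Lemma near_sub X (x : X) (P Q : set X) : near_pt x P -> P `<=` Q -> near_pt x Q.
Proof. by move=> [U [oU Ux UP]] PQ; exists U; split=> // y /UP /PQ. Qed.

Lemma near_refl X (x : X) P : near_pt x P -> P x.
Proof. by move=> [U [_ Ux UP]]; exact: UP. Qed.

Lemma near_near X (x : X) P : near_pt x P -> near_pt x [set y | near_pt y P].
Proof. by move=> [U [oU Ux UP]]; exists U; split=> // y Uy; exists U. Qed.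

Lemma near_open X (x : X) (U : set X) : zopen U -> U x -> near_pt x U.
Proof. by move=> oU Ux; exists U; split=> // y. Qed.

(** Properties of affine space inherited by subspaces, quotients, products and
    everything glued from affine pieces. *)
Record good X : Prop := Good {
  good_T : zopen [set: X];
  good_I : forall U V : set X, zopen U -> zopen V -> zopen (U `&` V);
  good_U : forall F : set (set X), F `<=` zopen -> zopen (\bigcup_(U in F) U);
  good_germ : forall (x : X) f g,
    near_pt x [set y | f y = g y] -> reg x f -> reg x g;
  good_near : forall (x : X) f, reg x f -> near_pt x [set y | reg y f];
  good_cst : forall (x : X) (a : C), reg x (fun=> a);
  good_add : forall (x : X) f g, reg x f -> reg x g -> reg x (fun y => f y + g y);
  good_mul : forall (x : X) f g, reg x f -> reg x g -> reg x (fun y => f y * g y);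
  good_inv : forall (x : X) f, reg x f -> f x != 0 -> reg x (fun y => (f y)^-1);
  good_nz : forall (x : X) f, reg x f -> f x != 0 -> near_pt x [set y | f y != 0] }.

Section Theory.
Variables (X : space R) (gX : good X).

Lemma nearT (x : X) P : (forall y, P y) -> near_pt x P.
Proof. by move=> PP; exists setT; split=> //; exact: good_T. Qed.

Lemma nearI (x : X) P Q : near_pt x P -> near_pt x Q -> near_pt x (P `&` Q).
Proof.
move=> [U [oU Ux UP]] [V [oV Vx VQ]]; exists (U `&` V); split=> //.
  exact: good_I.
by move=> y [/UP ? /VQ ?].
Qed.

Lemma near_all (I : finType) (x : X) (P : I -> set X) :
  (forall i, near_pt x (P i)) -> near_pt x [set y | forall i, P i y].
Proof.
move=> nP; suff H (s : seq I) : near_pt x [set y | forall i, i \in s -> P i y].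
  by apply: near_sub (H (enum I)) _ => y yP i; apply: yP; rewrite mem_enum.
elim: s => [|a s IHs]; first exact: nearT.
apply: near_sub (nearI (nP a) IHs) _ => y [Pa Ps] i.
by rewrite inE => /orP[/eqP->//|/Ps].
Qed.

Lemma open_near (U : set X) : (forall x, U x -> near_pt x U) -> zopen U.
Proof.
move=> nU; suff -> : U = \bigcup_(V in [set V | zopen V /\ V `<=` U]) V.
  by apply: good_U => // V [].
rewrite eqEsubset; split=> x.
  by move=> /nU [V [oV Vx VU]]; exists V.
by move=> [V [_ VU] /VU].
Qed.

Lemma open_interior (P : set X) : zopen [set x | near_pt x P].
Proof. by apply: open_near => x; exact: near_near. Qed.

Lemma reg_ext (x : X) f g : (forall y, f y = g y) -> reg x f -> reg x g.
Proof. by move=> fg; apply: good_germ => //; apply: nearT. Qed.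

Lemma reg_opp (x : X) f : reg x f -> reg x (fun y => - f y).
Proof.
move=> rf; apply: (@reg_ext _ (fun y => -1 * f y)); first by move=> y; rewrite mulN1r.
by apply: good_mul => //; exact: good_cst.
Qed.

Lemma reg_sub (x : X) f g : reg x f -> reg x g -> reg x (fun y => f y - g y).
Proof. by move=> rf rg; apply: good_add => //; apply: reg_opp. Qed.

Lemma reg_div (x : X) f g : reg x f -> reg x g -> g x != 0 ->
  reg x (fun y => f y / g y).
Proof. by move=> rf rg g0; apply: good_mul => //; apply: good_inv. Qed.

Lemma reg_exp (x : X) f k : reg x f -> reg x (fun y => f y ^+ k).
Proof.
move=> rf; elim: k => [|k IHk]; first exact: good_cst.
by apply: (@reg_ext _ (fun y => f y * f y ^+ k)) => [y|]; [rewrite exprS|exact: good_mul].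
Qed.

Lemma reg_sum (I : Type) (s : seq I) (P : pred I) (x : X) (f : I -> X -> C) :
  (forall i, P i -> reg x (f i)) -> reg x (fun y => \sum_(i <- s | P i) f i y).
Proof.
move=> rf; elim: s => [|a s IHs].
  by apply: (@reg_ext _ (fun=> 0)) => [y|]; [rewrite big_nil|exact: good_cst].
apply: (@reg_ext _ (fun y => (if P a then f a y else 0) + \sum_(i <- s | P i) f i y)).
  by move=> y; rewrite big_cons; case: (P a) => //; rewrite add0r.
apply: good_add => //; case Pa: (P a); [exact: rf|exact: good_cst].
Qed.

Lemma reg_prod (I : Type) (s : seq I) (P : pred I) (x : X) (f : I -> X -> C) :
  (forall i, P i -> reg x (f i)) -> reg x (fun y => \prod_(i <- s | P i) f i y).
Proof.
move=> rf; elim: s => [|a s IHs].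
  by apply: (@reg_ext _ (fun=> 1)) => [y|]; [rewrite big_nil|exact: good_cst].
apply: (@reg_ext _ (fun y => (if P a then f a y else 1) * \prod_(i <- s | P i) f i y)).
  by move=> y; rewrite big_cons; case: (P a) => //; rewrite mul1r.
apply: good_mul => //; case Pa: (P a); [exact: rf|exact: good_cst].
Qed.

Lemma reg_det (x : X) n (A : X -> 'M[C]_n) :
  (forall i j, reg x (fun y => A y i j)) -> reg x (fun y => \det (A y)).
Proof.
move=> rA; rewrite /determinant; apply: reg_sum => s _.
by apply: good_mul => //; [exact: good_cst|apply: reg_prod].
Qed.

Lemma reg_adj (x : X) n (A : X -> 'M[C]_n) i j :
  (forall i j, reg x (fun y => A y i j)) -> reg x (fun y => (\adj (A y)) i j).
Proof.
move=> rA; apply: (@reg_ext _ (fun y => cofactor (A y) j i)) => [y|].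
  by rewrite mxE.
apply: good_mul => //; first exact: good_cst.
apply: reg_det => k l; apply: reg_ext (rA (lift j k) (lift i l)) => y.
by rewrite !mxE.
Qed.

Lemma reg_mulmx (x : X) m n q (A : X -> 'M[C]_(m, n)) (B : X -> 'M[C]_(n, q)) i j :
  (forall i j, reg x (fun y => A y i j)) -> (forall i j, reg x (fun y => B y i j)) ->
  reg x (fun y => (A y *m B y) i j).
Proof.
move=> rA rB; apply: (@reg_ext _ (fun y => \sum_k A y i k * B y k j)) => [y|].
  by rewrite mxE.
by apply: reg_sum => k _; apply: good_mul.
Qed.

Lemma reg_horner (x : X) (q : {poly C}) f : reg x f -> reg x (fun y => q.[f y]).
Proof.
move=> rf; apply: (@reg_ext _ (fun y => \sum_(i < size q) q`_i * f y ^+ i)).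
  by move=> y; rewrite horner_coef.
by apply: reg_sum => i _; apply: good_mul => //; [exact: good_cst|exact: reg_exp].
Qed.

Lemma polyfun_reg (T I : Type) (c : I -> T -> C) p (x : X) (f : X -> T) :
  polyfun c p -> (forall i, reg x (fun y => c i (f y))) -> reg x (fun y => p (f y)).
Proof.
move=> Pp rc; elim: Pp => [a|i|p1 q1 _ IH1 _ IH2|p1 q1 _ IH1 _ IH2].
- exact: good_cst.
- exact: rc.
- exact: good_add.
- exact: good_mul.
Qed.

End Theory.

Lemma aff_good m n : good (@aff_space R m n).
Proof.
have cst a := @polyfun_cst R _ _ (@entry R m n) a.
split.
- by move=> x _; exists (fun=> 1); split=> //; exact: oner_neq0.
- move=> U V oU oV x [/oU [p [Pp p0 pU]] /oV [q [Pq q0 qV]]].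
  exists (fun t => p t * q t); split; [exact: polyfun_mul|exact: mulf_neq0|].
  by move=> y; rewrite mulf_eq0 negb_or => /andP[/pU ? /qV].
- move=> F oF x [U FU Ux]; have [p [Pp p0 pU]] := oF _ FU x Ux.
  by exists p; split=> // y /pU Uy; exists U.
- move=> x f g [U [oU Ux Ufg]] [p [q [Pp Pq q0 fpq]]].
  have [r [Pr r0 rU]] := oU x Ux.
  exists (fun t => p t * r t), (fun t => q t * r t); split.
  + exact: polyfun_mul.
  + exact: polyfun_mul.
  + exact: mulf_neq0.
  + move=> y; rewrite mulf_eq0 negb_or => /andP[qy ry].
    by rewrite -(Ufg y (rU y ry)) /= fpq // -mulf_div divff // mulr1.
- move=> x f [p [q [Pp Pq q0 fpq]]]; exists [set y | q y != 0]; split=> //.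
  + by move=> y /= qy; exists q; split.
  + by move=> y /= qy; exists p, q; split.
- move=> x a; exists (fun=> a), (fun=> 1); split=> [|||y _]; [exact: cst|exact: cst|exact: oner_neq0|by rewrite divr1].
- move=> x f g [p [q [Pp Pq q0 fpq]]] [p' [q' [Pp' Pq' q0' fpq']]].
  exists (fun t => p t * q' t + p' t * q t), (fun t => q t * q' t); split.
  + by apply: polyfun_add; apply: polyfun_mul.
  + exact: polyfun_mul.
  + exact: mulf_neq0.
  + move=> y; rewrite mulf_eq0 negb_or => /andP[qy ry].
    by rewrite fpq // fpq' // addf_div.
- move=> x f g [p [q [Pp Pq q0 fpq]]] [p' [q' [Pp' Pq' q0' fpq']]].
  exists (fun t => p t * p' t), (fun t => q t * q' t); split.
  + exact: polyfun_mul.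
  + exact: polyfun_mul.
  + exact: mulf_neq0.
  + move=> y; rewrite mulf_eq0 negb_or => /andP[qy ry].
    by rewrite fpq // fpq' // mulf_div.
- move=> x f [p [q [Pp Pq q0 fpq]]] fx.
  have px : p x != 0 by apply: contraNneq fx => p0; rewrite fpq // p0 mul0r.
  exists (fun t => q t * q t), (fun t => p t * q t); split.
  + exact: polyfun_mul.
  + exact: polyfun_mul.
  + exact: mulf_neq0.
  + move=> y; rewrite mulf_eq0 negb_or => /andP[py qy].
    by rewrite fpq // invf_div -mulf_div divff // mulr1.
- move=> x f [p [q [Pp Pq q0 fpq]]] fx.
  have px : p x != 0 by apply: contraNneq fx => p0; rewrite fpq // p0 mul0r.
  exists [set y | p y * q y != 0]; split=> /=.
  + move=> y /= qy; exists (fun t => p t * q t); split=> //; exact: polyfun_mul.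
  + exact: mulf_neq0.
  + move=> y /=; rewrite mulf_eq0 negb_or => /andP[py qy].
    by rewrite fpq // mulf_neq0 // invr_neq0.
Qed.

Lemma near_subP X (S : set X) (x : sub_space S) (P : set X) :
  near_pt (sval x) P -> near_pt x [set y | P (sval y)].
Proof.
move=> [U [oU Ux UP]]; exists [set y : sub_space S | U (sval y)]; split=> //.
  by exists U.
by move=> y /= /UP.
Qed.

Lemma near_sub_ex X (S : set X) (x : sub_space S) (P : set (sub_space S)) :
  near_pt x P -> near_pt (sval x) [set y | forall h : S y, P (exist _ y h)].
Proof.
move=> [U [[V oV ->] Ux UP]]; exists V; split=> // y Vy h; exact: UP.
Qed.

Lemma sub_good X (S : set X) : good X -> good (sub_space S).
Proof.
move=> gX.
have eqn (x : sub_space S) f g : near_pt x [set y | f y = g y] ->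
    near_pt (sval x) [set y | forall h : S y, f (exist _ y h) = g (exist _ y h)].
  by move=> /near_sub_ex.
split.
- exists setT; first exact: good_T.
  by rewrite eqEsubset.
- move=> U V [U' oU' ->] [V' oV' ->]; exists (U' `&` V'); first exact: good_I.
  by [].
- move=> F oF; exists (\bigcup_(V in [set V | zopen V /\ F [set x | V (sval x)]]) V).
    by apply: good_U => // V [].
  rewrite eqEsubset; split=> x /=.
    move=> [U FU Ux]; have [V oV EV] := oF _ FU; exists V.
      by split=> //; rewrite -EV.
    by move: Ux; rewrite EV.
  by move=> [V [oV FV] Vx]; exists [set x | V (sval x)].
- move=> x f g /eqn nfg [h rh nh]; exists h => //.
  by apply: near_sub (nearI gX nfg nh) _ => y [] /= e1 e2 Sy; rewrite -e1.
- move=> x f [g rg ng].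
  apply: near_sub (near_subP (nearI gX (good_near gX rg) (near_near ng))) _.
  by move=> y /= [r1 n1]; exists g.
- move=> x a; exists (fun=> a); first exact: good_cst.
  exact: nearT.
- move=> x f g [f' rf nf] [g' rg ng]; exists (fun y => f' y + g' y).
    exact: good_add.
  by apply: near_sub (nearI gX nf ng) _ => y [] /= e1 e2 Sy; rewrite e1 e2.
- move=> x f g [f' rf nf] [g' rg ng]; exists (fun y => f' y * g' y).
    exact: good_mul.
  by apply: near_sub (nearI gX nf ng) _ => y [] /= e1 e2 Sy; rewrite e1 e2.
- move=> [x Sx] f [f' rf nf] fx; exists (fun y => (f' y)^-1).
    by apply: good_inv => //; rewrite -(near_refl nf).
  by apply: near_sub nf _ => y /= e1 Sy; rewrite e1.
- move=> [x Sx] f [f' rf nf] fx; rewrite /= in rf nf.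
  have f0 : f' x != 0 by rewrite -(near_refl nf Sx).
  have := near_subP (x := exist _ x Sx) (nearI gX nf (good_nz gX rf f0)).
  by move=> /near_sub; apply=> -[y Sy] /= [e1]; rewrite e1.
Qed.

Lemma class_of_eq X (E : X -> set X) (c : quot_space E) : exists x, c = class_of E x.
Proof.
case: c => c [x e]; exists x; rewrite /class_of; subst c.
by congr exist; exact: Prop_irrelevance.
Qed.

Lemma quot_good X (E : X -> set X) : good X -> good (quot_space E).
Proof.
move=> gX; split.
- exact: (good_T gX).
- by move=> U V oU oV; exact: (good_I gX oU oV).
- move=> F oF; pose F' := [set V | zopen V /\ exists2 U, F U & V = [set x | U (class_of E x)]].
  have oF' : F' `<=` zopen by move=> V [].
  have := good_U gX oF'; congr zopen.
  rewrite eqEsubset; split=> x /=.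
    by move=> [V [oV [U FU ->]] Ux]; exists U.
  by move=> [U FU Ux]; exists [set x | U (class_of E x)] => //; split; [exact: oF|exists U].
- move=> c f g [U [oU Uc Ufg]] [V [oV Vc rV]]; exists (U `&` V); split=> //.
    exact: good_I.
  move=> x [Ux Vx]; apply: good_germ (rV x Vx) => //.
  by exists [set x | U (class_of E x)]; split=> // y /= Uy; exact: Ufg.
- by move=> c f [V [oV Vc rV]]; exists V; split=> // y Vy; exists V; split.
- move=> c a; exists setT; split=> //; first exact: good_T.
  by move=> x _; exact: good_cst.
- move=> c f g [U [oU Uc rU]] [V [oV Vc rV]]; exists (U `&` V); split=> //.
    exact: good_I.
  by move=> x [Ux Vx]; apply: (good_add gX (rU x Ux) (rV x Vx)).
- move=> c f g [U [oU Uc rU]] [V [oV Vc rV]]; exists (U `&` V); split=> //.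
    exact: good_I.
  by move=> x [Ux Vx]; apply: (good_mul gX (rU x Ux) (rV x Vx)).
- move=> c f [U [oU Uc rU]] f0; exists (U `&` [set c | f c != 0]); split=> //.
    apply: (@open_near _ gX [set x | (U `&` [set c | f c != 0]) (class_of E x)]).
    move=> x /= [Ux fx].
    apply: near_sub (nearI gX (near_open oU Ux) (good_nz gX (rU x Ux) fx)) _.
    by move=> y [].
  by move=> x [Ux fx]; apply: (good_inv gX (rU x Ux) fx).
- move=> c f [U [oU Uc rU]] f0; exists (U `&` [set c | f c != 0]); split=> //.
    apply: (@open_near _ gX [set x | (U `&` [set c | f c != 0]) (class_of E x)]).
    move=> x /= [Ux fx].
    apply: near_sub (nearI gX (near_open oU Ux) (good_nz gX (rU x Ux) fx)) _.
    by move=> y [].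
Qed.

(** The condition to be a morphism, on germs at one point. It lets maps that are meaningful only
    near a point be extended by default values and still be composed. *)
Definition morph_at X Y (f : X -> Y) (x : X) :=
  (forall V : set Y, near_pt (f x) V -> near_pt x (f @^-1` V)) /\
  (forall h, reg (f x) h -> reg x (h \o f)).

Lemma morph_atP X Y (f : X -> Y) : good X -> is_morph f <-> forall x, morph_at f x.
Proof.
move=> gX; split.
  move=> [fo fr] x; split=> [V [U [oU Ux UV]]|h]; last exact: fr.
  exists (f @^-1` U); split=> //; first exact: fo.
  by move=> y /= /UV.
move=> mf; split=> [U oU|x h].
  by apply: open_near => // x Ux; apply: (mf x).1; exact: near_open.
exact: (mf x).2.
Qed.

Lemma is_morph_at X Y (f : X -> Y) x : is_morph f -> morph_at f x.
Proof.
move=> [fo fr]; split=> [V [U [oU Ux UV]]|h]; last exact: fr.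
exists (f @^-1` U); split=> //; first exact: fo.
by move=> y /= /UV.
Qed.

Lemma is_morph_id X : is_morph (@id X).
Proof. by split. Qed.

Lemma morph_at_comp X Y Z (f : X -> Y) (g : Y -> Z) x :
  morph_at f x -> morph_at g (f x) -> morph_at (g \o f) x.
Proof.
move=> [fo fr] [go gr]; split=> [V /go /fo//|h rh].
by have := fr _ (gr _ rh).
Qed.

Lemma is_morph_comp X Y Z (f : X -> Y) (g : Y -> Z) :
  is_morph f -> is_morph g -> is_morph (g \o f).
Proof.
move=> [fo fr] [go gr]; split=> [V /go /fo//|x h rh].
by have := fr _ _ (gr _ _ rh).
Qed.

Lemma morph_at_near X Y (f g : X -> Y) x : good X ->
  near_pt x [set y | f y = g y] -> morph_at f x -> morph_at g x.
Proof.
move=> gX fg [fo fr]; have fgx := near_refl fg; rewrite /= in fgx; split.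
  rewrite -fgx => V /fo nV; apply: near_sub (nearI gX nV fg) _.
  by move=> y [/= Vy <-].
rewrite -fgx => h /fr; apply: good_germ => //.
by apply: near_sub fg _ => y /= ->.
Qed.

Lemma morph_at_cst X Y (y : Y) (x : X) : good X -> morph_at (fun=> y) x.
Proof.
move=> gX; split=> [V /near_refl Vy|h rh]; first exact: nearT.
exact: good_cst.
Qed.

Lemma is_morph_cst X Y (y : Y) : good X -> is_morph (fun _ : X => y).
Proof. by move=> gX; apply/(morph_atP _ gX) => x; exact: morph_at_cst. Qed.

Lemma sval_morph X (S : set X) : good X -> is_morph (fun x : sub_space S => sval x).
Proof.
move=> gX; split=> [U oU|x h rh]; first by exists U.
by exists h => //; apply: nearT.
Qed.

Lemma to_sub_morph_at X Y (S : set Y) (f : X -> sub_space S) x : good X ->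
  morph_at (fun x => sval (f x) : Y) x -> morph_at f x.
Proof.
move=> gX [fo fr]; split.
  move=> V /near_sub_ex /fo n1; apply: near_sub n1 _ => y /=.
  by case: (f y) => z Sz /= /(_ Sz).
move=> h [g /fr rg ng]; apply: good_germ rg => //.
have n1 := fo _ ng; apply: near_sub n1 _ => y /=; case: (f y) => z Sz /= /(_ Sz)->//.
Qed.

Lemma to_sub_morph X Y (S : set Y) (f : X -> sub_space S) : good X ->
  is_morph (fun x => sval (f x) : Y) -> is_morph f.
Proof.
move=> gX mf; apply/(morph_atP _ gX) => x; apply: to_sub_morph_at => //.
exact: is_morph_at.
Qed.

Lemma open_sub_reg X (U : set X) (x : sub_space U) (f : X -> C) : good X -> zopen U ->
  reg x (fun y => f (sval y)) <-> reg (sval x) f.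
Proof.
move=> gX oU; split; last exact: (is_morph_at _ (sval_morph _ gX)).2.
case: x => x Ux; move=> [g rg ng]; apply: good_germ rg => //.
by apply: near_sub (nearI gX ng (near_open oU Ux)) _ => y [] /= e Uy; rewrite (e Uy).
Qed.

Lemma open_sub_near X (U : set X) (x : sub_space U) (P : set X) : good X -> zopen U ->
  near_pt x (fun y => P (sval y)) -> near_pt (sval x) P.
Proof.
move=> gX oU; case: x => x Ux /near_sub_ex n1.
by apply: near_sub (nearI gX n1 (near_open oU Ux)) _ => y [] /= e /e.
Qed.

Lemma from_open_morph_at X Y (U : set X) (f : X -> Y) (x : sub_space U) :
  good X -> zopen U ->
  morph_at (fun y : sub_space U => f (sval y)) x <-> morph_at f (sval x).
Proof.
move=> gX oU; split=> [[fo fr]|m].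
  split=> [V /fo n1|h /fr].
    exact: (open_sub_near (P := f @^-1` V) gX oU n1).
  by move=> r; apply/(open_sub_reg _ _ gX oU).
by apply: morph_at_comp => //; apply/is_morph_at/sval_morph.
Qed.

Lemma class_of_morph X (E : X -> set X) : is_morph (class_of E : X -> quot_space E).
Proof. by split=> [U oU//|x h [U [oU Ux rU]]]; exact: rU. Qed.

(** A function on a quotient is regular at a class only if its pullback is regular on a whole
    invariant open set. The classes [c] with [h] regular at [f c] form such a set, open because
    regularity in [Y] is an open condition. *)
Lemma quot_morph X (E : X -> set X) Y (f : quot_space E -> Y) : good X -> good Y ->
  (forall x, morph_at (fun x => f (class_of E x)) x) -> is_morph f.
Proof.
move=> gX gY mf; split.
  move=> V oV; apply: (@open_near _ gX [set x | V (f (class_of E x))]) => x /= Vx.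
  by apply: (mf x).1; apply: near_open.
move=> c h rh; exists [set c | reg (f c) h]; split=> //.
  apply: (@open_near _ gX [set x | reg (f (class_of E x)) h]) => x /= rx.
  exact: (mf x).1 (good_near gY rx).
by move=> x rx; apply: (mf x).2.
Qed.

Lemma to_aff_morph_at X m n (f : X -> @aff_space R m n) x : good X ->
  (forall i j, reg x (fun y => (f y : 'M[C]_(m, n)) i j)) -> morph_at f x.
Proof.
move=> gX rf.
have rp p : polyfun (@entry R m n) p -> reg x (p \o f).
  by move=> Pp; apply: polyfun_reg Pp _ => // -[i j]; exact: rf.
split.
  move=> V [U [oU Ux UV]]; have [p [Pp p0 pU]] := oU _ Ux.
  by apply: near_sub (good_nz gX (rp _ Pp) p0) _ => y /pU /UV.
move=> h [p [q [Pp Pq q0 hpq]]].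
apply: (good_germ gX) (reg_div gX (rp _ Pp) (rp _ Pq) q0).
by apply: near_sub (good_nz gX (rp _ Pq) q0) _ => y /= /hpq ->.
Qed.

Lemma aff_coord_reg m n (x : @aff_space R m n) i j :
  reg x (fun y : @aff_space R m n => (y : 'M[C]_(m, n)) i j).
Proof.
exists (fun y => (y : 'M[C]_(m, n)) i j), (fun=> 1); split.
- exact: (@polyfun_coord R _ _ (@entry R m n) (i, j)).
- exact: polyfun_cst.
- exact: oner_neq0.
- by move=> y _; rewrite divr1.
Qed.

Lemma is_iso_sym X Y (f : X -> Y) (g : Y -> X) :
  is_morph f -> is_morph g -> cancel f g -> cancel g f -> is_iso f.
Proof. by move=> mf mg fK gK; split=> //; exists g. Qed.

Lemma is_iso_comp X Y Z (f : X -> Y) (g : Y -> Z) :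
  is_iso f -> is_iso g -> is_iso (g \o f).
Proof.
move=> [mf [f' [mf' fK fK']]] [mg [g' [mg' gK gK']]]; split.
  exact: is_morph_comp.
exists (f' \o g'); split; first exact: is_morph_comp.
- exact: can_comp.
- exact: can_comp.
Qed.

Lemma isomorphic_sym X Y : isomorphic X Y -> isomorphic Y X.
Proof. by move=> [f [mf [g [mg fK gK]]]]; exists g; split=> //; exists f. Qed.

Lemma isomorphic_trans X Y Z : isomorphic X Y -> isomorphic Y Z -> isomorphic X Z.
Proof. by move=> [f If] [g Ig]; exists (g \o f); exact: is_iso_comp. Qed.

Lemma iso_good X Y (f : X -> Y) : good Y -> is_iso f -> good X.
Proof.
move=> gY [mf [g [mg fK gK]]].
have op (U : set X) : zopen U <-> zopen (g @^-1` U).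
  split; first exact: mg.1.
  move=> /mf.1; congr zopen; rewrite eqEsubset; split=> x /=; by rewrite fK.
have rg x h : reg x h <-> reg (f x) (h \o g).
  split=> [|/(mf.2 x)]; first by rewrite -{1}(fK x) => /mg.2.
  by congr (reg _ _); apply/funext=> y /=; rewrite fK.
have nr x P : near_pt (f x) (g @^-1` P) -> near_pt x P.
  move=> [U [oU Ux UP]]; exists (f @^-1` U); split=> //; first exact: mf.1.
  by move=> y /= /UP /=; rewrite fK.
have rn x P : near_pt x P -> near_pt (f x) (g @^-1` P).
  move=> [U [oU Ux UP]]; exists (g @^-1` U); split=> /=; first exact: mg.1.
    by rewrite fK.
  by move=> y /= /UP.
split.
- by apply/op; exact: good_T.
- by move=> U V /op oU /op oV; apply/op; exact: good_I.
- move=> F oF; apply/op; pose F' := [set V | zopen V /\ exists2 U, F U & V = g @^-1` U].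
  have oF' : F' `<=` zopen by move=> V [].
  have := good_U gY oF'; congr zopen.
  rewrite eqEsubset; split=> x /=.
    by move=> [V [oV [U FU ->]] Ux]; exists U.
  by move=> [U FU Ux]; exists (g @^-1` U) => //; split; [exact/op/oF|exists U].
- by move=> x h k /rn n /rg r; apply/rg; apply: good_germ r => //; exact: n.
- move=> x h /rg r; apply: nr; apply: near_sub (good_near gY r) _ => y /=.
  by move=> r'; apply/rg; rewrite gK.
- by move=> x a; apply/rg; exact: good_cst.
- by move=> x h k /rg r /rg r'; apply/rg; exact: (good_add gY r r').
- by move=> x h k /rg r /rg r'; apply/rg; exact: (good_mul gY r r').
- move=> x h /rg r h0; apply/rg; apply: (good_inv gY r); rewrite /= fK//.
- move=> x h /rg r h0; apply: nr; apply: (good_nz gY r); rewrite /= fK//.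
Qed.

Lemma affine_good X : is_affine X -> good X.
Proof.
move=> [m [S [_ [f If]]]]; apply: iso_good If.
by apply/sub_good/aff_good.
Qed.

Lemma variety_good X : is_variety X -> good X.
Proof.
move=> [oT [oI oU] germ [k [U [oUi covU affU]]] _].
have gU i := affine_good (affU i).
have up i (x : X) (hx : U i x) (P : set X) :
    near_pt (exist _ x hx : sub_space (U i)) [set y | P (sval y)] -> near_pt x P.
  move=> /near_sub_ex [V [oV Vx VP]]; exists (V `&` U i); split=> //; first exact: oI.
  by move=> y [Vy Uy]; exact: VP.
have rg i (x : X) (hx : U i x) f :
    reg x f <-> reg (exist _ x hx : sub_space (U i)) (fun y => f (sval y)).
  split=> [r|[g r [V [oV Vx VP]]]].
    by exists f => //; exists setT; split.
  apply: germ r; exists (V `&` U i); split=> //; first exact: oI.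
  by move=> y [Vy Uy] /=; rewrite (VP y Vy Uy).
split=> //.
- move=> x f; have [i hx] := covU x; move=> /(rg i x hx) r.
  apply: (up i x hx); apply: near_sub (good_near (gU i) r) _ => -[y hy] /= r'.
  by apply/(rg i y hy).
- by move=> x a; have [i hx] := covU x; apply/(rg i x hx); exact: good_cst.
- move=> x f g; have [i hx] := covU x; move=> /(rg i x hx) r /(rg i x hx) r'.
  by apply/(rg i x hx); exact: (good_add (gU i) r r').
- move=> x f g; have [i hx] := covU x; move=> /(rg i x hx) r /(rg i x hx) r'.
  by apply/(rg i x hx); exact: (good_mul (gU i) r r').
- move=> x f; have [i hx] := covU x; move=> /(rg i x hx) r f0.
  by apply/(rg i x hx); exact: (good_inv (gU i) r f0).
- move=> x f; have [i hx] := covU x; move=> /(rg i x hx) r f0.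
  by apply: (up i x hx); exact: (good_nz (gU i) r f0).
Qed.

End Good.

(** * Projective spaces and products *)

Section ProjSpace.
Context {R : realType}.
Local Notation C := R[i].
Implicit Types X Y Z : space R.
Variable N : nat.
Local Notation PN := (@proj_space R N).

Definition sameline (v w : @nonzero_rows R N) :=
  exists2 a : C, a != 0 & (sval w : 'rV_N.+1) = a *: (sval v : 'rV_N.+1).

Definition point_of (v : 'rV[C]_N.+1) (h : v != 0) : PN :=
  class_of sameline (exist _ v h : nonzero_rows N).

Lemma row1_neq0 : (const_mx 1 : 'rV[C]_N.+1) != 0.
Proof. by apply/eqP => /rowP/(_ 0)/eqP; rewrite !mxE oner_eq0. Qed.

(** The point with homogeneous coordinates [v]; a junk point if [v = 0]. *)
Definition toP (v : 'rV[C]_N.+1) : PN :=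
  if pselect (v != 0) is left h then point_of h else point_of row1_neq0.

Lemma toPE (v : 'rV[C]_N.+1) (h : v != 0) : toP v = point_of h.
Proof.
by rewrite /toP; case: pselect => // h'; congr point_of; exact: Prop_irrelevance.
Qed.

Lemma homogE (x : PN) v : homog x v <-> v != 0 /\ x = toP v.
Proof.
split; last first.
  by move=> [v0 ->]; rewrite toPE; exists (exist _ v v0) => //=; exists 1; rewrite ?oner_neq0 ?scale1r.
move=> [[w w0] xw /= <-]; split=> //.
have [[u u0] xu] := class_of_eq x; rewrite xu in xw *.
have [a a0 /= wa] := xw; rewrite toPE /point_of /class_of.
rewrite /= in wa; apply: eq_exist.
apply/funext => -[t t0]; apply/propext; split.
  move=> [b b0 /= tb]; exists (b / a); rewrite ?mulf_neq0 ?invr_eq0//=.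
  by rewrite wa scalerA divfK.
move=> [b b0 /= tb]; exists (b * a); rewrite ?mulf_neq0 //=.
by rewrite tb wa scalerA.
Qed.

Lemma toP_homog v : v != 0 -> homog (toP v) v.
Proof. by move=> v0; apply/homogE. Qed.

Lemma homog_neq0 (x : PN) v : homog x v -> v != 0.
Proof. by move=> /homogE[]. Qed.

Lemma toP_scale v a : v != 0 -> a != 0 -> toP (a *: v) = toP v.
Proof.
move=> v0 a0; have av0 : a *: v != 0 by rewrite scaler_eq0 negb_or a0.
have : homog (toP v) (a *: v); last by move=> /homogE[].
exists (exist _ (a *: v) av0) => //; rewrite toPE.
by exists a.
Qed.

Lemma toP_eq v w : v != 0 -> w != 0 -> toP v = toP w ->
  exists2 a, a != 0 & w = a *: v.
Proof.
move=> v0 w0 vw; have : homog (toP v) w by rewrite vw; exact: toP_homog.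
by move=> [[u u0] + /= <-]; rewrite toPE => -[a a0 /=]; exists a.
Qed.

Lemma homog_ex (x : PN) : exists v, homog x v.
Proof.
have [[u u0] ->] := class_of_eq x; exists u, (exist _ u u0) => //.
by exists 1; rewrite ?oner_neq0 ?scale1r.
Qed.

Definition hc (x : PN) : 'rV[C]_N.+1 := xget 0 (homog x).

Lemma hcP x : homog x (hc x).
Proof. exact: (xgetPex 0 (homog_ex x)). Qed.

Lemma hc_neq0 x : hc x != 0.
Proof. exact: homog_neq0 (hcP x). Qed.

Lemma hcK x : toP (hc x) = x.
Proof. by have /homogE[_] := hcP x. Qed.

Lemma hc_toP v : v != 0 -> exists2 a, a != 0 & hc (toP v) = a *: v.
Proof. by move=> v0; apply: toP_eq => //; [exact: hc_neq0|rewrite hcK]. Qed.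

Lemma row_neq0 (v : 'rV[C]_N.+1) : v != 0 -> exists a, v 0 a != 0.
Proof.
move=> v0; have /eqP := v0; apply: contra_notP => /forallNP h; apply/rowP=> j.
by rewrite mxE; apply/eqP; apply: contrapT => /negP; exact: h.
Qed.

Lemma row_entry_neq0 (v : 'rV[C]_N.+1) a : v 0 a != 0 -> v != 0.
Proof. by apply: contraNneq => ->; rewrite mxE. Qed.

Lemma nz_rows_open : zopen [set v : @aff_space R 1 N.+1 | v != 0 :> 'rV_N.+1].
Proof.
apply: (open_near (aff_good _ _)) => v /row_neq0[a va].
apply: near_sub (good_nz (aff_good _ _) (aff_coord_reg v 0 a) va) _ => w /=.
exact: row_entry_neq0.
Qed.

Lemma proj_good : good PN.
Proof. by apply/quot_good/sub_good/aff_good. Qed.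

Lemma toP_morph_at (v : @aff_space R 1 N.+1) : v != 0 :> 'rV_N.+1 ->
  morph_at (toP : @aff_space R 1 N.+1 -> PN) v.
Proof.
move=> v0; pose x : nonzero_rows N := exist _ v v0.
apply: (from_open_morph_at (toP : @aff_space R 1 N.+1 -> PN) x (aff_good _ _) nz_rows_open).1.
have -> : (fun y : nonzero_rows N => toP (sval y)) = class_of sameline.
  by apply/funext=> -[w w0] /=; rewrite toPE.
exact/is_morph_at/class_of_morph.
Qed.

(** The quotient does not depend on the representative chosen by [hc], so these are the affine
    coordinates of projective space. *)
Definition cratio (j a : 'I_N.+1) (x : PN) : C := hc x 0 j / hc x 0 a.

Lemma cratioE j a v : v != 0 -> cratio j a (toP v) = v 0 j / v 0 a.
Proof.
by move=> /hc_toP[c c0 e]; rewrite /cratio e !mxE -mulf_div divff // mul1r.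
Qed.

Lemma hc_toP_eq0 a v : v != 0 -> (hc (toP v) 0 a == 0) = (v 0 a == 0).
Proof. by move=> /hc_toP[c c0 e]; rewrite e mxE mulf_eq0 (negbTE c0). Qed.

Lemma class_toP (v : @nonzero_rows R N) : class_of sameline v = toP (sval v).
Proof. by case: v => v v0; rewrite toPE. Qed.

Lemma cratio_reg j a x : hc x 0 a != 0 -> reg x (cratio j a).
Proof.
move=> xa; exists [set y | hc y 0 a != 0]; split=> //.
  apply: (@open_near _ _ (sub_good _ (aff_good _ _))
     [set v | hc (class_of sameline v) 0 a != 0]) => v /=.
  rewrite class_toP hc_toP_eq0 ?(svalP v) // => va.
  have := near_subP (x := v) (good_nz (aff_good _ _) (aff_coord_reg _ 0 a) va).
  move=> n1; apply: near_sub n1 _ => w /= wa.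
  by rewrite [class_of _ _]class_toP hc_toP_eq0 ?(svalP w).
move=> v /=; rewrite [class_of _ _]class_toP hc_toP_eq0 ?(svalP v) // => va.
exists (fun w : @aff_space R 1 N.+1 => (w : 'M[C]_(_, _)) 0 j / (w : 'M[C]_(_, _)) 0 a).
  by apply: (reg_div (aff_good _ _)) => //; exact: aff_coord_reg.
apply: (nearT (aff_good _ _)) => w w0 /=.
by rewrite [class_of _ _]class_toP cratioE.
Qed.

Lemma hc_near (x : PN) a : hc x 0 a != 0 -> near_pt x [set y | hc y 0 a != 0].
Proof.
move=> xa; have n1 := good_nz proj_good (cratio_reg a xa).
have : cratio a a x != 0 by rewrite /cratio divff // oner_neq0.
by move=> /n1 n2; apply: near_sub n2 _ => y /=; apply: contraNneq; rewrite /cratio => ->; rewrite mul0r.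
Qed.

Lemma toP_cratio (x : PN) a : hc x 0 a != 0 -> toP (\row_j cratio j a x) = x.
Proof.
move=> xa; have -> : \row_j cratio j a x = (hc x 0 a)^-1 *: hc x.
  by apply/rowP => j; rewrite !mxE mulrC.
by rewrite toP_scale ?hcK ?invr_eq0 ?hc_neq0.
Qed.

Lemma proj_lift Z (f : Z -> PN) z : good Z -> morph_at f z ->
  exists a, [/\ hc (f z) 0 a != 0, forall j, reg z (fun y => cratio j a (f y)),
    near_pt z [set y | hc (f y) 0 a != 0]
    & near_pt z [set y | f y = toP (\row_j cratio j a (f y))]].
Proof.
move=> gZ mf; have [a fa] := row_neq0 (hc_neq0 (f z)); exists a.
have n1 := mf.1 _ (hc_near fa); split=> //.
  by move=> j; exact: (mf.2 _ (cratio_reg j fa)).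
by apply: near_sub n1 _ => y /= ya; rewrite toP_cratio.
Qed.

Lemma toP_comp_morph_at Z (v : Z -> 'rV[C]_N.+1) z : good Z -> v z != 0 ->
  (forall j, reg z (fun y => v y 0 j)) -> morph_at (fun y => toP (v y)) z.
Proof.
move=> gZ v0 rv; apply: (@morph_at_comp _ _ (@aff_space R 1 N.+1) _ v toP).
  by apply: to_aff_morph_at => // i j; rewrite ord1.
exact: toP_morph_at.
Qed.

End ProjSpace.

Section Products.
Context {R : realType}.
Local Notation C := R[i].
Implicit Types Z : space R.
Variables (X Y : space R) (gX : good X) (gY : good Y).
Local Notation XY := (prod_space X Y).

(** Membership in the tensor product of the local rings at the two components of [p]: these are the
    numerators and denominators of the product structure. *)
Definition tfun (p : X * Y) (h : X * Y -> C) :=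
  exists k (f : 'I_k -> X -> C) (g : 'I_k -> Y -> C),
  [/\ forall i, reg p.1 (f i), forall i, reg p.2 (g i) & forall q, h q = tensor f g q].

Lemma tfunP (T : finType) (f : T -> X -> C) (g : T -> Y -> C) p h :
  (forall i, reg p.1 (f i)) -> (forall i, reg p.2 (g i)) ->
  (forall q, h q = \sum_i f i q.1 * g i q.2) -> tfun p h.
Proof.
move=> rf rg hE; exists #|T|, (fun i => f (enum_val i)), (fun i => g (enum_val i)).
split=> // q; rewrite hE /tensor (reindex (@enum_val T T)) //.
by apply: onW_bij; exact: enum_val_bij.
Qed.

Lemma tfun_mul1 p f g : reg p.1 f -> reg p.2 g -> tfun p (fun q => f q.1 * g q.2).
Proof.
move=> rf rg; apply: (@tfunP unit (fun=> f) (fun=> g)) => // q.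
by rewrite (big_pred1 tt) // => -[].
Qed.

Lemma tfun_cst p a : tfun p (fun=> a).
Proof.
have := @tfun_mul1 p (fun=> a) (fun=> 1) (good_cst gX _ _) (good_cst gY _ _).
by congr (tfun _ _); apply/funext => q; rewrite mulr1.
Qed.

Lemma tfun_fst p f : reg p.1 f -> tfun p (fun q => f q.1).
Proof.
move=> rf; have := @tfun_mul1 p f (fun=> 1) rf (good_cst gY _ _).
by congr (tfun _ _); apply/funext => q; rewrite mulr1.
Qed.

Lemma tfun_snd p f : reg p.2 f -> tfun p (fun q => f q.2).
Proof.
move=> rf; have := @tfun_mul1 p (fun=> 1) f (good_cst gX _ _) rf.
by congr (tfun _ _); apply/funext => q; rewrite mul1r.
Qed.

Lemma tfun_add p h h' : tfun p h -> tfun p h' -> tfun p (fun q => h q + h' q).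
Proof.
move=> [k [f [g [rf rg hE]]]] [k' [f' [g' [rf' rg' hE']]]].
pose F (s : 'I_k + 'I_k') := match s with inl i => f i | inr i => f' i end.
pose G (s : 'I_k + 'I_k') := match s with inl i => g i | inr i => g' i end.
apply: (@tfunP _ F G); [by case|by case|] => q.
by rewrite hE hE' /tensor big_sumType.
Qed.

Lemma tfun_mul p h h' : tfun p h -> tfun p h' -> tfun p (fun q => h q * h' q).
Proof.
move=> [k [f [g [rf rg hE]]]] [k' [f' [g' [rf' rg' hE']]]].
pose F (s : 'I_k * 'I_k') x := f s.1 x * f' s.2 x.
pose G (s : 'I_k * 'I_k') x := g s.1 x * g' s.2 x.
apply: (@tfunP _ F G).
- by move=> -[i j]; exact: (good_mul gX).
- by move=> -[i j]; exact: (good_mul gY).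
move=> q; rewrite hE hE' /tensor big_distrlr /= pair_bigA /=.
by apply: eq_bigr => -[i j] _; rewrite /F /G /= mulrACA.
Qed.

Lemma prod_nearP (p : XY) (W : set XY) : near_pt p W <->
  exists (U : set X) (V : set Y) d,
    [/\ near_pt p.1 U, near_pt p.2 V, tfun p d, d p != 0
      & forall q, U q.1 -> V q.2 -> d q != 0 -> W q].
Proof.
split.
  move=> [W' [oW Wp WW]].
  have [U [V [k [f [g [[oU oV] [rf rg] [Up Vp] t0 UV]]]]]] := oW _ Wp.
  exists U, V, (tensor f g); split=> //.
  - exact: near_open.
  - exact: near_open.
  - by exists k, f, g; split=> // i; [exact: rf|exact: rg].
  - by move=> q Uq Vq dq; exact/WW/UV.
move=> [U [V [d [nU nV [k [f [g [rf rg dE]]]] d0 UV]]]].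
pose U' := [set x | near_pt x (U `&` [set x | forall i, reg x (f i)])].
pose V' := [set x | near_pt x (V `&` [set x | forall i, reg x (g i)])].
exists [set q | [/\ U' q.1, V' q.2 & d q != 0]]; split.
- move=> q [Uq Vq dq]; exists U', V', k, f, g; split=> //.
  + by split; exact: open_interior.
  + by split=> i x /near_refl[].
  + by rewrite -dE.
  + by move=> r Ur Vr; rewrite -dE.
- split=> //.
  + apply: nearI => //; apply: near_all => // i; exact: (good_near gX).
  + apply: nearI => //; apply: near_all => // i; exact: (good_near gY).
- by move=> q [/near_refl[Uq _] /near_refl[Vq _] dq]; exact: UV.
Qed.

Lemma tfun_nz (p : XY) d : tfun p d -> d p != 0 -> near_pt p (fun q : XY => d q != 0).
Proof.
move=> td d0; apply/prod_nearP; exists setT, setT, d; split=> //.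
- exact: (nearT gX).
- exact: (nearT gY).
Qed.

Lemma prod_nearI (p : XY) (W W' : set XY) :
  near_pt p W -> near_pt p W' -> near_pt p (W `&` W').
Proof.
move=> /prod_nearP [U [V [d [nU nV td d0 UV]]]] /prod_nearP[U' [V' [d' [nU' nV' td' d0' UV']]]].
apply/prod_nearP; exists (U `&` U'), (V `&` V'), (fun q => d q * d' q); split.
- exact: (nearI gX).
- exact: (nearI gY).
- exact: tfun_mul.
- exact: mulf_neq0.
- move=> q [Uq Uq'] [Vq Vq']; rewrite mulf_eq0 negb_or => /andP[dq dq'].
  by split; [exact: UV|exact: UV'].
Qed.

Lemma prod_regP (p : XY) (h : XY -> C) : reg p h <->
  exists n d, [/\ tfun p n, tfun p d, d p != 0
    & near_pt p [set q | h q = n q / d q]].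
Proof.
split.
  move=> [k [f [f' [g [g' [rf rg [W [oW Wp hE]]]]]]]].
  exists (tensor f g), (tensor f' g'); split.
  - by exists k, f, g; split=> // i; [case: (rf i)|case: (rg i)].
  - by exists k, f', g'; split=> // i; [case: (rf i)|case: (rg i)].
  - by case: (hE _ Wp).
  - by exists W; split=> // q /hE[].
move=> [n [d [[k [f [g [rf rg nE]]]] td d0 nh]]].
have nd := tfun_nz td d0.
have [k' [f' [g' [rf' rg' dE]]]] := td.
(* The product structure wants numerator and denominator with the same number of terms, so both are
   padded by zero terms to length [k + k']. *)
pose F (i : 'I_(k + k')) := match fintype.split i with inl i => f i | inr i => fun=> 0 end.
pose F' (i : 'I_(k + k')) := match fintype.split i with inl i => fun=> 0 | inr i => f' i end.
pose G (i : 'I_(k + k')) := match fintype.split i with inl i => g i | inr i => fun=> 0 end.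
pose G' (i : 'I_(k + k')) := match fintype.split i with inl i => fun=> 0 | inr i => g' i end.
exists (k + k')%N, F, F', G, G'; split.
- by move=> i; rewrite /F /F'; case: (fintype.split i) => j; split=> //; exact: (good_cst gX).
- by move=> i; rewrite /G /G'; case: (fintype.split i) => j; split=> //; exact: (good_cst gY).
have [W [oW Wp WW]] := prod_nearI nh nd; exists W; split=> // q /WW[/= hq dq].
have -> : tensor F' G' q = d q.
  rewrite dE /tensor big_split_ord /= big1 ?add0r; last first.
    by move=> i _; rewrite /F' -[lshift _ _]/(unsplit (inl i)) unsplitK mul0r.
  apply: eq_bigr => i _.
  by rewrite /F' /G' -[rshift _ _]/(unsplit (inr i)) unsplitK.
have -> : tensor F G q = n q; last by [].
rewrite nE /tensor big_split_ord /= [X in _ + X]big1 ?addr0; last first.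
  by move=> i _; rewrite /F -[rshift _ _]/(unsplit (inr i)) unsplitK mul0r.
apply: eq_bigr => i _.
by rewrite /F /G -[lshift _ _]/(unsplit (inl i)) unsplitK.
Qed.

Lemma tfun_near (p : XY) h : tfun p h -> near_pt p [set q : XY | tfun q h].
Proof.
move=> [k [f [g [rf rg hE]]]]; apply/prod_nearP.
exists [set x | forall i, reg x (f i)], [set x | forall i, reg x (g i)], (fun=> 1).
split; last by move=> q /= rf' rg' _; exists k, f, g.
- by apply: near_all => // i; exact: (good_near gX).
- by apply: near_all => // i; exact: (good_near gY).
- exact: tfun_cst.
- exact: oner_neq0.
Qed.

Lemma tfun_reg (p : XY) h : tfun p h -> reg p (h : XY -> C).
Proof.
move=> th; apply/prod_regP; exists h, (fun=> 1); split=> //.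
- exact: tfun_cst.
- apply/prod_nearP; exists setT, setT, (fun=> 1); split=> //.
  + exact: (nearT gX).
  + exact: (nearT gY).
  + exact: tfun_cst.
  + by move=> q; rewrite /= divr1.
Qed.

Lemma prod_good : good XY.
Proof.
have nT (p : XY) P : (forall q, P q) -> near_pt p P.
  move=> PP; apply/prod_nearP; exists setT, setT, (fun=> 1); split=> //.
  + exact: (nearT gX).
  + exact: (nearT gY).
  + exact: tfun_cst.
have on (W : set XY) : (forall p, W p -> near_pt p W) -> zopen W.
  move=> nW p /nW [W' [oW' Wp WW]].
  have [U [V [k [f [g [oo rr ii t0 UV]]]]]] := oW' _ Wp.
  by exists U, V, k, f, g; split=> // q Uq Vq dq; exact/WW/UV.
split.
- by apply: on => p _; apply: nT.
- move=> U V oU oV; apply: on => p [Up Vp]; apply: prod_nearI; exact: near_open.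
- move=> F oF; apply: on => p [U FU Up]; exists U; split=> //; first exact: oF.
  by move=> q Uq; exists U.
- move=> p f g nfg /prod_regP[n [d [tn td d0 nf]]]; apply/prod_regP.
  exists n, d; split=> //; apply: near_sub (prod_nearI nfg nf) _.
  by move=> q [/= <-].
- move=> p f /prod_regP[n [d [tn td d0 nf]]].
  have n1 := prod_nearI (tfun_near tn) (prod_nearI (tfun_near td) (tfun_nz td d0)).
  apply: near_sub (prod_nearI n1 (near_near nf)) _.
  move=> q [[/= tn' [/= td' d0']] /= nf']; apply/prod_regP.
  by exists n, d.
- by move=> p a; exact/tfun_reg/tfun_cst.
- move=> p f g /prod_regP[n [d [tn td d0 nf]]] /prod_regP[n' [d' [tn' td' d0' nf']]].
  apply/prod_regP; exists (fun q => n q * d' q + n' q * d q), (fun q => d q * d' q); split.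
  + by apply: tfun_add; apply: tfun_mul.
  + exact: tfun_mul.
  + exact: mulf_neq0.
  + have := prod_nearI (prod_nearI nf nf') (prod_nearI (tfun_nz td d0) (tfun_nz td' d0')).
    by move=> n1; apply: near_sub n1 _ => q [[/= -> ->] [/= ? ?]]; rewrite addf_div.
- move=> p f g /prod_regP[n [d [tn td d0 nf]]] /prod_regP[n' [d' [tn' td' d0' nf']]].
  apply/prod_regP; exists (fun q => n q * n' q), (fun q => d q * d' q); split.
  + exact: tfun_mul.
  + exact: tfun_mul.
  + exact: mulf_neq0.
  + have := prod_nearI nf nf'.
    by move=> n1; apply: near_sub n1 _ => q [/= -> ->]; rewrite mulf_div.
- move=> p f /prod_regP[n [d [tn td d0 nf]]] f0.
  have n0 : n p != 0.
    by apply: contraNneq f0 => n0; rewrite (near_refl nf) n0 mul0r.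
  apply/prod_regP; exists d, n; split=> //.
  by apply: near_sub nf _ => q /= ->; rewrite invf_div.
- move=> p f /prod_regP[n [d [tn td d0 nf]]] f0.
  have n0 : n p != 0.
    by apply: contraNneq f0 => n0; rewrite (near_refl nf) n0 mul0r.
  have n1 := prod_nearI nf (prod_nearI (tfun_nz td d0) (tfun_nz tn n0)).
  apply: near_sub n1 _ => q [/= -> [/= ? ?]].
  by rewrite mulf_neq0 // invr_eq0.
Qed.

Lemma fst_morph : is_morph (fst : XY -> X).
Proof.
apply/(morph_atP _ prod_good) => p; split.
  move=> U nU; apply/prod_nearP; exists U, setT, (fun=> 1); split=> //.
  + exact: (nearT gY).
  + exact: tfun_cst.
by move=> h rh; apply/tfun_reg/tfun_fst.
Qed.

Lemma snd_morph : is_morph (snd : XY -> Y).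
Proof.
apply/(morph_atP _ prod_good) => p; split.
  move=> U nU; apply/prod_nearP; exists setT, U, (fun=> 1); split=> //.
  + exact: (nearT gX).
  + exact: tfun_cst.
by move=> h rh; apply/tfun_reg/tfun_snd.
Qed.

Lemma pair_morph_at Z (f : Z -> X) (g : Z -> Y) z : good Z ->
  morph_at f z -> morph_at g z -> morph_at (fun z => (f z, g z) : XY) z.
Proof.
move=> gZ mf mg.
have rt d : tfun (f z, g z) d -> reg z (fun z => d (f z, g z)).
  move=> [k [a [b [ra rb dE]]]].
  apply: (reg_ext gZ (f := fun z => \sum_i a i (f z) * b i (g z))).
    by move=> y; rewrite dE.
  apply: (reg_sum gZ) => i _; apply: (good_mul gZ).
    exact: (mf.2 _ (ra i)).
  exact: (mg.2 _ (rb i)).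
split.
  move=> W /prod_nearP[U [V [d [nU nV td d0 UV]]]].
  have n1 := nearI gZ (mf.1 _ nU) (nearI gZ (mg.1 _ nV) (good_nz gZ (rt _ td) d0)).
  by apply: near_sub n1 _ => y /= [Uy [Vy dy]]; apply: UV.
move=> h /prod_regP[n [d [tn td d0 nh]]].
apply: (good_germ gZ) (reg_div gZ (rt _ tn) (rt _ td) d0).
move: nh => /prod_nearP[U [V [e [nU nV te e0 UV]]]].
have n1 := nearI gZ (mf.1 _ nU) (nearI gZ (mg.1 _ nV) (good_nz gZ (rt _ te) e0)).
by apply: near_sub n1 _ => y /= [Uy [Vy dy]]; rewrite (UV (f y, g y)).
Qed.

Lemma pair_morph Z (f : Z -> X) (g : Z -> Y) : good Z ->
  is_morph f -> is_morph g -> is_morph (fun z => (f z, g z) : XY).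
Proof.
move=> gZ mf mg; apply/(morph_atP _ gZ) => z.
by apply: pair_morph_at => //; exact: is_morph_at.
Qed.

End Products.

(** * Polynomials and the charts of the projective line *)

Section PolyFacts.
Variable C : numFieldType.
Implicit Types p q : {poly C}.

Lemma poly_zero_all p : (forall z, p.[z] = 0) -> p = 0.
Proof.
move=> p0; apply/eqP; apply: contraT => pn0.
pose s := [seq (i%:R : C) | i <- iota 0 (size p)].
have us : uniq s by rewrite map_inj_uniq ?iota_uniq // => i j /eqP; rewrite eqr_nat => /eqP.
have rs : all (root p) s by apply/allP => z _; rewrite /root p0.
by have := max_poly_roots pn0 rs us; rewrite size_map size_iota ltnn.
Qed.

Lemma poly_nz_ex p : p != 0 -> exists z, p.[z] != 0.
Proof.
move=> /eqP pn0; apply: contra_notP pn0 => /forallNP h.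
by apply: poly_zero_all => z; apply/eqP; apply: contrapT => /negP /h.
Qed.

Lemma poly_eq_off q p p' : q != 0 -> (forall z, q.[z] != 0 -> p.[z] = p'.[z]) -> p = p'.
Proof.
move=> q0 e; apply/eqP; rewrite -subr_eq0.
have /eqP : q * (p - p') = 0.
  apply: poly_zero_all => z; rewrite !hornerE; have [->|qz] := eqVneq q.[z] 0.
    by rewrite mul0r.
  by rewrite e // subrr mulr0.
by rewrite mulf_eq0 (negbTE q0).
Qed.

Lemma horner_neq0 p z : p.[z] != 0 -> p != 0.
Proof. by apply: contraNneq => ->; rewrite horner0. Qed.

(** The polynomial read in the coordinate at infinity, as a section of degree [d]. The excess of [d]
    over the degree of [p] is the order of vanishing at infinity. *)
Definition revp d p : {poly C} := \poly_(i < d.+1) p`_(d - i).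

Lemma revpE d p z : (size p <= d.+1)%N -> z != 0 -> (revp d p).[z] = z ^+ d * p.[z^-1].
Proof.
move=> sp z0; rewrite horner_poly (horner_coef_wide _ sp) big_distrr /=.
rewrite (reindex_inj rev_ord_inj) /=; apply: eq_bigr => i _.
rewrite subSS subKn -1?ltnS // mulrCA; congr (_ * _).
have -> : z ^+ d = z ^+ (d - i) * z ^+ i by rewrite -exprD subnK // -ltnS.
by rewrite -mulrA -exprMn divff // expr1n mulr1.
Qed.

Lemma revp0 d p : (revp d p).[0] = p`_d.
Proof. by rewrite horner_coef0 coef_poly subn0. Qed.

End PolyFacts.

Section Line.
Context {R : realType}.
Local Notation C := R[i].
Local Notation P1 := (@proj_space R 1).
Implicit Types X Y Z : space R.

Definition row2 (a b : C) : 'rV[C]_2 := \row_j (if j == 0 then a else b).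

Lemma row2_0 a b : row2 a b 0 0 = a. Proof. by rewrite mxE. Qed.
Lemma row2_1 a b : row2 a b 0 1 = b. Proof. by rewrite mxE. Qed.
Definition row2E := (row2_0, row2_1).

Lemma row2P (v : 'rV[C]_2) : v = row2 (v 0 0) (v 0 1).
Proof.
apply/rowP => j; rewrite mxE; case: ifP => [/eqP->//|/negbT j0]; congr (v _ _).
by apply: val_inj; case: j j0 => -[|[]].
Qed.

Lemma row2Z c a b : c *: row2 a b = row2 (c * a) (c * b).
Proof. by rewrite [LHS]row2P !mxE. Qed.

Definition crow (c : bool) (z : C) : 'rV[C]_2 := if c then row2 z 1 else row2 1 z.

Lemma crow_neq0 c z : crow c z != 0.
Proof.
by case: c; [apply: (@row_entry_neq0 _ _ _ 1)|apply: (@row_entry_neq0 _ _ _ 0)];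
  rewrite row2E oner_neq0.
Qed.

(** The two affine charts of the projective line: [chart true z] is [z:1],
    [chart false z] is [1:z]. *)
Definition chart (c : bool) (z : C) : P1 := toP (crow c z).

Definition coord (c : bool) : P1 -> C := if c then cratio 0 1 else cratio 1 0.

Lemma coordK c z : coord c (chart c z) = z.
Proof.
by rewrite /coord /chart; case: c (crow_neq0 c z) => h; rewrite cratioE // /crow !row2E divr1.
Qed.

Lemma chart_ex (x : P1) : x = chart false 0 \/ exists z, x = chart true z.
Proof.
have [v1|v1] := eqVneq (hc x 0 1) 0; [left|right].
  rewrite -[LHS]hcK [hc x]row2P v1 /chart /crow.
  have v0 : hc x 0 0 != 0.
    by have := hc_neq0 x; apply: contraNneq => v0; rewrite [hc x]row2P v0 v1; apply/eqP/rowP => j; rewrite !mxE if_same.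
  rewrite -[RHS](@toP_scale _ _ _ (hc x 0 0)) ?(crow_neq0 false) //.
  by rewrite row2Z mulr1 mulr0.
exists (hc x 0 0 / hc x 0 1); rewrite -[LHS]hcK [hc x]row2P /chart /crow.
rewrite -[RHS](@toP_scale _ _ _ (hc x 0 1)) ?(crow_neq0 true) //.
by rewrite row2Z !row2E mulr1 mulrC divfK.
Qed.

Lemma chart_surj (x : P1) : exists c z, x = chart c z.
Proof.
by have [->|[z ->]] := chart_ex x; [exists false, 0|exists true, z].
Qed.

Lemma chart_inv z : z != 0 -> chart false z = chart true z^-1.
Proof.
move=> z0; rewrite /chart -[RHS](@toP_scale _ _ _ z) ?(crow_neq0 true) //.
by rewrite /crow row2Z mulr1 divff.
Qed.

Lemma coord_reg c z : reg (chart c z) (coord c).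
Proof.
rewrite /coord /chart; case: c => /=; apply: cratio_reg;
 rewrite hc_toP_eq0 ?(crow_neq0 true) ?(crow_neq0 false) // row2E oner_neq0//.
Qed.

Lemma near_chart c z : near_pt (chart c z) [set x | x = chart c (coord c x)].
Proof.
have h (x : P1) : hc x 0 (if c then 1 else 0) != 0 -> x = chart c (coord c x).
  case: c => /= hx; rewrite -[LHS]hcK [hc x]row2P /chart /coord /cratio /crow.
    rewrite -[RHS](@toP_scale _ _ _ (hc x 0 1)) ?(crow_neq0 true) //.
    by rewrite row2Z mulr1 mulrC divfK.
  rewrite -[RHS](@toP_scale _ _ _ (hc x 0 0)) ?(crow_neq0 false) //.
  by rewrite row2Z mulr1 mulrC divfK.
apply: (near_sub (P := [set x | hc x 0 (if c then 1 else 0) != 0])) => //.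
apply: hc_near; rewrite hc_toP_eq0 ?crow_neq0 //.
by rewrite /crow; case: c {h}; rewrite row2E oner_neq0.
Qed.

Lemma polyfun_crow c p : polyfun (@entry R 1 2) p ->
  exists P : {poly C}, forall z, p (crow c z) = P.[z].
Proof.
elim=> [a|i|p1 q1 _ [P e] _ [Q e']|p1 q1 _ [P e] _ [Q e']].
- by exists a%:P => z; rewrite hornerC.
- exists (if (i.2 == 0) == c then 'X else 1) => z.
  rewrite /entry /crow; case: c; case: ifP; rewrite !mxE ?hornerX ?hornerC;
   by case: (i.2 == 0).
- by exists (P + Q) => z; rewrite hornerD e e'.
- by exists (P * Q) => z; rewrite hornerM e e'.
Qed.

Lemma near_line c z0 (V : set P1) : near_pt (chart c z0) V ->
  exists2 q : {poly C}, q.[z0] != 0 & forall z, q.[z] != 0 -> V (chart c z).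
Proof.
have v0 := crow_neq0 c z0.
move=> /(toP_morph_at v0).1 [U [oU Uz UV]].
have [p [Pp pz pU]] := oU _ Uz.
have [P e] := polyfun_crow c Pp; exists P => [|z]; first by rewrite -e.
by rewrite -e => /pU /UV.
Qed.

Lemma reg_line c z0 (f : P1 -> C) : reg (chart c z0) f ->
  exists p q : {poly C}, q.[z0] != 0 /\
    forall z, q.[z] != 0 -> f (chart c z) = p.[z] / q.[z].
Proof.
have v0 := crow_neq0 c z0.
move=> /(toP_morph_at v0).2 [p [q [Pp Pq q0 fpq]]].
have [P e] := polyfun_crow c Pp; have [Q e'] := polyfun_crow c Pq.
by exists P, Q; rewrite -e'; split=> // z; rewrite -e' -e => /fpq.
Qed.

(** Irreducibility of the line: a neighbourhood of a point missing from [K] would contain some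
    [chart c z] with [g.[z] != 0]. *)
Lemma chart_closed_inf (K : set P1) c (g : {poly C}) : g != 0 ->
  zclosed K -> (forall z, g.[z] != 0 -> K (chart c z)) -> forall x, K x.
Proof.
move=> g0 cK gK x; apply: contrapT => Kx.
have [c' [z ex]] := chart_surj x; rewrite ex in Kx.
have oK : near_pt (chart c' z) (~` K) by exact: near_open.
have [q q0 qK] := near_line oK.
pose q' := q * (if c' == c then g else 'X).
have [w] : exists w, (q' * 'X).[w] != 0 /\ (c' != c -> g.[w^-1] != 0).
  have [e|e] := eqVneq c' c.
    have [|w h] := @poly_nz_ex _ (q' * 'X).
      by rewrite !mulf_neq0 ?polyX_eq0 ?(horner_neq0 q0) // e eqxx.
    by exists w.
  (* In the other chart [g] has to be nonzero at [w^-1]. The reversed polynomial makes this a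
     polynomial condition on [w], not identically false because its value at [0] is the leading
     coefficient of [g]. *)
  have [|w h] := @poly_nz_ex _ (q' * 'X * revp (size g).-1 g).
    rewrite !mulf_neq0 ?polyX_eq0 ?(horner_neq0 q0) //.
      by rewrite (negbTE e) polyX_eq0.
    apply: (@horner_neq0 _ _ 0); rewrite revp0.
    by rewrite -/(lead_coef g) lead_coef_eq0.
  exists w; move: h; rewrite hornerM mulf_eq0 negb_or => /andP[h1 h2]; split=> // _.
  have w0 : w != 0 by move: h1; rewrite hornerM hornerX mulf_eq0 negb_or => /andP[].
  by move: h2; rewrite revpE ?leqSpred // mulf_eq0 negb_or => /andP[].
move=> [h1 h2].
have /and3P[qw gw w0] : [&& q.[w] != 0, (if c' == c then g else 'X).[w] != 0 & w != 0].
  by move: h1; rewrite /q' !hornerM hornerX !mulf_eq0 !negb_or -andbA.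
apply: (qK _ qw); have [e|e] := eqVneq c' c.
  by rewrite e in gw *; apply: gK; move: gw; rewrite eqxx.
have -> : chart c' w = chart c w^-1.
  move: e w0; case: (c'); case: (c) => // _ w0; last exact: chart_inv.
  by rewrite chart_inv ?invr_neq0 // invrK.
exact/gK/h2.
Qed.

End Line.

Lemma prodD1_div (F : fieldType) (I : finType) (f : I -> F) i : (forall j, f j != 0) ->
  (\prod_(j | j != i) f j) / (\prod_j f j) = (f i)^-1.
Proof.
move=> f0; rewrite [X in _ / X](bigD1 i) //= invfM mulrCA divff ?mulr1 //.
by apply/prodf_neq0.
Qed.

(** * Functions on the product of a base with the line *)

Section PolyFamilies.
Context {R : realType}.
Local Notation C := R[i].
Local Notation P1 := (@proj_space R 1).
Variables (B : space R) (gB : good B).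
Implicit Types P : B -> {poly C}.
Local Notation BP := (prod_space B P1).

Let gP := @proj_good R 1.
Let gBP : good BP := prod_good gB gP.

Lemma fst_near (p : BP) U : near_pt p.1 U -> near_pt p [set q | U q.1].
Proof. exact: (is_morph_at p (fst_morph gB gP)).1. Qed.

Lemma snd_near (p : BP) U : near_pt p.2 U -> near_pt p [set q | U q.2].
Proof. exact: (is_morph_at p (snd_morph gB gP)).1. Qed.

Lemma snd_reg (p : BP) f : reg p.2 f -> reg p (fun q => f q.2).
Proof. exact: (is_morph_at p (snd_morph gB gP)).2. Qed.

Lemma fst_reg (p : BP) f : reg p.1 f -> reg p (fun q => f q.1).
Proof. exact: (is_morph_at p (fst_morph gB gP)).2. Qed.

Definition pfam (b0 : B) P :=
  (exists k, forall b, (size (P b) <= k)%N) /\ forall i, reg b0 (fun b => (P b)`_i).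

Lemma pfam_scale b0 f q : reg b0 f -> pfam b0 (fun b => f b *: q).
Proof.
move=> rf; split=> [|i].
  by exists (size q) => b; exact: size_scale_leq.
apply: (reg_ext gB (f := fun b => f b * q`_i)) => [b|]; first by rewrite coefZ.
by apply: (good_mul gB) => //; exact: (good_cst gB).
Qed.

Lemma pfam_cst b0 q : pfam b0 (fun=> q).
Proof. by split=> [|i]; [exists (size q)|exact: (good_cst gB)]. Qed.

Lemma pfam_add b0 P Q : pfam b0 P -> pfam b0 Q -> pfam b0 (fun b => P b + Q b).
Proof.
move=> [[k sP] rP] [[l sQ] rQ]; split=> [|i].
  exists (maxn k l) => b; apply: leq_trans (size_polyD _ _) _.
  by rewrite geq_max (leq_trans (sP b)) ?leq_maxl // (leq_trans (sQ b)) ?leq_maxr.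
apply: (reg_ext gB (f := fun b => (P b)`_i + (Q b)`_i)) => [b|]; first by rewrite coefD.
exact: (good_add gB).
Qed.

Lemma pfam_mul b0 P Q : pfam b0 P -> pfam b0 Q -> pfam b0 (fun b => P b * Q b).
Proof.
move=> [[k sP] rP] [[l sQ] rQ]; split=> [|i].
  exists (k + l)%N => b; apply: leq_trans (size_polyMleq _ _) _.
  by apply: leq_trans (leq_pred _) _; exact: leq_add.
apply: (reg_ext gB (f := fun b => \sum_(j < i.+1) (P b)`_j * (Q b)`_(i - j))).
  by move=> b; rewrite coefM.
by apply: (reg_sum gB) => j _; exact: (good_mul gB).
Qed.

Lemma pfam_sum b0 (I : Type) (s : seq I) (Q : pred I) (P : I -> B -> {poly C}) :
  (forall i, pfam b0 (P i)) -> pfam b0 (fun b => \sum_(i <- s | Q i) P i b).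
Proof.
move=> fP; elim: s => [|a s IHs].
  rewrite (_ : (fun _ => _) = fun=> 0); first exact: pfam_cst.
  by apply/funext => b; rewrite big_nil.
rewrite (_ : (fun _ => _) = fun b => (if Q a then P a b else 0) +
   \sum_(i <- s | Q i) P i b).
  by apply: pfam_add => //; case: (Q a) => //; exact: pfam_cst.
by apply/funext => b; rewrite big_cons; case: (Q a) => //; rewrite add0r.
Qed.

Lemma pfam_prod b0 (I : Type) (s : seq I) (Q : pred I) (P : I -> B -> {poly C}) :
  (forall i, pfam b0 (P i)) -> pfam b0 (fun b => \prod_(i <- s | Q i) P i b).
Proof.
move=> fP; elim: s => [|a s IHs].
  rewrite (_ : (fun _ => _) = fun=> 1); first exact: pfam_cst.
  by apply/funext => b; rewrite big_nil.
rewrite (_ : (fun _ => _) = fun b => (if Q a then P a b else 1) *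
   \prod_(i <- s | Q i) P i b).
  by apply: pfam_mul => //; case: (Q a) => //; exact: pfam_cst.
by apply/funext => b; rewrite big_cons; case: (Q a) => //; rewrite mul1r.
Qed.

Lemma pfam_horner b0 P z : pfam b0 P -> reg b0 (fun b => (P b).[z]).
Proof.
move=> [[k sP] rP].
apply: (reg_ext gB (f := fun b => \sum_(i < k) (P b)`_i * z ^+ i)) => [b|].
  by rewrite (horner_coef_wide _ (sP b)).
by apply: (reg_sum gB) => i _; apply: (good_mul gB) => //; exact: (good_cst gB).
Qed.

Lemma pfam_reg b0 P c z : pfam b0 P ->
  reg ((b0, chart c z) : BP) (fun q : BP => (P q.1).[coord c q.2]).
Proof.
move=> [[k sP] rP].
apply: (reg_ext gBP (f := fun q => \sum_(i < k) (P q.1)`_i * coord c q.2 ^+ i)) => [q|].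
  by rewrite (horner_coef_wide _ (sP q.1)).
apply: (reg_sum gBP) => i _; apply: (good_mul gBP).
  exact: (fst_reg (p := (b0, chart c z)) (rP i)).
apply: (reg_exp gBP).
exact: (snd_reg (p := (b0, chart c z)) (coord_reg c z)).
Qed.

(** The second factors are rational functions of one variable. Their common denominator does not
    depend on [b], so only the numerator varies with the base. *)
Lemma tfun_chart b0 c z0 (d : B * P1 -> C) : tfun (b0, chart c z0) d ->
  exists P (q : {poly C}), [/\ pfam b0 P, q.[z0] != 0 &
    forall b z, q.[z] != 0 -> d (b, chart c z) = (P b).[z] / q.[z]].
Proof.
move=> [k [f [g [rf rg dE]]]].
have /choice[pq pqP] : forall i, exists pq : {poly C} * {poly C}, pq.2.[z0] != 0 /\
    forall z, pq.2.[z] != 0 -> g i (chart c z) = pq.1.[z] / pq.2.[z].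
  by move=> i; have [p [q h]] := reg_line (rg i); exists (p, q).
exists (fun b => \sum_i f i b *: ((pq i).1 * \prod_(j | j != i) (pq j).2)),
  (\prod_j (pq j).2); split.
- by apply: pfam_sum => i; apply: pfam_scale; exact: rf.
- by rewrite horner_prod; apply/prodf_neq0 => i _; case: (pqP i).
move=> b z; rewrite horner_prod => qz.
have qi i : (pq i).2.[z] != 0 by move: qz => /prodf_neq0; apply.
rewrite dE /tensor horner_sum big_distrl /=; apply: eq_bigr => i _.
by rewrite (pqP i).2 // hornerZ hornerM horner_prod -!mulrA prodD1_div.
Qed.

Lemma near_prod_chart b0 c z0 (W : set BP) : near_pt ((b0, chart c z0) : BP) W ->
  exists U P, [/\ near_pt b0 U, pfam b0 P, (P b0).[z0] != 0 &
    forall b z, U b -> (P b).[z] != 0 -> W (b, chart c z)].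
Proof.
move=> /(prod_nearP gB gP)[U [V [d [nU nV td d0 UV]]]].
have [P [q [fP q0 dE]]] := tfun_chart td.
have [q' q'0 q'V] := near_line nV.
exists U, (fun b => P b * (q * q')); split=> //.
- by apply: pfam_mul => //; exact: pfam_cst.
- rewrite !hornerM !mulf_neq0 //; apply: contraNneq d0 => Pz.
  by rewrite dE // Pz mul0r.
move=> b z Ub; rewrite !hornerM !mulf_eq0 !negb_or => /and3P[Pz qz q'z].
by apply: UV => //=; [exact: q'V|rewrite dE // mulf_neq0 // invr_neq0].
Qed.

Lemma reg_prod_chart b0 c z0 (h : BP -> C) : reg ((b0, chart c z0) : BP) h ->
  exists U (N D : B -> {poly C}), [/\ near_pt b0 U, pfam b0 N, pfam b0 D,
    (D b0).[z0] != 0 &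
    forall b z, U b -> (D b).[z] != 0 -> h (b, chart c z) = (N b).[z] / (D b).[z]].
Proof.
move=> /(prod_regP gB gP)[n [d [tn td d0 nh]]].
have [U [P [nU fP P0 PW]]] := near_prod_chart nh.
have [Pn [qn [fn qn0 nE]]] := tfun_chart tn.
have [Pd [qd [fd qd0 dE]]] := tfun_chart td.
exists U, (fun b => Pn b * qd * (qd * P b)), (fun b => Pd b * qn * (qd * P b)).
have Pd0 : (Pd b0).[z0] != 0.
  by apply: contraNneq d0 => e; rewrite dE // e mul0r.
split=> //.
- by do !apply: pfam_mul => //; exact: pfam_cst.
- by do !apply: pfam_mul => //; exact: pfam_cst.
- by rewrite !hornerM !mulf_neq0.
move=> b z Ub; rewrite !hornerM !mulf_eq0 !negb_or => /andP[/andP[Pdz qnz] /andP[qdz Pz]].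
rewrite (PW b z Ub Pz) nE // dE // invf_div mulf_div [qn.[z] * _]mulrC.
by rewrite -[RHS]mulf_div [X in _ = _ * X]divff ?mulr1 // mulf_neq0.
Qed.

(** In a chart the [g i] are [N i / D] with a common denominator, and a relation between them is one
    between polynomials in the fibre coordinate, so it holds coefficient by coefficient. The
    coefficients of the [N i] are the functions on the base that the equational criterion asks
    for. *)
Lemma flat_prod (x : BP) : is_flat_at (fst : BP -> B) x.
Proof.
case: x => b0 x0; have [c [z0 ->]] := chart_surj x0.
move=> k f g rf rg /near_prod_chart[U' [P [nU' fP P0 PW]]].
have /choice[T TP] : forall i, exists T : (set B * (B -> {poly C}) * (B -> {poly C})),
    [/\ near_pt b0 T.1.1, pfam b0 T.1.2, pfam b0 T.2, (T.2 b0).[z0] != 0 &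
     forall b z, T.1.1 b -> (T.2 b).[z] != 0 ->
     g i (b, chart c z) = (T.1.2 b).[z] / (T.2 b).[z]].
  by move=> i; have [U [N [D h]]] := reg_prod_chart (rg i); exists (U, N, D).
pose D b := \prod_i (T i).2 b.
pose N i b := (T i).1.2 b * \prod_(j | j != i) (T j).2 b.
have fD : pfam b0 D by apply: pfam_prod => i; case: (TP i).
have fN i : pfam b0 (N i).
  by apply: pfam_mul; [case: (TP i)|apply: pfam_prod => j; case: (TP j)].
have D0 : (D b0).[z0] != 0.
  by rewrite horner_prod; apply/prodf_neq0 => i _; case: (TP i).
have nU : near_pt b0 [set b | forall i, (T i).1.1 b].
  by apply: (near_all gB) => i; case: (TP i).
have gE i b z : (T i).1.1 b -> (D b).[z] != 0 -> g i (b, chart c z) = (N i b).[z] / (D b).[z].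
  move=> Tb; rewrite horner_prod => Dz.
  have qi j : ((T j).2 b).[z] != 0 by move: Dz => /prodf_neq0; apply.
  have [_ _ _ _ ->//] := TP i.
  by rewrite hornerM horner_prod -!mulrA prodD1_div.
have /choice[s sP] i : exists s, forall b, (size (N i b) <= s)%N by case: (fN i).
pose m := (\max_i s i)%N.
have sm i b : (size (N i b) <= m)%N by apply: leq_trans (sP i b) _; exact: leq_bigmax.
exists m, (fun i j b => (N i b)`_j),
  (fun j q => coord c q.2 ^+ j / (D q.1).[coord c q.2]); split.
- by move=> i j; case: (fN i).
- move=> j; apply: (reg_div gBP).
  + apply: (reg_exp gBP).
    exact: (snd_reg (p := (b0, chart c z0)) (coord_reg c z0)).
  + exact: pfam_reg.
  + by rewrite /= coordK.
- move=> i.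
  have n1 : near_pt ((b0, chart c z0) : BP) [set q | (T i).1.1 q.1].
    by apply: (fst_near (p := (b0, chart c z0))); case: (TP i).
  have n2 : near_pt ((b0, chart c z0) : BP) [set q | q.2 = chart c (coord c q.2)].
    exact: (snd_near (p := (b0, chart c z0)) (near_chart c z0)).
  have n3 := good_nz gBP (pfam_reg c z0 fD).
  rewrite /= coordK in n3.
  apply: near_sub (nearI gBP n1 (nearI gBP n2 (n3 D0))) _ => -[b x] /= [Tb [ex Dx]].
  rewrite {1}ex gE // (horner_coef_wide _ (sm i b)) big_distrl /=.
  by apply: eq_bigr => j _; rewrite mulrA.
move=> j; have n1 := nearI gB nU (nearI gB nU' (nearI gB
   (good_nz gB (pfam_horner z0 fP) P0) (good_nz gB (pfam_horner z0 fD) D0))).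
apply: near_sub n1 _ => b /= [Tb [Ub [Pb Db]]].
(* For fixed [b] the relation is known only for [z] off the zeros of [P b * D b]; this polynomial is
   nonzero because its value at [z0] is. *)
have /polyP/(_ j) : \sum_i f i b *: N i b = 0.
  apply: (@poly_eq_off _ (P b * D b)).
    by rewrite mulf_neq0 // ?(horner_neq0 Pb) ?(horner_neq0 Db).
  move=> z; rewrite hornerM mulf_eq0 negb_or => /andP[Pz Dz].
  have := PW b z Ub Pz; rewrite /= horner0 horner_sum => e.
  apply: (mulIf (invr_neq0 Dz)); rewrite mul0r -[RHS]e big_distrl /=.
  by apply: eq_bigr => i _; rewrite hornerZ gE // mulrA.
by rewrite coef_sum coef0 => e; rewrite -[RHS]e; apply: eq_bigr => i _; rewrite coefZ.
Qed.

(** A function vanishing on the fibre over [b0] has a numerator with [N b0 = 0], so all coefficients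
    of [N] lie in the maximal ideal of [b0]. *)
Lemma reduced_prod (x : BP) : has_reduced_fibre_at (fst : BP -> B) x.
Proof.
case: x => b0 x0; have [c [z0 ->]] := chart_surj x0.
move=> f rf /near_prod_chart[U' [P [nU' fP P0 PW]]].
have [U [N [D [nU fN fD D0 fE]]]] := reg_prod_chart rf.
have N0 : N b0 = 0.
  apply: (@poly_eq_off _ (P b0 * D b0)).
    by rewrite mulf_neq0 // ?(horner_neq0 P0) ?(horner_neq0 D0).
  move=> z; rewrite hornerM mulf_eq0 negb_or => /andP[Pz Dz].
  have := PW b0 z (near_refl nU') Pz erefl; rewrite fE //; last exact: near_refl nU.
  by move=> /eqP; rewrite mulf_eq0 invr_eq0 (negbTE Dz) orbF horner0 => /eqP.
have [[m sm] _] := fN.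
exists m, (fun i b => (N b)`_i), (fun j q => coord c q.2 ^+ j / (D q.1).[coord c q.2]); split.
- by move=> i; split; [case: fN|rewrite N0 coef0].
- move=> j; apply: (reg_div gBP).
  + apply: (reg_exp gBP).
    exact: (snd_reg (p := (b0, chart c z0)) (coord_reg c z0)).
  + exact: pfam_reg.
  + by rewrite /= coordK.
have n1 : near_pt ((b0, chart c z0) : BP) [set q | U q.1].
  exact: (fst_near (p := (b0, chart c z0))).
have n2 : near_pt ((b0, chart c z0) : BP) [set q | q.2 = chart c (coord c q.2)].
  exact: (snd_near (p := (b0, chart c z0)) (near_chart c z0)).
have n3 := good_nz gBP (pfam_reg c z0 fD); rewrite /= coordK in n3.
apply: near_sub (nearI gBP n1 (nearI gBP n2 (n3 D0))) _ => -[b x] /= [Tb [ex Dx]].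
rewrite {1}ex fE // (horner_coef_wide _ (sm b)) big_distrl /=.
by apply: eq_bigr => j _; rewrite mulrA.
Qed.

End PolyFamilies.

(** * Families of marked lines *)

Section AffineBase.
Context {R : realType}.
Local Notation C := R[i].
Local Notation P1 := (@proj_space R 1).
Implicit Types X Y Z : space R.

Lemma sub_setT_iso X : good X -> is_iso (fun x : sub_space [set: X] => sval x).
Proof.
move=> gX; split; first exact: sval_morph.
exists (fun x => exist _ x I); split.
- by apply: to_sub_morph => //; exact: is_morph_id.
- by move=> [x []].
- by [].
Qed.

Lemma is_morph_eval m n Z (f : Z -> @aff_space R m n) z i j : is_morph f ->
  reg z (fun y => (f y : 'M[C]_(m, n)) i j).
Proof. by move=> mf; exact: (mf.2 z _ (aff_coord_reg _ i j)). Qed.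

Lemma to_aff_morph Z m n (f : Z -> @aff_space R m n) : good Z ->
  (forall z i j, reg z (fun y => (f y : 'M[C]_(m, n)) i j)) -> is_morph f.
Proof. by move=> gZ rf; apply/(morph_atP _ gZ) => z; apply: to_aff_morph_at. Qed.

Lemma sep_aff m n Z (f g : Z -> @aff_space R m n) (z : Z) : good Z ->
  morph_at f z -> morph_at g z -> f z <> g z -> near_pt z [set z | f z <> g z].
Proof.
move=> gZ mf mg fg.
have [i [j fgij]] : exists i j, (f z : 'M[C]_(m, n)) i j != (g z : 'M[C]_(m, n)) i j.
  apply: contrapT => h; apply: fg; apply/matrixP => i j; apply/eqP; apply: contrapT => hij.
  by apply: h; exists i, j; apply/negP.
have r := reg_sub gZ (mf.2 _ (aff_coord_reg (f z) i j)) (mg.2 _ (aff_coord_reg (g z) i j)).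
have := good_nz gZ r; rewrite /= subr_eq0 => /(_ fgij).
by move=> n1; apply: near_sub n1 _ => y /=; rewrite subr_eq0 => /eqP h e; apply: h; rewrite e.
Qed.

Lemma near_open_sub X (U : set X) : good X ->
  (forall x, U x -> near_pt x U) -> zopen U.
Proof. by move=> gX; exact: open_near. Qed.

Variables (m : nat) (S : set (@aff_space R 1 m)).
Hypothesis cS : zclosed S.
Local Notation B := (sub_space S).
Let gB : good B := sub_good S (aff_good 1 m).

Lemma affine_variety : is_variety B.
Proof.
split.
- exact: good_T.
- by split; [exact: good_I|exact: good_U].
- exact: good_germ.
- exists 1%N, (fun=> setT); split=> [_||_]; [exact: good_T|by exists 0|].
  exists m, S; split=> //; exists (fun x => sval x); exact: sub_setT_iso.
move=> k T f g cT mf mg.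
have gT := sub_good T (aff_good 1 k).
apply: near_open_sub => // z fg.
have mf' := is_morph_comp mf (sval_morph _ (aff_good 1 m)).
have mg' := is_morph_comp mg (sval_morph _ (aff_good 1 m)).
have fg' : sval (f z) <> sval (g z).
  by move=> e; apply: fg; apply: eq_sig_hprop => // x p q; exact: Prop_irrelevance.
have := sep_aff gT (is_morph_at z mf') (is_morph_at z mg') fg'.
by move=> n1; apply: near_sub n1 _ => y /= h e; apply: h; rewrite /= e.
Qed.

Local Notation BP := (prod_space B P1).
Let gP := @proj_good R 1.
Let gBP : good BP := prod_good gB gP.

Definition chart_dom c : set BP := [set q | q.2 = chart c (coord c q.2)].

Lemma chart_dom_open c : zopen (chart_dom c).
Proof.
apply: near_open_sub => // -[b x]; rewrite /chart_dom /= => ex.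
by rewrite ex; exact: (snd_near gB (p := (b, chart c (coord c x))) (near_chart c _)).
Qed.

Definition chart_img : set (@aff_space R 1 (m + 1)) :=
  [set v | S (lsubmx (v : 'rV[C]_(m + 1)))].

Lemma lsub_morph : is_morph (fun v : @aff_space R 1 (m + 1) =>
  (lsubmx (v : 'rV[C]_(m + 1)) : @aff_space R 1 m)).
Proof.
apply: to_aff_morph; first exact: aff_good.
move=> v i j; apply: (reg_ext (aff_good _ _)) (aff_coord_reg v i (lshift 1 j)).
by move=> w; rewrite mxE.
Qed.

Lemma chart_img_closed : zclosed chart_img.
Proof. exact: lsub_morph.1 cS. Qed.

(** The chart is the product of [S] with an affine line, whose coordinate is appended to the row of
    coordinates of the base. *)
Lemma chart_dom_affine c : is_affine (sub_space (chart_dom c)).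
Proof.
exists (m + 1)%N, chart_img; split; first exact: chart_img_closed.
have gD : good (sub_space (chart_dom c)) by exact: sub_good.
have gI : good (sub_space chart_img) by exact/sub_good/aff_good.
pose F0 (q : sub_space (chart_dom c)) : 'rV[C]_(m + 1) :=
  row_mx (sval (sval q).1) (coord c (sval q).2)%:M.
have F0S q : chart_img (F0 q).
  by rewrite /chart_img /F0 /= row_mxKl; exact: svalP.
pose F (q : sub_space (chart_dom c)) : sub_space chart_img := exist _ (F0 q) (F0S q).
pose G0 (v : sub_space chart_img) : BP :=
  (exist _ (lsubmx (sval v : 'rV[C]_(m + 1))) (svalP v),
   chart c ((sval v : 'rV[C]_(m + 1)) 0 (rshift m 0))).
have G0D v : chart_dom c (G0 v) by rewrite /chart_dom /= coordK.
pose G (v : sub_space chart_img) : sub_space (chart_dom c) := exist _ (G0 v) (G0D v).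
exists F; apply: (is_iso_sym (g := G)).
- apply: to_sub_morph => //; apply: to_aff_morph => // q i j.
  case: (split_ordP j) => l ->.
    have mh := is_morph_comp (is_morph_comp (sval_morph (chart_dom c) gBP) (fst_morph gB gP))
      (sval_morph S (aff_good 1 m)).
    apply: (reg_ext gD) (is_morph_eval q i l mh) => y /=.
    by rewrite /F0 row_mxEl.
  have mh := is_morph_comp (sval_morph (chart_dom c) gBP) (snd_morph gB gP).
  apply: (reg_ext gD (f := fun y => coord c (sval y).2)).
    by move=> y /=; rewrite /F0 row_mxEr !ord1 mxE eqxx mulr1n.
  apply: (mh.2 q (coord c)); have : chart_dom c (sval q) by exact: svalP.
  by rewrite /= /chart_dom /= => ->; exact: coord_reg.
- apply: to_sub_morph => //; apply: pair_morph => //.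
    apply: to_sub_morph => //.
    exact: is_morph_comp (sval_morph _ (aff_good _ _)) lsub_morph.
  apply/(morph_atP _ gI) => v; apply: toP_comp_morph_at => //; first exact: crow_neq0.
  move=> j; have r := is_morph_eval v 0 (rshift m 0) (sval_morph chart_img (aff_good 1 (m + 1))).
  case: c {F0 F0S F G0 G0D G gD} => /=; case: (eqVneq j 0) => [->|j0].
  + by apply: (@reg_ext _ _ gI v _ _ _ r) => y; rewrite row2E.
  + apply: (@reg_ext _ _ gI v _ _ _ (good_cst gI v 1)) => y.
    by rewrite /crow /row2 mxE (negbTE j0).
  + by apply: (@reg_ext _ _ gI v _ _ _ (good_cst gI v 1)) => y; rewrite row2E.
  + by apply: (@reg_ext _ _ gI v _ _ _ r) => y; rewrite /crow /row2 mxE (negbTE j0).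
- move=> q; apply: eq_sig_hprop => [y p1 p2|]; first exact: Prop_irrelevance.
  rewrite /= /G0; case: q => -[b x] /= ex; congr (_, _).
    apply: eq_sig_hprop => [y p1 p2|]; first exact: Prop_irrelevance.
    by rewrite /= row_mxKl.
  by rewrite /= row_mxEr mxE eqxx mulr1n -ex.
- move=> v; apply: eq_sig_hprop => [y p1 p2|]; first exact: Prop_irrelevance.
  rewrite /= /F0 /= coordK -[RHS](@hsubmxK _ 1 m 1); congr row_mx.
  by apply/matrixP => i j; rewrite !ord1 !mxE eqxx mulr1n.
Qed.

(** Two points of projective space differ exactly when a two-by-two minor of their coordinates is
    nonzero. Normalised by coordinates that do not vanish at [z], the minors are regular. *)
Lemma sep_proj N Z (f g : Z -> @proj_space R N) z : good Z ->
  morph_at f z -> morph_at g z -> f z <> g z -> near_pt z [set z | f z <> g z].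
Proof.
move=> gZ mf mg fg.
have [a [fa rf nf _]] := proj_lift gZ mf; have [b [gb rg ng _]] := proj_lift gZ mg.
pose u y i j := cratio i a (f y) * cratio j b (g y) - cratio j a (f y) * cratio i b (g y).
have ru i j : reg z (fun y => u y i j).
  by apply: (reg_sub gZ); apply: (good_mul gZ).
have [i [j uij]] : exists i j, u z i j != 0.
  apply: contrapT => h; apply: fg.
  have h' j : hc (f z) 0 a * hc (g z) 0 j = hc (f z) 0 j * hc (g z) 0 a.
    have e : u z a j = 0.
      by apply/eqP; apply: contrapT => h2; apply: h; exists a, j; apply/negP.
    move: e; rewrite /u /cratio divff // mul1r => /eqP; rewrite subr_eq0 => /eqP e.
    rewrite -[hc (g z) 0 j](divfK gb) e -!mulrA; move: fa gb.
    set A := hc (f z) 0 a; set B0 := hc (g z) 0 b => fa gb.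
    by field; rewrite fa gb.
  have ga : hc (g z) 0 a != 0.
    apply/eqP => g0; have : hc (g z) = 0.
      apply/rowP => j; rewrite mxE; have := h' j; rewrite g0 mulr0 => /eqP.
      by rewrite mulf_eq0 (negbTE fa) => /eqP.
    by move/eqP; rewrite (negbTE (hc_neq0 _)).
  rewrite -(hcK (f z)) -(hcK (g z)).
  have -> : hc (g z) = (hc (g z) 0 a / hc (f z) 0 a) *: hc (f z).
    by apply/rowP => j; rewrite mxE mulrAC [_ * hc (f z) 0 j]mulrC -h' mulrAC divff // mul1r.
  by rewrite toP_scale ?hc_neq0 // mulf_neq0 // invr_eq0.
have n1 := good_nz gZ (ru i j) uij.
apply: near_sub (nearI gZ n1 (nearI gZ nf ng)) _ => y /= [u0 [fy gy]] e.
move: u0; rewrite /u /cratio e => /eqP; apply.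
by rewrite e in fy; field; rewrite fy gy.
Qed.

Lemma prod_variety : is_variety BP.
Proof.
split.
- exact: good_T.
- by split; [exact: good_I|exact: good_U].
- exact: good_germ.
- exists 2%N, (fun i => chart_dom (val i == 0%N)); split=> [i|q|i].
  + exact: chart_dom_open.
  + have [c [z ez]] := chart_surj q.2; exists (if c then ord0 else ord_max).
    have -> : (val (if c then ord0 else ord_max : 'I_2) == 0%N) = c by case: (c).
    by rewrite /chart_dom /mkset ez coordK.
  + exact: chart_dom_affine.
move=> k T f g cT mf mg.
have gT := sub_good T (aff_good 1 k).
apply: near_open_sub => // z fg.
have m1 := sval_morph S (aff_good 1 m).
have mf1 := is_morph_comp (is_morph_comp mf (fst_morph gB gP)) m1.
have mg1 := is_morph_comp (is_morph_comp mg (fst_morph gB gP)) m1.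
have mf2 := is_morph_comp mf (snd_morph gB gP).
have mg2 := is_morph_comp mg (snd_morph gB gP).
have [e1|e1] := pselect (sval (f z).1 = sval (g z).1); last first.
  have n1 := sep_aff gT (is_morph_at z mf1) (is_morph_at z mg1) e1.
  by apply: near_sub n1 _ => y /= h e; apply: h; rewrite /= e.
have e2 : (f z).2 <> (g z).2.
  move=> e2; apply: fg; move: e1 e2; case: (f z) => [x1 x2]; case: (g z) => [y1 y2] /= e1 ->.
  by congr (_, _); apply: eq_sig_hprop => // x p q; exact: Prop_irrelevance.
have n1 := sep_proj gT (is_morph_at z mf2) (is_morph_at z mg2) e2.
by apply: near_sub n1 _ => y /= h e; apply: h; rewrite /= e.
Qed.

End AffineBase.

(** * Closed subvarieties and fibre products *)

Section ClosedSubvarieties.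
Context {R : realType}.
Implicit Types X Y Z B M : space R.

Lemma sig_eq (T : Type) (P : T -> Prop) (x y : {x | P x}) : sval x = sval y -> x = y.
Proof. by move=> e; apply: eq_sig_hprop => // z p q; exact: Prop_irrelevance. Qed.

Lemma closed_sub_variety X (T : set X) : is_variety X -> zclosed T ->
  is_variety (sub_space T).
Proof.
move=> vX cT; have gX := variety_good vX; have gT := sub_good T gX.
case: vX => _ _ _ [k [U [oU covU affU]]] sepX.
split.
- exact: good_T.
- by split; [exact: good_I|exact: good_U].
- exact: good_germ.
- exists k, (fun i => [set y : sub_space T | U i (sval y)]); split.
  + by move=> i; exact: (sval_morph T gX).1.
  + by move=> [x Tx]; have [i Ui] := covU x; exists i.
  move=> i; have [m [S [cS [g [mg [g' [mg' gK gK']]]]]]] := affU i.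
  pose S' := [set v : @aff_space R 1 m | exists h : S v, T (sval (g' (exist _ v h)))].
  have gA := aff_good (R := R) 1 m.
  exists m, S'; split.
    apply: (open_near gA) => v nS'.
    have [Sv|Sv] := pselect (S v); last first.
      apply: near_sub (near_open cS Sv) _ => w Sw [h _]; exact: Sw.
    have nT : ~ T (sval (g' (exist _ v Sv))) by move=> h; apply: nS'; exists Sv.
    have mh := is_morph_comp mg' (sval_morph (U i) gX).
    have := near_sub_ex ((is_morph_at (exist _ v Sv : sub_space S) mh).1 _ (near_open cT nT)).
    by move=> n1; apply: near_sub n1 _ => w /= h [Sw Tw]; exact: (h Sw).
  have gV : good (sub_space [set y : sub_space T | U i (sval y)]) by exact: sub_good.
  have gS' : good (sub_space S') by exact: sub_good.
  pose e (y : sub_space [set y : sub_space T | U i (sval y)]) : sub_space (U i) :=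
    exist _ (sval (sval y)) (svalP y).
  have me : is_morph e.
    apply: to_sub_morph => //.
    exact: is_morph_comp (sval_morph _ gT) (sval_morph _ gX).
  have FS y : S' (sval (g (e y))).
    exists (svalP (g (e y))).
    rewrite (_ : exist _ _ _ = g (e y)); last exact: sig_eq.
    by rewrite gK /=; exact: svalP.
  pose F y : sub_space S' := exist _ (sval (g (e y))) (FS y).
  pose e' (v : sub_space S') : sub_space S := exist _ (sval v)
    (let: ex_intro h _ := svalP v in h).
  have me' : is_morph e' by apply: to_sub_morph => //; exact: sval_morph.
  have GT v : T (sval (g' (e' v))).
    have [h Th] := svalP v.
    by rewrite (_ : e' v = exist _ (sval v) h) //; exact: sig_eq.
  pose G0 v : sub_space T := exist _ (sval (g' (e' v))) (GT v).
  have GU v : [set y : sub_space T | U i (sval y)] (G0 v) by exact: svalP (g' (e' v)).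
  pose G v : sub_space [set y : sub_space T | U i (sval y)] := exist _ (G0 v) (GU v).
  exists F; apply: (is_iso_sym (g := G)).
  + apply: to_sub_morph => //.
    exact: (is_morph_comp (is_morph_comp me mg) (sval_morph S gA)).
  + apply: to_sub_morph => //; apply: to_sub_morph => //.
    exact: (is_morph_comp (is_morph_comp me' mg') (sval_morph (U i) gX)).
  + move=> y; do 2 apply: sig_eq; rewrite /=.
    by rewrite (_ : e' (F y) = g (e y)) ?gK //; exact: sig_eq.
  + move=> v; apply: sig_eq; rewrite /=.
    by rewrite (_ : e (G v) = g' (e' v)) ?gK' //; exact: sig_eq.
move=> m S f g cS mf mg.
have -> : [set z | f z <> g z] = [set z | sval (f z) <> sval (g z)].
  by apply/funext => z; apply/propext; split=> h e; apply: h; [exact: sig_eq|rewrite e].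
apply: (sepX m S (fun z => sval (f z)) (fun z => sval (g z))) => //.
  exact: (is_morph_comp mf (sval_morph T gX)).
exact: (is_morph_comp mg (sval_morph T gX)).
Qed.

Lemma point_closed X (x0 : X) : is_variety X -> zclosed [set x0].
Proof.
move=> vX; have gX := variety_good vX; have [_ _ _ [k [U [oU covU affU]]] _] := vX.
apply: (open_near gX) => x xx0; have [i Ux] := covU x.
have [U0|U0] := pselect (U i x0); last first.
  by apply: near_sub (near_open (oU i) Ux) _ => y Uy e; apply: U0; rewrite -e.
have [m [S [cS [g [mg [g' [mg' gK gK']]]]]]] := affU i.
have gU := sub_good (U i) gX.
have mh := is_morph_comp mg (sval_morph S (aff_good 1 m)).
have mc := @is_morph_cst _ _ (@aff_space R 1 m) (sval (g (exist _ x0 U0))) gU.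
have ne : sval (g (exist _ x Ux)) <> sval (g (exist _ x0 U0)).
  move=> /(@sig_eq _ S) /(can_inj gK) [] /= e; exact: xx0.
have n1 := sep_aff gU (is_morph_at (exist _ x Ux : sub_space (U i)) mh) (is_morph_at _ mc) ne.
apply: (open_sub_near (x := exist _ x Ux : sub_space (U i)) gX (oU i)); apply: near_sub n1 _.
by move=> -[y Uy] /= h e; apply: h; congr (sval (g _)); exact: sig_eq.
Qed.

Lemma fibre_closed X B (pi : X -> B) b : is_variety B -> is_morph pi ->
  zclosed [set x | pi x = b].
Proof. by move=> vB mpi; exact: mpi.1 (point_closed b vB). Qed.

Lemma fibre_variety X B (pi : X -> B) b : is_variety X -> is_variety B -> is_morph pi ->
  is_variety (fibre pi b).
Proof. by move=> vX vB mpi; apply: closed_sub_variety => //; exact: fibre_closed. Qed.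

(** The universal property, applied to the fibre of [pi] mapped to [B] by the constant [b], gives a
    map into the fibre of [q]. That it inverts [psi] on the other side comes from uniqueness, tested
    on the fibre of [q] itself. *)
Lemma cartesian_fibre_iso Y B X M (q : Y -> B) (psi : Y -> X) (phi : B -> M) (pi : X -> M) b :
  is_variety Y -> is_variety B -> is_variety X -> is_variety M ->
  is_morph q -> is_morph pi -> is_cartesian q psi phi pi ->
  exists2 g : fibre q b -> fibre pi (phi b), is_iso g & forall y, sval (g y) = psi (sval y).
Proof.
move=> vY vB vX vM mq mpi [mpsi com univ].
have vFY := fibre_variety b vY vB mq; have vFX := fibre_variety (phi b) vX vM mpi.
have gFY := variety_good vFY; have gFX := variety_good vFX.
have gY := variety_good vY; have gX := variety_good vX.
have gpr (y : fibre q b) : [set x | pi x = phi b] (psi (sval y)).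
  by rewrite /= com (svalP y).
pose g y : fibre pi (phi b) := exist _ _ (gpr y).
have msY : is_morph (fun y : fibre q b => sval y) by exact: sval_morph.
have msX : is_morph (fun y : fibre pi (phi b) => sval y) by exact: sval_morph.
have mps : is_morph (fun y : fibre q b => psi (sval y)) by exact: is_morph_comp msY mpsi.
have mg : is_morph g by exact: to_sub_morph.
have [h [[mh qh psih] hu]] := univ _ (fun=> b) (fun x : fibre pi (phi b) => sval x) vFX
  (is_morph_cst _ gFX) msX (fun z => svalP z).
pose h' x : fibre q b := exist _ (h x) (qh x).
have mh' : is_morph h' by exact: to_sub_morph.
exists g => //; apply: (is_iso_sym (g := h')) => //.
  move=> y; apply: sig_eq => /=.
  have [k [_ ku]] := univ _ (fun=> b) (fun y : fibre q b => psi (sval y)) vFY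
    (is_morph_cst _ gFY) mps gpr.
  have e1 := ku (fun y => h (g y)); have e2 := ku (fun y => sval y).
  transitivity (k y).
    rewrite (e1 _) //; split; first exact: is_morph_comp mg mh.
    - by move=> z; rewrite qh.
    - by move=> z; rewrite psih.
  by rewrite (e2 _) //; split=> // z; exact: (svalP z).
by move=> x; apply: sig_eq; rewrite /= psih.
Qed.

Lemma is_cartesian_comp Y B X M X' M' (q : Y -> B) psi (phi : B -> M) (pi : X -> M)
    psi' (phi' : M -> M') (pi' : X' -> M') :
  is_morph phi -> is_cartesian q psi phi pi -> is_cartesian pi psi' phi' pi' ->
  is_cartesian q (psi' \o psi) (phi' \o phi) pi'.
Proof.
move=> mphi [mpsi com univ] [mpsi' com' univ']; split.
- exact: is_morph_comp.
- by move=> y /=; rewrite com' com.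
move=> Z f g vZ mf mg fg.
have [g1 [[mg1 pg1 psg1] ug1]] := univ' Z (phi \o f) g vZ (is_morph_comp mf mphi) mg fg.
have [h [[mh qh ph] uh]] := univ Z f g1 vZ mf mg1 pg1.
exists h; split=> [|h' [mh' qh' ph']].
  by split=> // z; rewrite /= ph psg1.
apply: uh; split=> // z.
have -> // : g1 = psi \o h'.
apply: ug1; split=> [|y|y]; [exact: is_morph_comp|by rewrite /= com qh'|exact: ph'].
Qed.

Lemma is_cartesian_id X B (pi : X -> B) : is_morph pi -> is_cartesian pi id id pi.
Proof.
move=> mpi; split=> //.
move=> Z f g vZ mf mg fg; exists g; split=> // h [_ _ e].
by apply/funext => z; rewrite -e.
Qed.

Lemma iso_closed_immersion X Y (f : X -> Y) : good X -> good Y -> is_iso f ->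
  is_closed_immersion f.
Proof.
move=> gX gY [mf [g [mg fK gK]]]; split; last first.
  apply: (open_near gY) => y /= ny; exfalso; apply: ny; exists (g y) => //.
split; first exact: can_inj fK.
- move=> U; split=> [oU|[V oV ->]]; last exact: mf.1.
  exists (g @^-1` U); first exact: mg.1.
  by apply/funext => x; rewrite /preimage /= fK.
- move=> x h; split=> [r|[k r [V [oV Vx VE]]]].
    exists (h \o g); first by apply: mg.2; rewrite fK.
    exists setT; split=> //; first exact: good_T.
    by move=> y _; rewrite /= fK.
  apply: (good_germ gX) (mf.2 _ _ r); exists (f @^-1` V); split=> //.
    exact: mf.1.
  by move=> y /VE.
Qed.

End ClosedSubvarieties.

Section ProductFamily.
Context {R : realType} {n : nat}.
Local Notation C := R[i].
Local Notation P1 := (@proj_space R 1).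
Implicit Types a : 'I_n -> rat.

(** The line marked by the columns of [L] is stable for the weights [a]. *)
Definition stabm a (L : 'M[C]_(2, n)) :=
  (forall i, col i L != 0) /\
  forall I : {set 'I_n}, (forall i j, i \in I -> j \in I -> pluecker L i j = 0) ->
    \sum_(i in I) a i <= 1.

Definition colpt (L : 'M[C]_(2, n)) i : P1 := toP (col i L)^T.

Lemma colT_neq0 (L : 'M[C]_(2, n)) i : col i L != 0 -> (col i L)^T != 0.
Proof. by apply: contraNneq => /(congr1 trmx); rewrite trmxK trmx0 => /eqP. Qed.

Lemma colpt_eq L i j : col i L != 0 -> col j L != 0 -> colpt L i = colpt L j ->
  pluecker L i j = 0.
Proof.
move=> Li Lj /(toP_eq (colT_neq0 Li) (colT_neq0 Lj))[c c0 /rowP e].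
have e0 := e 0; have e1 := e 1; rewrite !mxE in e0 e1.
by rewrite /pluecker e0 e1; ring.
Qed.

Lemma plueckerC (L : 'M[C]_(2, n)) i j : pluecker L j i = - pluecker L i j.
Proof. by rewrite /pluecker; ring. Qed.

Variables (m : nat) (S : set (@aff_space R 1 m)).
Hypothesis cS : zclosed S.
Local Notation B := (sub_space S).
Local Notation BP := (prod_space B P1).
Variables (a : 'I_n -> rat) (L : B -> 'M[C]_(2, n)).
Hypothesis a2 : 2 < \sum_i a i.
Hypothesis rL : forall b i j, reg b (fun b : B => L b i j).
Hypothesis sL : forall b, stabm a (L b).

Let gB : good B := sub_good S (aff_good 1 m).
Let gP := @proj_good R 1.
Let gBP : good BP := prod_good gB gP.

Definition line_sec i (b : B) : BP := (b, colpt (L b) i).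

Lemma line_sec_morph i : is_morph (line_sec i).
Proof.
apply: pair_morph => //.
apply/(morph_atP _ gB) => b; apply: toP_comp_morph_at => //.
  by apply: colT_neq0; case: (sL b).
by move=> j; apply: (@reg_ext _ _ gB b _ _ _ (rL b j i)) => y; rewrite !mxE.
Qed.

Lemma line_family : is_family a (fst : BP -> B) line_sec.
Proof.
split.
- exact: prod_variety.
- exact: fst_morph.
- by move=> i; split=> //; exact: line_sec_morph.
- split; last by move=> x; split; [exact: flat_prod|exact: reduced_prod].
  move=> b; exists setT; split=> //; first exact: good_T.
  pose e (x : sub_space (fst @^-1` [set: B] : set BP)) :
    prod_space (sub_space [set: B]) P1 := (exist _ (sval x).1 I, (sval x).2).
  exists 1%N, e; split=> //.
  have gD : good (sub_space (fst @^-1` [set: B] : set BP)) by exact: sub_good.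
  have gT : good (sub_space [set: B]) by exact: sub_good.
  have gTP : good (prod_space (sub_space [set: B]) P1) by exact: prod_good.
  apply: iso_closed_immersion => //.
  pose e' (y : prod_space (sub_space [set: B]) P1) : sub_space (fst @^-1` [set: B] : set BP) :=
    exist _ ((sval y.1, y.2) : BP) I.
  apply: (is_iso_sym (g := e')).
  + apply: pair_morph => //.
      apply: to_sub_morph => //.
      exact: is_morph_comp (sval_morph _ gBP) (fst_morph gB gP).
    exact: is_morph_comp (sval_morph _ gBP) (snd_morph gB gP).
  + apply: to_sub_morph => //; apply: pair_morph => //; last exact: snd_morph.
    exact: is_morph_comp (fst_morph gT gP) (sval_morph _ gB).
  + by move=> [[x y] p]; exact: sig_eq.
  + by move=> [[x p] y]; congr (_, _); exact: sig_eq.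
move=> b; pose t i : fibre (fst : BP -> B) b := exist _ (line_sec i b) erefl.
exists t => //; exists 1%N, (fun=> setT).
have gF : good (fibre (fst : BP -> B) b) by exact: sub_good.
have adjF v w : adj (fun _ : 'I_1 => [set: fibre (fst : BP -> B) b]) v w = false.
  by rewrite /adj !ord1.
split.
- split=> [v|x|||].
  + split; first by apply: (open_near gF) => x [].
    apply: (isomorphic_trans (Y := fibre (fst : BP -> B) b)).
      by exists (fun x => sval x); exact: sub_setT_iso.
    exists (fun x => (sval x).2).
    pose k x : fibre (fst : BP -> B) b := exist _ ((b, x) : BP) erefl.
    apply: (is_iso_sym (g := k)).
    * exact: is_morph_comp (sval_morph _ gBP) (snd_morph gB gP).
    * apply: to_sub_morph => //; apply: pair_morph => //.
      exact: is_morph_cst.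
    * by move=> [[b' x] /= e]; apply: sig_eq; rewrite /= -e.
    * by [].
  + by exists ord0.
  + by split=> [v w x y|u v w x]; rewrite !ord1 ?eqxx.
  + by move=> v w x; rewrite !ord1 eqxx.
  + split=> // [v w|]; first by rewrite !ord1 connect0.
    by apply: eq_card0 => e; rewrite inE adjF.
- by move=> i v w; rewrite !ord1.
- move=> v; rewrite /log_degree eq_card0 => [|w]; last by rewrite inE adjF.
  rewrite addr0 addrC subr_gt0 (eq_bigl xpredT) // => i.
  by apply/asboolP.
- move=> I tI; apply: (sL b).2 => i j iI jI.
  apply: colpt_eq; [exact: (sL b).1|exact: (sL b).1|].
  by have [] := tI i j iI jI.
Qed.

End ProductFamily.

Definition pick_or (T : Type) (t0 : T) (P : T -> Prop) : T :=
  if pselect (exists t, P t) is left h then projT1 (cid h) else t0.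

Lemma pick_orP (T : Type) (t0 : T) (P : T -> Prop) : (exists t, P t) -> P (pick_or t0 P).
Proof. by rewrite /pick_or; case: pselect => // h _; exact: (projT2 (cid h)). Qed.

(** * Modular points of matrices *)

Section Configurations.
Context {R : realType} {n : nat}.
Local Notation C := R[i].
Local Notation P1 := (@proj_space R 1).

(** The columns of [L] realise the marked fibre over [m]. The isomorphism is only asserted to exist,
    one fibre at a time. *)
Definition config (a : 'I_n -> rat) (M : hassett_space R a) (m : M) (L : 'M[C]_(2, n)) :=
  exists2 f : P1 -> fibre (@hs_proj _ _ _ M) m, is_iso f &
    forall i, sval (f (colpt L i)) = hs_sec i m.

Variables (a : 'I_n -> rat) (M : hassett_space R a).
Hypothesis a2 : 2 < \sum_i a i.
Local Notation X := (hs_curve M).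
Local Notation pi := (@hs_proj _ _ _ M).

Lemma hs_variety : is_variety M. Proof. by case: (hs_fine M). Qed.
Lemma hs_curve_variety : is_variety X. Proof. by case: (hs_fine M) => _ []. Qed.
Lemma hs_proj_morph : is_morph pi. Proof. by case: (hs_fine M) => _ []. Qed.
Lemma hs_good : good M. Proof. exact/variety_good/hs_variety. Qed.
Lemma hs_curve_good : good X. Proof. exact/variety_good/hs_curve_variety. Qed.

Let gP := @proj_good R 1.

(** Over a base with a single point, the trivial family marked by the columns of [L] is classified
    by the constant map to any [m] with [config m L], and classifying maps are unique. *)
Lemma config_unique (m m' : M) L : stabm a L -> config m L -> config m' L -> m = m'.
Proof.
move=> sL cm cm'; pose S := [set: @aff_space R 1 0].
have cS : zclosed S by apply: (open_near (aff_good _ _)) => x /= [].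
have gB := sub_good S (aff_good 1 0).
have rL (b : sub_space S) i j : reg b (fun _ : sub_space S => L i j) by exact: (good_cst gB).
have fam := line_family cS a2 rL (fun=> sL).
have [_ _ /(_ _ _ _ _ (affine_variety cS) fam) [phi [_ uphi]]] := hs_fine M.
have bE (b b' : sub_space S) : b = b' by apply: sig_eq; apply/matrixP => i [].
suff H (m0 : M) : config m0 L -> phi = fun=> m0.
  have b0 : sub_space S := exist _ 0 I.
  by rewrite -[m]/((fun=> m) b0) -(H m cm) (H m' cm').
move=> [f [mf [f' [mf' fK fK']]] fE]; apply: uphi; split; first exact: is_morph_cst.
have gBP := prod_good gB gP.
exists (fun q => sval (f q.2)); last by move=> i b; exact: fE.
split.
- have mf1 := is_morph_comp (snd_morph gB gP) mf.
  exact: is_morph_comp mf1 (sval_morph _ hs_curve_good).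
- by move=> y; exact: (svalP (f y.2)).
move=> Z u g vZ mu mg ug; have gZ := variety_good vZ.
pose g' z : fibre pi m0 := exist _ (g z) (ug z).
have mg' : is_morph g' by exact: to_sub_morph.
exists (fun z => (u z, f' (g' z))); split.
  split; first by apply: pair_morph => //; exact: is_morph_comp mg' mf'.
  - by [].
  - by move=> z; rewrite fK'.
move=> h [mh h1 h2]; apply/funext => z; rewrite [RHS]surjective_pairing; congr (_, _).
  exact: bE.
by rewrite (_ : g' z = f (h z).2) ?fK //; apply: sig_eq; rewrite /= h2.
Qed.

Lemma family_classified k (S : set (@aff_space R 1 k)) (L : sub_space S -> 'M[C]_(2, n)) :
  zclosed S -> (forall b i j, reg b (fun b : sub_space S => L b i j)) ->
  (forall b, stabm a (L b)) ->
  exists (phi : sub_space S -> M) (psi : prod_space (sub_space S) P1 -> X),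
   [/\ is_morph phi, is_morph psi, forall i b, psi (b, colpt (L b) i) = hs_sec i (phi b)
   & forall b, exists2 f : P1 -> fibre pi (phi b), is_iso f &
     forall x, sval (f x) = psi (b, x)].
Proof.
move=> cS rL sL; have fam := line_family cS a2 rL sL.
have gB := sub_good S (aff_good 1 k); have gBP := prod_good gB gP.
have vB := affine_variety cS.
have [_ _ /(_ _ _ _ _ vB fam) [phi [[mphi [psi cart psis]] _]]] := hs_fine M.
exists phi, psi; split=> // [|b]; first by case: cart.
have [g Ig gE] := cartesian_fibre_iso b (prod_variety cS) vB hs_curve_variety hs_variety
  (fst_morph gB gP) hs_proj_morph cart.
pose k0 x : fibre (fst : prod_space (sub_space S) P1 -> sub_space S) b :=
  exist _ ((b, x) : prod_space (sub_space S) P1) erefl.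
have Ik : is_iso k0.
  apply: (is_iso_sym (g := fun x : fibre (fst : prod_space (sub_space S) P1 -> sub_space S) b => (sval x).2)).
  - apply: to_sub_morph => //; apply: pair_morph => //; exact: is_morph_cst.
  - exact: is_morph_comp (sval_morph _ gBP) (snd_morph gB gP).
  - by [].
  - by move=> [[b' x] /= e]; apply: sig_eq; rewrite /= -e.
by exists (g \o k0) => [|x]; [exact: is_iso_comp|rewrite /= gE].
Qed.

Lemma ord2_cases (r : 'I_2) : r = 0 \/ r = 1.
Proof. by case: r => -[|[|//]] p; [left|right]; apply: val_inj. Qed.

Lemma col_neq0 (L : 'M[C]_(2, n)) i : col i L != 0 <-> exists r, L r i != 0.
Proof.
split=> [Li|[r]].
  apply: contrapT => /forallNP h; move/eqP: Li; apply.
  by apply/colP => r; rewrite !mxE; apply/eqP; apply: contrapT => /negP /h.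
by apply: contraNneq => /colP/(_ r); rewrite !mxE => /eqP.
Qed.

Lemma parallel_trans (L : 'M[C]_(2, n)) i j k : col i L != 0 ->
  pluecker L i j = 0 -> pluecker L i k = 0 -> pluecker L j k = 0.
Proof.
move=> /col_neq0[r Lri] ij ik.
have : L r i * pluecker L j k = L r j * pluecker L i k - L r k * pluecker L i j.
  by rewrite /pluecker; case: (ord2_cases r) => ->; ring.
rewrite ij ik !mulr0 subr0 => /eqP; rewrite mulf_eq0 (negbTE Lri) /=.
by move/eqP.
Qed.

(** Otherwise all columns are parallel to column [i], and together they form a parallel set of
    weight above [2]. *)
Lemma stabm_pluecker (L : 'M[C]_(2, n)) i : stabm a L -> exists j, pluecker L i j != 0.
Proof.
move=> [L0 Ls]; apply: contrapT => /forallNP h.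
have h' j : pluecker L i j = 0 by apply/eqP; apply: contrapT => /negP /h.
have := Ls [set: 'I_n]%SET (fun j k _ _ => parallel_trans (L0 i) (h' j) (h' k)).
rewrite (eq_bigl xpredT) => [|j]; last by rewrite inE.
by move=> /(lt_le_trans a2).
Qed.

(** Where this product does not vanish, columns parallel in [L] are parallel in [L0], so stability
    passes from [L0] to [L]: it cuts out a principal open neighbourhood of [L0] made of stable
    matrices. *)
Definition plprod (L0 L : 'M[C]_(2, n)) : C :=
  \prod_(e : 'I_n * 'I_n | pluecker L0 e.1 e.2 != 0) pluecker L e.1 e.2.

Lemma plprod_self L0 : plprod L0 L0 != 0.
Proof. by apply/prodf_neq0. Qed.

Lemma plprod_stabm (L0 L : 'M[C]_(2, n)) : stabm a L0 -> plprod L0 L != 0 -> stabm a L.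
Proof.
move=> s0 /prodf_neq0 Lp.
have Lij i j : pluecker L0 i j != 0 -> pluecker L i j != 0 by move=> h; exact: (Lp (i, j)).
split=> [i|I pI].
  have [j /Lij] := stabm_pluecker i s0.
  apply: contraNneq => /colP e; have := e 0; have := e 1; rewrite /pluecker !mxE => -> ->.
  by rewrite mul0r mulr0 subr0.
apply: s0.2 => i j iI jI; apply/eqP; apply: contrapT => /negP /Lij.
by rewrite pI // eqxx.
Qed.

Lemma plprod_reg (Z : space R) (f : Z -> 'M[C]_(2, n)) z L0 : good Z ->
  (forall i j, reg z (fun y => f y i j)) -> reg z (fun y => plprod L0 (f y)).
Proof.
move=> gZ rf; apply: (reg_prod gZ) => e _; rewrite /pluecker.
by apply: (reg_sub gZ); apply: (good_mul gZ).
Qed.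

(** Every stable matrix has a neighbourhood mapping to an affine base on which
    the tautological family of marked lines is defined. *)
Lemma stable_base (L0 : 'M[C]_(2, n)) : stabm a L0 ->
  exists k (S : set (@aff_space R 1 k)) (L : sub_space S -> 'M[C]_(2, n))
    (beta : @aff_space R 2 n -> sub_space S),
  [/\ zclosed S, forall b i j, reg b (fun b : sub_space S => L b i j),
      forall b, stabm a (L b) &
      near_pt (L0 : @aff_space R 2 n)
        [set A | morph_at beta A /\ L (beta A) = A]].
Proof.
move=> s0; pose k := (2 * n + 1)%N.
pose Lb (v : 'rV[C]_k) : 'M[C]_(2, n) := vec_mx (lsubmx (v : 'rV_(2 * n + 1))).
pose lst (v : 'rV[C]_k) := v 0 (rshift (2 * n) 0).
(* The principal open set becomes closed in an affine space of one more dimension, whose last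
   coordinate is the inverse of [plprod L0]. *)
pose S := [set v : @aff_space R 1 k | lst v * plprod L0 (Lb v) = 1].
have gA := aff_good (R := R) 1 k.
have gM := aff_good (R := R) 2 n.
have rLb (v : @aff_space R 1 k) i j : reg v (fun v : @aff_space R 1 k => Lb v i j).
  apply: (@reg_ext _ _ gA v _ _ _ (aff_coord_reg v 0 (lshift 1 (mxvec_index i j)))).
  by move=> w; rewrite !mxE.
have cS : zclosed S.
  apply: (open_near gA) => v /= nv.
  have r : reg v (fun v : @aff_space R 1 k => lst v * plprod L0 (Lb v) - 1).
    apply: (reg_sub gA); last exact: (good_cst gA).
    by apply: (good_mul gA); [exact: aff_coord_reg|exact: (plprod_reg _ gA)].
  have := good_nz gA r; rewrite subr_eq0 => /(_ (introN eqP nv)) n1.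
  by apply: near_sub n1 _ => w /=; rewrite subr_eq0 => /eqP.
pose be0 (A : 'M[C]_(2, n)) : 'rV[C]_k := row_mx (mxvec A) ((plprod L0 A)^-1)%:M.
have be0L A : Lb (be0 A) = A by rewrite /Lb row_mxKl mxvecK.
have be0l A : lst (be0 A) = (plprod L0 A)^-1 by rewrite /lst /be0 row_mxEr mxE eqxx mulr1n.
have be0S A : plprod L0 A != 0 -> S (be0 A).
  by move=> M0; rewrite /S /= be0L be0l mulVf.
pose beta (A : @aff_space R 2 n) : sub_space S :=
  if pselect (plprod L0 A != 0) is left h then exist _ (be0 A) (be0S A h)
  else exist _ (be0 L0) (be0S L0 (plprod_self L0)).
have betaE A : plprod L0 A != 0 -> sval (beta A) = be0 A.
  by rewrite /beta; case: pselect.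
exists k, S, (fun b => Lb (sval b)), beta; split=> //.
- by move=> b i j; exact: ((sval_morph S gA).2 b _ (rLb (sval b) i j)).
- move=> [v /= vS]; apply: (plprod_stabm s0).
  by apply: contra_eq_neq vS => ->; rewrite mulr0 eq_sym oner_neq0.
have rp (A : @aff_space R 2 n) : reg A (fun A : @aff_space R 2 n => plprod L0 A).
  by apply: (plprod_reg _ gM) => i j; exact: aff_coord_reg.
apply: near_sub (good_nz gM (rp L0) (plprod_self L0)) _ => A /= M0.
split; last by rewrite betaE.
apply: (to_sub_morph_at gM).
apply: (@morph_at_near _ _ _ (be0 : @aff_space R 2 n -> @aff_space R 1 k) _ _ gM).
  by apply: near_sub (good_nz gM (rp A) M0) _ => N /= N0; rewrite betaE.
apply: (to_aff_morph_at gM) => i j; rewrite ord1.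
case: (split_ordP j) => l ->.
  case/mxvec_indexP: l => i' j'.
  apply: (@reg_ext _ _ gM A _ _ _ (aff_coord_reg A i' j')) => N.
  by rewrite /be0 row_mxEl mxvecE.
apply: (@reg_ext _ _ gM A _ _ _ (good_inv gM (rp A) M0)) => N.
by rewrite /be0 row_mxEr !ord1 mxE eqxx mulr1n.
Qed.

Lemma matrix_classified (L0 : 'M[C]_(2, n)) : stabm a L0 ->
  exists Phi : @aff_space R 2 n -> M,
   near_pt (L0 : @aff_space R 2 n) [set L | [/\ stabm a L, morph_at Phi L & config (Phi L) L]].
Proof.
move=> s0; have [k [S [L [beta [cS rL sL nb]]]]] := stable_base s0.
have [phi [psi [mphi mpsi psis fib]]] := family_classified cS rL sL.
exists (phi \o beta); apply: near_sub nb _ => N [mb Lb]; split.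
- by rewrite -Lb.
- by apply: morph_at_comp => //; exact: is_morph_at.
have [f If fE] := fib (beta N); exists f => // i.
by rewrite fE -[in colpt N i]Lb psis.
Qed.

Lemma stabm_config (L : 'M[C]_(2, n)) : stabm a L -> exists m : M, config m L.
Proof.
move=> sL; have [Phi /near_refl[_ _ c]] := matrix_classified sL.
by exists (Phi L).
Qed.

(** On stable matrices the chosen point is forced by [config_unique], so this total map agrees there
    with the local classifying maps and inherits their regularity. *)
Definition modpt (m0 : M) (L : @aff_space R 2 n) : M :=
  pick_or m0 (fun m : M => config m L).

Lemma modptP m0 (L : 'M[C]_(2, n)) : stabm a L -> config (modpt m0 L) L.
Proof. by move=> /stabm_config h; exact: (@pick_orP _ m0 (fun m : M => config m L) h). Qed.

Lemma stabm_open : zopen [set L : @aff_space R 2 n | stabm a L].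
Proof.
apply: (open_near (aff_good _ _)) => L sL.
by have [Phi n1] := matrix_classified sL; apply: near_sub n1 _ => N [].
Qed.

Lemma modpt_morph m0 (L : 'M[C]_(2, n)) : stabm a L -> morph_at (modpt m0) L.
Proof.
move=> sL; have [Phi n1] := matrix_classified sL.
apply: (@morph_at_near _ _ _ Phi _ _ (aff_good _ _)); last by case: (near_refl n1).
apply: near_sub n1 _ => N [sN _ cN] /=.
exact: config_unique sN cN (modptP m0 sN).
Qed.

End Configurations.

(** * Morphisms from the line to projective space *)

Section PolyLemmas.
Variable C : numFieldType.
Implicit Types p q g h : {poly C}.

(** Common roots are divided out one at a time; the size of one nonzero member bounds the number of
    divisions. *)
Lemma common_factor (I : finType) (H : I -> {poly C}) : (exists i, H i != 0) ->
  exists (G : {poly C}) (F : I -> {poly C}), [/\ G != 0, forall i, H i = G * F i &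
    forall z, exists i, (F i).[z] != 0].
Proof.
move=> [a Ha]; move: {2}(size (H a)) (leqnn (size (H a))) => m.
elim: m H Ha => [|m IHm] H Ha sa.
  by move: sa Ha; rewrite leqn0 size_poly_eq0 => ->.
have [[z Hz]|nz] := pselect (exists z, forall i, (H i).[z] = 0); last first.
  exists 1, H; split=> // [|i|z]; rewrite ?oner_neq0 ?mul1r //.
  apply: contrapT => h; apply: nz; exists z => i; apply/eqP; apply: contrapT => /negP hi.
  by apply: h; exists i.
pose H' i := H i %/ ('X - z%:P).
have HE i : H i = H' i * ('X - z%:P).
  by rewrite divpK // dvdp_XsubCl /root Hz.
have H'a : H' a != 0 by apply: contraNneq Ha; rewrite HE => ->; rewrite mul0r.
have [|G [F [G0 GF Fz]]] := IHm H' H'a.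
  by move: sa; rewrite HE size_Mmonic ?monicXsubC // size_XsubC addn2.
exists (('X - z%:P) * G), F; split=> // [|i]; first by rewrite mulf_neq0 // polyXsubC_eq0.
by rewrite HE GF mulrC mulrA.
Qed.

(** A Bezout relation is multiplied by [g] and the coefficient of [q] is reduced modulo [p]; the
    bound on [a] then follows from the sizes of [g] and [b * q]. *)
Lemma bezout_gen p q D T g : coprimep p q -> size p = D.+1 -> (D + size q <= T.+1)%N ->
  (size g <= T)%N ->
  exists a b : {poly C}, [/\ (size a <= T - D)%N, (size b <= D)%N & g = a * p + b * q].
Proof.
move=> /Bezout_eq1_coprimepP[[u v] /= uv] sp sq sg.
have p0 : p != 0 by rewrite -size_poly_eq0 sp.
pose b := (g * v) %% p; have sb : (size b <= D)%N by rewrite -ltnS -sp ltn_modp.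
have gp : p %| g - b * q.
  have -> : g - b * q = (g * u + (g * v) %/ p * q) * p.
    have e := divp_eq (g * v) p.
    have -> : b = g * v - (g * v) %/ p * p by rewrite {1}e addrC addKr.
    rewrite -[X in X - _]mulr1 -uv; ring.
  exact: dvdp_mull.
exists ((g - b * q) %/ p), b; split=> //; last by rewrite divpK // subrK.
rewrite size_divp // sp /= leq_sub2r //.
apply: leq_trans (size_polyD _ _) _; rewrite geq_max sg size_polyN.
apply: leq_trans (size_polyMleq _ _) _; rewrite -subn1 leq_subLR add1n.
by apply: leq_trans sq; rewrite leq_add2r.
Qed.

(** A vector space over an infinite field is not a finite union of proper subspaces, here those of
    the members of [V] vanishing at a given [z]. *)
Lemma avoid_roots (V : {poly C} -> Prop) (s : seq C) : V 0 ->
  (forall h k c, V h -> V k -> V (h + c *: k)) ->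
  (forall z, z \in s -> exists2 h, V h & h.[z] != 0) ->
  exists2 h, V h & forall z, z \in s -> h.[z] != 0.
Proof.
move=> V0 VD; elim: s => [|z s IHs] Vs; first by exists 0.
have [|h Vh hs] := IHs; first by move=> y ys; apply: Vs; rewrite inE ys orbT.
have [k Vk kz] := Vs z (mem_head _ _).
have [hz|hz] := eqVneq h.[z] 0; last first.
  by exists h => // y; rewrite inE => /orP[/eqP->|/hs].
(* The factor ['X] makes [c] nonzero, as needed at [z], where [h] vanishes and [k] does not; the
   other factors keep the values at the points of [s] nonzero. *)
pose P := 'X * \prod_(y <- s) (h.[y]%:P + k.[y] *: 'X).
have P0 : P != 0.
  rewrite mulf_neq0 ?polyX_eq0 // prodf_seq_neq0; apply/allP => y ys /=.
  apply: (@horner_neq0 _ _ 0); rewrite hornerD hornerC hornerZ hornerX mulr0 addr0.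
  exact: hs.
have [c] := poly_nz_ex P0; rewrite hornerM hornerX mulf_eq0 negb_or => /andP[c0].
rewrite horner_prod prodf_seq_neq0 => /allP cs.
exists (h + c *: k); first exact: VD.
move=> y; rewrite inE => /orP[/eqP->|ys].
  by rewrite hornerD hornerZ hz add0r mulf_neq0.
have := cs y ys; rewrite /= !hornerD hornerC !hornerZ hornerX.
by rewrite mulrC.
Qed.

Lemma revp_coef n p i : (i <= n)%N -> (revp n p)`_i = p`_(n - i).
Proof. by move=> ni; rewrite coef_poly ltnS ni. Qed.

Lemma size_revp n p : (size (revp n p) <= n.+1)%N.
Proof. exact: size_poly. Qed.

Lemma revpK n p : (size p <= n.+1)%N -> revp n (revp n p) = p.
Proof.
move=> sp; apply/polyP => i; have [ni|ni] := leqP i n.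
  by rewrite !revp_coef ?leq_subr // subKn.
by rewrite coef_poly ltnS leqNgt ni /= nth_default // (leq_trans sp).
Qed.

Lemma revp_order n p t r : (size p <= n.+1)%N -> revp n p = 'X^t * r -> r.[0] != 0 ->
  (t <= n)%N /\ size p = (n - t).+1.
Proof.
move=> sp e r0.
have ct : (revp n p)`_t != 0 by rewrite e coefXnM ltnn subnn -horner_coef0.
have tn : (t <= n)%N.
  by rewrite leqNgt; apply: contra ct => nt; rewrite coef_poly ltnS leqNgt nt.
split=> //; apply/eqP; rewrite eqn_leq; apply/andP; split; last first.
  rewrite ltnNge; apply: contra ct => h; rewrite revp_coef // nth_default //.
apply/leq_sizeP => j hj; have [jn|jn] := leqP j n; last first.
  by rewrite nth_default // (leq_trans sp).
have -> : p`_j = (revp n p)`_(n - j) by rewrite revp_coef ?leq_subr // subKn.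
by rewrite e coefXnM; case: ltnP => //; lia.
Qed.

Lemma coprimeXn E q : q.[0] != 0 -> coprimep 'X^E q.
Proof.
move=> q0; case: E => [|E]; first by rewrite expr0 coprime1p.
rewrite coprimep_expl // coprimep_sym -['X]subr0 -polyC0 coprimep_XsubC.
exact: q0.
Qed.

(** A polynomial of degree below [E] is determined by its jet at [0]: here [p * q] is divisible by
    ['X^E] while [q] is a unit at [0]. *)
Lemma jet_zero p q r g E : (size p <= E)%N -> q.[0] != 0 -> g != 0 ->
  (forall z, g.[z] != 0 -> p.[z] * q.[z] = z ^+ E * r.[z]) -> p = 0.
Proof.
move=> sp q0 g0 e.
have pq : p * q = 'X^E * r.
  apply: (poly_eq_off g0) => z gz; rewrite !hornerM e //.
  by rewrite hornerXn.
have : 'X^E %| p by rewrite -(Gauss_dvdpl p (coprimeXn E q0)) pq dvdp_mulr.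
by move=> /dvdp_leq; case: eqVneq => // _ /(_ isT); rewrite size_polyXn => /leq_trans/(_ sp); rewrite ltnn.
Qed.

End PolyLemmas.

(** * Homogeneous forms and polynomial maps *)

Section Forms.
Context {R : realType}.
Local Notation C := R[i].
Variable N : nat.
Local Notation PN := (@proj_space R N).
Local Notation vec := ('I_N.+1 -> C).

(** Monomials are indexed by words in the coordinates. A form then has several systems of
    coefficients, but multiplication of monomials is concatenation. *)
Definition mono (A : comNzRingType) k (I : {ffun 'I_k -> 'I_N.+1}) (v : 'I_N.+1 -> A) : A :=
  \prod_j v (I j).

Definition hom k (p : vec -> C) :=
  exists c : {ffun 'I_k -> 'I_N.+1} -> C, forall v, p v = \sum_I c I * mono I v.

Lemma hom_scale k c p : hom k p -> hom k (fun v => c * p v).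
Proof.
move=> [d dE]; exists (fun I => c * d I) => v; rewrite dE big_distrr /=.
by apply: eq_bigr => I _; rewrite mulrA.
Qed.

Lemma hom_add k p q : hom k p -> hom k q -> hom k (fun v => p v + q v).
Proof.
move=> [c cE] [d dE]; exists (fun I => c I + d I) => v; rewrite cE dE -big_split /=.
by apply: eq_bigr => I _; rewrite mulrDl.
Qed.

Lemma hom0 k : hom k (fun=> 0).
Proof. by exists (fun=> 0) => v; rewrite big1 // => I _; rewrite mul0r. Qed.

Lemma hom_sum k (T : Type) (s : seq T) (P : pred T) (p : T -> vec -> C) :
  (forall t, hom k (p t)) -> hom k (fun v => \sum_(t <- s | P t) p t v).
Proof.
move=> hp; elim: s => [|t s IHs].
  rewrite (_ : (fun _ => _) = fun=> 0); first exact: hom0.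
  by apply/funext => v; rewrite big_nil.
rewrite (_ : (fun _ => _) = fun v => (if P t then p t v else 0) + \sum_(t <- s | P t) p t v).
  by apply: hom_add => //; case: (P t) => //; exact: hom0.
by apply/funext => v; rewrite big_cons; case: (P t) => //; rewrite add0r.
Qed.

Lemma hom_mono k (I : {ffun 'I_k -> 'I_N.+1}) : hom k (mono I).
Proof.
exists (fun J => (J == I)%:R) => v; rewrite (bigD1 I) //= eqxx mul1r big1 ?addr0 //.
by move=> J /negbTE ->; rewrite mul0r.
Qed.

Lemma hom_mul k l p q : hom k p -> hom l q -> hom (k + l) (fun v => p v * q v).
Proof.
move=> [c cE] [d dE].
rewrite (_ : (fun _ => _) = fun v => \sum_I \sum_J (c I * d J) *
   mono [ffun i : 'I_(k + l) => match fintype.split i with inl a => I a | inr b => J b end] v).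
  do 2 (apply: hom_sum => ?); apply: hom_scale; exact: hom_mono.
apply/funext => v; rewrite cE dE big_distrlr /=; apply: eq_bigr => I _; apply: eq_bigr => J _.
rewrite mulrACA; congr (_ * _); rewrite /mono big_split_ord /=; congr (_ * _);
  apply: eq_bigr => i _; rewrite ffunE.
  by rewrite -[lshift _ _]/(unsplit (inl i)) unsplitK.
by rewrite -[rshift _ _]/(unsplit (inr i)) unsplitK.
Qed.

Lemma hom_cst c : hom 0 (fun=> c).
Proof.
exists (fun=> c) => v; have f0 : {ffun 'I_0 -> 'I_N.+1} := [ffun i => ord0].
rewrite (big_pred1 f0) => [|I]; first by rewrite /mono big_ord0 mulr1.
by rewrite /=; apply/esym/eqP/ffunP => -[].
Qed.

Lemma hom_coord i : hom 1 (fun v => v i).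
Proof.
have := hom_mono [ffun _ : 'I_1 => i]; congr (hom _ _).
by apply/funext => v; rewrite /mono big_ord1 ffunE.
Qed.

Lemma hom_homogeneous k p : hom k p -> forall a v, p (fun i => a * v i) = a ^+ k * p v.
Proof.
move=> [c cE] a v; rewrite !cE big_distrr /=; apply: eq_bigr => I _.
by rewrite /mono big_split /= prodr_const card_ord mulrCA.
Qed.

Lemma polyfun_hom p : polyfun (@entry R 1 N.+1) p ->
  exists K (f : nat -> vec -> C), (forall k, hom k (f k)) /\
    forall v : 'rV[C]_N.+1, p v = \sum_(k < K) f k (v 0).
Proof.
elim=> [a|i|p1 q1 _ [K [f [hf fE]]] _ [K' [f' [hf' fE']]]|p1 q1 _ [K [f [hf fE]]] _ [K' [f' [hf' fE']]]].
- exists 1%N, (fun k => if k is 0 then fun=> a else fun=> 0); split=> [[|k]|v].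
  + exact: hom_cst.
  + exact: hom0.
  + by rewrite big_ord1.
- exists 2%N, (fun k => if k is 1%N then fun v => v i.2 else fun=> 0); split=> [[|[|k]]|v].
  + exact: hom0.
  + exact: hom_coord.
  + exact: hom0.
  + by rewrite big_ord_recl big_ord1 add0r /entry; case: i => i j /=; rewrite (ord1 i).
- exists (K + K')%N, (fun k v => (if (k < K)%N then f k v else 0) +
     (if (k < K')%N then f' k v else 0)); split=> [k|v].
    by apply: hom_add; [case: (k < K)%N|case: (k < K')%N] => //; exact: hom0.
  rewrite big_split /= fE fE'; congr (_ + _).
    rewrite (big_ord_widen (K + K') (fun i => f i (v 0))) ?leq_addr // big_mkcond /=.
    by apply: eq_bigr => i _; case: ifP.
  rewrite (big_ord_widen (K + K') (fun i => f' i (v 0))) ?leq_addl // big_mkcond /=.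
  by apply: eq_bigr => i _; case: ifP.
exists (K + K')%N, (fun k v => \sum_(e : 'I_K * 'I_K' | (e.1 + e.2 == k)%N) f e.1 v * f' e.2 v).
split=> [k|v].
  have h (e : 'I_K * 'I_K') : (e.1 + e.2 = k)%N -> hom k (fun v => f e.1 v * f' e.2 v).
    by move=> <-; exact: hom_mul.
  rewrite (_ : (fun _ => _) = fun v => \sum_(e : 'I_K * 'I_K')
     (if (e.1 + e.2 == k)%N then f e.1 v * f' e.2 v else 0)).
    apply: hom_sum => e; case: (boolP (e.1 + e.2 == k)%N) => [/eqP/h //|_]; exact: hom0.
  by apply/funext => v; rewrite big_mkcond.
rewrite fE fE' big_distrlr /= pair_bigA /=.
under [RHS]eq_bigr do rewrite big_mkcond /=.
rewrite exchange_big /=; apply: eq_bigr => -[e1 e2] _ /=.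
have l12 : (e1 + e2 < K + K')%N by rewrite -addnS leq_add // ltnW.
rewrite -big_mkcond (big_pred1 (Ordinal l12)) //=.
Qed.

(** On the cone [f] is a quotient of polynomials. It is constant along the line through [w], so the
    identity between numerator and denominator holds in each degree; [k] is a degree in which the
    denominator is nonzero at [v]. *)
Lemma reg_hom (f : PN -> C) v : v != 0 -> reg (toP v) f ->
  exists k p q r, [/\ hom k p, hom k q, polyfun (@entry R 1 N.+1) r, r v != 0 /\ q (v 0) != 0 &
   forall w : 'rV[C]_N.+1, w != 0 -> r w != 0 -> q (w 0) != 0 -> f (toP w) = p (w 0) / q (w 0)].
Proof.
move=> v0 /(toP_morph_at v0).2 [p [q [Pp Pq q0 fpq]]].
have [K [p' [hp pE]]] := polyfun_hom Pp; have [K' [q' [hq qE]]] := polyfun_hom Pq.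
have [k qk] : exists k : 'I_K', q' k (v 0) != 0.
  apply: contrapT => /forallNP h; move: q0; rewrite qE big1 ?eqxx // => i _.
  by apply/eqP; apply: contrapT => /negP /h.
exists k, (fun w => if (k < K)%N then p' k w else 0), (q' k), q; split=> //.
- by case: (k < K)%N; [exact: hp|exact: hom0].
move=> w w0 qw qkw.
pose Pw := \poly_(i < K) p' i (w 0); pose Qw := \poly_(i < K') q' i (w 0).
have eP l : p (l *: w) = Pw.[l].
  rewrite pE horner_poly; apply: eq_bigr => i _.
  rewrite mulrC -(hom_homogeneous (hp i)); congr (p' i _); apply/funext => j.
  by rewrite mxE.
have eQ l : q (l *: w) = Qw.[l].
  rewrite qE horner_poly; apply: eq_bigr => i _.
  rewrite mulrC -(hom_homogeneous (hq i)); congr (q' i _); apply/funext => j.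
  by rewrite mxE.
have Q1 : Qw.[1] != 0 by rewrite -eQ scale1r.
have e : f (toP w) *: Qw = Pw.
  apply: (@poly_eq_off _ ('X * Qw)).
    by rewrite mulf_neq0 ?polyX_eq0 // (horner_neq0 Q1).
  move=> l; rewrite hornerM hornerX mulf_eq0 negb_or -eQ => /andP[l0 ql].
  rewrite hornerZ -eP -eQ; have := fpq _ ql; rewrite /= toP_scale // => ->.
  by rewrite divfK.
have := congr1 (fun P : {poly C} => P`_k) e; rewrite coefZ !coef_poly ltn_ord => <-.
by rewrite mulfK.
Qed.

End Forms.

Section PolyMap.
Context {R : realType}.
Local Notation C := R[i].
Local Notation P1 := (@proj_space R 1).
Variable N : nat.
Local Notation PN := (@proj_space R N).
Local Notation fam := ('I_N.+1 -> {poly C}).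

Definition evalr (F : fam) (z : C) : 'rV[C]_N.+1 := \row_i (F i).[z].

Lemma evalr_neq0 F z : (exists i, (F i).[z] != 0) -> evalr F z != 0.
Proof. by move=> [i Fi]; apply: (@row_entry_neq0 _ _ _ i); rewrite mxE. Qed.

Lemma evalr_neq0P F z : evalr F z != 0 -> exists i, (F i).[z] != 0.
Proof. by move=> h; have [j] := row_neq0 h; rewrite mxE; exists j. Qed.

Lemma toP_cross (v w : 'rV[C]_N.+1) : v != 0 -> w != 0 ->
  (forall i j, v 0 i * w 0 j = v 0 j * w 0 i) -> toP v = toP w.
Proof.
move=> v0 w0 e; have [a va] := row_neq0 v0.
have wa : w 0 a != 0.
  apply: contraNneq w0 => wa; apply/eqP/rowP => j; rewrite mxE.
  by have /eqP := e a j; rewrite wa mulr0 mulf_eq0 (negbTE va) => /eqP.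
have -> : w = (w 0 a / v 0 a) *: v.
  by apply/rowP => j; rewrite mxE mulrAC [_ * v 0 j]mulrC -e mulrAC divff // mul1r.
by rewrite toP_scale // mulf_neq0 // invr_eq0.
Qed.

Lemma toP_crossE (v w : 'rV[C]_N.+1) : v != 0 -> w != 0 -> toP v = toP w ->
  forall i j, v 0 i * w 0 j = v 0 j * w 0 i.
Proof. by move=> v0 w0 /(toP_eq v0 w0)[a a0 ->] i j; rewrite !mxE; ring. Qed.

Lemma local_poly (T : P1 -> PN) c z0 : is_morph T ->
  exists (H : fam) (g : {poly C}), [/\ g.[z0] != 0, evalr H z0 != 0 &
    forall z, g.[z] != 0 -> evalr H z != 0 /\ T (chart c z) = toP (evalr H z)].
Proof.
move=> mT; have [a [Ta rT na nT]] := proj_lift (@proj_good R 1) (is_morph_at (chart c z0) mT).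
have /choice[pq pqP] : forall j, exists pq : {poly C} * {poly C}, pq.2.[z0] != 0 /\
    forall z, pq.2.[z] != 0 -> cratio j a (T (chart c z)) = pq.1.[z] / pq.2.[z].
  by move=> j; have [p [q h]] := reg_line (rT j); exists (p, q).
have [q0 q00 q0T] := near_line nT; have [q1 q10 q1T] := near_line na.
pose Q := \prod_i (pq i).2.
pose H j := (pq j).1 * \prod_(i | i != j) (pq i).2.
have HE z : Q.[z] != 0 -> evalr H z = Q.[z] *: (\row_j cratio j a (T (chart c z))).
  rewrite horner_prod => Qz; have qi j : (pq j).2.[z] != 0 by move: Qz => /prodf_neq0; apply.
  apply/rowP => j; rewrite !mxE (pqP j).2 // /H hornerM horner_prod mulrCA; congr (_ * _).
  by rewrite -(prodD1_div j qi) mulrC divfK.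
have Q0 : Q.[z0] != 0 by rewrite horner_prod; apply/prodf_neq0 => i _; case: (pqP i).
have key z : (Q * (q0 * q1)).[z] != 0 -> evalr H z != 0 /\ T (chart c z) = toP (evalr H z).
  rewrite !hornerM !mulf_eq0 !negb_or => /and3P[Qz q0z q1z].
  have r0 : \row_j cratio j a (T (chart c z)) != 0.
    by apply: (@row_entry_neq0 _ _ _ a); rewrite mxE /cratio divff ?oner_neq0 //; exact: q1T.
  by rewrite HE // scaler_eq0 negb_or Qz r0 toP_scale // -(q0T z q0z).
exists H, (Q * (q0 * q1)); have g0 : (Q * (q0 * q1)).[z0] != 0 by rewrite !hornerM !mulf_neq0.
by split=> //; case: (key z0 g0).
Qed.

(** Near [z0] both sides are given by polynomials. Equality of points is the vanishing of minors,
    and these polynomials vanish off finitely many values, hence identically. *)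
Lemma poly_agree (T : P1 -> PN) c z0 (K : fam) (g : {poly C}) : is_morph T ->
  g != 0 -> (forall z, g.[z] != 0 -> evalr K z != 0 /\ T (chart c z) = toP (evalr K z)) ->
  evalr K z0 != 0 -> T (chart c z0) = toP (evalr K z0).
Proof.
move=> mT g0 gK K0; have [H [g' [g'0 H0 g'H]]] := local_poly c z0 mT.
rewrite (g'H _ g'0).2; apply: toP_cross => // i j; rewrite !mxE -!hornerM.
congr (_.[_]); apply: (@poly_eq_off _ (g * g')).
  by rewrite mulf_neq0 // (horner_neq0 g'0).
move=> z; rewrite hornerM mulf_eq0 negb_or => /andP[/gK[Kz e] /g'H[Hz e']].
have := toP_crossE Hz Kz; rewrite -e -e' => /(_ erefl i j).
by rewrite !mxE !hornerM.
Qed.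

(** A morphism from the projective line to projective space is given by
    coprime polynomials; [d] is its degree. *)
Definition poly_map (T : P1 -> PN) (d : nat) (F : fam) :=
  [/\ forall i, (size (F i) <= d.+1)%N, forall z, evalr F z != 0,
      exists i, (F i)`_d != 0,
      forall z, T (chart true z) = toP (evalr F z)
    & forall z, T (chart false z) = toP (evalr (fun i => revp d (F i)) z)].

(** A local polynomial expression, freed from its common factor, has no common zero left and
    therefore describes the morphism on the whole affine chart. Taking for [d] the largest degree
    makes the reversed polynomials free of common zeros at infinity too. *)
Lemma poly_map_ex (T : P1 -> PN) : is_morph T -> exists d F, poly_map T d F.
Proof.
move=> mT; have [H [g [g0 H0 gH]]] := local_poly true 0 mT.
have [i Hi] := evalr_neq0P H0.
have [|G [F [G0 GF Fz]]] := @common_factor _ _ H; first by exists i; exact: horner_neq0 Hi.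
have Fz' z : evalr F z != 0 by exact: evalr_neq0.
have TF z : T (chart true z) = toP (evalr F z).
  apply: (@poly_agree _ _ _ _ (g * G)) => //; first by rewrite mulf_neq0 // (horner_neq0 g0).
  move=> y; rewrite hornerM mulf_eq0 negb_or => /andP[/gH[Hy ->] Gy]; split=> //.
  rewrite (_ : evalr H y = G.[y] *: evalr F y) ?toP_scale //.
  by apply/rowP => j; rewrite !mxE GF hornerM.
pose d := (\max_i size (F i)).-1.
have sF j : (size (F j) <= d.+1)%N.
  by apply: leq_trans (leqSpred _); exact: (leq_bigmax j).
have [j Fj] : exists j, (F j)`_d != 0.
  have [|j e] := @bigop.eq_bigmax _ (fun i => size (F i)); first by rewrite card_ord.
  exists j; rewrite /d e; rewrite -/(lead_coef (F j)) lead_coef_eq0.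
  have [k Fk] := evalr_neq0P (Fz' 0).
  have : (0 < size (F k))%N by rewrite size_poly_gt0 (horner_neq0 Fk).
  rewrite -size_poly_gt0 -e => h; exact: leq_trans h (leq_bigmax k).
exists d, F; split=> // [|z]; first by exists j.
have K0 : evalr (fun i => revp d (F i)) 0 != 0.
  by apply: evalr_neq0; exists j; rewrite revp0.
have key z' : 'X.[z'] != 0 -> evalr (fun i => revp d (F i)) z' != 0 /\
    T (chart false z') = toP (evalr (fun i => revp d (F i)) z').
  rewrite hornerX => z0.
  have e : evalr (fun i => revp d (F i)) z' = z' ^+ d *: evalr F z'^-1.
    by apply/rowP => l; rewrite !mxE revpE.
  rewrite e scaler_eq0 negb_or expf_neq0 ?Fz' // toP_scale ?expf_neq0 //.
  by rewrite chart_inv // TF.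
have [->|z0] := eqVneq z 0; last by apply: (key z _).2; rewrite hornerX.
by apply: (@poly_agree _ _ _ _ 'X) => //; rewrite polyX_eq0.
Qed.

End PolyMap.

(** * Restriction of forms to an embedded line *)

Section Surjectivity.
Context {R : realType}.
Local Notation C := R[i].
Local Notation P1 := (@proj_space R 1).
Variable N : nat.
Local Notation PN := (@proj_space R N).
Local Notation fam := ('I_N.+1 -> {poly C}).

Lemma size_mono (F : fam) d k (I : {ffun 'I_k -> 'I_N.+1}) :
  (forall i, size (F i) <= d.+1)%N -> (size (mono I F) <= (k * d).+1)%N.
Proof.
move=> sF; rewrite /mono; elim: k I => [|k IHk] I; first by rewrite big_ord0 size_poly1.
rewrite big_ord_recr /=; apply: leq_trans (size_polyMleq _ _) _.
have := IHk [ffun j => I (widen_ord (leqnSn k) j)].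
rewrite (eq_bigr (fun j => F (I (widen_ord (leqnSn k) j)))) => [h|j _]; last by rewrite ffunE.
rewrite -subn1 leq_subLR; apply: leq_trans (leq_add h (sF (I ord_max))) _.
by rewrite mulSn; lia.
Qed.

Lemma horner_mono (F : fam) k (I : {ffun 'I_k -> 'I_N.+1}) z :
  (mono I F).[z] = mono I (fun i => (F i).[z]).
Proof. by rewrite /mono horner_prod. Qed.

Lemma polyfun_evalr (F : fam) p : polyfun (@entry R 1 N.+1) p ->
  exists P : {poly C}, forall z, p (evalr F z) = P.[z].
Proof.
elim=> [a|i|p1 q1 _ [P e] _ [Q e']|p1 q1 _ [P e] _ [Q e']].
- by exists a%:P => z; rewrite hornerC.
- by exists (F i.2) => z; rewrite /entry mxE.
- by exists (P + Q) => z; rewrite hornerD e e'.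
- by exists (P * Q) => z; rewrite hornerM e e'.
Qed.

(** [h] is the restriction of a form of degree [k] to the curve. *)
Definition restr (F : fam) k (h : {poly C}) :=
  exists2 p, hom k p & forall z, h.[z] = p (fun i => (F i).[z]).

Lemma restr_ex (F : fam) k p : hom k p -> exists2 h, restr F k h &
  forall z, h.[z] = p (fun i => (F i).[z]).
Proof.
move=> hp; have [c cE] := hp.
have e z : (\sum_I c I *: mono I F).[z] = p (fun i => (F i).[z]).
  rewrite cE horner_sum; apply: eq_bigr => I _; by rewrite hornerZ horner_mono.
by exists (\sum_I c I *: mono I F) => //; exists p.
Qed.

Lemma restrP (F : fam) k h : restr F k h -> exists c : {ffun 'I_k -> 'I_N.+1} -> C,
  h = \sum_I c I *: mono I F.
Proof.
move=> [p [c cE] e]; exists c; apply: (@poly_eq_off _ 1); rewrite ?oner_neq0 // => z _.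
by rewrite e cE horner_sum; apply: eq_bigr => I _; rewrite hornerZ horner_mono.
Qed.

Lemma restr_size (F : fam) d k h : (forall i, size (F i) <= d.+1)%N ->
  restr F k h -> (size h <= (k * d).+1)%N.
Proof.
move=> sF /restrP[c ->]; apply: leq_trans (size_sum _ _ _) _.
apply/bigmax_leqP => I _; apply: leq_trans (size_scale_leq _ _) _.
exact: size_mono.
Qed.

Lemma restr_add F k g h : restr F k g -> restr F k h -> restr F k (g + h).
Proof.
move=> [p hp pE] [q hq qE]; exists (fun v => p v + q v); first exact: hom_add.
by move=> z; rewrite hornerD pE qE.
Qed.

Lemma restr_scale F k c h : restr F k h -> restr F k (c *: h).
Proof.
move=> [p hp pE]; exists (fun v => c * p v); first exact: hom_scale.
by move=> z; rewrite hornerZ pE.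
Qed.

Lemma restr0 F k : restr F k 0.
Proof. by exists (fun=> 0); [exact: hom0|move=> z; rewrite horner0]. Qed.

Lemma restr1 F : restr F 0 1.
Proof. by exists (fun=> 1); [exact: hom_cst|move=> z; rewrite hornerC]. Qed.

Lemma restr_mul F k l g h : restr F k g -> restr F l h -> restr F (k + l) (g * h).
Proof.
move=> [p hp pE] [q hq qE]; exists (fun v => p v * q v); first exact: hom_mul.
by move=> z; rewrite hornerM pE qE.
Qed.

Lemma restr_exp F i k : restr F k (F i ^+ k).
Proof.
elim: k => [|k IHk]; first exact: restr1.
rewrite exprS -add1n; apply: restr_mul => //.
by exists (fun v => v i) => //; exact: hom_coord.
Qed.

(** Such an [h] stays among the restrictions of degree [k] when multiplied by the coordinate, so a
    product of [s] of them absorbs any polynomial factor of degree at most [s]. *)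
Definition restr2 F k h := restr F k h /\ restr F k ('X * h).

Lemma restr2_mul F k l h g : restr2 F k h -> restr F l g -> restr2 F (k + l) (h * g).
Proof. by move=> [h1 h2] hg; split; [|rewrite mulrA]; exact: restr_mul. Qed.

Variables (T : P1 -> PN) (d : nat) (F : fam).
Hypothesis TF : poly_map T d F.
Hypothesis imm : forall x f, reg x f -> exists f', reg (T x) f' /\
  near_pt x [set y | f y = f' (T y)].

Let K : fam := fun i => revp d (F i).
Let sF : forall i, (size (F i) <= d.+1)%N. Proof. by case: TF. Qed.

(** The coordinate of the line is locally the pullback of a regular function on projective space,
    that is, of a quotient of two forms of equal degree. Cleared of denominators, the identity is
    polynomial and holds everywhere. *)
Lemma local_ratio c (G : fam) z0 : (forall z, T (chart c z) = toP (evalr G z)) ->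
  (forall z, evalr G z != 0) ->
  exists k p q, [/\ hom k p, hom k q, q (fun i => (G i).[z0]) != 0 &
    forall z, z * q (fun i => (G i).[z]) = p (fun i => (G i).[z])].
Proof.
move=> TG G0; have [f [rf nf]] := imm (coord_reg c z0).
have [g g0 gE] := near_line nf.
rewrite TG in rf; have [k [p [q [r [hp hq Pr [r0 q0] fE]]]]] := reg_hom (G0 z0) rf.
have eG z : evalr G z 0 = (fun i => (G i).[z]) by apply/funext => i; rewrite mxE.
rewrite eG in q0; exists k, p, q; split=> // z.
have [hq' _ qE] := restr_ex G hq; have [hp' _ pE] := restr_ex G hp.
have [ro rE] := polyfun_evalr G Pr.
rewrite -qE -pE; have <- : 'X * hq' = hp'; last by rewrite hornerM hornerX.
rewrite rE in r0; rewrite -qE in q0.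
apply: (@poly_eq_off _ (g * (ro * hq'))).
  by rewrite !mulf_neq0 // ?(horner_neq0 g0) ?(horner_neq0 r0) ?(horner_neq0 q0).
move=> y; rewrite !hornerM !mulf_eq0 !negb_or => /and3P[gy ry qy].
have := gE y gy; rewrite /= coordK TG fE //; last 2 first.
- by rewrite rE.
- by rewrite eG -qE.
by rewrite eG -qE -pE hornerX => {1}->; rewrite divfK.
Qed.

Lemma restr2_finite z0 : exists k h, restr2 F k h /\ h.[z0] != 0.
Proof.
have [_ F0 _ Tt _] := TF.
have [k [p [q [hp hq q0 e]]]] := local_ratio (c := true) z0 Tt F0.
have [h hh hE] := restr_ex F hq; exists k, h; split; last by rewrite hE.
split=> //; exists p => // z; by rewrite hornerM hornerX hE e.
Qed.

(** At infinity the coordinate is the inverse of [z], so the denominator of its expression is ['X]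
    times the numerator [g]. The denominator does not vanish at infinity, hence has full degree
    [k * d], and [g] is the required polynomial. *)
Lemma restr2_infinite : exists k h, restr2 F k h /\ size h = (k * d)%N /\ h != 0.
Proof.
have [_ F0 [i Fi] _ Tf] := TF.
have K0 z : evalr K z != 0.
  have [->|z0] := eqVneq z 0; first by apply: evalr_neq0; exists i; rewrite revp0.
  rewrite (_ : evalr K z = z ^+ d *: evalr F z^-1).
    by rewrite scaler_eq0 negb_or expf_neq0 ?F0.
  by apply/rowP => l; rewrite !mxE revpE.
have [k [p [q [hp hq q0 e]]]] := local_ratio (c := false) 0 Tf K0.
have [h hh hE] := restr_ex F hq; have [g hg gE] := restr_ex F hp.
have [h' _ hE'] := restr_ex K hq.
have FK z : z != 0 -> (fun i => (F i).[z]) = (fun i => z ^+ d * (K i).[z^-1]).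
  by move=> z0; apply/funext => j; rewrite -(revpK (sF j)) revpE // ?size_revp.
have hXg : h = 'X * g.
  apply: (@poly_eq_off _ 'X); rewrite ?polyX_eq0 // => z; rewrite hornerX => z0.
  rewrite hornerM hornerX hE gE FK // (hom_homogeneous hp) (hom_homogeneous hq).
  by rewrite -e [RHS]mulrCA [z * (_ * _)]mulrA divff // mul1r.
have sh : (size h <= (k * d).+1)%N by exact: restr_size sF hh.
have hkd : h`_(k * d) != 0.
  rewrite -revp0 (_ : revp _ h = h') ?hE' //.
  apply: (@poly_eq_off _ 'X); rewrite ?polyX_eq0 // => z; rewrite hornerX => z0.
  rewrite revpE // hE hE' FK ?invr_eq0 // (hom_homogeneous hq) invrK.
  by rewrite mulrA -exprM [(d * k)%N]mulnC -exprMn divff // expr1n mul1r.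
have g0 : g != 0.
  by apply: contraNneq hkd => g0; rewrite hXg g0 mulr0 coef0.
exists k, g; split; first by split=> //; rewrite -hXg.
split=> //; have : size h = (k * d).+1.
  apply/eqP; rewrite eqn_leq sh ltnNge; apply: contra hkd => h1.
  by rewrite nth_default.
by rewrite hXg mulrC size_mulX // => -[].
Qed.

Lemma restr2_add k h g c : restr2 F k h -> restr2 F k g -> restr2 F k (h + c *: g).
Proof.
move=> [h1 h2] [g1 g2]; split; first by apply: restr_add => //; exact: restr_scale.
by rewrite mulrDr -scalerAr; apply: restr_add => //; exact: restr_scale.
Qed.

(** [P] comes from [restr2_infinite], brought to a common degree by a power of some [F i] of full
    degree [d]. [Q] is chosen off the roots of [P], which is possible because at each finite point
    some [restr2] polynomial is nonzero. *)
Lemma restr2_coprime : exists k P Q, [/\ restr2 F k P, restr2 F k Q,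
  size P = (k * d)%N, P != 0 & coprimep P Q].
Proof.
have [_ F0 [i Fi] _ _] := TF.
have [k1 [h [Ih [sh h0]]]] := restr2_infinite.
have sFi : size (F i) = d.+1.
  apply/eqP; rewrite eqn_leq sF ltnNge; apply: contra Fi => s.
  by rewrite nth_default.
have Fi0 : F i != 0 by rewrite -size_poly_eq0 sFi.
have [rs rsE] : exists rs : seq C, h * F i = lead_coef (h * F i) *: \prod_(z <- rs) ('X - z%:P).
  by have [rs e] := closed_field_poly_normal (h * F i); exists rs.
have hF0 : h * F i != 0 by rewrite mulf_neq0.
have rsP z : root (h * F i) z = (z \in rs).
  by rewrite rsE rootZ ?lead_coef_eq0 // root_prod_XsubC.
have /choice[kz /choice[hz hzP]] z := restr2_finite z.
pose k := (k1 + \sum_(z <- rs) kz z)%N.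
have kzk z : z \in rs -> (kz z <= k)%N.
  by move=> zr; apply: leq_trans (leq_addl _ _); rewrite (big_rem z) //= leq_addr.
have [|||Q IQ Q0] := @avoid_roots _ (restr2 F k) rs.
- by split; rewrite ?mulr0; exact: restr0.
- by move=> *; exact: restr2_add.
- move=> z /kzk zk; have [j Fj] := evalr_neq0P (F0 z).
  exists (hz z * F j ^+ (k - kz z)).
    rewrite -(subnKC zk); apply: restr2_mul; first exact: (hzP z).1.
    by rewrite addKn; exact: restr_exp.
  by rewrite hornerM horner_exp mulf_neq0 ?expf_neq0 //; exact: (hzP z).2.
pose P := h * F i ^+ (k - k1).
have k1k : (k1 <= k)%N by exact: leq_addr.
have sP : size P = (k * d)%N.
  rewrite size_mul ?expf_neq0 // sh.
  have -> : size (F i ^+ (k - k1)) = ((k - k1) * d).+1.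
    by rewrite -[LHS]prednK ?size_poly_gt0 ?expf_neq0 // size_exp sFi /= mulnC.
  by rewrite addnS /= -mulnDl subnKC.
exists k, P, Q; split=> //.
- rewrite -(subnKC k1k); apply: restr2_mul => //; rewrite addKn; exact: restr_exp.
- by rewrite mulf_neq0 ?expf_neq0.
apply: Pdiv.ClosedField.root_coprimep => z; rewrite rootM => rz.
apply: Q0; rewrite -rsP rootM; move: rz => /orP[->//|].
by rewrite /root horner_exp expf_eq0 => /andP[_ ->]; rewrite orbT.
Qed.

Definition restrs k s h := forall j, (j <= s)%N -> restr F (s * k) ('X^j * h).

Lemma restrs_mul k s h g : restrs k s h -> restr2 F k g -> restrs k s.+1 (h * g).
Proof.
move=> hs [g1 g2] j; rewrite leq_eqVlt => /orP[/eqP->|js].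
  rewrite exprSr mulrACA mulSn addnC; apply: restr_mul => //.
  exact: hs.
by rewrite mulrA mulSn addnC; apply: restr_mul => //; exact: hs.
Qed.

Lemma restrs_poly k s h (g : {poly C}) : restrs k s h -> (size g <= s.+1)%N -> restr F (s * k) (h * g).
Proof.
move=> hs sg; have -> : h * g = \sum_(j < s.+1) g`_j *: ('X^j * h).
  rewrite [in LHS](_ : g = \sum_(j < s.+1) g`_j *: 'X^j).
    rewrite big_distrr /=; apply: eq_bigr => j _.
    by rewrite -scalerAr mulrC.
  by rewrite -poly_def; apply/polyP => j; rewrite coef_poly; case: ltnP => // /(leq_trans sg) /(nth_default _).
apply: (big_ind (restr F (s * k))) => [|*|j _]; [exact: restr0|exact: restr_add|].
by apply: restr_scale; apply: hs; rewrite -ltnS.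
Qed.

(** Repeated Bezout expansion: writing [g = a * P + b * Q] lowers the size to be treated by
    [D = k * d - 1] and adds one factor [P] or [Q] to the cofactor. At the end the remaining
    polynomial is short enough to be absorbed by the factors collected. *)
Lemma restr_surj : exists k, (0 < k * d)%N /\
  forall g : {poly C}, (size g <= (k * d).+1)%N -> restr F k g.
Proof.
have [k [P [Q [IP IQ sP P0 co]]]] := restr2_coprime.
have kd : (0 < k * d)%N by rewrite -sP size_poly_gt0.
pose D := (k * d).-1; have sP' : size P = D.+1 by rewrite sP prednK.
have sQ : (size Q <= D.+1)%N.
  have [->|Q0] := eqVneq Q 0; first by rewrite size_poly0.
  by have := restr_size sF IQ.2; rewrite mulrC size_mulX // -sP sP'.
(* [q] counts the expansions still to be made, [s] the factors already collected in [h]. *)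
have key q s (g h : {poly C}) E : (D <= E)%N -> (size g <= q * D + E)%N -> restrs k s h ->
    (E <= (q + s).+1)%N -> restr F ((q + s) * k) (h * g).
  elim: q s g h => [|q IHq] s g h DE sg hs Es.
    by rewrite add0n; apply: restrs_poly => //; exact: leq_trans sg Es.
  have [|a [b [sa sb ->]]] := @bezout_gen _ P Q D (q.+1 * D + E) g co sP' _ sg.
    by apply: leq_trans (leq_add (leqnn D) sQ) _; rewrite mulSn; lia.
  have -> : h * (a * P + b * Q) = (h * P) * a + (h * Q) * b by ring.
  apply: restr_add.
    rewrite addSnnS; apply: (IHq _ _ _ DE); [|exact: restrs_mul|by rewrite addnS -addSn].
    by apply: leq_trans sa _; rewrite mulSn; lia.
  rewrite addSnnS; apply: (IHq _ _ _ DE); [|exact: restrs_mul|by rewrite addnS -addSn].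
  by apply: leq_trans sb _; lia.
exists ((k * d) * k)%N; split.
  by rewrite -mulnA muln_gt0 kd.
move=> g sg; rewrite -[g]mul1r -[(k * d)%N]addn0.
have one : restrs k 0 1.
  by move=> j; rewrite leqn0 => /eqP->; rewrite mulr1 mul0n; exact: restr1.
(* With [k * d = D + 1] expansions both bounds are tight: [(D + 1) * D + D + 2 = (D + 1) ^ 2 + 1] is
   the size allowed for [g], and [D + 2] is the size absorbed by [D + 1] factors. *)
apply: (key (k * d)%N 0%N g 1 D.+2) => //; [by rewrite leqW|  |by rewrite addn0 /D prednK].
apply: leq_trans sg _; rewrite /D -mulnA; move: kd; case: (k * d)%N => // m _ /=.
by rewrite mulnS mulSn; lia.
Qed.

End Surjectivity.

(** * Completeness of the projective line *)

Section Tube.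
Context {R : realType}.
Local Notation C := R[i].
Local Notation P1 := (@proj_space R 1).
Variables (B : space R) (gB : good B).
Local Notation BP := (prod_space B P1).

Lemma pfam_revp b0 (P : B -> {poly C}) D : pfam b0 P -> pfam b0 (fun b => revp D (P b)).
Proof.
move=> [_ rP]; split=> [|i]; first by exists D.+1 => b; exact: size_revp.
have [iD|iD] := leqP i D.
  apply: (reg_ext gB) (rP (D - i)%N) => b; by rewrite revp_coef.
apply: (reg_ext gB) (good_cst gB b0 0) => b.
by rewrite nth_default // (leq_trans (size_revp _ _)).
Qed.

(** Completeness of the projective line, for one point of the base.  The
    complement of [W] is cut out by two families [G], [Q] of polynomials without
    common zeros over [b0]; a Sylvester-type matrix that is the identity at [b0]
    shows the same nearby. *)
Lemma tube b0 (W : set BP) : (forall x : P1, near_pt ((b0, x) : BP) W) ->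
  near_pt b0 [set b | forall x, W (b, x)].
Proof.
move=> nW.
have [U0 [P0 [nU0 fP0 P00 W0]]] := near_prod_chart gB (nW (chart false 0)).
have [[D sP0] _] := fP0.
(* [G b] at [z] tests [W] at the point with coordinate [z^-1] in the chart at infinity; the factor
   ['X] discards [z = 0], which that chart does not contain. *)
pose G b := revp D (P0 b) * 'X.
have fG : pfam b0 G by apply: pfam_mul => //; [exact: pfam_revp|exact: pfam_cst].
have sG b : (size (G b) <= D.+2)%N.
  rewrite /G; apply: leq_trans (size_polyMleq _ _) _.
  by rewrite size_polyX addn2 /= ltnS size_revp.
have GD b : (G b)`_D.+1 = (P0 b).[0] by rewrite /G coefMX /= revp_coef // subnn horner_coef0.
have sG0 : size (G b0) = D.+2.
  apply/eqP; rewrite eqn_leq sG ltnNge; apply: contra P00 => h.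
  by rewrite -GD nth_default.
have G00 : G b0 != 0 by rewrite -size_poly_eq0 sG0.
(* Polynomials over [b0] that extend to a family whose nonvanishing locus lies in [W]. They form a
   vector space without common zeros, so one of them can be chosen coprime to [G b0]. *)
pose V (h : {poly C}) := exists U (Q : B -> {poly C}), [/\ near_pt b0 U, pfam b0 Q, Q b0 = h &
  forall b z, U b -> (Q b).[z] != 0 -> W (b, chart true z)].
have [rs rsE] : exists rs : seq C, G b0 = lead_coef (G b0) *: \prod_(z <- rs) ('X - z%:P).
  by have [rs e] := closed_field_poly_normal (G b0); exists rs.
have rsP z : root (G b0) z = (z \in rs).
  by rewrite rsE rootZ ?lead_coef_eq0 // root_prod_XsubC.
have [|||h [UQ [Q [nUQ fQ Qh QW]]] h0] := @avoid_roots _ V rs.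
- exists setT, (fun=> 0); split=> //; [exact: nearT|exact: pfam_cst|].
  by move=> b z _; rewrite horner0 eqxx.
- move=> h k c [U [Q [nU fQ Qh QW]]] [U' [Q' [nU' fQ' Qh' QW']]].
  exists (U `&` U'), (fun b => Q b + c *: Q' b); split.
  + exact: nearI.
  + apply: pfam_add => //; rewrite (_ : (fun _ => _) = fun b => c%:P * Q' b).
      by apply: pfam_mul => //; exact: pfam_cst.
    by apply/funext => b; rewrite mul_polyC.
  + by rewrite Qh Qh'.
  + move=> b z [Ub U'b]; rewrite hornerD hornerZ => n0.
    have [Qz|Qz] := eqVneq (Q b).[z] 0; last exact: QW.
    apply: QW' => //; apply: contraNneq n0 => ->.
    by rewrite Qz mulr0 addr0.
- move=> z _; have [U [P [nU fP Pz PW]]] := near_prod_chart gB (nW (chart true z)).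
  by exists (P b0) => //; exists U, P.
have co : coprimep (G b0) (Q b0).
  by apply: Pdiv.ClosedField.root_coprimep => z; rewrite rsP Qh; exact: h0.
have [[kQ sQ] _] := fQ.
pose T := (D.+1 + kQ)%N.
have /choice[ab abP] : forall t : 'I_T, exists ab : {poly C} * {poly C},
    [/\ (size ab.1 <= T - D.+1)%N, (size ab.2 <= D.+1)%N & 'X^t = ab.1 * G b0 + ab.2 * Q b0].
  move=> t; have [||a [b [sa sb e]]] := @bezout_gen _ (G b0) (Q b0) D.+1 T 'X^t co sG0.
  - by rewrite /T leqW // leq_add2l.
  - by rewrite size_polyXn.
  - by exists (a, b).
(* Over [b0] these combinations of [G] and [Q] are the powers of the coordinate, so the matrix of
   their coefficients stays invertible near [b0]. *)
pose S t b := (ab t).1 * G b + (ab t).2 * Q b.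
have fS t : pfam b0 (S t).
  by apply: pfam_add => //; apply: pfam_mul => //; exact: pfam_cst.
have sS t b : (size (S t b) <= T)%N.
  have [sa sb _] := abP t.
  apply: leq_trans (size_polyD _ _) _; rewrite geq_max; apply/andP; split.
    apply: leq_trans (size_polyMleq _ _) _; rewrite -subn1 leq_subLR.
    by apply: leq_trans (leq_add sa (sG b)) _; rewrite /T; lia.
  apply: leq_trans (size_polyMleq _ _) _; rewrite -subn1 leq_subLR.
  by apply: leq_trans (leq_add sb (sQ b)) _; rewrite /T; lia.
pose E b : 'M[C]_T := \matrix_(t, j) (S t b)`_j.
have E0 : E b0 = 1%:M.
  by apply/matrixP => t j; rewrite !mxE /S; have [_ _ <-] := abP t; rewrite coefXn eq_sym.
have rE : reg b0 (fun b => \det (E b)).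
  apply: (reg_det gB) => t j; apply: (@reg_ext _ _ gB b0 _ _ _ ((fS t).2 j)) => b.
  by rewrite mxE.
have n1 : near_pt b0 [set b | \det (E b) != 0].
  by apply: (good_nz gB rE); rewrite E0 det1 oner_neq0.
have n2 : near_pt b0 [set b | (P0 b).[0] != 0] by exact: (good_nz gB (pfam_horner gB 0 fP0)).
apply: near_sub (nearI gB n1 (nearI gB n2 (nearI gB nU0 nUQ))) _ => b /= [dE [P0b [U0b UQb]]] x.
have [->|[z ->]] := chart_ex x; first exact: W0.
apply: contrapT => nWz.
have Qz : (Q b).[z] = 0.
  by apply/eqP; apply: contrapT => /negP /(QW b z UQb).
have Gz : (G b).[z] = 0.
  rewrite /G hornerM hornerX; have [->|z0] := eqVneq z 0; first by rewrite mulr0.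
  apply/eqP; apply: contrapT => /negP; rewrite mulf_eq0 (negbTE z0) orbF.
  rewrite revpE ?(leq_trans (sP0 b)) // mulf_eq0 expf_eq0 (negbTE z0) andbF /= => h1.
  by apply: nWz; have := W0 b _ U0b h1; rewrite chart_inv ?invr_neq0 // invrK.
(* At a common zero [z] of [G b] and [Q b] the vector of powers of [z] is in the kernel; its first
   entry is [1]. *)
pose v : 'cV[C]_T := \col_j z ^+ j.
have Ev : E b *m v = 0.
  apply/colP => t; rewrite !mxE.
  transitivity (S t b).[z]; last by rewrite /S hornerD [X in X + _]hornerM [X in _ + X]hornerM Gz Qz !mulr0 addr0.
  by rewrite (horner_coef_wide _ (sS t b)); apply: eq_bigr => j _; rewrite !mxE.
have uE : E b \in unitmx by rewrite unitmxE unitfE.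
have v0 : v = 0 by rewrite -[v](mulKmx uE) Ev mulmx0.
have T0 : (0 < T)%N by [].
by have /colP/(_ (Ordinal T0)) := v0; rewrite !mxE expr0 => /eqP; rewrite oner_eq0.
Qed.

End Tube.

(** * Marked lines in a family as columns of a matrix *)

Section LocalCoordinates.
Context {R : realType}.
Local Notation C := R[i].
Implicit Types X : space R.

(** An affine chart expressed by functions on [X] itself, extended by zero outside [U], so that no
    subspaces appear later. *)
Lemma affine_coords X (x0 : X) : is_variety X ->
  exists (U : set X) r (xi : X -> 'rV[C]_r), [/\ zopen U /\ U x0,
    forall y j, U y -> reg y (fun y => xi y 0 j),
    forall y y', U y -> U y' -> xi y = xi y' -> y = y'
  & forall y G, U y -> reg y G -> exists p q, [/\ polyfun (@entry R 1 r) p,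
      polyfun (@entry R 1 r) q, q (xi y) != 0
      & near_pt y [set y' | G y' = p (xi y') / q (xi y')]]].
Proof.
move=> vX; have gX := variety_good vX; have [_ _ _ [k [U [oU covU affU]]] _] := vX.
have [i Ux] := covU x0; have [r [S [cS [g [mg [g' [mg' gK gK']]]]]]] := affU i.
have gU := sub_good (U i) gX; have gA := aff_good (R := R) 1 r.
pose xi (y : X) : 'rV[C]_r := if pselect (U i y) is left h then sval (g (exist _ y h)) else 0.
have xiE (y : sub_space (U i)) : xi (sval y) = sval (g y).
  rewrite /xi; case: pselect => [h|nh]; last by case: nh; exact: svalP.
  by congr (sval (g _)); exact: sig_eq.
exists (U i), r, xi; split=> //.
- move=> y j Uy; apply/(open_sub_reg (exist _ y Uy : sub_space (U i)) _ gX (oU i)).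
  have mh := is_morph_comp mg (sval_morph S gA).
  apply: (@reg_ext _ _ gU _ _ _ _ (is_morph_eval (exist _ y Uy : sub_space (U i)) 0 j mh)) => z.
  by rewrite xiE.
- move=> y y' Uy Uy'.
  rewrite -[y]/(sval (exist _ y Uy : sub_space (U i))) -[y']/(sval (exist _ y' Uy' : sub_space (U i))).
  by rewrite !xiE => /sig_eq /(can_inj gK) [].
move=> y G Uy rG; pose z : sub_space (U i) := exist _ y Uy.
have rz : reg z (fun w => G (sval w)) by apply/(open_sub_reg z G gX (oU i)).
have : reg (g z) (fun w => G (sval (g' w))).
  by apply: (mg'.2 (g z) (fun w => G (sval w))); rewrite gK.
move=> [G1 [p [q [Pp Pq q0 GE]]] nG]; exists p, q.
have -> : xi y = sval (g z) by rewrite -xiE.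
split=> //; apply: (open_sub_near (x := z) gX (oU i)).
have n1 : near_pt (g z) [set v : sub_space S | G (sval (g' v)) = G1 (sval v)].
  have n2 := near_subP nG; apply: near_sub n2 _ => -[v Sv] /= h; exact: h.
have n2 : near_pt (g z) [set v : sub_space S | q (sval v) != 0].
  apply: (near_subP (x := g z) (P := [set v : @aff_space R 1 r | q v != 0])).
  exists [set v : @aff_space R 1 r | q v != 0]; split=> //.
  by move=> v qv; exists q.
have n3 := (is_morph_at z mg).1 _ (nearI (sub_good S gA) n1 n2).
apply: near_sub n3 _ => w /= [e qw].
by rewrite xiE -GE // -e gK.
Qed.

(** Hadamard's division of a difference of values by the differences of the coordinates, by
    induction on the polynomial. *)
Lemma poly_diff X (y : X) r (xi xi' : X -> 'rV[C]_r) p : good X ->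
  (forall j, reg y (fun y => xi y 0 j)) -> (forall j, reg y (fun y => xi' y 0 j)) ->
  polyfun (@entry R 1 r) p -> exists P : 'I_r -> X -> C, (forall j, reg y (P j)) /\
    forall y', p (xi y') - p (xi' y') = \sum_j (xi y' 0 j - xi' y' 0 j) * P j y'.
Proof.
move=> gX rx rx' Pp.
have rp q (z : X -> 'rV[C]_r) : (forall j, reg y (fun y => z y 0 j)) ->
    polyfun (@entry R 1 r) q -> reg y (fun y => q (z y)).
  move=> rz Pq; apply: (polyfun_reg gX Pq) => -[i j].
  apply: (@reg_ext _ _ gX y _ _ _ (rz j)) => y'.
  by rewrite /entry /= (ord1 i).
elim: Pp => [a|i|p1 q1 Pp1 [P [rP PE]] Pq1 [Q [rQ QE]]|p1 q1 Pp1 [P [rP PE]] Pq1 [Q [rQ QE]]].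
- exists (fun _ _ => 0); split=> [j|y']; first exact: good_cst.
  by rewrite subrr big1 // => j _; rewrite mulr0.
- exists (fun j _ => (j == i.2)%:R); split=> [j|y']; first exact: good_cst.
  rewrite (bigD1 i.2) //= eqxx mulr1 big1 ?addr0; first by rewrite /entry (ord1 i.1).
  by move=> j /negbTE ->; rewrite mulr0.
- exists (fun j y => P j y + Q j y); split=> [j|y']; first exact: good_add.
  rewrite opprD addrACA PE QE -big_split /=.
  by apply: eq_bigr => j _; rewrite mulrDr.
exists (fun j y => P j y * q1 (xi y) + p1 (xi' y) * Q j y); split=> [j|y'].
  by apply: (good_add gX); apply: (good_mul gX) => //; exact: rp.
transitivity ((p1 (xi y') - p1 (xi' y')) * q1 (xi y') + p1 (xi' y') * (q1 (xi y') - q1 (xi' y'))).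
  by ring.
rewrite PE QE big_distrl big_distrr /= -big_split /=.
by apply: eq_bigr => j _; ring.
Qed.

End LocalCoordinates.

(** * The ideal of a section *)

Section SectionIdeal.
Context {R : realType}.
Local Notation C := R[i].
Local Notation P1 := (@proj_space R 1).
Variables (X B : space R) (vX : is_variety X) (vB : is_variety B).
Variables (pi : X -> B) (s : B -> X) (mpi : is_morph pi) (ms : is_morph s).
Hypothesis sK : forall b, pi (s b) = b.
Variable b0 : B.
Hypothesis red : has_reduced_fibre_at pi (s b0).
Variables (f0 : P1 -> fibre pi b0) (If0 : is_iso f0).
Hypothesis f0s : sval (f0 (chart false 0)) = s b0.

Let gX := variety_good vX.
Let sigma y := s (pi y).
Let sigmas b : sigma (s b) = s b. Proof. by rewrite /sigma sK. Qed.
Let msigma : is_morph sigma. Proof. exact: is_morph_comp mpi ms. Qed.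

Lemma sigma_reg b G : reg (s b) G -> reg (s b) (fun y => G (s (pi y))).
Proof. by move=> rG; apply: (msigma.2 (s b) G); rewrite sigmas. Qed.

Lemma sigma_near b V : near_pt (s b) V -> near_pt (s b) [set y | V (s (pi y))].
Proof. by move=> nV; apply: (is_morph_at (s b) msigma).1; rewrite sigmas. Qed.

(** The ideal of the section [s] is principal near [s b0]: modulo the maximal
    ideal of [b0] it is generated by a coordinate of the fibre, so Nakayama's
    lemma applies. *)
Lemma section_generator : exists u : X -> C,
 [/\ reg (s b0) u /\ (forall b, u (s b) = 0),
  near_pt b0 [set b | forall G, reg (s b) G -> exists2 G', reg (s b) G' &
     near_pt (s b) [set y | G y = G (s (pi y)) + u y * G' y]],
  near_pt (chart false 0) [set x | u (sval (f0 x)) = coord false x]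
 & near_pt (s b0) [set y | u y = 0 -> y = s (pi y)]].
Proof.
have [mf0 [f0' [mf0' fK fK']]] := If0.
have mF0 : is_morph (fun x => sval (f0 x)) by exact: is_morph_comp mf0 (sval_morph _ gX).
have [U [r [xi [[oU Us] rxi xiI xiG]]]] := affine_coords (s b0) vX.
(* The coordinates minus their values along the section; by [poly_diff] they generate the ideal of
   the section, as recorded in [gen]. *)
pose de j y := xi y 0 j - xi (sigma y) 0 j.
have rde b j : U (s b) -> reg (s b) (de j).
  move=> Ub; apply: (reg_sub gX); first exact: rxi.
  by apply: (sigma_reg (G := fun y => xi y 0 j)); exact: rxi.
have deS b j : de j (s b) = 0 by rewrite /de sigmas subrr.
have gen b G : U (s b) -> reg (s b) G -> exists P : 'I_r -> X -> C, (forall j, reg (s b) (P j)) /\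
    near_pt (s b) [set y | G y - G (sigma y) = \sum_j de j y * P j y].
  move=> Ub rG; have [p [q [Pp Pq q0 nG]]] := xiG _ _ Ub rG.
  have rx' j : reg (s b) (fun y => xi (sigma y) 0 j).
    by apply: (sigma_reg (G := fun y => xi y 0 j)); exact: rxi.
  have rx j : reg (s b) (fun y => xi y 0 j) by exact: rxi.
  have [P [rP PE]] := poly_diff gX rx rx' Pp.
  have [Q [rQ QE]] := poly_diff gX rx rx' Pq.
  have rpq h (z : X -> 'rV[C]_r) : (forall j, reg (s b) (fun y => z y 0 j)) ->
      polyfun (@entry R 1 r) h -> reg (s b) (fun y => h (z y)).
    move=> rz Ph; apply: (polyfun_reg gX Ph) => -[i j].
    apply: (@reg_ext _ _ gX (s b) _ _ _ (rz j)) => y'.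
    by rewrite /entry /= (ord1 i).
  have q0' : q (xi (sigma (s b))) != 0 by rewrite sigmas.
  have rd : reg (s b) (fun y => q (xi y) * q (xi (sigma y))).
    by apply: (good_mul gX); apply: rpq.
  exists (fun j y => (P j y * q (xi (sigma y)) - p (xi (sigma y)) * Q j y) /
     (q (xi y) * q (xi (sigma y)))); split=> [j|].
    apply: (reg_div gX) => //; last by rewrite mulf_neq0.
    by apply: (reg_sub gX); apply: (good_mul gX) => //; apply: rpq.
  have n1 := nearI gX nG (nearI gX (sigma_near nG) (good_nz gX rd (mulf_neq0 q0 q0'))).
  apply: near_sub n1 _ => y /= [e [e' d0]].
  rewrite e -/(sigma y) in e' *; rewrite e'.
  move: d0; rewrite mulf_eq0 negb_or => /andP[d0 d0'].
  transitivity (((p (xi y) - p (xi (sigma y))) * q (xi (sigma y)) -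
     p (xi (sigma y)) * (q (xi y) - q (xi (sigma y)))) / (q (xi y) * q (xi (sigma y)))).
    by field; rewrite d0 d0'.
  rewrite PE QE big_distrl big_distrr /= -sumrB big_distrl /=.
  by apply: eq_bigr => j _; rewrite /de -/(sigma y); ring.
have lift k : reg (chart false 0) k -> exists2 g, reg (s b0) g &
    near_pt (s b0) [set y | forall h : [set x | pi x = b0] y, k (f0' (exist _ y h)) = g y].
  move=> rk; have : reg (f0 (chart false 0)) (fun y => k (f0' y)).
    by apply: (mf0'.2 (f0 (chart false 0)) k); rewrite fK.
  by move=> [g rg ng]; rewrite /= f0s in rg ng; exists g.
have up V : near_pt (chart false 0) V ->
    near_pt (s b0) [set y | forall h : [set x | pi x = b0] y, V (f0' (exist _ y h))].
  move=> nV; have n1 : near_pt (f0 (chart false 0)) [set y | V (f0' y)].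
    by apply: (is_morph_at _ mf0').1; rewrite fK.
  by have := near_sub_ex n1; rewrite f0s.
have [g0 rg0 ng0] := lift _ (coord_reg false 0).
have sb : [set x | pi x = b0] (s b0) by exact: sK.
have f0'0 h : f0' (exist _ (s b0) h) = chart false 0.
  by rewrite -[RHS]fK; congr f0'; apply: sig_eq; rewrite f0s.
have g00 : g0 (s b0) = 0 by rewrite -(near_refl ng0 sb) f0'0 coordK.
(* A lift [g0] of the coordinate of the fibre over [b0], corrected so as to vanish along the whole
   section. *)
pose u y := g0 y - g0 (sigma y).
have ru : reg (s b0) u by apply: (reg_sub gX) => //; exact: sigma_reg.
have uS b : u (s b) = 0 by rewrite /u sigmas subrr.
(* On the fibre over [b0], [de j] vanishes at the marked point, hence is a multiple of the
   coordinate there; the quotient is lifted to [h]. *)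
have /choice[h hP] j : exists h, reg (s b0) h /\ near_pt (s b0)
    [set y | pi y = b0 -> de j y - u y * h y = 0].
  have rF : reg (chart false 0) (fun x => de j (sval (f0 x))).
    by apply: (mF0.2 (chart false 0) (de j)); rewrite f0s; exact: rde.
  have [p [q [q0 pqE]]] := reg_line rF.
  have p0 : root p 0.
    have := pqE 0 q0; rewrite f0s deS => /esym/eqP.
    by rewrite mulf_eq0 invr_eq0 (negbTE q0) orbF.
  have [p' pE] := factor_theorem p 0 p0; rewrite subr0 in pE.
  have [|h rh nh] := lift (fun x => p'.[coord false x] / q.[coord false x]).
    apply: (reg_div (@proj_good R 1)); rewrite ?coordK //.
    - by apply: (reg_horner (@proj_good R 1)); exact: coord_reg.
    - by apply: (reg_horner (@proj_good R 1)); exact: coord_reg.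
  exists h; split=> //.
  have nq : near_pt (chart false 0) [set x | q.[coord false x] != 0].
    apply: (good_nz (@proj_good R 1)); rewrite ?coordK //.
    by apply: (reg_horner (@proj_good R 1)); exact: coord_reg.
  have n1 := nearI gX nh (nearI gX ng0 (up _ (nearI (@proj_good R 1) nq (near_chart false 0)))).
  apply: near_sub n1 _ => y /= [hy [gy cy]] pyb.
  have := hy pyb; have := gy pyb; have := cy pyb; set x := f0' _ => -[qx ex] gx hx.
  have ey : y = sval (f0 x) by rewrite /x fK'.
  have sy : sigma y = s b0 by rewrite /sigma pyb.
  have edy : de j y = p.[coord false x] / q.[coord false x] by rewrite ey {1}ex pqE.
  rewrite /u sy g00 subr0 -gx -hx edy pE hornerM hornerX.
  by rewrite mulrAC [coord false x * _]mulrC subrr.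
have hom1 b a : reg b a -> reg (s b) (fun y => a (pi y)).
  by move=> ra; apply: (mpi.2 (s b) a); rewrite sK.
(* Reducedness of the fibre puts the difference in the ideal generated by functions vanishing at
   [b0]. Since it also vanishes along the section, its coefficients may be replaced by multiples of
   the [de l], with factors [A] that are zero at [s b0]. *)
have /choice[A AP] j : exists A : 'I_r -> X -> C, [/\ forall l, reg (s b0) (A l),
    forall l, A l (s b0) = 0 &
    near_pt (s b0) [set y | de j y - u y * h j y = \sum_l de l y * A l y]].
  have [rh nh] := hP j; have [||k [a [g [ra rg nag]]]] := red (f := fun y => de j y - u y * h j y).
  - apply: (reg_sub gX); first exact: rde.
    exact: (good_mul gX).
  - by apply: near_sub nh _ => y /= + pyb; apply; rewrite pyb sK.
  rewrite sK in ra.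
  have /choice[P PP] i := gen b0 (g i) Us (rg i).
  exists (fun l y => \sum_i a i (pi y) * P i l y); split=> [l|l|].
  - apply: (reg_sum gX) => i _; apply: (good_mul gX); last exact: (PP i).1.
    by apply: hom1; case: (ra i).
  - by rewrite big1 // => i _; rewrite sK (ra i).2 mul0r.
  have n1 : near_pt (s b0) [set y | forall i, g i y - g i (sigma y) = \sum_l de l y * P i l y].
    by apply: (near_all gX) => i; exact: (PP i).2.
  apply: near_sub (nearI gX n1 (nearI gX nag (sigma_near nag))) _ => y /= [gy [e e']].
  have {}e' : \sum_i a i (pi y) * g i (sigma y) = 0.
    by move: e'; rewrite deS uS mul0r subr0 sK.
  rewrite e; transitivity (\sum_i a i (pi y) * g i y - \sum_i a i (pi y) * g i (sigma y)).
    by rewrite e' subr0.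
  rewrite -sumrB.
  under [RHS]eq_bigr do rewrite big_distrr /=.
  rewrite exchange_big /=; apply: eq_bigr => i _.
  by rewrite -mulrBr gy big_distrr /=; apply: eq_bigr => l _; rewrite mulrCA.
(* Nakayama's lemma made explicit: [M] times the vector of the [de j] is [u] times the vector of the
   [h j], and [M], the identity at [s b0], is inverted by its adjugate. *)
pose M y : 'M[C]_r := \matrix_(j, l) ((j == l)%:R - A j l y).
have M1 : M (s b0) = 1%:M.
  by apply/matrixP => j l; rewrite !mxE; have [_ -> _] := AP j; rewrite subr0.
have rM j l : reg (s b0) (fun y => M y j l).
  apply: (@reg_ext _ _ gX (s b0) (fun y => (j == l)%:R - A j l y)) => [y|].
    by rewrite mxE.
  by apply: (reg_sub gX); [exact: good_cst|case: (AP j)].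
have rdet : reg (s b0) (fun y => \det (M y)) by exact: reg_det.
have det0 : \det (M (s b0)) != 0 by rewrite M1 det1 oner_neq0.
pose eta j y := (\sum_l (\adj (M y)) j l * h l y) / \det (M y).
have reta j : reg (s b0) (eta j).
  apply: (reg_div gX) => //; apply: (reg_sum gX) => l _; apply: (good_mul gX).
    exact: (reg_adj gX).
  by case: (hP l).
have neta : near_pt (s b0) [set y | forall j, de j y = u y * eta j y].
  have n1 : near_pt (s b0) [set y | forall j, de j y - u y * h j y = \sum_l de l y * A j l y].
    by apply: (near_all gX) => j; case: (AP j).
  apply: near_sub (nearI gX n1 (good_nz gX rdet det0)) _ => y /= [e d0] j.
  pose dv : 'cV[C]_r := \col_l de l y; pose hv : 'cV[C]_r := \col_l h l y.
  have Md : M y *m dv = u y *: hv.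
    apply/colP => l; rewrite !mxE; transitivity (de l y - \sum_k de k y * A l k y).
      transitivity (\sum_k ((l == k)%:R * de k y - de k y * A l k y)).
        by apply: eq_bigr => k _; rewrite !mxE mulrBl [A _ _ _ * _]mulrC.
      rewrite sumrB; congr (_ - _); rewrite (bigD1 l) //= eqxx mul1r big1 ?addr0 //.
      by move=> k kl; rewrite eq_sym (negbTE kl) mul0r.
    by rewrite -e opprB addrC subrK.
  have : \det (M y) *: dv = u y *: (\adj (M y) *m hv).
    by rewrite -mul_scalar_mx -mul_adj_mx -mulmxA Md scalemxAr.
  move=> /colP/(_ j); rewrite !mxE => e1.
  rewrite /eta -[LHS](mulKf d0) e1 mulrCA; congr (_ * _).
  by rewrite mulrC; congr (_ / _); apply: eq_bigr => l _; rewrite !mxE.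
have mid (V : set X) : near_pt (s b0) V -> near_pt b0 [set b | V (s b)].
  exact: (is_morph_at b0 ms).1.
exists u; split=> //.
- have n1 : near_pt (s b0) [set y | forall j, reg y (eta j)].
    by apply: (near_all gX) => j; exact: good_near.
  apply: near_sub (mid _ (nearI gX n1 (nearI gX (near_near neta) (near_open oU Us)))) _.
  move=> b /= [rb [nb Ub]] G rG; have [P [rP nP]] := gen b G Ub rG.
  exists (fun y => \sum_j eta j y * P j y).
    by apply: (reg_sum gX) => j _; exact: (good_mul gX).
  apply: near_sub (nearI gX nb nP) _ => y /= [e1 e2].
  rewrite -[LHS](subrK (G (sigma y))) e2 addrC; congr (_ + _).
  by rewrite big_distrr /=; apply: eq_bigr => j _; rewrite e1 -mulrA.
- have n2 : near_pt (chart false 0) [set x | forall h : [set x | pi x = b0] (sval (f0 x)),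
      coord false (f0' (exist _ (sval (f0 x)) h)) = g0 (sval (f0 x))].
    apply: ((is_morph_at (chart false 0) mF0).1 [set y | forall h : [set x | pi x = b0] y,
      coord false (f0' (exist _ y h)) = g0 y]).
    by rewrite f0s.
  apply: near_sub n2 _ => x /= hx; rewrite /u -(hx (svalP (f0 x))).
  rewrite (_ : exist _ _ _ = f0 x) ?fK; last exact: sig_eq.
  by rewrite /sigma (svalP (f0 x)) g00 subr0.
- have n1 := nearI gX neta (nearI gX (near_open oU Us) (sigma_near (near_open oU Us))).
  apply: near_sub n1 _ => y /= [e [Uy Us']] u0.
  apply: xiI => //; apply/rowP => j; have := e j.
  by rewrite u0 mul0r /de => /eqP; rewrite subr_eq0 => /eqP.
Qed.

End SectionIdeal.

Section FibreFacts.
Context {R : realType}.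
Local Notation C := R[i].
Local Notation P1 := (@proj_space R 1).
Variables (X B : space R) (gX : good X) (pi : X -> B) (b : B) (f : P1 -> fibre pi b).
Hypothesis If : is_iso f.

Lemma fibre_morph : is_morph (fun x => sval (f x)).
Proof. by case: If => mf _; exact: is_morph_comp mf (sval_morph _ gX). Qed.

Lemma fibre_inj x x' : sval (f x) = sval (f x') -> x = x'.
Proof. by case: If => _ [g [_ gK _]] /(@sig_eq _ _ _ _)/(can_inj gK). Qed.

Lemma fibre_surj y : pi y = b -> exists x, sval (f x) = y.
Proof.
by case: If => _ [g [_ _ gK]] yb; exists (g (exist _ y yb)); rewrite gK.
Qed.

Lemma fibre_lift x k : reg x k -> exists2 g, reg (sval (f x)) g &
  near_pt x [set x' | g (sval (f x')) = k x'].
Proof.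
case: If => mf [f' [mf' fK fK']] rk.
have : reg (f x) (fun y => k (f' y)) by apply: (mf'.2 (f x) k); rewrite fK.
move=> [g rg ng]; exists g => //.
have n1 := (is_morph_at x fibre_morph).1 _ ng.
apply: near_sub n1 _ => x' /= /(_ (svalP (f x'))) <-.
by rewrite (_ : exist _ _ _ = f x') ?fK //; exact: sig_eq.
Qed.

Lemma fibre_line c z0 (g : X -> C) : reg (sval (f (chart c z0))) g ->
  exists p q : {poly C}, q.[z0] != 0 /\
    forall z, q.[z] != 0 -> g (sval (f (chart c z))) = p.[z] / q.[z].
Proof. by move=> rg; exact: (reg_line (fibre_morph.2 _ g rg)). Qed.

Lemma fibre_near_line c z0 (V : set X) : near_pt (sval (f (chart c z0))) V ->
  exists2 q : {poly C}, q.[z0] != 0 & forall z, q.[z] != 0 -> V (sval (f (chart c z))).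
Proof.
by move=> nV; have := (is_morph_at _ fibre_morph).1 _ nV; exact: near_line.
Qed.

End FibreFacts.

(** * Forms with prescribed jets along a section *)

Section LocalForms.
Context {R : realType}.
Local Notation C := R[i].
Local Notation P1 := (@proj_space R 1).
Variables (X M : space R) (vX : is_variety X) (vM : is_variety M).
Variables (pi : X -> M) (s : M -> X) (mpi : is_morph pi) (ms : is_morph s).
Hypothesis sK : forall b, pi (s b) = b.
Hypothesis red : forall x, has_reduced_fibre_at pi x.
Variable fb : forall m, P1 -> fibre pi m.
Hypothesis Ifb : forall m, is_iso (fb m).
Hypothesis fbs : forall m, sval (fb m (chart false 0)) = s m.
Variables (N : nat) (O : set M) (Y : X -> @proj_space R N).
Hypothesis oO : zopen O.
Hypothesis mY : forall y, O (pi y) -> morph_at Y y.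
Hypothesis imm : forall y g, O (pi y) -> reg y g -> exists f, reg (Y y) f /\
  near_pt y [set y' | pi y' = pi y -> g y' = f (Y y')].
Variables (d : M -> nat) (F : M -> 'I_N.+1 -> {poly C}).
Hypothesis dF : forall m, O m -> poly_map (fun x => Y (sval (fb m x))) (d m) (F m).

Let gX := variety_good vX.
Let gM := variety_good vM.

Lemma fibre_imm m : O m -> forall (x : P1) f, reg x f -> exists f',
  reg (Y (sval (fb m x))) f' /\ near_pt x [set y | f y = f' (Y (sval (fb m y)))].
Proof.
move=> Om x f rf; have [g rg ng] := fibre_lift gX (Ifb m) rf.
have px y : pi (sval (fb m y)) = m by exact: (svalP (fb m y)).
have [|f' [rf' nf']] := imm _ rg; first by rewrite px.
exists f'; split=> //.
have n1 := (is_morph_at x (fibre_morph gX (Ifb m))).1 _ nf'.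
apply: near_sub (nearI (@proj_good R 1) n1 ng) _ => y /= [h <-].
by apply: h; rewrite !px.
Qed.

Section AtPoint.
Variable m0 : M.
Hypothesis Om0 : O m0.
Variable u : X -> C.
Hypothesis ru : reg (s m0) u.
Hypothesis us : forall b, u (s b) = 0.
Hypothesis ugen : near_pt m0 [set b | forall G, reg (s b) G -> exists2 G', reg (s b) G' &
     near_pt (s b) [set y | G y = G (s (pi y)) + u y * G' y]].
Hypothesis uw : near_pt (chart false 0) [set x | u (sval (fb m0 x)) = coord false x].

(** Taylor expansion along the section with coefficients on the base: the value on the section is
    subtracted and the rest divided by [u], [E] times. *)
Lemma jet_expand E G : reg (s m0) G -> exists (c : nat -> M -> C) H,
  [/\ forall i, reg m0 (c i), reg (s m0) H &
   near_pt (s m0) [set y | G y = \sum_(i < E) c i (pi y) * u y ^+ i + u y ^+ E * H y]].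
Proof.
elim: E G => [|E IHE] G rG.
  exists (fun _ _ => 0), G; split=> // [i|]; first exact: good_cst.
  by apply: (nearT gX) => y; rewrite /= big_ord0 add0r expr0 mul1r.
have [G' rG' nG'] := near_refl ugen G rG.
have [c [H [rc rH nH]]] := IHE _ rG'.
exists (fun i b => if i is j.+1 then c j b else G (s b)), H; split=> // [[|i]|].
- exact: (ms.2 m0 G rG).
- exact: rc.
apply: near_sub (nearI gX nG' nH) _ => y /= [-> ->].
rewrite big_ord_recl /= expr0 mulr1 -addrA; congr (_ + _).
rewrite mulrDr exprS mulrA; congr (_ + _); rewrite big_distrr /=.
by apply: eq_bigr => i _; rewrite /= exprS mulrCA.
Qed.

Let d0 := d m0.
Let F0 := F m0.
Let K0 := fun i => revp d0 (F0 i).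

Lemma mono_scale (A : comNzRingType) k (I : {ffun 'I_k -> 'I_N.+1}) (a : A) v :
  mono I (fun i => a * v i) = a ^+ k * mono I v.
Proof. by rewrite /mono big_split /= prodr_const card_ord. Qed.

Lemma evalr_revp m z : O m -> z != 0 ->
  (fun i => (revp (d m) (F m i)).[z]) = (fun i => z ^+ d m * (F m i).[z^-1]).
Proof.
by move=> Om z0; have [sF _ _ _ _] := dF Om; apply/funext => i; rewrite revpE.
Qed.

(* the restriction to a fibre of a form, dehomogenised at [a], near infinity *)
Lemma form_fibre m a k (al : {ffun 'I_k -> 'I_N.+1} -> C) z : O m -> z != 0 ->
  (revp (d m) (F m a)).[z] != 0 ->
  \sum_I al I * mono I (fun j => cratio j a (Y (sval (fb m (chart false z))))) =
  (revp (k * d m) (\sum_I al I *: mono I (F m))).[z] / (revp (d m) (F m a)).[z] ^+ k.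
Proof.
move=> Om z0 Ka; have [sF F0' _ _ Tf] := dF Om; rewrite Tf.
have K0' : evalr (fun i => revp (d m) (F m i)) z != 0.
  by apply: (@row_entry_neq0 _ _ _ a); rewrite mxE.
have -> : (fun j => cratio j a (toP (evalr (fun i => revp (d m) (F m i)) z))) =
   (fun j => (revp (d m) (F m a)).[z]^-1 * (revp (d m) (F m j)).[z]).
  by apply/funext => j; rewrite cratioE // !mxE mulrC.
under eq_bigr do rewrite mono_scale mulrCA.
rewrite -big_distrr /= mulrC exprVn; congr (_ / _).
have sP : (size (\sum_I al I *: mono I (F m))%R <= (k * d m).+1)%N.
  apply: leq_trans (size_sum _ _ _) _; apply/bigmax_leqP => I _.
  by apply: leq_trans (size_scale_leq _ _) _; exact: size_mono.
rewrite revpE // horner_sum big_distrr /=; apply: eq_bigr => I _.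
rewrite evalr_revp // mono_scale -exprM [(d m * k)%N]mulnC hornerZ horner_mono.
by rewrite mulrCA.
Qed.

Lemma near_m0 (V : set X) : near_pt (s m0) V -> near_pt m0 [set b | V (s b)].
Proof. exact: (is_morph_at m0 ms).1. Qed.

(** Over [m0], surjectivity of restriction provides forms with any prescribed jet along the section.
    With the same constant coefficients [NN] over a nearby [m], their jets form a matrix [D m] with
    [D m0 = 1]. Multiplying by the adjugate of [D] restores the jets [u ^+ t] up to the factor
    [De = \det D]. *)
Lemma local_forms : exists k (a : 'I_N.+1) (al : 'I_(k * d0).+1 -> {ffun 'I_k -> 'I_N.+1} -> M -> C)
    (De : M -> C) (H : 'I_(k * d0).+1 -> X -> C),
  [/\ (0 < k * d0)%N, hc (Y (s m0)) 0 a != 0,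
      (forall t I, reg m0 (al t I)) /\ (forall t, reg (s m0) (H t)), reg m0 De /\ De m0 = 1 &
      near_pt (s m0) [set y | forall t,
        \sum_I al t I (pi y) * mono I (fun j => cratio j a (Y y)) =
        De (pi y) * u y ^+ t + u y ^+ (k * d0).+1 * H t y]].
Proof.
have [k [kd surj]] := restr_surj (dF Om0) (fibre_imm Om0).
have Os : O (pi (s m0)) by rewrite sK.
have [a [Ya rY _ _]] := proj_lift gX (mY Os).
set E := (k * d0).+1.
pose G (I : {ffun 'I_k -> 'I_N.+1}) y := mono I (fun j => cratio j a (Y y)).
have rG I : reg (s m0) (G I) by apply: (reg_prod gX) => j _; exact: rY.
have /choice[c /choice[GE cP]] I := jet_expand E (rG I).
have Ka0 : (K0 a).[0] != 0.
  have [_ _ _ _ Tf] := dF Om0; have := Ya; rewrite -fbs Tf hc_toP_eq0 ?mxE //.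
  apply: evalr_neq0; have [_ _ [i Fi] _ _] := dF Om0.
  by exists i; rewrite revp0.
(* Dehomogenising at [a] divides by [K0 a ^+ k], so the restriction should be ['X^t * K0 a ^+ k]; it
   is truncated below order [E], as the degree of such a restriction is at most [k * d0]. *)
pose rho (t : 'I_E) : {poly C} := take_poly E ('X^t * K0 a ^+ k).
have /choice[NN NP] t : exists c : {ffun 'I_k -> 'I_N.+1} -> C,
    revp (k * d0) (rho t) = \sum_I c I *: mono I F0.
  by apply: restrP; apply: surj; exact: size_revp.
pose D b : 'M[C]_E := \matrix_(t, i) \sum_I NN t I * c I i b.
have rD t i : reg m0 (fun b => D b t i).
  apply: (@reg_ext _ _ gM m0 (fun b => \sum_I NN t I * c I i b)) => [b|].
    by rewrite mxE.
  apply: (reg_sum gM) => I _; apply: (good_mul gM); first exact: good_cst.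
  by case: (cP I).
have D1 : D m0 = 1%:M.
  apply/matrixP => t i; apply/eqP; rewrite -subr_eq0; apply/eqP.
  pose R0 y := \sum_I NN t I * GE I y.
  have rR : reg (sval (fb m0 (chart false 0))) R0.
    rewrite fbs; apply: (reg_sum gX) => I _; apply: (good_mul gX); first exact: good_cst.
    by case: (cP I).
  have [rn [rd [rd0 RE]]] := fibre_line gX (Ifb m0) rR.
  have n1 : near_pt (s m0) [set y | forall I, G I y = \sum_(i < E) c I i (pi y) * u y ^+ i + u y ^+ E * GE I y].
    by apply: (near_all gX) => I; case: (cP I).
  rewrite -fbs in n1; have [g1 g10 g1E] := fibre_near_line gX (Ifb m0) n1.
  have [g2 g20 g2E] := near_line uw.
  (* Row [t] of [D m0 - 1], as a polynomial of degree below [E]. It vanishes to order [E] at [0],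
     hence identically. *)
  pose p := \poly_(j < E) (D m0 t (inord j) - 1%:M t (inord j)).
  have p0 : p = 0.
    apply: (@jet_zero _ p (K0 a ^+ k * rd)
      (drop_poly E ('X^t * K0 a ^+ k) * - rd - rn * K0 a ^+ k)
      ('X * (g1 * g2 * rd * K0 a)) E).
    - exact: size_poly.
    - by rewrite hornerM horner_exp mulf_neq0 ?expf_neq0.
    - by rewrite !mulf_neq0 ?polyX_eq0 // ?(horner_neq0 g10) ?(horner_neq0 g20)
        ?(horner_neq0 rd0) ?(horner_neq0 Ka0).
    move=> z; rewrite !(hornerM, hornerX) !mulf_eq0 !negb_or.
    move=> /andP[z0 /andP[/andP[/andP[g1z g2z] rdz] Kz]].
    have := form_fibre (NN t) Om0 z0 Kz; rewrite -NP revpK ?size_take_poly //.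
    under eq_bigr do rewrite -/(G _ _) (g1E _ g1z) mulrDr.
    rewrite big_split /= (g2E z g2z) coordK.
    have -> : pi (sval (fb m0 (chart false z))) = m0 by exact: (svalP (fb m0 _)).
    under [X in _ + X = _]eq_bigr do rewrite mulrCA.
    rewrite -mulr_sumr -/(R0 _) (RE z rdz) /= => e.
    have pz : p.[z] = \sum_I NN t I * (\sum_(i < E) c I i m0 * z ^+ i) - z ^+ t.
      rewrite horner_poly; under eq_bigr => j _ do rewrite inord_val mulrBl !mxE big_distrl /=.
      rewrite sumrB exchange_big /=; congr (_ - _).
        apply: eq_bigr => I _; rewrite big_distrr /=.
        by apply: eq_bigr => j _; rewrite mulrA.
      by rewrite (bigD1 t) //= eqxx mul1r big1 ?addr0 // => j /negbTE; rewrite eq_sym => ->; rewrite mul0r.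
    have tz : (take_poly E ('X^t * K0 a ^+ k)).[z] = z ^+ t * (K0 a).[z] ^+ k -
        (drop_poly E ('X^t * K0 a ^+ k)).[z] * z ^+ E.
      have := congr1 (fun q : {poly C} => q.[z]) (poly_take_drop E ('X^t * K0 a ^+ k)).
      rewrite hornerD !hornerM !hornerXn horner_exp => <-.
      by rewrite addrK.
    move: e; rewrite /rho tz pz !(hornerM, hornerD, hornerN, horner_exp).
    set S1 := (\sum_I _); set dp := (drop_poly _ _).[z]; move: Kz; rewrite -/F0 -/d0 -/(K0 a); set kz := (K0 a).[z] => kz0.
    have kk0 : kz ^+ k != 0 by rewrite expf_neq0.
    move=> e; have -> : S1 = (z ^+ t * kz ^+ k - dp * z ^+ E) / kz ^+ k - z ^+ E * (rn.[z] / rd.[z]).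
      by rewrite -e addrK.
    by field; rewrite rdz kk0.
  have := congr1 (fun q : {poly C} => q`_i) p0.
  by rewrite coef0 coef_poly ltn_ord inord_val.
have De1 : \det (D m0) = 1 by rewrite D1 det1.
exists k, a, (fun t I b => \sum_t' (\adj (D b)) t t' * NN t' I), (fun b => \det (D b)),
  (fun t y => \sum_t' (\adj (D (pi y))) t t' * (\sum_I NN t' I * GE I y)); split=> //.
- split=> [t I|t].
    apply: (reg_sum gM) => t' _; apply: (good_mul gM); last exact: good_cst.
    exact: (reg_adj gM).
  apply: (reg_sum gX) => t' _; apply: (good_mul gX).
    apply: (mpi.2 (s m0) (fun b => (\adj (D b)) t t')); rewrite sK.
    exact: (reg_adj gM).
  apply: (reg_sum gX) => I _; apply: (good_mul gX); first exact: good_cst.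
  by case: (cP I).
- by split=> //; exact: (reg_det gM).
have n1 : near_pt (s m0) [set y | forall I, G I y = \sum_(i < E) c I i (pi y) * u y ^+ i + u y ^+ E * GE I y].
  by apply: (near_all gX) => I; case: (cP I).
apply: near_sub n1 _ => y /= Gy t.
transitivity (\sum_t' (\adj (D (pi y))) t t' * (\sum_(i < E) D (pi y) t' i * u y ^+ i +
    u y ^+ E * (\sum_I NN t' I * GE I y))).
  under eq_bigr do rewrite -/(G _ _) big_distrl /=.
  rewrite exchange_big /=; apply: eq_bigr => t' _.
  under eq_bigr do rewrite -mulrA.
  rewrite -big_distrr /=; congr (_ * _).
  under eq_bigr do rewrite Gy mulrDr.
  rewrite big_split /=; congr (_ + _).
    under eq_bigr do rewrite big_distrr /=.
    rewrite exchange_big /=; apply: eq_bigr => i _.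
    by rewrite mxE big_distrl /=; apply: eq_bigr => I _; rewrite mulrA.
  by rewrite big_distrr /=; apply: eq_bigr => I _; rewrite mulrCA.
under [LHS]eq_bigr do rewrite mulrDr.
rewrite big_split /=; congr (_ + _); last first.
  by rewrite big_distrr /=; apply: eq_bigr => t' _; rewrite mulrCA.
under eq_bigr do rewrite big_distrr /=.
rewrite exchange_big /= (bigD1 t) //= [X in _ + X]big1 ?addr0 => [|i it].
  have := congr1 (fun A : 'M[C]_E => A t t) (mul_adj_mx (D (pi y))).
  rewrite !mxE eqxx mulr1n => <-; rewrite big_distrl /=.
  by apply: eq_bigr => t' _; rewrite mulrA.
have := congr1 (fun A : 'M[C]_E => A t i) (mul_adj_mx (D (pi y))).
rewrite !mxE eq_sym (negbTE it) mulr0n => e.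
transitivity ((\sum_t' (\adj (D (pi y))) t t' * D (pi y) t' i) * u y ^+ i).
  by rewrite big_distrl /=; apply: eq_bigr => t' _; rewrite mulrA.
by rewrite e mul0r.
Qed.

Lemma poly_map_infinity m a : O m -> hc (Y (s m)) 0 a != 0 -> (revp (d m) (F m a)).[0] != 0.
Proof.
move=> Om; have [_ _ [i Fi] _ Tf] := dF Om; rewrite -fbs Tf hc_toP_eq0 ?mxE //.
by apply: evalr_neq0; exists i; rewrite revp0.
Qed.

(** On fibres near that of [m0], [u] still generates the ideal of the marked point, so it is a
    uniformiser there and the form [t] vanishes at infinity to order exactly [t]. In the affine
    coordinate this is a drop of the degree from [k * d m]; that such a drop is possible gives the
    inequality. *)
Lemma local_degree k a (al : 'I_(k * d0).+1 -> {ffun 'I_k -> 'I_N.+1} -> M -> C) De H :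
  hc (Y (s m0)) 0 a != 0 -> (forall t, reg (s m0) (H t)) -> reg m0 De -> De m0 = 1 ->
  near_pt (s m0) [set y | forall t,
        \sum_I al t I (pi y) * mono I (fun j => cratio j a (Y y)) =
        De (pi y) * u y ^+ t + u y ^+ (k * d0).+1 * H t y] ->
  near_pt m0 [set m | forall t : 'I_(k * d0).+1, (t <= k * d m)%N /\
    size (\sum_I al t I m *: mono I (F m))%R = (k * d m - t).+1].
Proof.
move=> Ya rH rDe De0 nid; have Os : O (pi (s m0)) by rewrite sK.
have De0' : De m0 != 0 by rewrite De0 oner_neq0.
have n1 : near_pt (s m0) [set y | hc (Y y) 0 a != 0] by exact: ((mY Os).1 _ (hc_near Ya)).
have n2 : near_pt (s m0) [set y | forall t, reg y (H t)].
  by apply: (near_all gX) => t; exact: good_near.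
have n3 := nearI gX (good_near gX ru) (nearI gX (near_near nid) (nearI gX n1 n2)).
apply: near_sub (nearI gM (nearI gM ugen (near_m0 n3)) (nearI gM (near_open oO Om0)
  (good_nz gM rDe De0'))) _.
move=> m /= [[um [rum [idm [Yam rHm]]]] [Om Dem]] t.
have Ka := poly_map_infinity Om Yam.
have [sF _ _ _ _] := dF Om.
have pm z : pi (sval (fb m (chart false z))) = m by exact: (svalP (fb m _)).
rewrite -fbs in rum; have [p [q [q0 uE]]] := fibre_line gX (Ifb m) rum.
have [p1 pE] : exists p1, p = 'X * p1.
  have : root p 0.
    have := uE 0 q0; rewrite fbs us => /esym/eqP.
    by rewrite mulf_eq0 invr_eq0 (negbTE q0) orbF.
  by move=> /factor_theorem[p1 ->]; exists p1; rewrite subr0 mulrC.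
(* The coordinate of the fibre at infinity lifts to a germ that vanishes at the marked point and so
   is divisible by [u] on the fibre; hence [u] vanishes to order one only. *)
have p10 : p1.[0] != 0.
  have [G rG nG] := fibre_lift gX (Ifb m) (coord_reg false 0).
  rewrite fbs in rG; have [G' rG' nG'] := um G rG.
  rewrite -fbs in rG'; have [r [v [v0 G'E]]] := fibre_line gX (Ifb m) rG'.
  have [g1 g10 g1E] := near_line nG.
  rewrite -fbs in nG'; have [g2 g20 g2E] := fibre_near_line gX (Ifb m) nG'.
  have G0 : G (s m) = 0 by rewrite -fbs (near_refl nG) coordK.
  have e : q * v = p1 * r.
    apply: (@poly_eq_off _ ('X * (g1 * g2 * q * v))).
      by rewrite !mulf_neq0 ?polyX_eq0 // ?(horner_neq0 g10) ?(horner_neq0 g20)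
        ?(horner_neq0 q0) ?(horner_neq0 v0).
    move=> z; rewrite !(hornerM, hornerX) !mulf_eq0 !negb_or.
    move=> /andP[z0 /andP[/andP[/andP[g1z g2z] qz] vz]].
    have := g2E z g2z; rewrite /= (g1E z g1z) coordK pm G0 add0r uE // G'E //.
    rewrite pE hornerM hornerX => e; apply: (mulfI z0).
    rewrite {1}e; field; by rewrite qz vz.
  have := congr1 (fun h : {poly C} => h.[0]) e; rewrite !hornerM => e0.
  by apply: contraTneq (mulf_neq0 q0 v0) => p0; rewrite e0 p0 mul0r eqxx.
have rHt : reg (sval (fb m (chart false 0))) (H t) by rewrite fbs.
have [h1 [h2 [h20 HE]]] := fibre_line gX (Ifb m) rHt.
rewrite -fbs in idm; have [g g0 gE] := fibre_near_line gX (Ifb m) idm.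
set phi := \sum_I _; set E := (k * d0).+1.
have tE : (t <= E)%N by exact: ltnW.
pose Kam := revp (d m) (F m a).
(* The form with denominators cleared and ['X^t] removed. Since [t < E], the term of [De] alone
   contributes at [0], with a nonzero value. *)
pose rho := Kam ^+ k * ((De m)%:P * p1 ^+ t * q ^+ (E - t) * h2 + 'X^(E - t) * p1 ^+ E * h1).
have key : revp (k * d m) phi * (q ^+ E * h2) = 'X^t * rho.
  apply: (@poly_eq_off _ ('X * (g * q * h2 * Kam))).
    by rewrite !mulf_neq0 ?polyX_eq0 // ?(horner_neq0 g0) ?(horner_neq0 q0)
      ?(horner_neq0 h20) ?(horner_neq0 Ka).
  move=> z; rewrite !(hornerM, hornerX) !mulf_eq0 !negb_or.
  move=> /andP[z0 /andP[/andP[/andP[gz qz] h2z] Kz]].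
  have := gE z gz t; rewrite /= pm (form_fibre _ Om z0 Kz) -/phi uE // HE // pE => e.
  have -> : (revp (k * d m) phi).[z] = Kam.[z] ^+ k *
     (De m * (('X * p1).[z] / q.[z]) ^+ t + (('X * p1).[z] / q.[z]) ^+ E * (h1.[z] / h2.[z])).
    by rewrite -e mulrC divfK // expf_neq0.
  rewrite /rho !(hornerM, hornerX, hornerD, hornerXn, hornerC, horner_exp) !expr_div_n !exprMn.
  have -> : q.[z] ^+ E = q.[z] ^+ t * q.[z] ^+ (E - t) by rewrite -exprD subnKC.
  have -> : z ^+ E = z ^+ t * z ^+ (E - t) by rewrite -exprD subnKC.
  have qt0 : q.[z] ^+ t != 0 by rewrite expf_neq0.
  have qE0 : q.[z] ^+ (E - t) != 0 by rewrite expf_neq0.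
  move: (q.[z] ^+ t) (q.[z] ^+ (E - t)) (z ^+ t) (z ^+ (E - t)) (p1.[z] ^+ t) (p1.[z] ^+ E)
    (Kam.[z] ^+ k) qt0 qE0 => x1 x2 x3 x4 x5 x6 x7 x10 x20.
  by field; rewrite x10 x20 h2z.
have Et : (0 < E - t)%N by rewrite subn_gt0.
have rho0 : rho.[0] != 0.
  rewrite /rho !(hornerM, hornerD, hornerXn, hornerC, horner_exp) expr0n gtn_eqF //=.
  by rewrite !mul0r addr0 !mulf_neq0 ?expf_neq0.
have qh0 : (q ^+ E * h2).[0] != 0 by rewrite hornerM horner_exp mulf_neq0 ?expf_neq0.
have Xd : 'X^t %| revp (k * d m) phi.
  by rewrite -(Gauss_dvdpl _ (coprimeXn t qh0)) key dvdp_mulr.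
have [r rE] : exists r, revp (k * d m) phi = 'X^t * r.
  by exists (revp (k * d m) phi %/ 'X^t); rewrite mulrC divpK.
have sphi : (size phi <= (k * d m).+1)%N.
  apply: leq_trans (size_sum _ _ _) _; apply/bigmax_leqP => I _.
  by apply: leq_trans (size_scale_leq _ _) _; exact: size_mono.
apply: (revp_order sphi rE).
have : r * (q ^+ E * h2) = rho.
  apply: (mulfI (_ : 'X^t != 0)); first by rewrite expf_neq0 // polyX_eq0.
  by rewrite mulrA -rE key.
move=> /(congr1 (fun h : {poly C} => h.[0])); rewrite hornerM => e.
by apply: contraNneq rho0 => r0; rewrite -e r0 mul0r.
Qed.

End AtPoint.
End LocalForms.

(** * Linear automorphisms of the line *)

Section Automorphisms.
Context {R : realType}.
Local Notation C := R[i].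
Local Notation P1 := (@proj_space R 1).

Definition aut (g : 'M[C]_2) (x : P1) : P1 := toP (hc x *m g).

Lemma mul_unit_neq0 (v : 'rV[C]_2) g : g \in unitmx -> v != 0 -> v *m g != 0.
Proof.
by move=> ug; apply: contraNneq => e; rewrite -[v](mulmxK ug) e mul0mx.
Qed.

Lemma aut_toP g (v : 'rV[C]_2) : g \in unitmx -> v != 0 -> aut g (toP v) = toP (v *m g).
Proof.
move=> ug v0; have [c c0 e] := hc_toP v0.
by rewrite /aut e -scalemxAl toP_scale // mul_unit_neq0.
Qed.

Lemma autM g h x : g \in unitmx -> h \in unitmx -> aut h (aut g x) = aut (g *m h) x.
Proof.
by move=> ug uh; rewrite {2}/aut aut_toP ?mul_unit_neq0 ?hc_neq0 // -mulmxA.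
Qed.

Lemma aut1 x : aut 1%:M x = x.
Proof. by rewrite /aut mulmx1 hcK. Qed.

Lemma aut_morph g : g \in unitmx -> is_morph (aut g).
Proof.
move=> ug; have gN := sub_good [set v : @aff_space R 1 2 | v != 0 :> 'rV_2] (aff_good 1 2).
apply: (quot_morph gN (@proj_good R 1)) => v.
have -> : (fun x : nonzero_rows 1 => aut g (class_of (@sameline R 1) x)) =
  (fun v => toP (v *m g)) \o (fun x => sval x).
  by apply/funext => x; rewrite class_toP aut_toP //; exact: (svalP x).
apply: (@morph_at_comp _ _ (@aff_space R 1 2)).
  by apply: is_morph_at; apply: sval_morph; exact: aff_good.
apply: (toP_comp_morph_at (aff_good 1 2)); first by rewrite mul_unit_neq0 //; exact: (svalP v).
move=> j; apply: (reg_mulmx (aff_good 1 2)) => i k; first exact: aff_coord_reg.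
exact: (good_cst (aff_good 1 2)).
Qed.

Lemma aut_iso g : g \in unitmx -> is_iso (aut g).
Proof.
move=> ug; have ug' : invmx g \in unitmx by rewrite unitmx_inv.
apply: (is_iso_sym (g := aut (invmx g))); [exact: aut_morph|exact: aut_morph| |].
- by move=> x; rewrite autM // mulmxV // aut1.
- by move=> x; rewrite autM // mulVmx // aut1.
Qed.

Definition mat2 (r0 r1 : 'rV[C]_2) : 'M[C]_2 := \matrix_(i, j) (if i == 0 then r0 0 j else r1 0 j).

Lemma row2_mat2 x y r0 r1 : row2 x y *m mat2 r0 r1 = x *: r0 + y *: r1.
Proof. by apply/rowP => j; rewrite !mxE big_ord_recl big_ord1 !mxE. Qed.

Lemma mat2_unit (r0 r1 : 'rV[C]_2) : r0 0 0 * r1 0 1 - r0 0 1 * r1 0 0 != 0 -> mat2 r0 r1 \in unitmx.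
Proof.
set D := (X in X != 0) => D0.
pose B := mat2 (row2 (r1 0 1 / D) (- r0 0 1 / D)) (row2 (- r1 0 0 / D) (r0 0 0 / D)).
have e : mat2 r0 r1 *m B = 1%:M; last by have [] := mulmx1_unit e.
apply/matrixP => i j; rewrite !mxE big_ord_recl big_ord1 !mxE /=.
have l1 : lift ord0 ord0 = 1 :> 'I_2 by apply: val_inj.
have l0 : ord0 = 0 :> 'I_2 by apply: val_inj.
by case: (ord2_cases i) => ->; case: (ord2_cases j) => -> /=; rewrite l1 ?l0 /D; field; exact: D0.
Qed.

(** A coordinate vector of [x] is completed to a basis. *)
Lemma move_infinity (x : P1) : exists2 g, g \in unitmx & aut g (chart false 0) = x.
Proof.
pose v := hc x.
have key (w : 'rV[C]_2) : v 0 0 * w 0 1 - v 0 1 * w 0 0 != 0 ->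
    exists2 g, g \in unitmx & aut g (chart false 0) = x.
  move=> /mat2_unit ug; exists (mat2 v w) => //.
  rewrite /chart aut_toP ?(crow_neq0 false) // -[RHS]hcK; congr toP.
  by rewrite /crow row2_mat2 scale1r scale0r addr0.
have [v0|v0] := eqVneq (v 0 0) 0; last first.
  by apply: (key (row2 0 1)); rewrite !row2E mulr1 mulr0 subr0.
apply: (key (row2 1 0)); rewrite !row2E mulr1 mulr0 sub0r oppr_eq0.
apply: contraNneq (hc_neq0 x) => v1; apply/eqP.
by rewrite -/v [v]row2P v0 v1; apply/rowP => j; rewrite !mxE if_same.
Qed.

Lemma chart_true_neq (z : C) : chart true z <> chart false 0.
Proof.
move=> /(toP_eq (crow_neq0 true z) (crow_neq0 false 0))[c c0 /rowP/(_ 1)/eqP].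
by rewrite !mxE /= mulr1 eq_sym (negbTE c0).
Qed.

End Automorphisms.

(** * Constancy of the degree and regular matrices *)

Section ConstantDegree.
Context {R : realType}.
Local Notation C := R[i].
Local Notation P1 := (@proj_space R 1).
Variables (X M : space R) (vX : is_variety X) (vM : is_variety M).
Variables (pi : X -> M) (s : M -> X) (mpi : is_morph pi) (ms : is_morph s).
Hypothesis sK : forall b, pi (s b) = b.
Hypothesis red : forall x, has_reduced_fibre_at pi x.
Variable fb : forall m, P1 -> fibre pi m.
Hypothesis Ifb : forall m, is_iso (fb m).
Hypothesis fbs : forall m, sval (fb m (chart false 0)) = s m.
Variables (N : nat) (O : set M) (Y : X -> @proj_space R N).
Hypothesis oO : zopen O.
Hypothesis mY : forall y, O (pi y) -> morph_at Y y.
Hypothesis imm : forall y g, O (pi y) -> reg y g -> exists f, reg (Y y) f /\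
  near_pt y [set y' | pi y' = pi y -> g y' = f (Y y')].
Variables (d : M -> nat) (F : M -> 'I_N.+1 -> {poly C}).
Hypothesis dF : forall m, O m -> poly_map (fun x => Y (sval (fb m x))) (d m) (F m).
Variable m0 : M.
Hypothesis Om0 : O m0.

Let gX := variety_good vX.
Let gM := variety_good vM.

Section Forms.
Variables (k : nat) (al : {ffun 'I_k -> 'I_N.+1} -> M -> C).

(** The value at [y] of a form depending on the base point, up to a nonzero factor. *)
Definition form_at y := \sum_I al I (pi y) * mono I (hc (Y y) 0).
Definition form_poly m : {poly C} := \sum_I al I m *: mono I (F m).

Lemma form_at_ratio y a : hc (Y y) 0 a != 0 ->
  form_at y = hc (Y y) 0 a ^+ k *
    \sum_I al I (pi y) * mono I (fun j => cratio j a (Y y)).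
Proof.
move=> Ya; rewrite /form_at big_distrr /=; apply: eq_bigr => I _.
rewrite mulrCA -mono_scale; congr (_ * mono I _); apply/funext => j.
by rewrite /cratio mulrC divfK.
Qed.

Lemma ratio_reg y a : O (pi y) -> hc (Y y) 0 a != 0 ->
  (forall I, reg (pi y) (al I)) ->
  reg y (fun y => \sum_I al I (pi y) * mono I (fun j => cratio j a (Y y))).
Proof.
move=> Oy Ya ral; apply: (reg_sum gX) => I _; apply: (good_mul gX).
  exact: (mpi.2 y _ (ral I)).
apply: (reg_prod gX) => j _; exact: ((mY Oy).2 _ (cratio_reg _ Ya)).
Qed.

Lemma form_at_near y : O (pi y) -> (forall I, reg (pi y) (al I)) -> form_at y != 0 ->
  near_pt y [set y | form_at y != 0].
Proof.
move=> Oy ral; have [a Ya] := row_neq0 (hc_neq0 (Y y)).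
rewrite (form_at_ratio Ya) mulf_eq0 negb_or => /andP[_ h].
have n1 := good_nz gX (ratio_reg Oy Ya ral) h.
have n2 := (mY Oy).1 _ (hc_near Ya).
apply: near_sub (nearI gX n1 n2) _ => z /= [h1 h2].
by rewrite (form_at_ratio h2) mulf_neq0 // expf_neq0.
Qed.

End Forms.

Lemma form_at_chart k m z : O m -> exists2 c, c != 0 &
  forall al, @form_at k al (sval (fb m (chart true z))) = c * (form_poly al m).[z].
Proof.
move=> Om; have [_ F0 _ Tt _] := dF Om.
have [c c0 e] := hc_toP (F0 z); exists (c ^+ k) => [|al]; first by rewrite expf_neq0.
rewrite /form_at (svalP (fb m _)) Tt e horner_sum big_distrr /=.
apply: eq_bigr => I _; rewrite hornerZ horner_mono mulrCA; congr (_ * _).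
by rewrite -mono_scale; congr mono; apply/funext => j; rewrite !mxE.
Qed.

(** Near [m0] there are forms, with coefficients regular on the base, whose
    restrictions to the fibres over [m] have a zero of order exactly [k d(m0)],
    resp. [k d(m0) - 1], along the section [s] and degree [k d(m)] in total. *)
Lemma pencil : exists k (al0 al1 : {ffun 'I_k -> 'I_N.+1} -> M -> C)
    (g0 g1 u : X -> C),
  [/\ (0 < k * d m0)%N, forall I, reg m0 (al0 I) /\ reg m0 (al1 I),
    [/\ reg (s m0) g0, reg (s m0) g1, reg (s m0) u, g0 (s m0) != 0 & g1 (s m0) != 0],
    near_pt m0 [set m | [/\ (k * d m0 <= k * d m)%N,
      size (form_poly al0 m) = (k * d m - (k * d m0).-1).+1 &
      size (form_poly al1 m) = (k * d m - k * d m0).+1]] &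
    near_pt (s m0) [set y | (u y = 0 <-> y = s (pi y)) /\ exists2 c, c != 0 &
      form_at al0 y = c * (u y ^+ (k * d m0).-1 * g0 y) /\
      form_at al1 y = c * (u y ^+ (k * d m0) * g1 y)]].
Proof.
have [u [[ru us] ugen uw uz]] := section_generator vX mpi ms sK (@red (s m0)) (Ifb m0) (fbs m0).
have [k [a [al [De [H [kd Ya [ral rH] [rDe De1] nid]]]]]] :=
  local_forms vX vM mpi ms sK Ifb fbs mY imm dF Om0 ugen uw.
have ndeg := local_degree vX vM ms sK Ifb fbs oO mY dF Om0 ru us ugen Ya rH rDe De1 nid.
have l0 : ((k * d m0).-1 < (k * d m0).+1)%N by rewrite ltnS leq_pred.
have us0 := us m0.
exists k, (al (Ordinal l0)), (al ord_max),
  (fun y => De (pi y) + u y ^+ 2 * H (Ordinal l0) y), (fun y => De (pi y) + u y * H ord_max y), u.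
have rDe' : reg (s m0) (fun y => De (pi y)) by apply: (mpi.2 (s m0) De); rewrite sK.
have g0r : reg (s m0) (fun y => De (pi y) + u y ^+ 2 * H (Ordinal l0) y).
  by apply: (good_add gX) => //; apply: (good_mul gX) => //; exact: reg_exp.
have g1r : reg (s m0) (fun y => De (pi y) + u y * H ord_max y).
  by apply: (good_add gX) => //; apply: (good_mul gX).
split=> //.
- by split=> //; rewrite us0 ?expr0n mul0r addr0 sK De1 oner_neq0.
- apply: near_sub ndeg _ => m /= h; split; first by case: (h ord_max).
    by case: (h (Ordinal l0)).
  by case: (h ord_max).
have Os : O (pi (s m0)) by rewrite sK.
have n1 := (mY Os).1 _ (hc_near Ya).
apply: near_sub (nearI gX n1 (nearI gX uz nid)) _ => y /= [hy [uy idy]]; split.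
  by split=> // ->.
exists (hc (Y y) 0 a ^+ k); first by rewrite expf_neq0.
rewrite !(form_at_ratio _ hy) !idy /=; split; congr (_ * _).
  rewrite mulrDr [De _ * _]mulrC mulrA -exprD; congr (_ + u y ^+ _ * _).
  by rewrite addn2 prednK.
by rewrite mulrDr [De _ * _]mulrC mulrA -exprSr.
Qed.

(** Over [m0] the form [al1] has no zero besides the marked point. As the family over [B] is a
    product with the line, [tube] keeps this true near [b0]: the restriction of [al1] has no finite
    zeros, so its degree [k * d m - k * d m0], with [m = phi b], is zero. *)
Lemma degree_tube (B : space R) (phi : B -> M) (psi : prod_space B P1 -> X) b0 :
  good B -> is_morph phi -> is_morph psi -> phi b0 = m0 ->
  (forall b, exists2 f : P1 -> fibre pi (phi b), is_iso f & forall x, sval (f x) = psi (b, x)) ->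
  near_pt b0 [set b | O (phi b) -> d (phi b) = d m0].
Proof.
move=> gB mphi mpsi e0 fib.
have [k [al0 [al1 [g0 [g1 [u [kd ral [rg0 rg1 ru g00 g10] ndeg nid]]]]]]] := pencil.
pose Om : set X := [set y | form_at al1 y != 0 \/ y = s (pi y)].
have nOm y : pi y = m0 -> near_pt y Om.
  move=> py; have [x ex] := fibre_surj (Ifb m0) py.
  have Oy : O (pi y) by rewrite py.
  have ral1 I : reg (pi y) (al1 I) by rewrite py; case: (ral I).
  have [exx|[z exx]] := chart_ex x.
    have ys : y = s m0 by rewrite -ex exx fbs.
    rewrite ys; have n1 := good_nz gX rg1 g10.
    apply: near_sub (nearI gX nid n1) _ => w /= [[uw [c c0 [_ e1]]] g1w].
    have [uw0|uw0] := eqVneq (u w) 0; first by right; exact/uw.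
    by left; rewrite e1 !mulf_neq0 // expf_neq0.
  have h : form_at al1 y != 0.
    rewrite -ex exx; have [c c0 ->] := form_at_chart k z Om0.
    rewrite mulf_neq0 //; have [_ _] := near_refl ndeg; rewrite subnn => /eqP/size_poly1P[a a0 ->].
    by rewrite hornerC.
  by apply: near_sub (form_at_near Oy ral1 h) _ => w ?; left.
have nW x : near_pt ((b0, x) : prod_space B P1) [set q | Om (psi q)].
  apply: (is_morph_at _ mpsi).1; apply: nOm.
  by have [f _ fE] := fib b0; rewrite -fE -e0; exact: (svalP (f x)).
have n1 := tube gB nW.
have n2 : near_pt b0 [set b | (k * d m0 <= k * d (phi b))%N /\
     size (form_poly al1 (phi b)) = (k * d (phi b) - k * d m0).+1].
  apply: ((is_morph_at b0 mphi).1 [set m | (k * d m0 <= k * d m)%N /\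
     size (form_poly al1 m) = (k * d m - k * d m0).+1]); rewrite e0.
  by apply: near_sub ndeg _ => m [].
apply: near_sub (nearI gB n1 n2) _ => b /= [hOm [hle hs]] Ob.
have : size (form_poly al1 (phi b)) == 1%N.
  apply/negPn/negP => /closed_rootP[z]; rewrite /root.
  have [c c0 e] := form_at_chart k z Ob.
  have [f If fE] := fib b.
  have [x ex] := fibre_surj If (svalP (fb (phi b) (chart true z))).
  have := hOm x; rewrite -fE ex => -[|es].
    by rewrite e mulf_eq0 (negbTE c0) /= => /negbTE ->.
  exfalso; apply: (@chart_true_neq R z); apply: (fibre_inj (Ifb (phi b))).
  by rewrite es (svalP (fb (phi b) _)) fbs.
rewrite hs => /eqP[] /eqP; rewrite subn_eq0 => h.
have /eqP : (k * d (phi b) == k * d m0)%N by rewrite eqn_leq h hle.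
by move: kd; rewrite muln_gt0 => /andP[k0 _] /eqP; rewrite eqn_pmul2l // => /eqP.
Qed.

Section Matrix.
Hypothesis dconst : near_pt m0 [set m | d m = d m0].
Variables (k : nat) (al0 al1 : {ffun 'I_k -> 'I_N.+1} -> M -> C) (g0 g1 u : X -> C).
Hypothesis kd : (0 < k * d m0)%N.
Hypothesis ral : forall I, reg m0 (al0 I) /\ reg m0 (al1 I).
Hypothesis rg : [/\ reg (s m0) g0, reg (s m0) g1, reg (s m0) u, g0 (s m0) != 0 & g1 (s m0) != 0].
Hypothesis ndeg : near_pt m0 [set m | [/\ (k * d m0 <= k * d m)%N,
      size (form_poly al0 m) = (k * d m - (k * d m0).-1).+1 &
      size (form_poly al1 m) = (k * d m - k * d m0).+1]].
Hypothesis nid : near_pt (s m0) [set y | (u y = 0 <-> y = s (pi y)) /\ exists2 c, c != 0 &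
      form_at al0 y = c * (u y ^+ (k * d m0).-1 * g0 y) /\
      form_at al1 y = c * (u y ^+ (k * d m0) * g1 y)].

(** The values of [al0] and [al1] along [sg] become regular after division by a suitable factor.
    Away from [s] this is a power of a homogeneous coordinate. Where [sg] meets [s] at [m0], the
    common factor [u ^+ (k * d m0).-1] is removed as well, which leaves [g0] and [u * g1]. *)
Lemma section_coords (sg : M -> X) : is_morph sg -> (forall m, pi (sg m) = m) ->
  exists l0 l1 : M -> C, [/\ reg m0 l0, reg m0 l1 &
   near_pt m0 [set m | forall x, sval (fb m x) = sg m -> exists2 c, c != 0 &
     (x = chart false 0 /\ l0 m = c /\ l1 m = 0) \/
     (exists2 z, x = chart true z & l0 m = c * (form_poly al0 m).[z] /\
        l1 m = c * (form_poly al1 m).[z])]].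
Proof.
move=> msg sgK; case: rg => rg0 rg1 ru g00 g10.
have nO := near_open oO Om0.
have [e|ne] := pselect (sg m0 = s m0).
  have nS V : near_pt (s m0) V -> near_pt m0 [set m | V (sg m)].
    by move=> nV; apply: (is_morph_at m0 msg).1; rewrite e.
  have rS g : reg (s m0) g -> reg m0 (fun m => g (sg m)).
    by move=> rg'; apply: (msg.2 m0 g); rewrite e.
  exists (fun m => g0 (sg m)), (fun m => u (sg m) * g1 (sg m)); split.
  - exact: rS.
  - by apply: (good_mul gM); exact: rS.
  apply: near_sub (nearI gM nO (nS _ (nearI gX nid (good_nz gX rg0 g00)))) _.
  move=> m /= [Om [[um [c c0 [e0 e1]]] g0m]] x ex; rewrite sgK in um.
  have [exx|[z exx]] := chart_ex x.
    exists (g0 (sg m)) => //; left; split=> //; split=> //.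
    by rewrite (um.2 _) ?mul0r // -ex exx fbs.
  have u0 : u (sg m) != 0.
    apply/eqP => /um.1 es; apply: (@chart_true_neq R z); apply: (fibre_inj (Ifb m)).
    by rewrite -exx ex es fbs.
  have [c' c'0 eF] := form_at_chart k z Om.
  rewrite -exx ex in eF; rewrite !eF in e0 e1.
  have up0 : u (sg m) ^+ (k * d m0).-1 != 0 by rewrite expf_neq0.
  exists (c' / (c * u (sg m) ^+ (k * d m0).-1)).
    by rewrite mulf_neq0 // invr_eq0 mulf_neq0.
  right; exists z => //; split; apply: (mulfI (mulf_neq0 c0 up0)).
    rewrite -[LHS]mulrA -e0 mulrA; congr (_ * _).
    by rewrite mulrCA divff ?mulr1 // mulf_neq0.
  transitivity (c' * (form_poly al1 m).[z]).
    have ek : u (sg m) ^+ (k * d m0) = u (sg m) ^+ (k * d m0).-1 * u (sg m).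
      by rewrite -exprSr prednK.
    by rewrite e1 ek !mulrA.
  by rewrite mulrA [c * _ * (_ / _)]mulrCA divff ?mulr1 // mulf_neq0.
have [a Ya] := row_neq0 (hc_neq0 (Y (sg m0))).
have Osg : O (pi (sg m0)) by rewrite sgK.
have rl al : (forall I, reg m0 (al I)) -> reg m0 (fun m => \sum_I al I m *
    mono I (fun j => cratio j a (Y (sg m)))) => [ra|].
  have r1 : reg (sg m0) (fun y => \sum_I al I (pi y) * mono I (fun j => cratio j a (Y y))).
    by apply: (ratio_reg Osg Ya); rewrite sgK.
  apply: (@reg_ext _ _ gM m0 _ _ _ (msg.2 m0 _ r1)) => m /=.
  by rewrite sgK.
exists (fun m => \sum_I al0 I m * mono I (fun j => cratio j a (Y (sg m)))),
  (fun m => \sum_I al1 I m * mono I (fun j => cratio j a (Y (sg m)))).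
have r0 := rl _ al0 (fun I => (ral I).1); have r1 := rl _ al1 (fun I => (ral I).2).
split=> //.
have [x0 ex0] := fibre_surj (Ifb m0) (sgK m0).
have [exx0|[z0 exx0]] := chart_ex x0; first by case: ne; rewrite -ex0 exx0 fbs.
have l10 : \sum_I al1 I m0 * mono I (fun j => cratio j a (Y (sg m0))) != 0.
  have := form_at_ratio al1 Ya; rewrite sgK => h.
  have [c c0 eF] := form_at_chart k z0 Om0.
  have : form_at al1 (sg m0) != 0.
    rewrite -ex0 exx0 eF mulf_neq0 //; have [_ _] := near_refl ndeg.
    by rewrite subnn => /eqP/size_poly1P[b b0 ->]; rewrite hornerC.
  by rewrite h mulf_eq0 negb_or => /andP[].
have nY : near_pt m0 [set m | hc (Y (sg m)) 0 a != 0].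
  exact: ((is_morph_at m0 msg).1 _ ((mY Osg).1 _ (hc_near Ya))).
have nsid : near_pt m0 [set m | (u (s m) = 0 <-> s m = s (pi (s m))) /\ exists2 c, c != 0 &
      form_at al0 (s m) = c * (u (s m) ^+ (k * d m0).-1 * g0 (s m)) /\
      form_at al1 (s m) = c * (u (s m) ^+ (k * d m0) * g1 (s m))].
  exact: ((is_morph_at m0 ms).1 _ nid).
apply: near_sub (nearI gM (nearI gM nO nY) (nearI gM nsid (good_nz gM r1 l10))) _.
move=> m /= [[Om Ym] [[um [c c0 [_ e1]]] l1m]] x ex.
have fr (al : {ffun 'I_k -> 'I_N.+1} -> M -> C) : form_at al (sg m) = hc (Y (sg m)) 0 a ^+ k *
    \sum_I al I m * mono I (fun j => cratio j a (Y (sg m))).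
  by rewrite (form_at_ratio al Ym) sgK.
have Yk : hc (Y (sg m)) 0 a ^+ k != 0 by rewrite expf_neq0.
have [exx|[z exx]] := chart_ex x.
  have ss : sg m = s m by rewrite -ex exx fbs.
  have u0 : u (s m) = 0 by apply/um.2; rewrite sK.
  have : form_at al1 (sg m) = 0 by rewrite ss e1 u0 expr0n gtn_eqF // mul0r mulr0.
  by rewrite fr => /eqP; rewrite mulf_eq0 (negbTE Yk) (negbTE l1m).
have [c' c'0 eF] := form_at_chart k z Om; rewrite -exx ex in eF.
exists (c' / hc (Y (sg m)) 0 a ^+ k); first by rewrite mulf_neq0 // invr_eq0.
right; exists z => //; split; apply: (mulfI Yk); rewrite -fr eF mulrA; congr (_ * _);
  by rewrite mulrCA divff ?mulr1.
Qed.

(** With constant degree [al0] restricts to a polynomial of degree one and [al1] to a nonzero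
    constant. Together they are a linear change [g] of homogeneous coordinates on the fibre, so the
    matrix of their values along the sections gives the marked points up to an automorphism of the
    line. *)
Lemma local_matrix n (sg : 'I_n -> M -> X) : (forall i, is_morph (sg i)) ->
  (forall i m, pi (sg i m) = m) ->
  exists L : M -> 'M[C]_(2, n), (forall i j, reg m0 (fun m => L m i j)) /\
   near_pt m0 [set m | (forall i, col i (L m) != 0) /\
     exists2 f : P1 -> fibre pi m, is_iso f & forall i, sval (f (colpt (L m) i)) = sg i m].
Proof.
move=> msg sgK.
have /choice[l0 /choice[l1 lP]] i := section_coords (msg i) (sgK i).
exists (fun m => \matrix_(r, i) (if r == 0 then l0 i m else l1 i m)); split.
  move=> i j; have [r0 r1 _] := lP j.
  case: (ord2_cases i) => ->; [apply: (@reg_ext _ _ gM m0 _ _ _ r0)|apply: (@reg_ext _ _ gM m0 _ _ _ r1)];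
  by move=> m; rewrite mxE.
have n1 : near_pt m0 [set m | forall i x, sval (fb m x) = sg i m -> exists2 c, c != 0 &
     (x = chart false 0 /\ l0 i m = c /\ l1 i m = 0) \/
     (exists2 z, x = chart true z & l0 i m = c * (form_poly al0 m).[z] /\
        l1 i m = c * (form_poly al1 m).[z])].
  by apply: (near_all gM) => i; case: (lP i).
apply: near_sub (nearI gM n1 (nearI gM ndeg dconst)) _ => m /= [hl [[_ s0 s1] dm]].
rewrite dm subnn in s1; rewrite dm in s0.
have {}s0 : size (form_poly al0 m) = 2.
  by rewrite s0; move: kd; case: (k * d m0)%N => // e _ /=; rewrite subSn // subnn.
have /eqP/size_poly1P[ga ga0 e1] := s1.
have [al [be [al_0 e0]]] : exists al be : C, al != 0 /\ form_poly al0 m = al *: 'X + be%:P.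
  exists (form_poly al0 m)`_1, (form_poly al0 m)`_0; split.
    have : lead_coef (form_poly al0 m) != 0 by rewrite lead_coef_eq0 -size_poly_eq0 s0.
    by rewrite /lead_coef s0.
  apply/polyP => -[|[|i]]; rewrite coefD coefZ coefX coefC /= ?mulr0 ?mulr1 ?add0r ?addr0 //.
  by rewrite nth_default // s0.
pose g := mat2 (row2 al 0) (row2 be ga).
have ug : g \in unitmx by apply: mat2_unit; rewrite !row2E mul0r subr0 mulf_neq0.
have ug' : invmx g \in unitmx by rewrite unitmx_inv.
pose Lm : 'M[C]_(2, n) := \matrix_(r, i) (if r == 0 then l0 i m else l1 i m).
have key i x : sval (fb m x) = sg i m -> exists2 c, c != 0 &
    exists v, [/\ v != 0, x = toP v & (col i Lm)^T = c *: (v *m g)].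
  move=> /hl[c c0 h].
  have cE : (col i Lm)^T = row2 (l0 i m) (l1 i m) by apply/rowP => j; rewrite !mxE.
  rewrite cE; case: h => [[-> [-> ->]]|[z -> [-> ->]]].
    exists (c / al); first by rewrite mulf_neq0 // invr_eq0.
    exists (crow false 0); split; rewrite ?crow_neq0 //.
    by rewrite /crow row2_mat2 scale1r scale0r addr0 row2Z divfK // mulr0.
  exists c => //; exists (crow true z); split; rewrite ?crow_neq0 //.
  rewrite /crow row2_mat2 scale1r e0 e1 !hornerE.
  by apply/rowP => j; rewrite !mxE; case: ifP => _; ring.
split=> [i|].
  have [x ex] := fibre_surj (Ifb m) (sgK i m).
  have [c c0 [v [v0 _ cE]]] := key i x ex.
  apply/negP => /eqP h; have := mul_unit_neq0 ug v0.
  have : c *: (v *m g) = 0 by rewrite -cE h trmx0.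
  by move/eqP; rewrite scaler_eq0 (negbTE c0) /= => ->.
exists (fb m \o aut (invmx g)); first by apply: is_iso_comp; [exact: aut_iso|exact: Ifb].
move=> i; have [x ex] := fibre_surj (Ifb m) (sgK i m).
have [c c0 [v [v0 xv cE]]] := key i x ex.
have vg := mul_unit_neq0 ug v0.
by rewrite /= /colpt cE toP_scale // aut_toP // mulmxK // -xv.
Qed.

End Matrix.

End ConstantDegree.

(** * Regular matrices on the Hassett space *)

Section ModuliCharts.
Context {R : realType} {n : nat}.
Local Notation C := R[i].
Local Notation P1 := (@proj_space R 1).

(** Polynomials not vanishing at [x], resp. [y], restrict to nonzero polynomials on the line joining
    the two points. *)
Lemma aff_irreducible k l (x y : @aff_space R k l) (V W : set (@aff_space R k l)) :
  near_pt x V -> near_pt y W -> exists z, V z /\ W z.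
Proof.
move=> [V' [oV Vx VV]] [W' [oW Wy WW]].
have [p [Pp px pV]] := oV _ Vx; have [q [Pq qy qW]] := oW _ Wy.
pose z (t : C) : 'M[C]_(k, l) := x + t *: ((y : 'M[C]_(k, l)) - x).
have line r : polyfun (@entry R k l) r -> exists P : {poly C}, forall t, r (z t) = P.[t].
  elim=> [c|i|p1 q1 _ [P e] _ [Q e']|p1 q1 _ [P e] _ [Q e']].
  - by exists c%:P => t; rewrite hornerC.
  - exists ((x : 'M[C]_(k, l)) i.1 i.2 *: (1 - 'X) + (y : 'M[C]_(k, l)) i.1 i.2 *: 'X) => t.
    by rewrite /entry /z !mxE !(hornerD, hornerN, hornerZ, hornerX, hornerC); ring.
  - by exists (P + Q) => t; rewrite hornerD e e'.
  - by exists (P * Q) => t; rewrite hornerM e e'.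
have [P e] := line _ Pp; have [Q e'] := line _ Pq.
have z0 : z 0 = x by rewrite /z scale0r addr0.
have z1 : z 1 = y by rewrite /z scale1r addrC subrK.
have [|t] := @poly_nz_ex _ (P * Q).
  rewrite mulf_neq0 //; first by apply: (@horner_neq0 _ _ 0); rewrite -e z0.
  by apply: (@horner_neq0 _ _ 1); rewrite -e' z1.
rewrite hornerM mulf_eq0 negb_or -e -e' => /andP[pt qt].
by exists (z t); split; [exact/VV/pV|exact/WW/qW].
Qed.

Lemma pluecker_eq0 (L : 'M[C]_(2, n)) i j : col i L != 0 -> col j L != 0 ->
  pluecker L i j = 0 -> colpt L i = colpt L j.
Proof.
move=> Li Lj p0; apply: toP_cross; [exact: colT_neq0|exact: colT_neq0|].
move=> k l; rewrite !mxE; move: p0; rewrite /pluecker => /eqP; rewrite subr_eq0 => /eqP p0.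
case: (ord2_cases k) => ->; case: (ord2_cases l) => -> //.
  by rewrite p0 mulrC.
by rewrite mulrC -p0 mulrC.
Qed.

Variables (a : 'I_n -> rat) (M : hassett_space R a).
Hypothesis a2 : 2 < \sum_i a i.
Local Notation X := (hs_curve M).
Local Notation pi := (@hs_proj _ _ _ M).

Lemma config_stabm (m : M) L L' : config m L -> stabm a L -> config m L' ->
  (forall i, col i L' != 0) -> stabm a L'.
Proof.
move=> [f If fE] sL [f' If' fE'] cL'; split=> // I hI; apply: sL.2 => i j iI jI.
apply: colpt_eq; [exact: sL.1|exact: sL.1|].
apply: (fibre_inj If); rewrite !fE -!fE'.
by congr (sval (f' _)); apply: pluecker_eq0; rewrite ?hI.
Qed.

Hypothesis conf : forall m : M, exists2 L, stabm a L & config m L.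
Variable i0 : 'I_n.

Let gX := hs_curve_good M.
Let gM := hs_good M.

Lemma immersion_morph (Z Z' : space R) (e : Z -> Z') : good Z' -> is_immersion e -> is_morph e.
Proof.
move=> gZ' [_ eo er]; split=> [V oV|x h rh]; first by apply/eo; exists V.
by apply/er; exists h => //; exists setT; split=> //; exact: good_T.
Qed.

(** The isomorphisms [fb m] are chosen point by point, with the section [i0] at infinity, and the
    universal curve is embedded over a neighbourhood [U] of [m0]. The degree [d] and the polynomials
    [F] are defined fibre by fibre, so the constancy of [d] has to be proved before forms can be
    used. *)
Lemma moduli_matrix (m0 : M) : exists L : M -> 'M[C]_(2, n),
  (forall i j, reg m0 (fun m => L m i j)) /\
  near_pt m0 [set m : M | stabm a (L m) /\ config m (L m)].
Proof.
have [_ [_ mpi secs [locp flat] _] _] := hs_fine M.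
have red (x : X) : has_reduced_fibre_at pi x by case: (flat x).
pose s : M -> X := hs_sec i0; have [ms sK] := secs i0.
have fbex (m : M) : exists f : P1 -> fibre pi m, is_iso f /\ sval (f (chart false 0)) = s m.
  have [L sL [f If fE]] := conf m; have [g ug gE] := move_infinity (colpt L i0).
  exists (f \o aut g); split; first by apply: is_iso_comp => //; exact: aut_iso.
  by rewrite /= gE fE.
pose fb (m : M) := projT1 (cid (fbex m)).
have Ifb m : is_iso (fb m) by case: (projT2 (cid (fbex m))).
have fbs m : sval (fb m (chart false 0)) = s m by case: (projT2 (cid (fbex m))).
have [U [oU Um0 [N [e [[eimm _] eE]]]]] := locp m0.
pose V := pi @^-1` U; have oV : zopen V by exact: mpi.1.
have gV := sub_good V gX; have gU := sub_good U gM.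
have gPN := @proj_good R N.
have gUP := prod_good gU gPN.
have me := immersion_morph gUP eimm; have [einj eo er] := eimm.
pose Y (y : X) : @proj_space R N :=
  if pselect (V y) is left h then (e (exist _ y h)).2 else toP 0.
have YE (x : sub_space V) : Y (sval x) = (e x).2.
  rewrite /Y; case: pselect => [h|nh]; last by case: nh; exact: svalP.
  by congr ((e _).2); exact: sig_eq.
have mY y : U (pi y) -> morph_at Y y.
  move=> Uy; pose y' : sub_space V := exist _ y Uy.
  apply: (from_open_morph_at Y y' gX oV).1.
  rewrite (_ : (fun _ => _) = snd \o e); last by apply/funext => z; rewrite YE.
  by apply: is_morph_at; apply: is_morph_comp me (snd_morph gU gPN).
have imm y g : U (pi y) -> reg y g -> exists f, reg (Y y) f /\
    near_pt y [set y' | pi y' = pi y -> g y' = f (Y y')].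
  move=> Uy rg; pose y' : sub_space V := exist _ y Uy.
  have : reg y' (fun z => g (sval z)) by apply/(open_sub_reg y' g gX oV).
  move=> /er[g' rg' [W [oW We WE]]].
  (* On a fibre the first component of the embedding is constant; freezing it turns a germ on the
     product into a germ on projective space. *)
  exists (fun p => g' ((e y').1, p)); split.
    have mp := pair_morph gU gPN gPN (is_morph_cst (e y').1 gPN) (@is_morph_id _ _).
    apply: (mp.2 (Y y) g'); rewrite -[Y y]/(Y (sval y')) YE.
    by rewrite -surjective_pairing.
  have n1 : near_pt y' [set z | W (e z)] by apply: near_open; [exact: me.1|].
  apply: near_sub (nearI gX (near_sub_ex n1) (near_open oV Uy)) _ => w /= [h Vw] pw.
  have := WE (exist _ w Vw : sub_space V) (h Vw); rewrite /= => ->.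
  rewrite -[Y w]/(Y (sval (exist _ w Vw : sub_space V))) YE.
  congr (g' _); rewrite [LHS]surjective_pairing; congr (_, _).
  by apply: sig_eq; rewrite !eE /= pw.
have mT m : U m -> is_morph (fun x => Y (sval (fb m x))).
  move=> Um; apply/(morph_atP _ (@proj_good R 1)) => x.
  apply: (morph_at_comp (is_morph_at x (fibre_morph gX (Ifb m)))).
  by apply: mY; rewrite (svalP (fb m x)).
have /choice[dF dFP] (m : M) : exists t : nat * ('I_N.+1 -> {poly C}),
    U m -> poly_map (fun x => Y (sval (fb m x))) t.1 t.2.
  have [Um|nUm] := pselect (U m); last by exists (0%N, fun=> 0).
  by have [d [F h]] := poly_map_ex (mT m Um); exists (d, F).
pose d m := (dF m).1; pose F m := (dF m).2.
have dFp m : U m -> poly_map (fun x => Y (sval (fb m x))) (d m) (F m) by exact: dFP.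
(* The degree is constant on a neighbourhood of a matrix of [m1], since near that matrix the family
   is pulled back from a product. *)
have loc m1 : U m1 -> exists L1 : @aff_space R 2 n, near_pt L1 [set L : @aff_space R 2 n |
    exists m, [/\ stabm a L, config m L & d m = d m1]].
  move=> Um1; have [L1 sL1 cL1] := conf m1; exists L1.
  have [k [S [Lb [beta [cS rL sLb nb]]]]] := stable_base a2 sL1.
  have gB := sub_good S (aff_good 1 k).
  have [phi [psi [mphi mpsi psis fib]]] := family_classified M a2 cS rL sLb.
  have cphi b : config (phi b) (Lb b).
    by have [f If fE] := fib b; exists f => // i; rewrite fE psis.
  have [mb Lb1] := near_refl nb.
  have phi0 : phi (beta L1) = m1.
    by apply: (config_unique a2 (sLb (beta L1)) (cphi _)); rewrite Lb1.
  have n1 := degree_tube (hs_curve_variety M) (hs_variety M) mpi ms sK red Ifb fbs oU mY imm dFp Um1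
    gB mphi mpsi phi0 fib.
  have n2 : near_pt (beta L1) [set b | U (phi b)].
    by apply: near_open; [exact: mphi.1|rewrite /= phi0].
  apply: near_sub (nearI (aff_good 2 n) nb (mb.1 _ (nearI gB n1 n2))) _.
  move=> L /= [[_ LbL] [h Up]]; exists (phi (beta L)); split.
  - by rewrite -[L in stabm _ L]LbL.
  - by rewrite -[L in config _ L]LbL.
  - exact: h.
(* The neighbourhoods found for [m1] and [m0] have a matrix in common, and this matrix has only one
   modular point. *)
have dconst m1 : U m1 -> d m1 = d m0.
  move=> Um1; have [L1 n1] := loc m1 Um1; have [L0 n0] := loc m0 Um0.
  have [L [[m [sL cm <-]] [m' [_ cm' <-]]]] := aff_irreducible n1 n0.
  by rewrite (config_unique a2 sL cm cm').
have nd : near_pt m0 [set m | d m = d m0].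
  by apply: near_sub (near_open oU Um0) _ => m /dconst.
have [k [al0 [al1 [g0 [g1 [u [kd ral rg ndeg nid]]]]]]] :=
  pencil (hs_curve_variety M) (hs_variety M) mpi ms sK red Ifb fbs oU mY imm dFp Um0.
have [L [rL nL]] := local_matrix (hs_curve_variety M) (hs_variety M) mpi ms sK Ifb fbs oU mY
  dFp Um0 nd kd ral rg ndeg nid (fun i => (secs i).1) (fun i => (secs i).2).
exists L; split=> //; apply: near_sub nL _ => m [cL [f If fE]].
have cm : config m (L m) by exists f.
by split=> //; have [L' sL' cL'] := conf m; exact: (config_stabm cL' sL').
Qed.

End ModuliCharts.

(** * Spaces of parameters *)

Section LineAutomorphisms.
Context {R : realType}.
Local Notation C := R[i].
Local Notation P1 := (@proj_space R 1).

Lemma chart_inj c : injective (@chart R c).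
Proof. by move=> z w /(congr1 (coord c)); rewrite !coordK. Qed.

(** By injectivity no finite point goes to infinity, so the second homogeneous component has no
    zeros and is constant. *)
Lemma fix_infinity_poly (h : P1 -> P1) : is_morph h -> injective h ->
  h (chart false 0) = chart false 0 ->
  exists P : {poly C}, forall z, h (chart true z) = chart true P.[z].
Proof.
move=> mh hi h0; have [d [F [sF F0 [i Fi] Tt Tf]]] := poly_map_ex mh.
have F1 z : (F 1).[z] != 0.
  apply/eqP => F1z; apply: (@chart_true_neq R z); apply: hi; rewrite h0 Tt.
  have e : evalr F z = row2 ((F 0).[z]) 0 by rewrite [LHS]row2P !mxE F1z.
  have F0z : (F 0).[z] != 0.
    by have := F0 z; apply: contraNneq => e0; rewrite e e0; apply/eqP/rowP => j; rewrite !mxE if_same.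
  rewrite e /chart -[RHS](@toP_scale _ _ _ (F 0).[z]) ?(crow_neq0 false) //.
  by rewrite /crow row2Z mulr1 mulr0.
have : size (F 1) == 1%N.
  by apply/negPn/negP => /closed_rootP[z]; rewrite /root (negbTE (F1 z)).
move=> /size_poly1P[c c0 Fc]; exists (c^-1 *: F 0) => z.
rewrite Tt /chart -[RHS](@toP_scale _ _ _ c) ?(crow_neq0 true) //; congr toP.
by rewrite /crow row2Z hornerZ mulrA divff // mul1r mulr1 [LHS]row2P !mxE Fc hornerC.
Qed.

(** After composition with a linear automorphism the map and its inverse are polynomials; their
    composite has degree one, hence so has each of them. *)
Lemma iso_aut (h : P1 -> P1) : is_iso h -> exists2 g, g \in unitmx & h =1 aut g.
Proof.
move=> [mh [h' [mh' hK hK']]]; have [g ug gE] := move_infinity (h (chart false 0)).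
have ug' : invmx g \in unitmx by rewrite unitmx_inv.
pose k := aut (invmx g) \o h; pose k' := h' \o aut g.
have kk' : cancel k k' by move=> x; rewrite /k /k' /= autM // mulVmx // aut1 hK.
have k'k : cancel k' k by move=> x; rewrite /k /k' /= hK' autM // mulmxV // aut1.
have mk : is_morph k by apply: is_morph_comp => //; exact: aut_morph.
have mk' : is_morph k' by apply: is_morph_comp => //; exact: aut_morph.
have k0 : k (chart false 0) = chart false 0 by rewrite /k /= -gE autM // mulmxV // aut1.
have k'0 : k' (chart false 0) = chart false 0 by rewrite -{1}k0 kk'.
have [P PE] := fix_infinity_poly mk (can_inj kk') k0.
have [Q QE] := fix_infinity_poly mk' (can_inj k'k) k'0.
have PQ : P \Po Q = 'X.
  apply: (@poly_eq_off _ 1); rewrite ?oner_neq0 // => z _.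
  by apply: (@chart_inj true); rewrite horner_comp -PE -QE k'k hornerX.
have := size_comp_poly P Q; rewrite PQ size_polyX => /esym/eqP.
rewrite muln_eq1 => /andP[/eqP sP _].
have {}sP : size P = 2 by move: sP; case: (size P) => [|[|[|]]].
have al0 : P`_1 != 0.
  have : lead_coef P != 0 by rewrite lead_coef_eq0 -size_poly_eq0 sP.
  by rewrite /lead_coef sP.
pose f := mat2 (row2 P`_1 0) (row2 P`_0 1).
have uf : f \in unitmx by apply: mat2_unit; rewrite !row2E mul0r subr0 mulr1.
have kf x : k x = aut f x.
  have [->|[z ->]] := chart_ex x.
    rewrite k0 /chart aut_toP ?(crow_neq0 false) // /crow row2_mat2 scale1r scale0r addr0.
    rewrite -[LHS](@toP_scale _ _ _ P`_1) ?(crow_neq0 false) //.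
    by rewrite row2Z mulr1 mulr0.
  rewrite PE /chart aut_toP ?(crow_neq0 true) //; congr toP.
  rewrite /crow row2_mat2 scale1r row2Z mulr0 horner_coef sP big_ord_recl big_ord1 /= expr0 mulr1 expr1.
  by apply/rowP => j; rewrite !mxE; case: ifP => _; ring.
exists (f *m g); first by rewrite unitmx_mul uf.
by move=> x; rewrite -autM // -kf /k /= autM // mulVmx // aut1.
Qed.

End LineAutomorphisms.

Section Matrices.
Context {R : realType} {n : nat}.
Local Notation C := R[i].
Implicit Types L : 'M[C]_(2, n).

Definition mx_equiv L L' := exists (g : 'M[C]_2) (t : 'rV[C]_n),
  [/\ g \in unitmx, forall i, t 0 i != 0 & L' = g *m L *m diag_mx t].

Lemma col_equiv (g : 'M[C]_2) L (t : 'rV[C]_n) i :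
  (col i (g *m L *m diag_mx t))^T = t 0 i *: ((col i L)^T *m g^T).
Proof.
rewrite -trmx_mul; apply/rowP => j; rewrite mul_mx_diag !mxE mulrC; congr (_ * _).
by apply: eq_bigr => k _; rewrite !mxE.
Qed.

Lemma colpt_equiv (g : 'M[C]_2) L (t : 'rV[C]_n) i : g \in unitmx -> t 0 i != 0 ->
  col i L != 0 -> colpt (g *m L *m diag_mx t) i = aut g^T (colpt L i).
Proof.
move=> ug ti Li; have ug' : g^T \in unitmx by rewrite unitmx_tr.
rewrite /colpt col_equiv toP_scale // ?aut_toP ?colT_neq0 //.
by rewrite mul_unit_neq0 // colT_neq0.
Qed.

Lemma equiv_col_neq0 (g : 'M[C]_2) L (t : 'rV[C]_n) i : g \in unitmx -> t 0 i != 0 ->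
  col i L != 0 -> col i (g *m L *m diag_mx t) != 0.
Proof.
move=> ug ti Li; have ug' : g^T \in unitmx by rewrite unitmx_tr.
have : (col i (g *m L *m diag_mx t))^T != 0.
  by rewrite col_equiv scaler_eq0 negb_or ti mul_unit_neq0 // colT_neq0.
by apply: contraNneq => ->; rewrite trmx0.
Qed.

Lemma equiv_stabm a L L' : mx_equiv L L' -> stabm a L -> stabm a L'.
Proof.
move=> [g [t [ug t0 ->]]] [cL sL]; split=> [i|I hI]; first exact: equiv_col_neq0.
have ug' : g^T \in unitmx by rewrite unitmx_tr.
apply: sL => i j iI jI; apply: colpt_eq => //.
have [_ [h [_ hK _]]] := aut_iso ug'; apply: (can_inj hK).
rewrite -!(colpt_equiv (t := t)) //.
by apply: pluecker_eq0; rewrite ?equiv_col_neq0 ?hI.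
Qed.

Lemma config_equiv a (M : hassett_space R a) (m : M) L L' : mx_equiv L L' ->
  (forall i, col i L != 0) -> config m L -> config m L'.
Proof.
move=> [g [t [ug t0 ->]]] cL [f If fE]; have ug' : g^T \in unitmx by rewrite unitmx_tr.
have ug'' : invmx g^T \in unitmx by rewrite unitmx_inv.
exists (f \o aut (invmx g^T)); first by apply: is_iso_comp => //; exact: aut_iso.
by move=> i; rewrite /= colpt_equiv // autM // mulmxV // aut1.
Qed.

(** The transition between the two isomorphisms is an automorphism of the line, hence linear; the
    columns then agree as points, that is, up to scalars. *)
Lemma equiv_config a (M : hassett_space R a) (m : M) L L' :
  (forall i, col i L != 0) -> (forall i, col i L' != 0) ->
  config m L -> config m L' -> mx_equiv L L'.
Proof.
move=> cL cL' [f If fE] [f' If' f'E].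
have [mf' [h [mh f'K hK]]] := If'.
have Ih : is_iso h by apply: (is_iso_sym (g := f')).
have [g ug gE] := iso_aut (is_iso_comp If Ih).
have e i : colpt L' i = aut g (colpt L i).
  rewrite -gE /= (_ : f (colpt L i) = f' (colpt L' i)) ?f'K //.
  by apply: sig_eq; rewrite fE f'E.
have /choice[c cP] i : exists c, c != 0 /\ (col i L')^T = c *: ((col i L)^T *m g).
  have := e i; rewrite /colpt aut_toP ?colT_neq0 // => e'.
  have [c c0 cE] := toP_eq (mul_unit_neq0 ug (colT_neq0 (cL i))) (colT_neq0 (cL' i)) (esym e').
  by exists c.
have ug' : g^T \in unitmx by rewrite unitmx_tr.
exists g^T, (\row_i c i); split=> // [i|]; first by rewrite mxE; case: (cP i).
apply/matrixP => r i; have /rowP/(_ r) : (col i L')^T = (col i (g^T *m L *m diag_mx (\row_i c i)))^T.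
  by rewrite col_equiv trmxK mxE; case: (cP i).
by rewrite !mxE.
Qed.

Lemma rank2_pluecker L i j : pluecker L i j != 0 -> mxrank L = 2%N.
Proof.
move=> Lij; apply/eqP; rewrite eqn_leq rank_leq_row /=.
pose f (k : 'I_2) := if k == 0 then i else j.
have ue : mxsub id f L \in unitmx.
  rewrite (_ : mxsub id f L = mat2 (row2 (L 0 i) (L 0 j)) (row2 (L 1 i) (L 1 j))).
    by apply: mat2_unit; rewrite !row2E.
  apply/matrixP => r k; rewrite !mxE /f.
  by case: (ord2_cases r) => ->; case: (ord2_cases k) => ->.
have : (\rank (mxsub id f L) <= \rank L)%N.
  by rewrite -[X in (\rank (mxsub id f X) <= _)%N]mulmx1 -mulmx_colsub mxrankM_maxl.
by rewrite mxrank_unit.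
Qed.

Lemma stabm_rank a L : 2 < \sum_i a i -> (0 < n)%N -> stabm a L -> mxrank L = 2%N.
Proof.
move=> a2 n0 sL; have [j] := stabm_pluecker a2 (Ordinal n0) sL.
exact: rank2_pluecker.
Qed.

End Matrices.

Section Quotients.
Context {R : realType}.
Implicit Types X Y : space R.

Lemma quot_morph_at X (E : X -> set X) Y (f : quot_space E -> Y) (W : set (quot_space E)) :
  good X -> good Y -> zopen [set x | W (class_of E x)] ->
  (forall x, W (class_of E x) -> morph_at (fun x => f (class_of E x)) x) ->
  forall c, W c -> morph_at f c.
Proof.
move=> gX gY oW mf c Wc; have [x0 ec] := class_of_eq c; rewrite ec in Wc *.
split=> [V nV|h rh].
  exists [set c | W c /\ near_pt (f c) V]; split=> //; last by move=> c' [_ /near_refl].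
  apply: (@open_near _ _ gX [set x | W (class_of E x) /\ near_pt (f (class_of E x)) V]).
  move=> x [Wx nx]; have n1 := (mf x Wx).1 _ (near_near nx).
  by apply: near_sub (nearI gX (near_open oW Wx) n1) _ => y [].
exists [set c | W c /\ reg (f c) h]; split=> //.
  apply: (@open_near _ _ gX [set x | W (class_of E x) /\ reg (f (class_of E x)) h]).
  move=> x [Wx rx]; have n1 := (mf x Wx).1 _ (good_near gY rx).
  by apply: near_sub (nearI gX (near_open oW Wx) n1) _ => y [].
by move=> x [Wx rx]; apply: (mf x Wx).2.
Qed.

End Quotients.

Section Equivalence.
Context {R : realType} {n : nat}.
Local Notation C := R[i].
Implicit Types L : 'M[C]_(2, n).

Lemma mx_equiv_sym L L' : mx_equiv L L' -> mx_equiv L' L.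
Proof.
move=> [g [t [ug t0 ->]]]; exists (invmx g), (\row_i (t 0 i)^-1); split.
- by rewrite unitmx_inv.
- by move=> i; rewrite mxE invr_eq0.
rewrite !mulmxA mulVmx // mul1mx -mulmxA mulmx_diag.
rewrite (_ : diag_mx _ = 1%:M) ?mulmx1 //.
apply/matrixP => i j; rewrite !mxE; case: eqVneq => [->|]; last by rewrite !mulr0n.
by rewrite mulfV.
Qed.

Lemma mx_equiv_trans L1 L2 L3 : mx_equiv L1 L2 -> mx_equiv L2 L3 -> mx_equiv L1 L3.
Proof.
move=> [g [t [ug t0 ->]]] [g' [t' [ug' t'0 ->]]].
exists (g' *m g), (\row_i (t 0 i * t' 0 i)); split.
- by rewrite unitmx_mul ug'.
- by move=> i; rewrite mxE mulf_neq0.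
by rewrite -mulmx_diag !mulmxA.
Qed.

Lemma mx_equiv_left (g : 'M[C]_2) L : g \in unitmx -> mx_equiv L (g *m L).
Proof.
move=> ug; exists g, (const_mx 1); split=> // [i|]; first by rewrite mxE oner_neq0.
by rewrite diag_const_mx mulmx1.
Qed.

Lemma mx_equiv_right (t : 'rV[C]_n) L : (forall i, t 0 i != 0) -> mx_equiv L (L *m diag_mx t).
Proof. by move=> t0; exists 1%:M, t; split=> //; [exact: unitmx1|rewrite mul1mx]. Qed.

Lemma mx_equiv_refl L : mx_equiv L L.
Proof. by rewrite -{2}[L]mul1mx; apply: mx_equiv_left; exact: unitmx1. Qed.

Definition row_equiv (L L' : @full_rank R n) := exists2 g : 'M[C]_2, g \in unitmx &
  (sval L' : 'M[C]_(2, n)) = g *m (sval L : 'M[C]_(2, n)).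

Definition gr L (h : mxrank L = 2%N) : Gr R n := class_of row_equiv (exist _ L h : full_rank).

Lemma spans_gr L (h : mxrank L = 2%N) : spans (gr h) L.
Proof.
exists (exist _ L h : full_rank) => //; exists 1%:M; first exact: unitmx1.
by rewrite mul1mx.
Qed.

Lemma spans_rank (c : Gr R n) L : spans c L -> mxrank L = 2%N.
Proof. by move=> [l _ <-]; exact: (svalP l). Qed.

Lemma spans_equiv (c : Gr R n) L L' : spans c L -> spans c L' ->
  exists2 g : 'M[C]_2, g \in unitmx & L' = g *m L.
Proof.
have [x ->] := class_of_eq c => -[l [g ug lE] <-] [l' [g' ug' lE'] <-].
exists (g' *m invmx g); first by rewrite unitmx_mul ug' unitmx_inv.
by rewrite lE lE' mulmxA mulmxKV.
Qed.

Lemma spans_mul (c : Gr R n) L (g : 'M[C]_2) : g \in unitmx -> spans c L -> spans c (g *m L).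
Proof.
move=> ug sc; have rk := spans_rank sc.
have fg : row_full g by rewrite row_full_unit.
have rk' : mxrank (g *m L) = 2%N by rewrite (eqmxMfull L fg).
have [x ex] := class_of_eq c; rewrite ex in sc *; move: sc => [l [h uh lE] lL].
exists (exist _ (g *m L) rk' : full_rank) => //.
exists (g *m h); first by rewrite unitmx_mul ug.
by rewrite /= -lL lE mulmxA.
Qed.

End Equivalence.

Section ParamSpace.
Context {R : realType} {n : nat}.
Local Notation C := R[i].
Implicit Types L : 'M[C]_(2, n).
Variables (omega : {set pluecker_set n}) (a : 'I_n -> rat) (M : hassett_space R a).
Hypothesis n0 : (0 < n)%N.
Hypothesis a2 : 2 < \sum_i a i.
Hypothesis conf : forall m : M, exists2 L, stabm a L & config m L.
Hypothesis omegaP : forall L, mxrank L = 2%N -> (pl_support L \in omega <-> stabm a L).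

Local Notation F := (param_space R n omega).
Local Notation strata := (@strata R n omega).

Let gM := hs_good M.
Let gG : good (Gr R n) := quot_good row_equiv (sub_good _ (aff_good 2 n)).

Lemma rank_of_stab L : stabm a L -> mxrank L = 2%N.
Proof. exact: stabm_rank. Qed.

Lemma mkst_proof L (h : stabm a L) :
  [set c : Gr R n | exists2 sigma, sigma \in omega & stratum sigma c] (gr (rank_of_stab h)).
Proof.
exists (pl_support L); first by apply/omegaP => //; exact: rank_of_stab.
by exists L => //; exact: spans_gr.
Qed.

Definition mkst L (h : stabm a L) : strata := exist _ _ (mkst_proof h).

Lemma strata_stab (c : strata) : exists2 L, spans (sval c) L & stabm a L.
Proof.
have [sigma so [L sL sE]] := svalP c; exists L => //.
by apply/omegaP; [exact: spans_rank sL|rewrite sE].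
Qed.

Definition torus_equiv (c c' : strata) := exists L L' (t : 'rV[C]_n),
  [/\ spans (sval c) L, spans (sval c') L', forall i, t 0 i != 0 & L' = L *m diag_mx t].

Lemma torus_equivP (c c' : strata) A B : spans (sval c) A -> spans (sval c') B ->
  torus_equiv c c' <-> mx_equiv A B.
Proof.
move=> sA sB; split.
  move=> [L [L' [t [sL sL' t0 LE]]]].
  have [g ug gE] := spans_equiv sA sL; have [h uh hE] := spans_equiv sL' sB.
  apply: (mx_equiv_trans (mx_equiv_left A ug)); rewrite -gE.
  apply: (mx_equiv_trans (mx_equiv_right L t0)); rewrite -LE hE.
  exact: mx_equiv_left.
move=> [g [t [ug t0 BE]]]; exists (g *m A), B, t; split=> //.
exact: spans_mul.
Qed.

Lemma rep_class (c : strata) A L : spans (sval c) A ->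
  represents (class_of torus_equiv c : F) L <-> mx_equiv A L /\ mxrank L = 2%N.
Proof.
move=> sA; split.
  move=> [c' cc' sL]; split; last exact: spans_rank sL.
  exact: (torus_equivP sA sL).1.
move=> [AL rL]; have [L0 sL0 stL0] := strata_stab c.
have [g ug gE] := spans_equiv sL0 sA.
have stL : stabm a L.
  by apply: equiv_stabm AL _; apply: equiv_stabm stL0; rewrite gE; exact: mx_equiv_left.
exists (mkst stL); last exact: spans_gr.
by have /= := (torus_equivP (c' := mkst stL) sA (spans_gr (rank_of_stab stL))).2 AL.
Qed.

Lemma rep_ex (y : F) : exists2 L, represents y L & stabm a L.
Proof.
have [c ->] := class_of_eq y; have [L sL st] := strata_stab c; exists L => //.
by apply/(rep_class L sL); split; [exact: mx_equiv_refl|exact: rank_of_stab].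
Qed.

Lemma rep_stab (y : F) L : represents y L -> stabm a L.
Proof.
have [c ->] := class_of_eq y; have [A sA st] := strata_stab c.
by move=> /(rep_class L sA)[e _]; exact: equiv_stabm e st.
Qed.

Lemma rep_equiv (y : F) L L' : represents y L -> represents y L' -> mx_equiv L L'.
Proof.
have [c ->] := class_of_eq y; have [A sA st] := strata_stab c.
move=> /(rep_class L sA)[e _] /(rep_class L' sA)[e' _].
exact: mx_equiv_trans (mx_equiv_sym e) e'.
Qed.

Lemma rep_of_equiv (y : F) L L' : represents y L -> mx_equiv L L' -> represents y L'.
Proof.
move=> rL e; have sL := rep_stab rL; have sL' := equiv_stabm e sL.
have [c ec] := class_of_eq y; rewrite ec in rL *; have [A sA st] := strata_stab c.
move: rL => /(rep_class L sA)[e1 _]; apply/(rep_class L' sA).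
by split; [exact: mx_equiv_trans e1 e|exact: rank_of_stab].
Qed.

Lemma rep_inj (y y' : F) L : represents y L -> represents y' L -> y = y'.
Proof.
have [c ->] := class_of_eq y; have [c' ->] := class_of_eq y'.
have [A sA _] := strata_stab c; have [A' sA' _] := strata_stab c'.
move=> /(rep_class L sA)[e _] /(rep_class L sA')[e' _].
apply: sig_eq; apply/funext => d; apply/propext => /=.
have [B sB _] := strata_stab d.
rewrite -[X in X <-> _]/(torus_equiv c d) -[X in _ <-> X]/(torus_equiv c' d).
split=> /torus_equivP h; apply/torus_equivP => //; [exact: sA'|exact: sB| |exact: sA|exact: sB|].
  exact: mx_equiv_trans e' (mx_equiv_trans (mx_equiv_sym e) (h A B sA sB)).
exact: mx_equiv_trans e (mx_equiv_trans (mx_equiv_sym e') (h A' B sA' sB)).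
Qed.

Lemma rep_mk L (h : stabm a L) : represents (class_of torus_equiv (mkst h) : F) L.
Proof.
apply/(rep_class L (A := L)); first exact: spans_gr.
by split; [exact: mx_equiv_refl|exact: rank_of_stab].
Qed.

Lemma to_moduli_ex (y : F) : exists m : M, exists2 L, represents y L & config m L.
Proof.
have [L rL sL] := rep_ex y; have [m cm] := stabm_config M a2 sL.
by exists m, L.
Qed.

Definition to_moduli (y : F) : M := projT1 (cid (to_moduli_ex y)).

Lemma to_moduliP y L : represents y L -> config (to_moduli y) L.
Proof.
rewrite /to_moduli; case: cid => m [L' rL' cm] rL /=.
by apply: (config_equiv (rep_equiv rL' rL)) cm; case: (rep_stab rL').
Qed.

Lemma of_moduli_ex (m : M) : exists y : F, exists2 L, represents y L & config m L.
Proof.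
by have [L sL cL] := conf m; exists (class_of torus_equiv (mkst sL)), L => //; exact: rep_mk.
Qed.

Definition of_moduli (m : M) : F := projT1 (cid (of_moduli_ex m)).

Lemma of_moduliP m L : stabm a L -> config m L -> represents (of_moduli m) L.
Proof.
rewrite /of_moduli; case: cid => y [L' rL' cm] sL cL /=.
apply: (rep_of_equiv rL'); apply: equiv_config cm cL; last by case: sL.
by case: (rep_stab rL').
Qed.

Lemma to_moduliK : cancel to_moduli of_moduli.
Proof.
move=> y; have [L rL sL] := rep_ex y; apply: (rep_inj _ rL).
by apply: of_moduliP => //; exact: to_moduliP.
Qed.

Lemma of_moduliK : cancel of_moduli to_moduli.
Proof.
move=> m; have [L sL cL] := conf m.
apply: (config_unique a2 sL) => //; apply: to_moduliP; exact: of_moduliP.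
Qed.

(** On matrices the map is [modpt], and it descends through the two quotients. The quotient by
    change of basis is taken before restricting to the strata, so [tostr] and [PG] extend the map to
    all planes by a default value. *)
Lemma to_moduli_morph : is_morph to_moduli.
Proof.
have gS : good strata by exact: sub_good.
apply: (quot_morph gS gM) => c0.
pose W : set (Gr R n) := [set c | exists2 sigma, sigma \in omega & stratum sigma c].
pose tostr (c : Gr R n) : strata := if pselect (W c) is left h then exist _ c h else c0.
pose PG (c : Gr R n) := to_moduli (class_of torus_equiv (tostr c)).
have PGE (c : strata) : PG (sval c) = to_moduli (class_of torus_equiv c).
  rewrite /PG /tostr; case: pselect => [h|nh]; last by case: nh; exact: svalP.
  by congr (to_moduli (class_of _ _)); exact: sig_eq.
have gF : good (@full_rank R n) by exact/sub_good/aff_good.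
have spl (l : @full_rank R n) : spans (class_of row_equiv l) (sval l).
  by rewrite (_ : l = exist _ (sval l) (svalP l)); [exact: spans_gr|exact: sig_eq].
have WP (l : @full_rank R n) : W (class_of row_equiv l) <-> stabm a (sval l).
  split=> [[sigma so [L sL sE]]|sl].
    have [g ug gE] := spans_equiv sL (spl l); rewrite gE.
    apply: equiv_stabm (mx_equiv_left L ug) _.
    by apply/omegaP; [exact: spans_rank sL|rewrite sE].
  exists (pl_support (sval l)); last by exists (sval l).
  by apply/omegaP => //; exact: (svalP l).
have nst (l : @full_rank R n) : stabm a (sval l) ->
    near_pt l [set l | stabm a (sval l)].
  move=> sl; apply: (near_subP (P := [set L : @aff_space R 2 n | stabm a L])).
  by apply: near_open => //; exact: (stabm_open M a2).
have m00 : M by exact: to_moduli (class_of torus_equiv c0).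
suff mPG : morph_at PG (sval c0).
  have := morph_at_comp (is_morph_at c0 (sval_morph _ gG)) mPG.
  rewrite (_ : PG \o _ = fun c => to_moduli (class_of torus_equiv c)) //.
  by apply/funext => c; rewrite /= PGE.
apply: (@quot_morph_at _ _ _ _ PG W gF gM); last exact: (svalP c0).
  by apply: (open_near gF) => l /WP /nst n1; apply: near_sub n1 _ => l' /WP.
move=> l /WP sl.
have mm := morph_at_comp (is_morph_at l (sval_morph _ (aff_good 2 n))) (modpt_morph a2 m00 sl).
apply: (morph_at_near gF _ mm).
apply: near_sub (nst l sl) _ => l' /= sl'.
have [Wl'] : exists h : W (class_of row_equiv l'), True by have h := (WP l').2 sl'; exists h.
rewrite /PG /tostr; case: pselect => // h _.
apply: (config_unique a2 sl'); first exact: modptP.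
pose cl : strata := exist _ (class_of row_equiv l') h.
apply: to_moduliP; exists cl; last exact: spl.
exact: (torus_equivP (c := cl) (c' := cl) (spl l') (spl l')).2 (mx_equiv_refl _).
Qed.

(** Near [m0] the map sends [m] to the orbit of the regular matrix provided by [moduli_matrix]; [fr]
    and [st] take default values on unstable matrices. *)
Lemma of_moduli_morph (i0 : 'I_n) : is_morph of_moduli.
Proof.
apply/(morph_atP _ gM) => m0.
have [L [rL nL]] := moduli_matrix a2 conf i0 m0.
have [s0 c0] := near_refl nL; have gA := aff_good (R := R) 2 n.
pose fr (A : @aff_space R 2 n) : @full_rank R n :=
  if pselect (stabm a A) is left h then exist _ A (rank_of_stab h)
  else exist _ (L m0) (rank_of_stab s0).
pose st (A : @aff_space R 2 n) : strata :=
  if pselect (stabm a A) is left h then mkst h else mkst s0.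
have stE A : sval (st A) = class_of row_equiv (fr A) by rewrite /st /fr; case: pselect.
have ms : morph_at (fun A => class_of torus_equiv (st A) : F) (L m0).
  apply: (morph_at_comp (f := st)); last exact/is_morph_at/class_of_morph.
  apply: (to_sub_morph_at gA).
  rewrite (_ : (fun _ => _) = class_of row_equiv \o fr); last exact/funext.
  apply: (morph_at_comp (f := fr)); last exact/is_morph_at/class_of_morph.
  apply: (to_sub_morph_at gA).
  apply: (morph_at_near (f := id) gA) => //.
  have n1 : near_pt (L m0 : @aff_space R 2 n) [set A : @aff_space R 2 n | stabm a A].
    by apply: near_open => //; exact: (stabm_open M a2).
  by apply: near_sub n1 _ => A sA; rewrite /= /fr; case: pselect.
have mL : morph_at (L : M -> @aff_space R 2 n) m0 by exact: to_aff_morph_at.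
apply: (morph_at_near gM _ (morph_at_comp mL ms)).
apply: near_sub nL _ => m [sm cm] /=.
apply: (rep_inj (L := L m)); last exact: of_moduliP.
by rewrite /st; case: pselect => // h; exact: rep_mk.
Qed.

End ParamSpace.

(** * Polytopes and chambers *)

Section Polytopes.
Context {R : realType} {n : nat}.
Local Notation C := R[i].
Implicit Types (L : 'M[C]_(2, n)) (z : 'rV[R]_n) (S : {set 'I_n}).

Definition parallel L S := forall i j, i \in S -> j \in S -> pluecker L i j = 0.

Lemma pluecker_diag L i : pluecker L i i = 0.
Proof. by rewrite /pluecker mulrC subrr. Qed.

Lemma pluecker_sym L i j : pluecker L i j = 0 -> pluecker L j i = 0.
Proof. by move=> p; rewrite plueckerC p oppr0. Qed.

Lemma pl_supportP L I : I \in pl_support L <->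
  exists i j, [/\ i != j, I = [set i; j]%SET & pluecker L i j != 0].
Proof.
rewrite inE; split=> [/existsP[i /existsP[j /andP[/eqP -> ij]]]|[i [j [_ -> ij]]]].
  exists i, j; split=> //; apply: contraNneq ij => ->; by rewrite pluecker_diag.
by apply/existsP; exists i; apply/existsP; exists j; rewrite eqxx.
Qed.

(** When the columns are nonzero, these are the inequalities of the rank two matroid polytope of
    [L], a parallel set having rank one. *)
Definition balanced L z := [/\ \sum_i z 0 i = 2, forall i, 0 <= z 0 i
  & forall S, parallel L S -> \sum_(i in S) z 0 i <= 1].

Definition fractional z : {set 'I_n} := [set i | 0 < z 0 i < 1]%SET.

Lemma balanced_le1 L z i : balanced L z -> z 0 i <= 1.
Proof.
move=> [_ _ /(_ [set i]%SET)]; rewrite big_set1; apply => j k; rewrite !inE => /eqP -> /eqP ->.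
exact: pluecker_diag.
Qed.

Lemma not_fractional L z i : balanced L z -> i \notin fractional z -> z 0 i = 0 \/ z 0 i = 1.
Proof.
move=> bz; have z1 := balanced_le1 i bz; have [_ /(_ i) z0 _] := bz.
rewrite inE negb_and -!leNgt => /orP[h|h]; [left|right]; apply/eqP; rewrite eq_le.
  by rewrite h.
by rewrite z1.
Qed.

(** Weight moves from [j] to [i] by the largest amount that keeps both coordinates in the unit
    interval, so that one of them becomes integral. *)
Definition shift z i j : 'rV[R]_n :=
  z + Num.min (1 - z 0 i) (z 0 j) *: (delta_mx 0 i - delta_mx 0 j).

Lemma sum_delta S i : \sum_(k in S) (delta_mx 0 i : 'rV[R]_n) 0 k = (i \in S)%:R.
Proof.
rewrite (eq_bigr (fun k => (k == i)%:R)) => [|k _]; last by rewrite mxE eqxx.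
by rewrite big_mkcond /= (bigD1 i) //= eqxx big1 ?addr0 => [|k /negbTE ->]; case: ifP.
Qed.

Lemma sum_line S z t i j :
  \sum_(k in S) (z + t *: (delta_mx 0 i - delta_mx 0 j)) 0 k
  = \sum_(k in S) z 0 k + t * ((i \in S)%:R - (j \in S)%:R).
Proof.
rewrite -!sum_delta -sumrB mulr_sumr -big_split /=; apply: eq_bigr => k _.
by rewrite !mxE.
Qed.

Lemma sum_setT z : \sum_(k in [set: 'I_n]%SET) z 0 k = \sum_k z 0 k.
Proof. by apply: eq_bigl => k; rewrite inE. Qed.

Lemma lineE z t i j k :
  (z + t *: (delta_mx 0 i - delta_mx 0 j)) 0 k = z 0 k + t * ((k == i)%:R - (k == j)%:R).
Proof. by rewrite !mxE eqxx. Qed.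

(** Only parallel sets with [i] and without [j] are at risk. If [i] and [j] are parallel, adding [j]
    to the set bounds the new sum. Otherwise the other members of the set have integral coordinates,
    which are zero because [z 0 i] is positive. *)
Lemma balanced_shift L z i j : col i L != 0 -> balanced L z -> i != j ->
  i \in fractional z -> j \in fractional z ->
  pluecker L i j = 0 \/
    (forall k, k \in fractional z -> k != i -> pluecker L i k != 0) ->
  balanced L (shift z i j) /\ (#|fractional (shift z i j)| < #|fractional z|)%N.
Proof.
move=> Li bz ij fi fj cas; have [z2 z0 zS] := bz.
have /andP[zi zi1] : 0 < z 0 i < 1 by move: fi; rewrite inE.
have /andP[zj zj1] : 0 < z 0 j < 1 by move: fj; rewrite inE.
rewrite /shift; set t := Num.min _ _.
have t0 : 0 < t by rewrite lt_min subr_gt0 zi1.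
have ti : t <= 1 - z 0 i by rewrite ge_min lexx.
have tj : t <= z 0 j by rewrite ge_min lexx orbT.
set z' := z + _.
have z'i : z' 0 i = z 0 i + t by rewrite lineE eqxx (negbTE ij) subr0 mulr1.
have z'j : z' 0 j = z 0 j - t by rewrite lineE eqxx eq_sym (negbTE ij) sub0r mulrN1.
have z'k k : k != i -> k != j -> z' 0 k = z 0 k.
  by move=> /negbTE ki /negbTE kj; rewrite lineE ki kj subrr mulr0 addr0.
have z'0 k : 0 <= z' 0 k.
  case: (eqVneq k i) => [->|ki]; first by rewrite z'i addr_ge0 // ltW.
  by case: (eqVneq k j) => [->|kj]; [rewrite z'j subr_ge0|rewrite z'k].
split; first split=> //.
- have := sum_line [set: 'I_n]%SET z t i j; rewrite !inE subrr mulr0 addr0.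
  by rewrite !sum_setT => ->.
- move=> S pS; rewrite sum_line; case: (boolP (i \in S)) => iS; last first.
    apply: le_trans (zS S pS); rewrite sub0r mulrN gerBl.
    by rewrite mulr_ge0 // ltW.
  case: (boolP (j \in S)) => jS; first by rewrite subrr mulr0 addr0; exact: zS.
  rewrite subr0 mulr1; case: cas => [pij|cas].
    have pS' : parallel L (j |: S)%SET.
      have pi k : k \in (j |: S)%SET -> pluecker L i k = 0.
        by rewrite !inE => /orP[/eqP -> //|kS]; exact: pS.
      by move=> k l /pi pk /pi pl; exact: parallel_trans Li pk pl.
    have := zS _ pS'; rewrite big_setU1 //= addrC; apply: le_trans.
    by rewrite lerD2l.
  rewrite (big_setD1 i) //= big1 ?addr0; first by rewrite -lerBrDl.
  move=> k; rewrite !inE => /andP[ki kS].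
  have nf : k \notin fractional z.
    apply/negP => kf; move/eqP: (cas k kf ki); apply; exact: pS.
  case: (not_fractional bz nf) => // zk.
  have := zS [set i; k]%SET; rewrite big_setU1 ?inE 1?eq_sym // big_set1 zk.
  rewrite gerDr leNgt zi => /(_ _)/negP[] //.
  by move=> u v; rewrite !inE => /orP[] /eqP -> /orP[] /eqP ->; exact: pS.
have sub : (fractional z' \subset fractional z)%SET.
  apply/fintype.subsetP => k; case: (eqVneq k i) => [-> //|ki].
  by case: (eqVneq k j) => [-> //|kj]; rewrite !inE z'k.
apply: proper_card; rewrite finset.properEneq sub andbT; apply/eqP => e.
have : (i \in fractional z') && (j \in fractional z') by rewrite e fi.
rewrite !inE z'i z'j /t; case: (leP (1 - z 0 i) (z 0 j)) => h.
  by rewrite addrC subrK ltxx andbF.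
by rewrite subrr ltxx andbF.
Qed.

Lemma polytope_convex (sigma : pluecker_set n) (x y : 'rV[R]_n) (s : R) : 0 <= s <= 1 ->
  polytope sigma x -> polytope sigma y -> polytope sigma (s *: x + (1 - s) *: y).
Proof.
move=> /andP[s0 s1] [c [c0 c1 ->]] [d [d0 d1 ->]].
exists (fun I => s * c I + (1 - s) * d I); split.
- by move=> I; rewrite addr_ge0 // mulr_ge0 // subr_ge0.
- by rewrite big_split /= -!mulr_sumr c1 d1 !mulr1 addrC subrK.
rewrite !scaler_sumr -big_split /=; apply: eq_bigr => I _.
by rewrite !scalerA -scalerDl.
Qed.

Lemma polytope_vertex (sigma : pluecker_set n) I : I \in sigma -> polytope (R := R) sigma (Lambda I).
Proof.
move=> Is; exists (fun J => (J == I)%:R); split.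
- by move=> J; rewrite ler0n.
- by rewrite (bigD1 I) //= eqxx big1 ?addr0 // => J /andP[_ /negbTE ->].
rewrite (bigD1 I) //= eqxx scale1r big1 ?addr0 // => J /andP[_ /negbTE ->].
by rewrite scale0r.
Qed.

Lemma sum_integral z (D : {set 'I_n}) : (forall i, i \notin D -> z 0 i = 0 \/ z 0 i = 1) ->
  \sum_i z 0 i = \sum_(i in D) z 0 i + #|[set i | (i \notin D) && (z 0 i == 1)]%SET|%:R.
Proof.
move=> h; rewrite (bigID (mem D)) /=; congr (_ + _).
rewrite -sum1_card natr_sum big_mkcond [RHS]big_mkcond /=; apply: eq_bigr => i _.
rewrite inE; case: ifP => //= iD; have [->|->] := h i iD; last by rewrite eqxx.
by rewrite eq_sym oner_eq0.
Qed.

(** Extreme points of the region cut out by the parallel classes are integral: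
    transferring weight between two fractional coordinates, in both directions
    until a coordinate becomes integral, writes any other point as a convex
    combination. *)
Lemma balanced_polytope L z : (forall i, col i L != 0) -> balanced L z ->
  polytope (pl_support L) z.
Proof.
move=> Lc; have [N] := ubnP #|fractional z|; elim: N z => // N IH z; rewrite ltnS => zN bz.
have [z2 z0 zS] := bz.
case: (pickP (mem (fractional z))) => [i /= fi|f0]; last first.
  have nf i : i \notin fractional z by rewrite -[_ \in _]/(mem (fractional z) i) f0.
  have := sum_integral (z := z) (D := finset.set0) (fun i _ => not_fractional bz (nf i)).
  rewrite z2 big_set0 add0r => /esym/eqP; rewrite eqr_nat => /cards2P[u [v [ij e]]].
  have zE : z = Lambda [set u; v]%SET.
    apply/rowP => k; rewrite mxE -e !inE.
    by have [->|->] := not_fractional bz (nf k); rewrite ?eqxx // eq_sym oner_eq0.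
  rewrite zE; apply: polytope_vertex; apply/pl_supportP; exists u, v; split=> //.
  apply/eqP => pij; have := zS [set u; v]%SET; rewrite zE.
  rewrite big_setU1 ?inE //= big_set1 !mxE !inE !eqxx orbT.
  have := ler1n R 2; rewrite -[1 + 1]/(2 : R) => _ /(_ _); rewrite leNgt ltr1n => /(_ _)/negP[] //.
  move=> k l; rewrite !inE => /orP[] /eqP -> /orP[] /eqP ->; rewrite ?pluecker_diag //.
  exact: pluecker_sym.
(* A parallel pair of fractional coordinates is taken if there is one, otherwise any pair. A single
   fractional coordinate is excluded because the total is the integer [2]. *)
have [j [i' [ij fi' fj cas]]] : exists j i', [/\ i' != j, i' \in fractional z, j \in fractional z &
   pluecker L i' j = 0 \/ forall k l, k \in fractional z -> l \in fractional z -> k != l ->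
     pluecker L k l != 0].
  have [[j [i' [ij fi' fj p]]]|nex] := pselect (exists j i', [/\ i' != j, i' \in fractional z,
      j \in fractional z & pluecker L i' j = 0]); first by exists j, i'; split=> //; left.
  have [[j [ij fj]]|nj] := pselect (exists j, i != j /\ j \in fractional z).
    exists j, i; split=> //; right=> k l fk fl kl; apply/eqP => p.
    by apply: nex; exists l, k.
  exfalso; have nf k : k \notin [set i]%SET -> z 0 k = 0 \/ z 0 k = 1.
    rewrite inE => ki; apply: (not_fractional bz); apply/negP => kf; apply: nj; exists k.
    by rewrite eq_sym.
  have := sum_integral nf; rewrite z2 big_set1; set m := #|_|%SET => e.
  move: fi; rewrite inE (_ : z 0 i = 2 - m%:R); last by rewrite e addrK.
  rewrite subr_gt0 ltrBlDr -[1 + _](natrD R 1%N m) !ltr_nat; lia.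
have cas1 : pluecker L i' j = 0 \/
    (forall k, k \in fractional z -> k != i' -> pluecker L i' k != 0).
  by case: cas => [p|h]; [left|right=> k fk ki; apply: h => //; rewrite eq_sym].
have cas2 : pluecker L j i' = 0 \/
    (forall k, k \in fractional z -> k != j -> pluecker L j k != 0).
  by case: cas => [p|h]; [left; exact: pluecker_sym|right=> k fk ki; apply: h => //; rewrite eq_sym].
have [b1 n1] := balanced_shift (Lc i') bz ij fi' fj cas1.
have ji : j != i' by rewrite eq_sym.
have [b2 n2] := balanced_shift (Lc j) bz ji fj fi' cas2.
have /= p1 := IH _ (leq_trans n1 zN) b1; have p2 := IH _ (leq_trans n2 zN) b2.
move: p1 p2; rewrite /shift; set t := Num.min _ _; set t' := Num.min _ _ => p1 p2.
move: fi' fj; rewrite !inE => /andP[zi zi1] /andP[zj zj1].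
have t0 : 0 < t by rewrite lt_min subr_gt0 zi1.
have t'0 : 0 < t' by rewrite lt_min subr_gt0 zj1.
have tt : t + t' != 0 by rewrite gt_eqF // addr_gt0.
have s01 : 0 <= t' / (t + t') <= 1.
  have s0 : 0 < t + t' by exact: addr_gt0.
  apply/andP; split; first by rewrite divr_ge0 // ltW.
  by rewrite ler_pdivrMr // mul1r lerDr ltW.
have := polytope_convex s01 p1 p2; congr (polytope _ _).
apply/rowP => k; rewrite [LHS]mxE [X in X + _]mxE [X in _ + X]mxE !lineE.
by field.
Qed.

End Polytopes.

Section Chambers.
Context {R : realType} {n : nat}.
Local Notation C := R[i].
Implicit Types (L : 'M[C]_(2, n)) (y z : 'rV[R]_n) (S : {set 'I_n}) (sigma : pluecker_set n).

Lemma row_norm_ltP z e : 0 < e -> `|z| < e <-> forall i, `|z 0 i| < e.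
Proof.
move=> e0; rewrite [`|z|]mx_normrE; split=> [/bigmax_ltP[_ h] i|h].
  exact: (h (0, i)).
by apply/bigmax_ltP; split=> // -[i j] _; rewrite (ord1 i).
Qed.

Lemma positive_lower_bound (I : finType) (f : I -> R) : (forall i, 0 < f i) ->
  exists2 e, 0 < e & forall i, e <= f i.
Proof.
move=> f0; exists (\big[Num.min/1]_i f i); first by apply/lt_bigmin.
by move=> i; exact: bigmin_le_cond.
Qed.

Lemma sum_close y z S e : (forall i, `|z 0 i - y 0 i| <= e) ->
  `|\sum_(i in S) z 0 i - \sum_(i in S) y 0 i| <= n%:R * e.
Proof.
move=> h; rewrite -sumrB; apply: le_trans (ler_norm_sum _ _ _) _.
rewrite big_mkcond /= -[n in n%:R]card_ord mulr_natl -sumr_const.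
apply: ler_sum => i _; case: ifP => _; first exact: h.
by apply: le_trans (h i).
Qed.

Lemma sg_close (u v : R) : `|u - v| < `|v| -> Num.sg u = Num.sg v.
Proof.
have [v0|v0|->] := ltgtP v 0; last by rewrite normr0 ltNge normr_ge0.
  by rewrite (ltr0_norm v0) ltr_norml => /andP[_ h]; rewrite !ltr0_sg //; lra.
by rewrite (gtr0_norm v0) ltr_norml => /andP[h _]; rewrite !gtr0_sg //; lra.
Qed.

Lemma wall_sign_lt z S : (wall_sign z S == -1) = (\sum_(i in S) z 0 i < 1).
Proof. by rewrite /wall_sign sgr_cp0 subr_lt0. Qed.

Lemma wall_sign0 z S : (wall_sign z S == 0) = (\sum_(i in S) z 0 i == 1).
Proof. by rewrite /wall_sign sgr_eq0 subr_eq0. Qed.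

(** Finitely many positive quantities have a positive lower bound [e]. It is divided by [n + 2]
    because a wall sum adds up at most [n] errors and the result has to stay strictly below [e]. *)
Lemma sign_stable y : exists2 e, 0 < e & forall z, (forall i, `|z 0 i - y 0 i| <= e) ->
  (forall i, 0 < y 0 i -> 0 < z 0 i) /\
  forall S, \sum_(i in S) y 0 i != 1 -> wall_sign z S = wall_sign y S.
Proof.
pose f (x : {set 'I_n} + 'I_n) : R := match x with
  | inl T => if \sum_(i in T) y 0 i == 1 then 1 else `|\sum_(i in T) y 0 i - 1|
  | inr i => if 0 < y 0 i then y 0 i else 1 end.
have [|e e0 ef] := @positive_lower_bound _ f.
  by case=> [S|i] /=; case: ifPn => // h; rewrite normr_gt0 subr_eq0.
have n1 : 0 < n.+2%:R :> R by rewrite ltr0n.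
have ne : n%:R * (e / n.+2%:R) < e.
  by rewrite mulrCA gtr_pMr // ltr_pdivrMr // mul1r ltr_nat ltnW.
have en : e / n.+2%:R < e by rewrite gtr_pMr // invf_lt1 // ltr1n.
exists (e / n.+2%:R); first by rewrite divr_gt0.
move=> z zy; split=> [i yi|S yS].
  have := le_lt_trans (zy i) en; have := ef (inr i); rewrite /= yi ltr_norml => h /andP[h1 _].
  lra.
apply: sg_close; have := ef (inl S); rewrite /= (negbTE yS) => h.
apply: lt_le_trans h; apply: le_lt_trans ne; rewrite opprB addrA subrK; exact: sum_close.
Qed.

Lemma Lambda_sum (sigma : pluecker_set n) (c : {set 'I_n} -> R) S :
  \sum_(i in S) (\sum_(I in sigma) c I *: Lambda I : 'rV[R]_n) 0 i
  = \sum_(I in sigma) c I * #|I :&: S|%SET%:R.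
Proof.
under eq_bigr do rewrite summxE.
rewrite exchange_big; apply: eq_bigr => I _ /=.
under eq_bigr do rewrite !mxE; rewrite -mulr_sumr; congr (_ * _).
rewrite -sum1_card natr_sum big_mkcond [RHS]big_mkcond /=; apply: eq_bigr => i _.
by rewrite inE; case: (i \in I) => //=; case: ifP.
Qed.

Lemma affine_hull_sum L y : affine_hull (pl_support L) y -> \sum_i y 0 i = 2.
Proof.
move=> [c [c1 ->]]; rewrite -sum_setT Lambda_sum.
rewrite (eq_bigr (fun I => c I * 2)) => [|I /pl_supportP[i [j [ij -> _]]]].
  by rewrite -mulr_suml c1 mul1r.
by rewrite finset.setIT cards2 ij.
Qed.

Lemma parallel_card L S I : parallel L S -> I \in pl_support L -> (#|I :&: S|%SET <= 1)%N.
Proof.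
move=> pS /pl_supportP[i [j [ij -> p]]]; rewrite leqNgt; apply/negP => h.
have /card_gt1P[u [v []]] := h; rewrite !inE => /andP[ui uS] /andP[vi vS] uv.
have puv := pS _ _ uS vS; case/negP: p; apply/eqP.
by move: ui vi uv puv => /orP[] /eqP -> /orP[] /eqP ->; rewrite ?eqxx // => _; exact: pluecker_sym.
Qed.

Lemma affine_hull_line sigma d (x : 'rV[R]_n) (M : 'M[R]_(d, n)) (u : 'rV[R]_d) :
  affine_hull sigma x -> (forall i, affine_hull sigma (x + row i M)) ->
  affine_hull sigma (x + u *m M).
Proof.
move=> [c [c1 xE]] h.
have [e [e1 eE]] : exists e : 'I_d -> {set 'I_n} -> R, (forall i, \sum_(I in sigma) e i I = 1) /\
    forall i, x + row i M = \sum_(I in sigma) e i I *: Lambda I.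
  by exists (fun i => projT1 (cid (h i))); split=> i; case: cid => e [].
exists (fun I => c I + \sum_i u 0 i * (e i I - c I)); split.
  rewrite big_split /= c1 exchange_big big1 ?addr0 //= => i _.
  by rewrite -mulr_sumr sumrB e1 c1 subrr mulr0.
rewrite (eq_bigr (fun I => c I *: Lambda I + \sum_i u 0 i *: ((e i I - c I) *: Lambda I))).
  rewrite big_split /= -xE; congr (_ + _); rewrite mulmx_sum_row exchange_big.
  apply: eq_bigr => i _ /=; rewrite -scaler_sumr; congr (_ *: _).
  under eq_bigr do rewrite scalerBl.
  by rewrite sumrB -eE -xE addrC addKr.
by move=> I _; rewrite scalerDl scaler_suml; under [in RHS]eq_bigr do rewrite scalerA.
Qed.

Hypothesis n0 : (0 < n)%N.

(** The rows of [M] lie in the kernel of the all-ones column, whose rank is also [n - 1]. *)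
Lemma frame_full (x : 'rV[R]_n) (M : 'M[R]_(n.-1, n)) : \sum_i x 0 i = 2 ->
  (forall i, \sum_j (x + row i M) 0 j = 2) -> row_free M ->
  forall z : 'rV[R]_n, \sum_i z 0 i = 0 -> (z <= M)%MS.
Proof.
move=> x2 xM fM z z0; pose one : 'cV[R]_n := const_mx 1.
have oneE d (A : 'M[R]_(d, n)) i j : (A *m one) i j = \sum_k A i k.
  by rewrite mxE; apply: eq_bigr => k _; rewrite mxE mulr1.
have Mk : (M <= kermx one)%MS.
  apply/sub_kermxP/matrixP => i j; rewrite oneE mxE.
  have := xM i; under eq_bigr do rewrite mxE; rewrite big_split /= x2.
  move/eqP; rewrite -subr_eq0 addrAC subrr add0r => /eqP {2}<-.
  by apply: eq_bigr => k _; rewrite mxE.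
have zk : (z <= kermx one)%MS.
  by apply/sub_kermxP/matrixP => i j; rewrite oneE mxE (ord1 i).
have [_] := mxrank_leqif_sup Mk; move: fM; rewrite /row_free => /eqP ->.
have -> : mxrank (kermx one) = n.-1.
  rewrite mxrank_ker (_ : mxrank one = 1%N) ?subn1 //.
  apply/eqP; rewrite eqn_leq rank_leq_col lt0n mxrank_eq0.
  by apply/eqP => /matrixP/(_ (Ordinal n0) 0); rewrite !mxE => /eqP; rewrite oner_eq0.
by rewrite eqxx => /esym kM; exact: submx_trans zk kM.
Qed.

End Chambers.

(** * Chambers of maximal dimension *)

Section MaximalChamber.
Context {R : realType} {n : nat}.
Local Notation C := R[i].
Implicit Types (L : 'M[C]_(2, n)) (y z : 'rV[R]_n) (S : {set 'I_n}) (sigma : pluecker_set n).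
Hypothesis n3 : (3 <= n)%N.
Variable omega : {set pluecker_set n}.
Hypothesis maxo : is_max_chamber R omega.

Let n0 : (0 < n)%N := leq_trans (isT : (1 <= 3)%N) n3.

(** The counterpart of [stabm] for the real weights given by a point of the hypersimplex. The
    inequality is strict, as relative interiors of polytopes require. *)
Definition stable_at L y := (forall i, col i L != 0) /\
  forall S, parallel L S -> \sum_(i in S) y 0 i < 1.

Lemma admissible_ex sigma : is_admissible (R := R) sigma ->
  exists2 L : 'M[C]_(2, n), mxrank L = 2%N & pl_support L = sigma.
Proof. by move=> [c [L sL sE]]; exists L => //; exact: spans_rank sL. Qed.

Lemma omega_ex sigma : sigma \in omega -> exists2 L : 'M[C]_(2, n), mxrank L = 2%N & pl_support L = sigma.
Proof. by have [[adm _ _] _] := maxo => /adm; exact: admissible_ex. Qed.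

Lemma admissible_support L : mxrank L = 2%N -> is_admissible (R := R) (pl_support L).
Proof. by move=> rL; exists (gr rL), L => //; exact: spans_gr. Qed.

(** The chamber of the empty set would be the whole space, of dimension [n] instead of [n - 1]. *)
Lemma omega_neq0 : exists sigma, sigma \in omega.
Proof.
apply: contrapT => /forallNP h; have [_ [_]] := maxo; apply.
have cT y : chamber (R := R) omega y by move=> sigma /h.
have cast d (e : n = d) : row_free (castmx (e, erefl n) (1%:M : 'M[R]_n)).
  by case: _ / e; rewrite castmx_id row_free_unit unitmx1.
by exists 0, (castmx (esym (prednK n0), erefl) 1%:M).
Qed.

Lemma chamber_hull sigma y : sigma \in omega -> chamber (R := R) omega y ->
  affine_hull sigma y.
Proof.
by move=> so /(_ _ so)[[c [_ c1 ->]] _]; exists c.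
Qed.

Lemma chamber_sum y : chamber omega y -> \sum_i y 0 i = 2.
Proof.
have [sigma so] := omega_neq0; move=> /(chamber_hull so).
have [L _ <-] := omega_ex so; exact: affine_hull_sum.
Qed.

Lemma chamber_frame : exists (x : 'rV[R]_n) (M : 'M[R]_(n.-1, n)),
  [/\ chamber omega x, forall i, chamber omega (x + row i M) &
      forall z, \sum_i z 0 i = 0 -> (z <= M)%MS].
Proof.
have [_ [[x [M [cx cM fM]]] _]] := maxo; exists x, M; split=> //.
apply: (frame_full n0 (x := x)) => //; first exact: chamber_sum.
by move=> i; apply: chamber_sum; exact: cM.
Qed.

(** The affine hull contains the chamber, which already spans the hyperplane of vectors of sum
    [2]. *)
Lemma hull_full sigma z : sigma \in omega -> \sum_i z 0 i = 2 -> affine_hull sigma z.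
Proof.
move=> so z2; have [x [M [cx cM full]]] := chamber_frame.
have /submxP[u uE] : (z - x <= M)%MS.
  apply: full; under eq_bigr do rewrite !mxE.
  by rewrite sumrB z2 chamber_sum // subrr.
have := affine_hull_line u (chamber_hull so cx) (fun i => chamber_hull so (cM i)).
by rewrite -uE addrC subrK.
Qed.

Lemma line_norm t (i j : 'I_n) : 0 < t -> `|t *: (delta_mx 0 i - delta_mx 0 j) : 'rV[R]_n| < t * 2.
Proof.
move=> t0; apply/row_norm_ltP => [|k]; first by rewrite mulr_gt0.
rewrite !mxE eqxx /= normrM gtr0_norm // ltr_pM2l //.
by case: (k == i); case: (k == j); rewrite ?subrr ?subr0 ?sub0r ?normrN ?normr0 ?normr1 ?ltr1n ?ltr0n.
Qed.

Lemma polytope_line sigma y i j : sigma \in omega -> polytope_int sigma y ->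
  exists2 t, 0 < t & polytope sigma (y + t *: (delta_mx 0 i - delta_mx 0 j) : 'rV[R]_n).
Proof.
move=> so [py [e e0 he]]; exists (e / 2); first by rewrite divr_gt0.
apply: he; last first.
  by rewrite addrAC subrr add0r; apply: lt_le_trans (line_norm _ _ _) _; rewrite ?divr_gt0 // divfK.
apply: (hull_full so).
have y2 : \sum_i y 0 i = 2.
  have [L _ e'] := omega_ex so; apply: (affine_hull_sum (L := L)); rewrite e'.
  by case: py => c [_ c1 ->]; exists c.
rewrite -sum_setT sum_line sum_setT y2 !inE subrr mulr0; ring.
Qed.

Lemma polytope_ge0 sigma (y : 'rV[R]_n) i : polytope sigma y -> 0 <= y 0 i.
Proof.
move=> [c [c0 _ ->]]; rewrite summxE; apply: sumr_ge0 => I _.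
by rewrite !mxE mulr_ge0.
Qed.

Lemma polytope_parallel L S y : parallel L S -> polytope (pl_support L) y ->
  \sum_(i in S) y 0 i <= 1.
Proof.
move=> pS [c [c0 c1 ->]]; rewrite Lambda_sum -[leRHS]c1; apply: ler_sum => I Is.
by rewrite ler_piMr // lern1 (parallel_card pS).
Qed.

Lemma other_index (i : 'I_n) : exists j : 'I_n, j != i.
Proof.
have n1 : (1 < n)%N by apply: leq_trans n3.
case: (eqVneq i (Ordinal n0)) => [->|h]; first by exists (Ordinal n1).
by exists (Ordinal n0); rewrite eq_sym.
Qed.

(** The inequalities are strict at [y], so they persist at nearby points of the affine hull, where
    [balanced_polytope] turns them back into membership. *)
Lemma stable_interior L y : stable_at L y -> \sum_i y 0 i = 2 -> (forall i, 0 < y 0 i) ->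
  polytope_int (pl_support L) y.
Proof.
move=> [Lc yS] y2 y0.
have bal z : \sum_i z 0 i = 2 -> (forall i, 0 <= z 0 i) ->
    (forall S, parallel L S -> \sum_(i in S) z 0 i <= 1) -> polytope (pl_support L) z.
  by move=> z2 z0 zS; apply: balanced_polytope.
split; first by apply: bal => // [i|S pS]; apply: ltW; [exact: y0|exact: yS].
have [e e0 he] := sign_stable y; exists e => // z hz /(row_norm_ltP _ e0) zy.
have [i|z0 zS] := he z; first by have := zy i; rewrite !mxE => /ltW.
apply: bal; first exact: affine_hull_sum hz.
  by move=> i; exact/ltW/z0.
move=> S pS; apply: ltW; have yS1 := yS S pS; rewrite -wall_sign_lt zS ?wall_sign_lt //.
by rewrite lt_eqF.
Qed.

(** From an interior point one can move a little along every [delta_i - delta_j] inside the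
    polytope, which makes its inequalities strict at that point. *)
Lemma interior_stable L y : pl_support L \in omega -> polytope_int (pl_support L) y ->
  stable_at L y /\ forall i, 0 < y 0 i.
Proof.
move=> Lo yi; have [py _] := yi.
have y0 i : 0 < y 0 i.
  have [j ji] := other_index i; have [t t0 pt] := polytope_line j i Lo yi.
  have := polytope_ge0 i pt; rewrite lineE eqxx eq_sym (negbTE ji) sub0r mulrN1 subr_ge0.
  exact: lt_le_trans.
split=> //; split=> [i|S pS].
  (* If column [i] were zero, no vertex of the polytope would involve [i]; but the affine hull is
     the whole hyperplane and contains [2 *: delta_mx 0 i]. *)
  apply: contraT => /negPn/eqP Li0.
  have hz : affine_hull (pl_support L) (2 *: delta_mx 0 i : 'rV[R]_n).
    apply: hull_full => //; rewrite -sum_setT.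
    under eq_bigr do rewrite mxE; by rewrite -mulr_sumr sum_delta inE mulr1.
  have [c [_ /rowP/(_ i)]] := hz.
  rewrite summxE big1 => [/eqP|I /pl_supportP[u [v [uv -> p]]]].
    by rewrite !mxE !eqxx mulr1 pnatr_eq0.
  have Lr r : L r i = 0 by move/colP/(_ r): Li0; rewrite !mxE.
  rewrite !mxE !inE; case: eqP => [iu|_]; last case: eqP => [iv|_]; last by rewrite mulr0.
    by move: p; rewrite -iu /pluecker !Lr mul0r mulr0 subrr eqxx.
  by move: p; rewrite -iv /pluecker !Lr mulr0 mul0r subrr eqxx.
case: (finset.set_0Vmem S) => [->|[i iS]]; first by rewrite big_set0 ltr01.
case: (boolP ([set: 'I_n]%SET \subset S)) => [|/subsetPn[j _ jS]].
  rewrite finset.subTset => /eqP SE; have := polytope_parallel pS py; rewrite SE sum_setT.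
  have /affine_hull_sum -> : affine_hull (pl_support L) y by case: py => c [_ c1 e]; exists c.
  by rewrite leNgt ltr1n.
have [t t0 pt] := polytope_line i j Lo yi.
have := polytope_parallel pS pt; rewrite sum_line iS (negbTE jS) subr0 mulr1.
by apply: lt_le_trans; rewrite ltrDl.
Qed.

(** An admissible set outside [omega] has a polytope whose interior misses the chamber, while
    stability puts [y] into that interior. *)
Lemma omega_mem L y : mxrank L = 2%N -> chamber omega y ->
  pl_support L \in omega <-> stable_at L y.
Proof.
move=> rL cy; split=> [Lo|sL].
  by have [] := interior_stable Lo (cy _ Lo).
apply: contrapT => /negP nL.
have [[_ _ /(_ _ (admissible_support rL) nL) h] _] := maxo.
suff : (@set0 'rV[R]_n) y by [].
rewrite -h; split=> //; apply: stable_interior => //; first exact: chamber_sum.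
move=> i; have [sigma so] := omega_neq0; have [L' _ e] := omega_ex so.
rewrite -e in so; by have [_] := interior_stable so (cy _ so).
Qed.

Lemma chamber_pos y i : chamber omega y -> 0 < y 0 i.
Proof.
move=> cy; have [sigma so] := omega_neq0; have [L' _ e] := omega_ex so.
by rewrite -e in so; have [_] := interior_stable so (cy _ so).
Qed.

Lemma chamber_lt1 y i : chamber omega y -> y 0 i < 1.
Proof.
move=> cy; have [sigma so] := omega_neq0; have [L' _ e] := omega_ex so.
rewrite -e in so; have [[_ h] _] := interior_stable so (cy _ so).
have := h [set i]%SET; rewrite big_set1; apply=> u v; rewrite !inE => /eqP -> /eqP ->; exact: pluecker_diag.
Qed.

(** A plane whose nontrivial parallel sets are the subsets of [S]. *)
Definition parallel_plane S : 'M[C]_(2, n) :=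
  \matrix_(r, i) if i \in S then (r == 0)%:R else if r == 0 then (i : nat)%:R else 1.

Lemma parallel_planeP S i j : pluecker (parallel_plane S) i j = 0 <->
  i = j \/ (i \in S /\ j \in S).
Proof.
rewrite /pluecker !mxE /=; case: (boolP (i \in S)) => iS; case: (boolP (j \in S)) => jS;
  rewrite ?(mulr1, mulr0, mul0r, mul1r, subrr, subr0, sub0r); split=> //; try by right.
- by move/eqP; rewrite oner_eq0.
- by case=> [ij|[]//]; move: iS jS; rewrite ij => ->.
- by move/eqP; rewrite oppr_eq0 oner_eq0.
- by case=> [ij|[]//]; move: iS jS; rewrite ij => /negbTE ->.
- by move/eqP; rewrite subr_eq0 eqr_nat => /eqP /val_inj; left.
by case=> [->|[]//]; rewrite subrr.
Qed.

(** The left side does not involve [y]: the side of the wall on which a point lies is therefore the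
    same all over the chamber. *)
Lemma parallel_plane_mem S y : S != finset.set0 -> S != [set: 'I_n]%SET -> chamber omega y ->
  pl_support (parallel_plane S) \in omega <-> \sum_(i in S) y 0 i < 1.
Proof.
move=> /set0Pn[i iS]; rewrite -finset.subTset => /subsetPn[j _ jS] cy.
have pij : pluecker (parallel_plane S) i j != 0.
  by apply/eqP => /parallel_planeP[e|[_ /negPn]]; [move: jS; rewrite -e iS|rewrite jS].
rewrite (omega_mem (rank2_pluecker pij) cy); split=> [[_]|h].
  by apply=> u v uS vS; apply/parallel_planeP; right.
split=> [k|T pT].
  apply/col_neq0; case: (boolP (k \in S)) => kS; [exists 0|exists 1]; rewrite mxE.
    by rewrite kS oner_eq0.
  by rewrite (negbTE kS) oner_eq0.
case: (boolP (T \subset S)) => [TS|].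
  apply: le_lt_trans h; rewrite [leRHS](big_setID T) /= (finset.setIidPr TS) lerDl.
  by apply: sumr_ge0 => k _; exact/ltW/chamber_pos.
move=> /subsetPn[k kT kS].
rewrite (_ : T = [set k]%SET) ?big_set1; first exact: chamber_lt1.
apply/setP => l; rewrite inE; apply/idP/eqP => [lT|->//].
by have /parallel_planeP[//|[]] := pT l k lT kT; rewrite (negbTE kS).
Qed.

(** If the sum over [S] were [1] at [y], neither [S] nor its complement could have weight below [1]
    anywhere in the chamber. The total being [2], the whole chamber would lie on the wall, against
    its dimension. *)
Lemma chamber_off_wall y S : S != finset.set0 -> S != [set: 'I_n]%SET -> chamber omega y ->
  \sum_(i in S) y 0 i != 1.
Proof.
move=> S0 ST cy; apply/eqP => y1.
have S0' : (~: S != finset.set0)%SET by rewrite -(inj_eq (@finset.setC_inj _)) finset.setCK finset.setC0.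
have ST' : (~: S != [set: 'I_n])%SET by rewrite -(inj_eq (@finset.setC_inj _)) finset.setCK finset.setCT.
have sC z : chamber omega z -> \sum_(i in (~: S)%SET) z 0 i = 2 - \sum_(i in S) z 0 i.
  move=> /chamber_sum; rewrite (bigID (mem S)) /= => <-; rewrite addrAC subrr add0r.
  by apply: eq_bigl => k; rewrite inE.
have all1 z : chamber omega z -> \sum_(i in S) z 0 i = 1.
  move=> cz; have h1 := parallel_plane_mem S0 ST; have h2 := parallel_plane_mem S0' ST'.
  have /negP : ~ (\sum_(i in S) z 0 i < 1) by move=> /(h1 _ cz)/(h1 _ cy); rewrite y1 ltxx.
  have /negP : ~ (\sum_(i in (~: S)%SET) z 0 i < 1).
    by move=> /(h2 _ cz)/(h2 _ cy); rewrite (sC y cy) y1; lra.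
  by rewrite (sC z cz); lra.
have [x [M [cx cM full]]] := chamber_frame.
have [i iS] := set0Pn _ S0; move: ST; rewrite -finset.subTset => /subsetPn[j _ jS].
have : ((delta_mx 0 i - delta_mx 0 j : 'rV[R]_n) <= M)%MS.
  apply: full; rewrite -sum_setT -[_ - _]scale1r -[_ *: _]add0r sum_line.
  by rewrite big1 ?inE ?subrr ?mulr0 ?addr0 // => k _; rewrite mxE.
move=> /submxP[u uE].
have : \sum_(k in S) (delta_mx 0 i - delta_mx 0 j : 'rV[R]_n) 0 k = 1.
  rewrite -[_ - _]scale1r -[_ *: _]add0r sum_line.
  by rewrite iS (negbTE jS) subr0 mulr1 big1 ?add0r // => k _; rewrite mxE.
rewrite uE mulmx_sum_row; under eq_bigr do rewrite summxE.
rewrite exchange_big big1 => [/esym/eqP|k _ /=]; first by rewrite oner_eq0.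
have : \sum_(l in S) (x 0 l + row k M 0 l) = 1.
  by rewrite -[RHS](all1 _ (cM k)); apply: eq_bigr => l _; rewrite !mxE.
rewrite big_split /= all1 // => /eqP; rewrite -subr_eq0 addrAC subrr add0r => /eqP h.
by under eq_bigr do rewrite mxE; rewrite -mulr_sumr h mulr0.
Qed.

End MaximalChamber.

(** * Weights near the boundary *)

Section Boundary.
Context {R : realType} {n : nat}.
Local Notation C := R[i].
Implicit Types (L : 'M[C]_(2, n)) (y z : 'rV[R]_n) (S : {set 'I_n}) (omega : {set pluecker_set n})
  (A : weights n).
Hypothesis n3 : (3 <= n)%N.

Lemma card_le1_sum (V : zmodType) (w : 'I_n -> V) S : (#|S| <= 1)%N ->
  \sum_(i in S) w i = 0 \/ exists j, \sum_(i in S) w i = w j.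
Proof.
rewrite leq_eqVlt ltnS leqn0 => /orP[/cards1P[j ->]|]; first by right; exists j; rewrite big_set1.
by rewrite cards_eq0 => /eqP ->; left; rewrite big_set0.
Qed.

Lemma card_ge_sum (V : zmodType) (w : 'I_n -> V) S : (n.-1 <= #|S|)%N ->
  \sum_(i in S) w i = \sum_i w i \/ exists j, \sum_(i in S) w i = \sum_i w i - w j.
Proof.
move=> Sn; have C1 : (#|~: S|%SET <= 1)%N.
  by have := cardsC S; rewrite card_ord; move: (#|S|) (#|~: S|%SET) Sn => p q; lia.
have e : \sum_(i in S) w i = \sum_i w i - \sum_(i in (~: S)%SET) w i.
  rewrite [\sum_i w i](bigID (mem S)) /= -addrA -[LHS]addr0; congr (_ + _).
  by apply/esym/eqP; rewrite subr_eq0; apply/eqP; apply: eq_bigl => i; rewrite inE.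
by have [h|[j h]] := card_le1_sum w C1; [left|right; exists j]; rewrite e h ?subr0.
Qed.

Lemma wt_row_sum A S : \sum_(i in S) wt_row A 0 i = ratr (\sum_(i in S) A i) :> R.
Proof. by rewrite raddf_sum; apply: eq_bigr => i _; rewrite mxE. Qed.

Lemma wall_neq S : is_wall S -> S != finset.set0 /\ S != [set: 'I_n]%SET.
Proof.
move=> /andP[S2 Sn]; split; apply/eqP => SE; move: S2 Sn; rewrite SE.
  by rewrite cards0.
by rewrite cardsT card_ord; lia.
Qed.

(** Points of the weight chamber close to [y] have the wall signs of [y], which is on no wall, and
    all points of the weight chamber have the signs of [A]. *)
Lemma boundary_sign omega A y S : is_max_chamber R omega ->
  chamber (R := R) omega `<=` closure (weight_chamber (wt_row A)) -> chamber omega y -> is_wall S ->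
  wall_sign y S = wall_sign (wt_row A) S.
Proof.
move=> maxo cl cy wS; have [e e0 he] := sign_stable y.
have [b [[_ bA] yb]] := cl y cy _ (nbhsx_ballx y e e0).
have [S0 ST] := wall_neq wS.
have [|_ /(_ S (chamber_off_wall n3 maxo S0 ST cy)) <-] := he b; last exact: bA.
move=> i; have := yb; rewrite -ball_normE /= => /(row_norm_ltP _ e0)/(_ i).
by rewrite !mxE distrC => /ltW.
Qed.

(** On walls the sums for [y] and for [A] lie on the same side of [1]. The other sets are decided by
    their size: with at most one element both sums meet the bound, with at least [n - 1] both exceed
    [1]. *)
Lemma boundary_stabm omega A L : is_max_chamber R omega ->
  (forall S, is_wall S -> wall_sign (wt_row A : 'rV[R]_n) S != 0) ->
  chamber (R := R) omega `<=` closure (weight_chamber (wt_row A)) -> mxrank L = 2%N ->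
  pl_support L \in omega <-> stabm A L.
Proof.
move=> maxo Aw cl rL; have [[_ [y cy] _] _] := maxo.
rewrite (omega_mem n3 maxo rL cy).
suff key S : (\sum_(i in S) y 0 i < 1) = (\sum_(i in S) A i <= 1).
  by split=> -[Lc LS]; split=> // S /LS; rewrite key.
have [S1|S1] := leqP #|S| 1.
  transitivity true; [|apply/esym]; apply/idP.
    by have [->|[j ->]] := card_le1_sum (y 0) S1; [exact: ltr01|exact: chamber_lt1 cy].
  have [->|[j ->]] := card_le1_sum A S1; first exact: ler01.
  by have /andP[] := wt_bounds A j.
have [Sn|Sn] := leqP n.-1 #|S|.
  transitivity false; [|apply/esym]; apply/negbTE.
    rewrite -leNgt; have [->|[j ->]] := card_ge_sum (y 0) Sn; rewrite (chamber_sum n3 maxo cy).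
      by rewrite ler1n.
    by have := chamber_lt1 n3 maxo j cy; lra.
  rewrite -ltNge; have := wt_sum A; have [->|[j ->]] := card_ge_sum A Sn; first by lra.
  by have /andP[_] := wt_bounds A j; lra.
have wS : is_wall S by apply/andP; split=> //; lia.
rewrite -wall_sign_lt (boundary_sign maxo cl cy wS) wall_sign_lt wt_row_sum.
have := Aw S wS; rewrite wall_sign0 wt_row_sum.
rewrite -(rmorph1 (@ratr R)) (inj_eq (fmorph_inj _)) ltr_rat => h.
by rewrite lt_neqAle h.
Qed.

(** [omega] consists of the supports of the rank two matrices that are stable for [A]. *)
Lemma boundary_unique omega omega' A : is_max_chamber R omega -> is_max_chamber R omega' ->
  (forall S, is_wall S -> wall_sign (wt_row A : 'rV[R]_n) S != 0) ->
  chamber (R := R) omega `<=` closure (weight_chamber (wt_row A)) ->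
  chamber (R := R) omega' `<=` closure (weight_chamber (wt_row A)) -> omega = omega'.
Proof.
move=> m m' Aw cl cl'; apply/setP => sigma; apply/idP/idP => so.
  have [L rL e] := omega_ex m so; rewrite -e in so *.
  by apply/(boundary_stabm m' Aw cl' rL)/(boundary_stabm m Aw cl rL).
have [L rL e] := omega_ex m' so; rewrite -e in so *.
by apply/(boundary_stabm m Aw cl rL)/(boundary_stabm m' Aw cl' rL).
Qed.

Lemma chamber_hypersimplex omega : is_max_chamber R omega ->
  chamber (R := R) omega `<=` hypersimplex_int.
Proof.
move=> m y cy; split; first exact: (chamber_sum n3 m).
by move=> i; rewrite (chamber_pos n3 m) // (chamber_lt1 n3 m).
Qed.

(** Moving a point [y] of the chamber into the weight domain by increasing
    its coordinates slightly. *)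
Lemma raise_closure omega A y : is_max_chamber R omega -> chamber omega y ->
  (forall S, is_wall S -> wall_sign y S = wall_sign (wt_row A) S) ->
  closure (weight_chamber (wt_row A)) y.
Proof.
move=> m cy sg B /nbhs_ballP[e /= e0 eB]; have [d d0 hd] := sign_stable y.
have [f f0 hf] := @positive_lower_bound _ _ (fun i => 1 - y 0 i)
  (fun i => etrans (subr_gt0 _ _) (chamber_lt1 n3 m i cy)).
pose t := Num.min (Num.min (e / 2) d) f.
have t0 : 0 < t by rewrite !lt_min divr_gt0 // d0 f0.
have te : t < e by apply: le_lt_trans (_ : e / 2 < e); rewrite /t ?ge_min ?lexx //; lra.
have td : t <= d by rewrite /t !ge_min lexx orbT.
have tf : t <= f by rewrite /t ge_min lexx orbT.
exists (y + const_mx t); split; last first.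
  apply: eB; rewrite -ball_normE /= opprD addrA subrr add0r normrN.
  by apply/(row_norm_ltP _ e0) => i; rewrite mxE gtr0_norm.
have [i|_ hS] := hd (y + const_mx t); first by rewrite !mxE addrAC subrr add0r gtr0_norm.
split; first split=> [i|].
- rewrite !mxE addr_gt0 ?(chamber_pos n3 m) //=; have := hf i; lra.
- under eq_bigr do rewrite !mxE; rewrite big_split /= (chamber_sum n3 m cy) ltrDl sumr_const.
  by rewrite card_ord mulrn_wgt0 ?pmulrn_lgt0 //; lia.
move=> S wS; rewrite -sg // hS //; have [S0 ST] := wall_neq wS.
exact: (chamber_off_wall n3 m S0 ST cy).
Qed.

(** Rational weights slightly above the coordinates of a point of the chamber have total above [2]
    and the same wall signs. They are kept below [1], so that they differ from the weights of the
    initial object. *)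
Lemma boundary_weights omega : is_max_chamber R omega -> exists A : weights n,
  [/\ ~ all_ones A, forall S, is_wall S -> wall_sign (wt_row A : 'rV[R]_n) S != 0
    & chamber (R := R) omega `<=` closure (weight_chamber (wt_row A))].
Proof.
move=> m; have [[_ [y cy] _] _] := m; have [d d0 hd] := sign_stable y.
have n0 : (0 < n)%N by lia.
have q_ex i : exists q : rat, y 0 i < ratr q < Num.min 1 (y 0 i + d).
  have [|q] := @rat_in_itvoo R (y 0 i) (Num.min 1 (y 0 i + d)).
    by rewrite lt_min (chamber_lt1 n3 m) // ltrDl.
  by rewrite in_itv /=; exists q.
have [q hq] := choice q_ex.
have qb i : 0 < q i < 1.
  have /andP[] := hq i; rewrite lt_min => yq /andP[q1 _].
  rewrite -(ltr0q R) (lt_trans (chamber_pos n3 m i cy) yq) /=.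
  by rewrite -(ltr_rat R) rmorph1.
have qb' i : 0 < q i <= 1 by have /andP[-> /ltW ->] := qb i.
have q2 : 2 < \sum_i q i.
  rewrite -(ltr_rat R) raddf_sum /= (_ : ratr 2 = \sum_i y 0 i :> R).
    apply: ltr_sum => [|i _]; last by have /andP[] := hq i.
    by apply/hasP; exists (Ordinal n0) => //; rewrite mem_index_enum.
  by rewrite (chamber_sum n3 m cy) rmorph_nat.
pose A := Weights qb' q2.
have sgA S : is_wall S -> wall_sign (wt_row A : 'rV[R]_n) S = wall_sign y S.
  move=> wS; have [S0 ST] := wall_neq wS.
  have [i|_ h] := hd (wt_row A); last by apply: h; exact: (chamber_off_wall n3 m S0 ST cy).
  rewrite mxE /=; have /andP[] := hq i; rewrite lt_min => yq /andP[_ qd].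
  by rewrite gtr0_norm ?subr_gt0 // lerBlDl ltW.
exists A; split.
- by move=> /(_ (Ordinal n0)) /= e; have := qb (Ordinal n0); rewrite e ltxx andbF.
- move=> S wS; have [S0 ST] := wall_neq wS; rewrite sgA // wall_sign0.
  exact: (chamber_off_wall n3 m S0 ST cy).
move=> z cz; apply: (raise_closure m cz) => S wS; rewrite sgA //.
have [S0 ST] := wall_neq wS.
have eqv : (\sum_(i in S) z 0 i < 1) = (\sum_(i in S) y 0 i < 1).
  have mem x := parallel_plane_mem n3 m (y := x) S0 ST.
  by apply/idP/idP => [/(mem z cz)/(mem y cy)|/(mem y cy)/(mem z cz)].
have := chamber_off_wall n3 m S0 ST cz; have := chamber_off_wall n3 m S0 ST cy.
rewrite /wall_sign; move: eqv; case: ltgtP => // [z1|z1]; case: ltgtP => // y1 _ _ _.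
  by rewrite !ltr0_sg ?subr_lt0.
by rewrite !gtr0_sg ?subr_gt0.
Qed.

End Boundary.

(** * Curves *)

Section TreeCurves.
Context {R : realType}.
Local Notation C := R[i].
Local Notation P1 := (@proj_space R 1).
Implicit Types X : space R.

(** A proper closed subset misses all [chart true z] off the zeros of a nonzero polynomial, and
    finitely many such sets cannot cover the line. *)
Lemma line_component k (K : 'I_k -> set P1) : (forall v, zclosed (K v)) ->
  (forall x, exists v, K v x) -> exists v, forall x, K v x.
Proof.
move=> cK cov; apply: contrapT => /forallNP h.
have ex v : exists q : {poly C}, q != 0 /\ forall z, q.[z] != 0 -> ~ K v (chart true z).
  have [z nz] : exists z, ~ K v (chart true z).
    apply: contrapT => /forallNP h'; apply: (h v).
    apply: (chart_closed_inf (c := true) (oner_neq0 _) (cK v)) => z _.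
    by apply: contrapT => /h'.
  have [q qz hq] := near_line (near_open (cK v) nz).
  by exists q; split=> //; exact: horner_neq0 qz.
have [q hq] := choice ex.
have [z] : exists z, (\prod_v q v).[z] != 0.
  by apply: poly_nz_ex; apply/prodf_neq0 => v _; case: (hq v).
rewrite horner_prod => /prodf_neq0 qz; have [v Kv] := cov (chart true z).
by have [_ /(_ z (qz v isT))] := hq v.
Qed.

(** One component is the whole curve; a second one would share two points with it. *)
Lemma line_tree X k (K : 'I_k -> set X) : isomorphic P1 X -> is_tree_curve K ->
  (forall v x, K v x) /\ (forall v w : 'I_k, v = w).
Proof.
move=> [f [mf [g [mg fK gK]]]] [Kc cov [inter _] _ _].
have [v0 full] : exists v, forall x, K v x.
  have [v|x|v full] := @line_component k (fun v => f @^-1` K v).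
  - by have [cv _] := Kc v; exact: mf.1 cv.
  - exact: cov.
  - by exists v => x; have := full (g x); rewrite /preimage /= gK.
suff all0 v : v = v0 by split=> [v|v w]; rewrite (all0 v) // (all0 w).
apply: contrapT => /eqP vv0; have [_ /isomorphic_sym[e [_ [e' [_ eK _]]]]] := Kc v.
have := inter v v0 (sval (e (chart true 0))) (sval (e (chart true 1))) vv0
  (svalP _) (full _) (svalP _) (full _).
move=> /(@sig_eq _ (K v))/(can_inj eK)/(congr1 (coord true)).
by rewrite !coordK => /esym/eqP; rewrite oner_eq0.
Qed.

Lemma line_log_degree n (a : 'I_n -> rat) X (s : 'I_n -> X) k (K : 'I_k -> set X) v :
  isomorphic P1 X -> is_tree_curve K -> log_degree a s K v = - 2 + \sum_i a i.
Proof.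
move=> iX tK; have [full all1] := line_tree iX tK; rewrite /log_degree.
rewrite eq_card0 => [|w]; last by rewrite !inE /adj (all1 v w) eqxx.
rewrite addr0; congr (_ + _); apply: eq_bigl => i; exact/asboolP.
Qed.

(** The single component of a line has degree [- 2 + \sum_i a i], which is positive, so nothing can
    be collapsed. *)
Lemma collapses_line n (a : 'I_n -> rat) X (s : 'I_n -> X) X' (s' : 'I_n -> X') :
  2 < \sum_i a i -> isomorphic P1 X -> collapses a s s' ->
  exists2 f : X -> X', is_iso f & forall i, f (s i) = s' i.
Proof.
move=> a2 iX cl; case: X s X' s' / cl iX => [X s X' s' f If fE _|]; first by exists f.
move=> X s X1 s1 X' s' k K v k1 K1 c p tK _ d0 _ _ _ _ _ _ iX.
by move: d0; rewrite (line_log_degree a s v iX tK); lra.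
Qed.

(** Valencies are positive by connectedness and add up to [2 (k - 1)], so at least two of them equal
    [1]. *)
Lemma tree_leaves X k (K : 'I_k -> set X) : is_tree_curve K -> (1 < k)%N ->
  exists v w, [/\ v != w, #|[pred u | adj K v u]| = 1%N & #|[pred u | adj K w u]| = 1%N].
Proof.
move=> [_ _ _ _ [_ con ce]] k1; pose d v := #|[pred u | adj K v u]|.
have dpos v : (0 < d v)%N.
  have [w wv] : exists w, w != v.
    pose o1 := Ordinal k1; pose o0 := Ordinal (ltnW k1).
    by case: (eqVneq v o0) => [->|h]; [exists o1|exists o0; rewrite eq_sym].
  have /connectP[[|u p] /=] := con v w; first by move=> _ e; rewrite e eqxx in wv.
  by move=> /andP[vu _] _; apply/card_gt0P; exists u.
have dsum : (\sum_v d v = (k.-1).*2)%N.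
  rewrite -ce /d; under eq_bigr do rewrite -sum1_card.
  by rewrite pair_big_dep /= sum1_card.
have : (1 < #|[set v | d v == 1%N]%SET|)%N.
  rewrite ltnNge; apply/negP => h.
  have : (\sum_(v < k) 2 <= \sum_v (d v + (d v == 1%N)))%N.
    by apply: leq_sum => v _; have := dpos v; case: (d v) => [|[|e]].
  rewrite big_split /= dsum sum_nat_const card_ord -[X in (_ + X)%N]big_mkcond /= sum1_card.
  by move: h; rewrite cardsE; move: #|_| => m; lia.
move=> /card_gt1P[v [w [vd wd vw]]]; exists v, w; move: vd wd.
by rewrite !inE => /eqP vd /eqP wd; split.
Qed.

End TreeCurves.

Section LineFibres.
Context {R : realType} {n : nat}.
Local Notation C := R[i].
Local Notation P1 := (@proj_space R 1).

Lemma tree_single (X : space R) k (K : 'I_k -> set X) : good X -> is_tree_curve K -> k = 1%N ->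
  isomorphic P1 X.
Proof.
move=> gX tK k1; subst k; have [Kc cov _ _ _] := tK; have [_] := Kc ord0.
rewrite (_ : K ord0 = setT) => [iK|].
  apply: isomorphic_trans (isomorphic_sym iK) _.
  by exists (fun x => sval x); exact: sub_setT_iso.
by apply/funext => x; apply/propext; split=> // _; have [v] := cov x; rewrite (ord1 v).
Qed.

Lemma fibre_good (a : 'I_n -> rat) (M : hassett_space R a) (m : M) :
  good (fibre (@hs_proj _ _ _ M) m).
Proof. exact/sub_good/hs_curve_good. Qed.

Lemma line_fibre_config (a : 'I_n -> rat) (M : hassett_space R a) (m : M)
    (t : 'I_n -> fibre (@hs_proj _ _ _ M) m) :
  (forall i, sval (t i) = hs_sec i m) -> is_weighted_stable a t ->
  isomorphic P1 (fibre (@hs_proj _ _ _ M) m) ->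
  exists2 L : 'M[C]_(2, n), stabm a L & config m L.
Proof.
move=> tE [k [K [_ _ _ st]]] [f [mf [g [mg fK gK]]]].
pose L : 'M[C]_(2, n) := \matrix_(r, i) hc (g (t i)) 0 r.
have LE i : (col i L)^T = hc (g (t i)) by apply/rowP => r; rewrite !mxE.
have ptE i : colpt L i = g (t i) by rewrite /colpt LE hcK.
have Lc i : col i L != 0.
  by apply/eqP => e; have := LE i; rewrite e trmx0 => /esym/eqP; rewrite (negbTE (hc_neq0 _)).
exists L; last by exists f => [|i]; [exact: (is_iso_sym mf mg)|rewrite ptE gK].
split=> // I hI; apply: st => i j iI jI; apply: (can_inj gK).
by rewrite -!ptE; apply: pluecker_eq0; rewrite ?hI.
Qed.

(** By [collapses_line] a fibre that is a line survives the reduction unchanged, with its marked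
    points. *)
Lemma reduction_config (a0 a : 'I_n -> rat) (M0 : hassett_space R a0) (M : hassett_space R a)
    (rho : M0 -> M) (m : M0) (L : 'M[C]_(2, n)) :
  2 < \sum_i a0 i -> 2 < \sum_i a i -> is_reduction rho -> config m L -> config (rho m) L.
Proof.
move=> a02 a2 [_ /(_ m)[t [t' [tE tE' cl]]]] [f If fE].
have [|g Ig gE] := collapses_line a2 _ cl; first by exists f.
exists (g \o f) => [|i]; first exact: is_iso_comp.
by rewrite /= (_ : f (colpt L i) = t i) ?gE //; apply: sig_eq; rewrite fE tE.
Qed.

Hypothesis n3 : (3 <= n)%N.

(** The marked points on the two leaves would be two disjoint sets of weight
    above [1], hence of weight above [1] also at the points of the chamber,
    where the total weight is [2]. *)
Lemma boundary_fibre_line (omega : {set pluecker_set n}) (A : weights n) (X : space R) (t : 'I_n -> X) :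
  good X -> is_max_chamber R omega ->
  (forall S, is_wall S -> wall_sign (wt_row A : 'rV[R]_n) S != 0) ->
  chamber (R := R) omega `<=` closure (weight_chamber (wt_row A)) ->
  is_weighted_stable A t -> isomorphic P1 X.
Proof.
move=> gX maxo Aw cl [k [K [tK inj deg _]]].
apply: (tree_single gX tK); have [_ _ _ _ [k0 _ _]] := tK; apply: contrapT => k1.
have {}k1 : (1 < k)%N by lia.
have [v [w [vw dv dw]]] := tree_leaves tK k1.
pose S (u : 'I_k) : {set 'I_n} := [set i | `[< K u (t i) >]]%SET.
have SE u : \sum_(i | `[< K u (t i) >]) A i = \sum_(i in S u) A i.
  by apply: eq_bigl => i; rewrite inE.
have big u : #|[pred x | adj K u x]| = 1%N -> 1 < \sum_(i in S u) A i.
  by move=> du; have := deg u; rewrite /log_degree du SE; lra.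
have dis : (S v :&: S w = finset.set0)%SET.
  apply/setP => i; rewrite !inE; apply/negP => /andP[/asboolP h /asboolP h'].
  by move/eqP: vw; apply; exact: inj h h'.
have card2 u : 1 < \sum_(i in S u) A i -> (2 <= #|S u|)%N.
  move=> h; rewrite leqNgt ltnS; apply/negP => /(card_le1_sum A)[e|[j e]]; rewrite e in h.
    by rewrite ltr10 in h.
  by have := wt_bounds A j; rewrite leNgt h andbF.
have cv := card2 v (big v dv); have cw := card2 w (big w dw).
have cvw : (#|S v| + #|S w| <= n)%N.
  by have := max_card (mem (S v :|: S w)%SET); rewrite cardsU dis cards0 subn0 card_ord.
have wv : is_wall (S v) by apply/andP; split=> //; lia.
have ww : is_wall (S w) by apply/andP; split=> //; lia.
have [[_ [y cy] _] _] := maxo.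
have ybig u : is_wall (S u) -> 1 < \sum_(i in S u) A i -> 1 < \sum_(i in S u) y 0 i.
  move=> wu h; have := boundary_sign n3 maxo cl cy wu.
  have [S0 ST] := wall_neq n3 wu; have := chamber_off_wall n3 maxo S0 ST cy.
  rewrite lt_neqAle eq_sym => -> /= e; rewrite leNgt -wall_sign_lt e wall_sign_lt wt_row_sum.
  by rewrite -(rmorph1 (@ratr R)) ltr_rat -leNgt ltW.
have := ybig v wv (big v dv); have := ybig w ww (big w dw).
have := chamber_sum n3 maxo cy; rewrite (bigID (mem (S v))) /=.
have : \sum_(i in S w) y 0 i <= \sum_(i | i \notin S v) y 0 i.
  rewrite big_mkcond [leRHS]big_mkcond /=; apply: ler_sum => i _.
  have yi := ltW (chamber_pos n3 maxo i cy).
  case: ifP => iw; case: ifPn => // /negPn iv.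
  by have := congr1 (fun T : {set 'I_n} => i \in T) dis; rewrite finset.in_setI iv iw finset.in_set0.
lra.
Qed.

Lemma boundary_config (omega : {set pluecker_set n}) (A : weights n) (M : hassett_space R A) (m : M) :
  is_max_chamber R omega ->
  (forall S, is_wall S -> wall_sign (wt_row A : 'rV[R]_n) S != 0) ->
  chamber (R := R) omega `<=` closure (weight_chamber (wt_row A)) ->
  exists2 L : 'M[C]_(2, n), stabm A L & config m L.
Proof.
move=> maxo Aw cl; have [_ [_ _ _ _ /(_ m)[t tE st]] _] := hs_fine M.
apply: (line_fibre_config tE st).
exact: (boundary_fibre_line (fibre_good m) maxo Aw cl st).
Qed.

End LineFibres.

(** * The classical topology *)

Section Euclid.
Context {R : realType}.
Local Notation C := R[i].
Implicit Types X Y Z : space R.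

(** The order on the complex numbers is partial, so a minimum is replaced by the inverse of the sum
    of the inverses; the summand [1] takes care of the empty family. *)
Lemma pos_lower_bound k (e : 'I_k -> C) : (forall i, 0 < e i) ->
  exists2 d, 0 < d & forall i, d <= e i.
Proof.
move=> e0; have s0 (P : pred 'I_k) : 0 <= \sum_(i | P i) (e i)^-1.
  by apply: sumr_ge0 => i _; rewrite invr_ge0 ltW.
have s1 : 0 < 1 + \sum_i (e i)^-1 by rewrite ltr_wpDr.
exists (1 + \sum_i (e i)^-1)^-1; first by rewrite invr_gt0.
move=> i; rewrite -[leRHS]invrK lef_pV2 ?posrE ?invr_gt0 // (bigD1 i) //= addrCA lerDl.
by rewrite addr_ge0.
Qed.

Lemma pos_min (d e : C) : 0 < d -> 0 < e -> exists c, [/\ 0 < c, c <= d & c <= e].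
Proof.
move=> d0 e0.
have [|c c0 ce] := @pos_lower_bound 2 (fun i => if i == 0 then d else e).
  by move=> i; case: ifP.
by exists c; split=> //; [have := ce 0|have := ce 1].
Qed.

Lemma polyfun_continuous (T I : Type) (c : I -> T -> C) p : polyfun c p -> forall t (e : C),
  0 < e -> exists2 d : C, 0 < d & forall t', (forall i, `|c i t' - c i t| < d) -> `|p t' - p t| < e.
Proof.
elim=> [a t e e0|i t e e0|p1 p2 _ h1 _ h2 t e e0|p1 p2 _ h1 _ h2 t e e0].
- by exists 1 => // t' _; rewrite subrr normr0.
- by exists e.
- have e2 : 0 < e / 2 by rewrite divr_gt0.
  have [d1 d10 hd1] := h1 t _ e2; have [d2 d20 hd2] := h2 t _ e2.
  have [d [d0 dd1 dd2]] := pos_min d10 d20; exists d => // t' ht.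
  have := ltrD (hd1 t' (fun i => lt_le_trans (ht i) dd1)) (hd2 t' (fun i => lt_le_trans (ht i) dd2)).
  by rewrite -splitr; apply: le_lt_trans; rewrite opprD addrACA ler_normD.
have b10 : 0 < `|p1 t| + 1 by rewrite ltr_wpDl.
have b20 : 0 < `|p2 t| + 1 by rewrite ltr_wpDl.
have e2 : 0 < e / 2 by rewrite divr_gt0.
have [d1 d10 hd1] := h1 t _ (divr_gt0 e2 b20).
have [d2' d2'0 hd2'] := h2 t _ ltr01; have [d2 d20 hd2] := h2 t _ (divr_gt0 e2 b10).
have [d' [d'0 dd1 dd2]] := pos_min d10 d20; have [d [d0 dd' dd2']] := pos_min d'0 d2'0.
exists d => // t' ht.
have q1 := hd1 t' (fun i => lt_le_trans (ht i) (le_trans dd' dd1)).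
have q2 := hd2 t' (fun i => lt_le_trans (ht i) (le_trans dd' dd2)).
have q2' := hd2' t' (fun i => lt_le_trans (ht i) dd2').
have bd : `|p2 t'| < `|p2 t| + 1.
  rewrite -[p2 t'](subrK (p2 t)) addrC; apply: le_lt_trans (ler_normD _ _) _.
  by rewrite ltrD2l.
rewrite (_ : _ - _ = (p1 t' - p1 t) * p2 t' + p1 t * (p2 t' - p2 t)); last by ring.
apply: le_lt_trans (ler_normD _ _) _; rewrite !normrM [e]splitr; apply: ltr_leD.
  apply: (@le_lt_trans _ _ (`|p1 t' - p1 t| * (`|p2 t| + 1))).
    by rewrite ler_wpM2l // ltW.
  by rewrite -ltr_pdivlMr.
apply: (@le_trans _ _ ((`|p1 t| + 1) * `|p2 t' - p2 t|)).
  by rewrite ler_wpM2r // lerDl.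
by rewrite mulrC -ler_pdivlMr // ltW.
Qed.

Lemma euclid_openI X (U V : set X) : good X -> euclid_open U -> euclid_open V ->
  euclid_open (U `&` V).
Proof.
move=> gX oU oV x [/oU[k [f [e [rf e0 nf]]]] /oV[l [g [d [rg d0 ng]]]]].
have [c [c0 ce cd]] := pos_min e0 d0.
pose h (i : 'I_(k + l)) := match fintype.split i with inl j => f j | inr j => g j end.
exists (k + l)%N, h, c; split=> // [i|].
  by rewrite /h; case: fintype.split.
apply: near_sub (nearI gX nf ng) _ => y /= [Uy Vy] hy; split.
  by apply: Uy => i; apply: lt_le_trans ce; have := hy (lshift l i); rewrite /h (unsplitK (inl i)).
by apply: Vy => i; apply: lt_le_trans cd; have := hy (rshift k i); rewrite /h (unsplitK (inr i)).
Qed.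

Lemma morph_continuous X Y (f : X -> Y) : good X -> is_morph f -> euclid_continuous f.
Proof.
move=> gX mf V oV x /oV[k [g [e [rg e0 ng]]]].
exists k, (fun i => g i \o f), e; split=> // [i|]; first exact: mf.2.
exact: (is_morph_at x mf).1 _ ng.
Qed.

Lemma continuous_comp X Y Z (f : X -> Y) (g : Y -> Z) :
  euclid_continuous f -> euclid_continuous g -> euclid_continuous (g \o f).
Proof. by move=> cf cg V /cg /cf. Qed.

(** A polydisc around [x] in a chart given by finitely many functions. *)
Lemma polydisc_open X (U : set X) k (f : 'I_k -> X -> C) (x : X) (e : C) : good X -> zopen U ->
  (forall i y, U y -> reg y (f i)) -> euclid_open [set y | U y /\ forall i, `|f i y - f i x| < e].
Proof.
move=> gX oU rf y [Uy fy].
have [|d d0 hd] := @pos_lower_bound _ (fun i => e - `|f i y - f i x|).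
  by move=> i; rewrite subr_gt0.
exists k, f, d; split=> // [i|]; first exact: rf.
apply: near_sub (near_open oU Uy) _ => z Uz /= fz; split=> // i.
rewrite -(subrKA (f i y)); apply: le_lt_trans (ler_normD _ _) _.
by rewrite -ltrBrDr; apply: lt_le_trans (hd i).
Qed.

(** Points of two affine charts are separated by polydiscs, because the locus
    where the two parametrisations differ is open on the product of the charts. *)
Lemma euclid_hausdorff X (x y : X) : is_variety X -> x <> y -> exists U V : set X,
  [/\ euclid_open U, euclid_open V, U x, V y & forall z, U z -> V z -> False].
Proof.
move=> vX xy; have gX := variety_good vX; have [_ _ _ [k [W [oW cov aff]]] sep] := vX.
have [i Wx] := cov x; have [j Wy] := cov y.
have [m1 [S1 [cS1 [f1 [mf1 [g1 [mg1 fK1 gK1]]]]]]] := aff i.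
have [m2 [S2 [cS2 [f2 [mf2 [g2 [mg2 fK2 gK2]]]]]]] := aff j.
have gA m : good (@aff_space R 1 m) := aff_good 1 m.
pose l v : @aff_space R 1 m1 := lsubmx (v : 'rV[C]_(m1 + m2)).
pose r v : @aff_space R 1 m2 := rsubmx (v : 'rV[C]_(m1 + m2)).
(* The product of the two charts as a closed set of an affine space; separatedness is applied to its
   two projections to [X]. *)
pose T : set (@aff_space R 1 (m1 + m2)) := [set v | S1 (l v) /\ S2 (r v)].
have ml : is_morph (l : @aff_space R 1 (m1 + m2) -> _).
  apply: to_aff_morph => // v a b; apply: (reg_ext (gA _)) (aff_coord_reg v a (lshift m2 b)) => w.
  by rewrite mxE.
have mr : is_morph (r : @aff_space R 1 (m1 + m2) -> _).
  apply: to_aff_morph => // v a b; apply: (reg_ext (gA _)) (aff_coord_reg v a (rshift m1 b)) => w.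
  by rewrite mxE.
have gT := sub_good T (gA _).
have cT : zclosed T.
  apply: (open_near (gA _)) => v nT; have [s1|s1] := pselect (S1 (l v)); last first.
    by apply: near_sub (near_open (ml.1 _ cS1) s1) _ => w h [].
  have s2 : ~ S2 (r v) by move=> s2; apply: nT.
  by apply: near_sub (near_open (mr.1 _ cS2) s2) _ => w h [].
pose p1 (v : sub_space T) : sub_space S1 := exist _ (l (sval v)) (svalP v).1.
pose p2 (v : sub_space T) : sub_space S2 := exist _ (r (sval v)) (svalP v).2.
pose q1 v := sval (g1 (p1 v)); pose q2 v := sval (g2 (p2 v)).
have mT := sval_morph T (gA _).
have mq1 : is_morph q1.
  apply: is_morph_comp (sval_morph _ gX); apply: is_morph_comp mg1.
  by apply: to_sub_morph => //; exact: is_morph_comp mT ml.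
have mq2 : is_morph q2.
  apply: is_morph_comp (sval_morph _ gX); apply: is_morph_comp mg2.
  by apply: to_sub_morph => //; exact: is_morph_comp mT mr.
have [V oV VE] := sep _ T q1 q2 cT mq1 mq2.
pose coords (D : set X) m (S : set (@aff_space R 1 m)) (f : sub_space D -> sub_space S)
    (a : 'I_m) (z : X) : C :=
  if pselect (D z) is left h then (sval (f (exist _ z h)) : 'rV[C]_m) 0 a else 0.
have coordsE (D : set X) m (S : set (@aff_space R 1 m)) (f : sub_space D -> sub_space S) a
    (z : sub_space D) : coords D m S f a (sval z) = (sval (f z) : 'rV[C]_m) 0 a.
  rewrite /coords; case: pselect => [h|[]]; last exact: svalP.
  by congr ((sval (f _) : 'rV[C]_m) 0 a); exact: sig_eq.
have coords_reg (D : set X) m (S : set (@aff_space R 1 m)) (f : sub_space D -> sub_space S) a z :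
    zopen D -> is_morph f -> D z -> reg z (coords D m S f a).
  move=> oD mf Dz; apply/(open_sub_reg (exist _ z Dz : sub_space D) _ gX oD).
  have := is_morph_eval (exist _ z Dz : sub_space D) 0 a (is_morph_comp mf (sval_morph S (gA m))).
  by apply: (reg_ext (sub_good D gX)) => w; rewrite coordsE.
pose xW : sub_space (W i) := exist _ x Wx; pose yW : sub_space (W j) := exist _ y Wy.
pose w0 (z : sub_space (W i)) (z' : sub_space (W j)) : @aff_space R 1 (m1 + m2) :=
  row_mx (sval (f1 z) : 'rV[C]_m1) (sval (f2 z') : 'rV[C]_m2).
have Tw z z' : T (w0 z z').
  by rewrite /T /= /l /r /w0 row_mxKl row_mxKr; split; exact: svalP.
have q1w z z' : q1 (exist _ (w0 z z') (Tw z z')) = sval z.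
  rewrite /q1 (_ : p1 _ = f1 z) ?fK1 //; apply: sig_eq; exact: row_mxKl.
have q2w z z' : q2 (exist _ (w0 z z') (Tw z z')) = sval z'.
  rewrite /q2 (_ : p2 _ = f2 z') ?fK2 //; apply: sig_eq; exact: row_mxKr.
have VP z z' : V (w0 z z') <-> sval z <> sval z'.
  have := congr1 (fun Q : set (sub_space T) => Q (exist _ (w0 z z') (Tw z z'))) VE.
  by rewrite /= q1w q2w => ->.
(* The pairs of distinct points contain a principal open set around the pair of [x] and [y]. By
   continuity [p] stays nonzero on a product of polydiscs, and these are therefore disjoint. *)
have [p [Pp p0 pV]] := oV (w0 xW yW) ((VP xW yW).2 xy).
have pn0 : 0 < `|p (w0 xW yW)| by rewrite normr_gt0.
have [d d0 hd] := polyfun_continuous Pp (w0 xW yW) pn0.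
exists [set z | W i z /\ forall a, `|coords _ _ _ f1 a z - coords _ _ _ f1 a x| < d],
  [set z | W j z /\ forall a, `|coords _ _ _ f2 a z - coords _ _ _ f2 a y| < d]; split.
- by apply: polydisc_open => // a z Wz; exact: coords_reg.
- by apply: polydisc_open => // a z Wz; exact: coords_reg.
- by split=> // a; rewrite subrr normr0.
- by split=> // a; rewrite subrr normr0.
move=> z [Wiz iz] [Wjz jz].
pose zi : sub_space (W i) := exist _ z Wiz; pose zj : sub_space (W j) := exist _ z Wjz.
suff : V (w0 zi zj) by move/VP.
apply: pV; have : `|p (w0 zi zj) - p (w0 xW yW)| < `|p (w0 xW yW)|; last first.
  by apply: contraTneq => ->; rewrite sub0r normrN ltxx.
apply: hd => -[a b]; rewrite /entry /= (ord1 a); case: (split_ordP b) => c ->.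
  have := iz c; rewrite -[z]/(sval zi) -[x]/(sval xW) !coordsE.
  by rewrite /w0 !row_mxEl.
have := jz c; rewrite -[z]/(sval zj) -[y]/(sval yW) !coordsE.
by rewrite /w0 !row_mxEr.
Qed.

Lemma dense_agree X Y (S : set X) (f g : X -> Y) : good X -> is_variety Y ->
  euclid_continuous f -> euclid_continuous g -> euclid_dense S ->
  (forall x, S x -> f x = g x) -> forall x, f x = g x.
Proof.
move=> gX vY cf cg dS fg x; apply: contrapT => ne.
have [U [V [oU oV Ux Vx dis]]] := euclid_hausdorff vY ne.
have [|y [[Uy Vy] Sy]] := dS _ (euclid_openI gX (cf _ oU) (cg _ oV)); first by exists x.
by apply: (dis (f y)) => //; rewrite fg.
Qed.

End Euclid.

(** * Comparison of the two categories *)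

Section MainStratum.
Context {R : realType} {n : nat}.
Local Notation C := R[i].
Implicit Types (L : 'M[C]_(2, n)).
Hypothesis n3 : (3 <= n)%N.

Definition generic L := forall i j : 'I_n, i != j -> pluecker L i j != 0.

(** Parallel sets of a generic matrix have at most one element. *)
Lemma generic_stabm (a : 'I_n -> rat) L : (forall i, a i <= 1) -> generic L -> stabm a L.
Proof.
move=> a1 gL; split=> [i|I pI].
  have [j ji] := other_index n3 i; have := gL j i ji.
  apply: contraNneq => /colP e; have Lr r : L r i = 0 by have := e r; rewrite !mxE.
  by rewrite /pluecker !Lr !mulr0 mul0r subrr.
have [|->|[j ->]//] := @card_le1_sum n rat a I; last exact: ler01.
rewrite leqNgt; apply/negP => /card_gt1P[i [j [iI jI ij]]].
by have := gL i j ij; rewrite pI // eqxx.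
Qed.

Lemma main_generic (y : main_param_space R n) : exists2 L, represents y L & generic L.
Proof.
have [c ->] := class_of_eq y; have [sigma so [L sL sE]] := svalP c.
exists L => [|i j ij].
  exists c => //; exists L, L, (const_mx 1); split=> // [i|]; first by rewrite mxE oner_neq0.
  by rewrite diag_const_mx mulmx1.
move: so; rewrite inE => /eqP so; rewrite so in sE.
have /pl_supportP[u [v [uv e p]]] : [set i; j]%SET \in pl_support L.
  by rewrite sE inE cards2 ij.
have /setP hi := e; have := hi u; have := hi v; rewrite !inE !eqxx orbT /=.
move=> /orP[] /eqP ev /orP[] /eqP eu; rewrite ?eu ?ev in uv p *; rewrite ?eqxx // in uv *.
by rewrite plueckerC oppr_eq0.
Qed.

Lemma universal_config (F : universal_space R n) y L : (forall i, col i L != 0) ->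
  represents y L -> config (us_incl F y) L.
Proof.
move=> Lc /(us_columns F)[f If fE]; exists f => // i; apply: fE.
by apply/toP_homog; exact: colT_neq0.
Qed.

End MainStratum.

Section FineModuli.
Context {R : realType} {n : nat}.
Variables (a : 'I_n -> rat) (M N : hassett_space R a).

Lemma classifying_map : exists (phi : M -> N) (psi : hs_curve M -> hs_curve N),
  [/\ is_morph phi, is_cartesian (@hs_proj _ _ _ M) psi phi (@hs_proj _ _ _ N)
    & forall i b, psi (hs_sec i b) = hs_sec i (phi b)].
Proof.
have [vM fM _] := hs_fine M; have [_ _ /(_ _ _ _ _ vM fM)] := hs_fine N.
by move=> [phi [[mphi [psi cart psiE]] _]]; exists phi, psi.
Qed.

Lemma classifying_self (phi : M -> M) (psi : hs_curve M -> hs_curve M) : is_morph phi ->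
  is_cartesian (@hs_proj _ _ _ M) psi phi (@hs_proj _ _ _ M) ->
  (forall i b, psi (hs_sec i b) = hs_sec i (phi b)) -> phi = id.
Proof.
move=> mphi cart psiE; have [vM fM /(_ _ _ _ _ vM fM)[phi0 [_ u]]] := hs_fine M.
transitivity phi0; first by apply/esym/u; split=> //; exists psi.
apply: u; split; first exact: is_morph_id.
exists id => //; exact/is_cartesian_id/hs_proj_morph.
Qed.

Lemma classifying_config (phi : M -> N) (psi : hs_curve M -> hs_curve N) m L :
  is_cartesian (@hs_proj _ _ _ M) psi phi (@hs_proj _ _ _ N) ->
  (forall i b, psi (hs_sec i b) = hs_sec i (phi b)) -> config m L -> config (phi m) L.
Proof.
move=> cart psiE [f If fE].
have [g Ig gE] := cartesian_fibre_iso m (hs_curve_variety M) (hs_variety M)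
  (hs_curve_variety N) (hs_variety N) (hs_proj_morph M) (hs_proj_morph N) cart.
exists (g \o f) => [|i]; first exact: is_iso_comp.
by rewrite /= gE fE psiE.
Qed.

End FineModuli.

(** The classifying maps of two universal families are mutually inverse. This is needed because the
    universal space of parameters carries its own moduli space for the weights [1], unrelated to the
    given [H A]. *)
Lemma hassett_unique (R : realType) n (a : 'I_n -> rat) (M N : hassett_space R a) :
  exists (h : M -> N) (g : N -> M), [/\ is_morph h, is_morph g, cancel h g, cancel g h
    & forall m L, config m L -> config (g m) L].
Proof.
have [h [psi [mh ch ph]]] := classifying_map M N.
have [g [chi [mg cg pg]]] := classifying_map N M.
exists h, g; split=> //.
- suff e : g \o h = id by move=> m; have := congr1 (fun u => u m) e.
  apply: (@classifying_self _ _ _ M _ (chi \o psi)).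
  + exact: is_morph_comp.
  + exact: is_cartesian_comp ch cg.
  + by move=> i b; rewrite /= ph pg.
- suff e : h \o g = id by move=> m; have := congr1 (fun u => u m) e.
  apply: (@classifying_self _ _ _ N _ (psi \o chi)).
  + exact: is_morph_comp.
  + exact: is_cartesian_comp cg ch.
  + by move=> i b; rewrite /= pg ph.
- by move=> m L; exact: (classifying_config cg pg).
Qed.

Lemma iso_birational (R : realType) (X Y : space R) (f : X -> Y) : good X -> good Y ->
  is_iso f -> is_birational f.
Proof.
move=> gX gY [mf [g [mg fK gK]]]; split=> //.
have dT (Z : space R) : zdense [set: Z] by move=> V _ [z Vz]; exists z.
exists setT, setT; split; [by split; [exact: good_T|]|by split; [exact: good_T|]|].
exists (fun x : sub_space [set: X] => exist _ (f (sval x)) I : sub_space [set: Y]) => //.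
apply: (is_iso_sym (g := fun y : sub_space [set: Y] => exist _ (g (sval y)) I : sub_space [set: X])).
- apply: to_sub_morph; first exact: sub_good.
  exact: is_morph_comp (sval_morph _ gX) mf.
- apply: to_sub_morph; first exact: sub_good.
  exact: is_morph_comp (sval_morph _ gY) mg.
- by move=> x; apply: sig_eq; rewrite /= fK.
- by move=> x; apply: sig_eq; rewrite /= gK.
Qed.

Section Comparison.
Context {R : realType} {n : nat}.
Local Notation C := R[i].
Implicit Types (L : 'M[C]_(2, n)).
Hypothesis n3 : (3 <= n)%N.
Variables (H : forall A : weights n, hassett_space R A) (F : universal_space R n).

Definition near_chamber (omega : {set pluecker_set n}) (A : weights n) :=
  (forall S, is_wall S -> wall_sign (wt_row A : 'rV[R]_n) S != 0) /\
  chamber (R := R) omega `<=` closure (weight_chamber (wt_row A)).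

(** The comparison map of an object of the Hassett category with its image: its
    inverse sends a point to the modular point of the line marked by the columns
    of a representing matrix. *)
Definition comparison (A : weights n) (o : option (max_chambers R n)) (h : H A -> param_ob F o) :=
  exists g : param_ob F o -> H A, [/\ is_morph h, is_morph g, cancel h g, cancel g h &
    (match o as o0 return (param_ob F o0 -> H A) -> Prop with
     | None => fun g => all_ones A /\
         forall y L, (forall i, col i L != 0) -> represents y L -> config (g (us_incl F y)) L
     | Some omega => fun g => [/\ ~ all_ones A, near_chamber (sval omega) A
         & forall y L, represents y L -> config (g y) L]
     end) g].

Lemma all_ones_comparison (A : weights n) : all_ones A ->
  exists h : H A -> param_ob F None, comparison h.
Proof.
move=> A1; have e : (fun _ : 'I_n => 1) = wt A by apply/funext => i; rewrite A1.
have [h [g [mh mg hK gK cfg]]] : exists (h : H A -> F) (g : F -> H A),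
    [/\ is_morph h, is_morph g, cancel h g, cancel g h & forall m L, config m L -> config (g m) L].
  (* The constant weights of [F] and the weights of [A] are equal only by extensionality, so both
     spaces are generalised before rewriting in their types. *)
  move: (H A); move: (us_moduli F); rewrite e => N M; exact: hassett_unique.
exists h, g; split=> //; split=> // y L Lc yL.
exact/cfg/universal_config.
Qed.

Lemma near_chamber_comparison (A : weights n) (omega : max_chambers R n) : ~ all_ones A ->
  near_chamber (sval omega) A -> exists h : H A -> param_ob F (Some omega), comparison h.
Proof.
move=> nA [Aw cl]; have mo : is_max_chamber R (sval omega) := svalP omega; have n0 : (0 < n)%N by lia.
have conf m : exists2 L : 'M[C]_(2, n), stabm A L & config (m : H A) L.
  exact: (boundary_config n3 m mo Aw cl).
have oP L : mxrank L = 2%N -> (pl_support L \in sval omega <-> stabm A L).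
  exact: (boundary_stabm n3 mo Aw cl).
exists (of_moduli n0 (wt_sum A) conf oP), (to_moduli (H A) n0 (wt_sum A) oP).
split; first exact: (of_moduli_morph _ _ _ _ (Ordinal n0)).
- exact: to_moduli_morph.
- exact: of_moduliK.
- exact: to_moduliK.
by split=> // y L; exact: to_moduliP.
Qed.

Lemma comparison_ex (a : @hassett_ob R n) : exists o (h : H (sval a) -> param_ob F o), comparison h.
Proof.
case: a => A /= nA; have [A1|A1] := pselect (all_ones A).
  by exists None; exact: all_ones_comparison.
case: nA => [//|[Aw [omega [mo _ cl]]]].
by exists (Some (exist _ omega mo)); exact: near_chamber_comparison.
Qed.

(** Both maps send the orbit of a generic plane to the line marked by the columns
    of a matrix of the plane, and such orbits are dense. *)
Lemma comparison_reduction (A0 A : weights n) (h : H A0 -> param_ob F None) (rho : H A0 -> H A)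
    (u : F -> H A) : comparison h -> is_reduction rho -> euclid_continuous u ->
  (forall y L, (forall i, col i L != 0) -> represents y L -> config (u (us_incl F y)) L) ->
  forall x, u (h x) = rho x.
Proof.
move=> [g [mh mg hK gK [_ cfg]]] red cu uP x.
rewrite -{2}[x]hK; move: (h x) => {x}.
have crg : euclid_continuous (rho \o g : F -> H A).
  apply: morph_continuous; first exact: hs_good.
  exact: is_morph_comp mg red.1.
apply: (dense_agree (hs_good F) (hs_variety (H A)) cu crg (us_dense (u := F))).
move=> _ [y _ <-]; have [L yL gL] := main_generic y.
have sL : stabm A L by apply: (generic_stabm n3) gL => i; case/andP: (wt_bounds A i).
apply: (config_unique (wt_sum A) sL); first exact: uP sL.1 yL.
apply: (reduction_config (wt_sum A0) (wt_sum A) red); exact: cfg sL.1 yL.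
Qed.

End Comparison.

(** Inversion of [param_hom]. Except from [None] to [Some] only identities occur, but the two
    objects are equal only propositionally, so the identity is stated as a transport along [e]. *)
Lemma param_homP (R : realType) n (F : universal_space R n)
    (p : forall omega : max_chambers R n, F -> param_space R n (sval omega)) a b
    (g : param_ob F a -> param_ob F b) : param_hom p g ->
  match a as a0, b as b0 return (param_ob F a0 -> param_ob F b0) -> Prop with
  | None, Some omega => fun g => g = p omega
  | a, b => fun g => forall e : a = b, g = fun x => eq_rect a (fun c => param_ob F c) x b e
  end g.
Proof.
by case=> [[omega|]|omega] // e; rewrite (Prop_irrelevance e erefl).
Qed.

Theorem corollary14 (R : realType) (n : nat) (n_ge3 : (3 <= n)%N)
  (H : forall A : weights n, hassett_space R (wt A))
  (rho : forall A0 A : weights n, H A0 -> H A)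
  (rho_red : forall A0 A : weights n,
     all_ones A0 -> all_ones A \/ near_boundary R A -> is_reduction (rho A0 A))
  (F : universal_space R n)
  (p : forall omega : max_chambers R n, F -> param_space R n (sval omega))
  (p_proj : forall omega : max_chambers R n, is_projection (p omega)) :
  isomorphically_modeled (hassett_cat rho) (param_cat p).
Proof.
(* Objects and maps are chosen, and only the property [comparison] is retained; which chamber was
   attached to [A] is recovered later from [boundary_unique]. *)
pose Phi (a : @hassett_ob R n) := projT1 (cid (comparison_ex n_ge3 H F a)).
have hex (a : @hassett_ob R n) : exists h : H (sval a) -> param_ob F (Phi a), comparison h.
  exact: projT2 (cid (comparison_ex n_ge3 H F a)).
pose h a := projT1 (cid (hex a)); have hP a : comparison (h a) := projT2 (cid (hex a)).
have hI a : is_iso (h a).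
  by have [g [mh mg hK gK _]] := hP a; exact: is_iso_sym mh mg hK gK.
have gH (a : @hassett_ob R n) : good (H (sval a)) by exact: hs_good.
have gP (a : @hassett_ob R n) : good (param_ob F (Phi a)).
  have [g [mh mg hK gK _]] := hP a; apply: (iso_good (f := g) (gH a)).
  exact: is_iso_sym mg mh gK hK.
exists Phi, h; split=> //; split=> [a|b|a a' f].
- exact: (iso_birational (gH a) (gP a) (hI a)).
- case: b => [omega|].
    have [A [nA Aw cl]] := boundary_weights n_ge3 (svalP omega).
    have nb : near_boundary R A.
      split=> //; exists (sval omega); split=> //; first exact: svalP.
      by apply: (chamber_hypersimplex n_ge3); exact: svalP.
    pose a : @hassett_ob R n := exist _ A (or_intror nb); exists a.
    have := hP a; move: (h a); case: (Phi a) => [omega'|] ha [g [_ _ _ _]]; last by case.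
    move=> [_ [_ cl'] _]; congr Some; apply: sig_eq; apply: (boundary_unique n_ge3 _ _ Aw cl' cl).
      exact: svalP.
    exact: svalP.
  have b1 (i : 'I_n) : 0 < (1 : rat) <= 1 by [].
  have s1 : 2 < \sum_(i < n) (1 : rat) by rewrite sumr_const card_ord ltr_nat.
  pose a : @hassett_ob R n := exist _ (Weights b1 s1) (or_introl (fun=> erefl)); exists a.
  have := hP a; move: (h a); case: (Phi a) => [omega'|] // ha [g [_ _ _ _ [nA _ _]]].
  by case: nA.
case: a a' f / => [a|a0 a A1].
  split; first by exists id; exact: param_id.
  move=> g /param_homP; move: (h a); case: (Phi a) g => [omega|] g ha /(_ erefl) -> //.
have red : is_reduction (rho (sval a0) (sval a)) by exact: (rho_red _ _ A1 (svalP a)).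
have := hP a0; have := hP a; move: (h a) (h a0).
have -> : Phi a0 = None.
  have := hP a0; move: (h a0); case: (Phi a0) => [omega|] // ha [g [_ _ _ _ [nA _ _]]].
  by case: nA.
case: (Phi a) => [omega|] ha h0 ca c0.
  split; first by exists (p omega); exact: param_proj.
  move=> g /param_homP -> x; have [ga [mh mg hK gK [_ _ cfg]]] := ca.
  have [cp pP] := p_proj omega.
  rewrite -(comparison_reduction n_ge3 (u := ga \o p omega) c0 red) ?gK //.
    apply: continuous_comp cp _; apply: (morph_continuous _ mg).
    exact: (iso_good (hs_good (H (sval a))) (is_iso_sym mg mh gK hK)).
  by move=> y L _ yL; apply: cfg; exact: pP.
(* A reduction between two objects with all weights [1] has to correspond to the identity of [F];
   both sides are again compared on generic lines. *)
split; first by exists id; exact: param_id.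
move=> g /param_homP/(_ erefl) -> x; have [ga [mh mg hK gK [_ cfg]]] := ca.
rewrite -(comparison_reduction n_ge3 (u := ga) c0 red) ?gK //.
by apply: (morph_continuous _ mg); exact: hs_good.
Qed.
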